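(* Let $(M,g,\alpha,\omega)$ be a compact, Einstein, almost cokähler manifold, with $\mathrm{Ric}=\tau g$ ($\tau$ constant). If either $\tau\geq 0$ or $\int_M\tau^*\geq 0$, then $(M,g,\alpha,\omega)$ is Ricci-flat and cokähler.
   Context: An almost contact metric structure $(\alpha,\omega,g)$ on a $(2n+1)$-dimensional manifold $M$ consists of a $1$-form $\alpha$, a $2$-form $\omega$ and a Riemannian metric $g$ such that near each point there is an orthonormal coframe $e^1,\dots,e^{2n+1}$ with $\alpha=e^{2n+1}$ and $\omega=e^{1}\wedge e^2+e^3\wedge e^4+\dots+e^{2n-1}\wedge e^{2n}$. It is almost cokähler if $d\alpha=0$ and $d\omega=0$, and cokähler if $\alpha$ and $\omega$ are both parallel for the Levi-Civita connection $\nabla$ of $g$. It is Einstein if $\mathrm{Ric}=\tau g$ with $\tau$ constant. Let $J$ be the endomorphism of $TM$ with $\omega(X,Y)=g(JX,Y)$ (so $J$ kills the Reeb vector field $\xi=e_{2n+1}$ and is an almost complex structure on $\ker\alpha$). With $R(X,Y)Z=\nabla_X\nabla_YZ-\nabla_Y\nabla_XZ-\nabla_{[X,Y]}Z$ and a local orthonormal frame $e_1,\dots,e_{2n+1}$, the $*$-Ricci form is $\rho^*(X,Y)=\sum_i g(R(X,e_i)(Je_i),Y)$, and $\tau^*$ is the function $\tau^*=\frac1n\langle\omega,\rho^*\rangle$, where the inner product on $2$-forms is the one for which the $e^i\wedge e^j$, $i<j$, are orthonormal. *)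

(* Defs.v *)
From HB Require Import structures.
From mathcomp Require Import all_boot all_order all_algebra.
From mathcomp Require Import ring.
From mathcomp Require Import all_classical all_reals all_analysis.
Set Implicit Arguments.
Unset Strict Implicit.
Unset Printing Implicit Defensive.
Import Order.TTheory GRing.Theory Num.Theory.
Import numFieldNormedType.Exports.

Local Open Scope classical_set_scope.
Local Open Scope ring_scope.

(* Smooth manifolds are given by atlases, and tensor fields by their components
   in every chart, subject to the transformation law under transition maps.
   Vectors and covectors of R^m are row vectors; a bilinear form is represented
   by its Gram matrix. *)

Section Smooth.
Variables (R : realType) (m : nat).

(* All iterated directional derivatives of order at most k exist and are
   continuous; this is only meant for open U. *)
Fixpoint Ck (V : normedModType R) (k : nat) (U : set 'rV[R]_m)
    (f : 'rV[R]_m -> V) : Prop :=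
  (forall x, U x -> {for x, continuous f}) /\
  match k with
  | 0 => True
  | k'.+1 => forall v : 'rV[R]_m,
      (forall x, U x -> derivable f x v) /\ Ck k' U (fun x => 'D_v f x)
  end.

Definition smooth_on (V : normedModType R) (U : set 'rV[R]_m)
  (f : 'rV[R]_m -> V) : Prop := forall k, Ck k U f.

End Smooth.

(* The atlas need not be maximal. *)
Record smooth_manifold (R : realType) (m : nat) (M : ptopologicalType) := {
  chart_idx : Type;
  chart_dom : chart_idx -> set M;
  chart : chart_idx -> M -> 'rV[R]_m;
  chart_inv : chart_idx -> 'rV[R]_m -> M;
  manifold_hausdorff : hausdorff_space M;
  manifold_second_countable : @second_countable M;
  chart_dom_open : forall i, open (chart_dom i);
  chart_cover : forall p, exists i, chart_dom i p;
  chart_img_open : forall i, open (chart i @` chart_dom i);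
  chartK : forall i p, chart_dom i p -> chart_inv i (chart i p) = p;
  chart_continuous : forall i p, chart_dom i p -> {for p, continuous (chart i)};
  chart_inv_continuous : forall i x, (chart i @` chart_dom i) x ->
    {for x, continuous (chart_inv i)};
  transition_smooth : forall i j,
    smooth_on (chart i @` (chart_dom i `&` chart_dom j))
      (chart j \o chart_inv i)
}.

Definition chart_img (R : realType) (m : nat) (M : ptopologicalType)
    (A : smooth_manifold R m M) (i : chart_idx A) : set 'rV[R]_m :=
  chart i @` chart_dom i.

Section LinearAlgebra.
Variables (R : realType) (m : nat).
Implicit Types (a b u v : 'rV[R]_m) (B E : 'M[R]_m).

Definition ev1 a u : R := (u *m a^T) 0 0.

Definition ev2 B u v : R := (u *m B *m v^T) 0 0.

Definition wedge a b : 'M[R]_m := a^T *m b - b^T *m a.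

(* The rows of E are orthonormal vectors, resp. covectors, for the inner
   product with Gram matrix B; the Gram matrix on covectors is the inverse. *)
Definition orthonormal_frame B E : Prop := E *m B *m E^T = 1%:M.

Definition orthonormal_coframe B E : Prop := E *m invmx B *m E^T = 1%:M.

(* The inner product on 2-forms for which the e^a /\ e^b, a < b, are
   orthonormal, e^1, ..., e^m being the coframe dual to the rows of E. *)
Definition form2_inner E (f h : 'rV[R]_m -> 'rV[R]_m -> R) : R :=
  \sum_(a < m) \sum_(b < m | (a < b)%N)
    f (row a E) (row b E) * h (row a E) (row b E).

End LinearAlgebra.

Section Coordinates.
Variables (R : realType) (m : nat).
Local Notation vec := 'rV[R]_m.
Implicit Types (G W : vec -> 'M[R]_m) (a : vec -> vec) (X Y Z : vec -> vec).

(* Exterior derivatives, evaluated on constant vector fields. *)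
Definition extd1 a (x u v : vec) : R :=
  ev1 ('D_u a x) v - ev1 ('D_v a x) u.

Definition extd2 W (x u v w : vec) : R :=
  ev2 ('D_u W x) v w + ev2 ('D_v W x) w u + ev2 ('D_w W x) u v.

(* Koszul formula for constant fields:
   2 g(Gamma(u,v), w) = D_u g(v,w) + D_v g(u,w) - D_w g(u,v). *)
Definition christoffel G (x u v : vec) : vec :=
  (\row_k (2^-1 * (ev2 ('D_u G x) v 'e_k + ev2 ('D_v G x) u 'e_k
                   - ev2 ('D_'e_k G x) u v))) *m invmx (G x).

Definition nabla G X Y : vec -> vec :=
  fun x => 'D_(X x) Y x + christoffel G x (X x) (Y x).

Definition lie X Y : vec -> vec := fun x => 'D_(X x) Y x - 'D_(Y x) X x.

Definition Riem G X Y Z : vec -> vec := fun x =>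
  nabla G X (nabla G Y Z) x - nabla G Y (nabla G X Z) x
  - nabla G (lie X Y) Z x.

(* By tensoriality the value at x only depends on the values of the fields at
   x, so vectors may be extended to constant fields. *)
Definition curvature G (x u v w : vec) : vec :=
  Riem G (cst u) (cst v) (cst w) x.

(* Ric(u, v) is the trace of w |-> R(w, u) v. *)
Definition ricci G (x u v : vec) : R :=
  \sum_(k < m) curvature G x 'e_k u v 0 k.

Definition nabla1 G a X Y : vec -> R := fun x =>
  'D_(X x) (fun y => ev1 (a y) (Y y)) x - ev1 (a x) (nabla G X Y x).

Definition nabla2 G W X Y Z : vec -> R := fun x =>
  'D_(X x) (fun y => ev2 (W y) (Y y) (Z y)) x
  - ev2 (W x) (nabla G X Y x) (Z x) - ev2 (W x) (Y x) (nabla G X Z x).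

(* The endomorphism J with W(u, v) = G(J u, v); see Jop_spec. *)
Definition Jop G W (x u : vec) : vec := u *m W x *m invmx (G x).

Definition rho_star G W (x : vec) (E : 'M[R]_m) (u v : vec) : R :=
  \sum_(k < m)
    ev2 (G x) (curvature G x u (row k E) (Jop G W x (row k E))) v.

Lemma Jop_spec G W x u v : G x \in unitmx ->
  ev2 (W x) u v = ev2 (G x) (Jop G W x u) v.
Proof. by move=> Gx; rewrite /ev2 /Jop mulmxKV. Qed.

(* christoffel is the Levi-Civita connection: torsion-free (christoffelC, as
   coordinate fields commute) and metric (christoffel_metric). *)
Lemma ev2C (B : 'M[R]_m) u v : B^T = B -> ev2 B u v = ev2 B v u.
Proof.
move=> symB; rewrite /ev2; set N := u *m B *m v^T.
have -> : N 0 0 = N^T 0 0 by rewrite [RHS]mxE.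
by rewrite /N !trmx_mul trmxK symB mulmxA.
Qed.

Lemma christoffelC G x u v : (forall w, ('D_w G x)^T = 'D_w G x) ->
  christoffel G x u v = christoffel G x v u.
Proof.
move=> symG; rewrite /christoffel; congr (_ *m _); apply/rowP => k.
rewrite [LHS]mxE [RHS]mxE; apply: (congr1 (fun r => 2^-1 * r)).
by apply: (congr2 (fun r s => r - s)); [exact: addrC | exact: ev2C].
Qed.

Lemma ev2_christoffel G x u v k : G x \in unitmx ->
  ev2 (G x) (christoffel G x u v) 'e_k =
  2^-1 * (ev2 ('D_u G x) v 'e_k + ev2 ('D_v G x) u 'e_k
          - ev2 ('D_'e_k G x) u v).
Proof.
move=> Gx; rewrite {1}/ev2 /christoffel mulmxKV //.
by rewrite trmx_delta -colE mxE [LHS]mxE.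
Qed.

Lemma christoffel_metric G x (i j k : 'I_m) :
  G x \in unitmx -> (G x)^T = G x -> (forall w, ('D_w G x)^T = 'D_w G x) ->
  ev2 ('D_'e_k G x) 'e_i 'e_j =
  ev2 (G x) (christoffel G x 'e_k 'e_i) 'e_j +
  ev2 (G x) 'e_i (christoffel G x 'e_k 'e_j).
Proof.
move=> Gx symGx symG.
have aux (a a' b c s t t' : R) : s = 2^-1 * (a + b - c) ->
    t' = 2^-1 * (a' + c - b) -> t = t' -> a' = a -> a = s + t.
  by move=> -> -> -> ->; field.
exact: (aux _ _ _ _ _ _ _ (ev2_christoffel 'e_k 'e_i j Gx)
  (ev2_christoffel 'e_k 'e_j i Gx) (ev2C _ _ symGx) (ev2C _ _ (symG _))).
Qed.

End Coordinates.

Section TensorFields.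
Variables (R : realType) (m : nat) (M : ptopologicalType).
Variable A : smooth_manifold R m M.

Definition covector_field := chart_idx A -> 'rV[R]_m -> 'rV[R]_m.

Definition bilinear_field := chart_idx A -> 'rV[R]_m -> 'M[R]_m.

(* The differential at the point p of the change of charts from i to j. *)
Definition dtransition (i j : chart_idx A) (p : M) (u : 'rV[R]_m) : 'rV[R]_m :=
  'D_u (chart j \o chart_inv i) (chart i p).

Definition is_form1 (alpha : covector_field) : Prop :=
  (forall i, smooth_on (chart_img i) (alpha i)) /\
  (forall i j p u, chart_dom i p -> chart_dom j p ->
    ev1 (alpha i (chart i p)) u =
    ev1 (alpha j (chart j p)) (dtransition i j p u)).

Definition is_bilinear (B : bilinear_field) : Prop :=
  (forall i, smooth_on (chart_img i) (B i)) /\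
  (forall i j p u v, chart_dom i p -> chart_dom j p ->
    ev2 (B i (chart i p)) u v =
    ev2 (B j (chart j p)) (dtransition i j p u) (dtransition i j p v)).

Definition is_form2 (omega : bilinear_field) : Prop :=
  is_bilinear omega /\
  forall i x, chart_img i x -> (omega i x)^T = - omega i x.

Definition is_metric (g : bilinear_field) : Prop :=
  is_bilinear g /\
  forall i x, chart_img i x ->
    (g i x)^T = g i x /\ forall u, u != 0 -> 0 < ev2 (g i x) u u.

Definition closed1 (alpha : covector_field) : Prop :=
  forall i x u v, chart_img i x -> extd1 (alpha i) x u v = 0.

Definition closed2 (omega : bilinear_field) : Prop :=
  forall i x u v w, chart_img i x -> extd2 (omega i) x u v w = 0.

Definition parallel1 (g : bilinear_field) (alpha : covector_field) : Prop :=
  forall i x u v, chart_img i x ->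
    nabla1 (g i) (alpha i) (cst u) (cst v) x = 0.

Definition parallel2 (g omega : bilinear_field) : Prop :=
  forall i x u v w, chart_img i x ->
    nabla2 (g i) (omega i) (cst u) (cst v) (cst w) x = 0.

Definition einstein (g : bilinear_field) (tau : R) : Prop :=
  forall i x u v, chart_img i x ->
    ricci (g i) x u v = tau * ev2 (g i x) u v.

Definition ricci_flat (g : bilinear_field) : Prop :=
  forall i x u v, chart_img i x -> ricci (g i) x u v = 0.

End TensorFields.

(* The rows of theta y are the covectors e^1, ..., e^(2n+1) at y, numbered
   from 0. *)
Section AlmostContactMetric.
Variables (R : realType) (n : nat) (M : ptopologicalType).
Variable A : smooth_manifold R n.*2.+1 M.
Implicit Types (alpha : covector_field A) (omega g : bilinear_field A).

Definition almost_contact_metric alpha omega g : Prop :=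
  [/\ is_form1 alpha, is_form2 omega, is_metric g &
   forall i x, chart_img i x ->
   exists (U : set 'rV[R]_(n.*2.+1))
          (theta : 'rV[R]_(n.*2.+1) -> 'M[R]_(n.*2.+1)),
   [/\ open U, U x, U `<=` chart_img i, smooth_on U theta &
    forall y, U y ->
    [/\ orthonormal_coframe (g i y) (theta y),
        alpha i y = row ord_max (theta y) &
        omega i y = \sum_(k < n) wedge (row (inord k.*2) (theta y))
                                       (row (inord k.*2.+1) (theta y))]]].

Definition almost_cokahler alpha omega g : Prop :=
  [/\ almost_contact_metric alpha omega g, closed1 alpha & closed2 omega].

Definition cokahler alpha omega g : Prop :=
  [/\ almost_contact_metric alpha omega g, parallel1 g alpha &
      parallel2 g omega].

(* taustar is the function tau^*, computed at each point in any chart and any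
   orthonormal frame (the value does not depend on either). *)
Definition is_tau_star omega g (taustar : M -> R) : Prop :=
  forall i p (E : 'M[R]_(n.*2.+1)), chart_dom i p ->
  let x := chart i p in
  orthonormal_frame (g i x) E ->
  taustar p =
    n%:R^-1 * form2_inner E (ev2 (omega i x)) (rho_star (g i) (omega i) x E).

End AlmostContactMetric.

Notation borel_type M := (g_sigma_algebraType (@open M)).

Section RiemannianMeasure.
Variables (R : realType).

(* The Lebesgue integral over R^m of a nonnegative measurable function, as an
   iterated integral (Tonelli). *)
Fixpoint integral_rV (m : nat) : ('rV[R]_m -> \bar R) -> \bar R :=
  match m with
  | 0 => fun f => f 0
  | m'.+1 => fun f =>
      (\int[@lebesgue_measure R]_t
         integral_rV (fun y : 'rV[R]_m' =>
           f (row_mx (const_mx t : 'rV[R]_1) y)))%E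
  end.

Variables (m : nat) (M : ptopologicalType) (A : smooth_manifold R m M).

(* vol is the Borel measure on M with density sqrt (det g) with respect to
   the Lebesgue measure in every chart; this determines it. *)
Definition is_riemannian_measure (g : bilinear_field A)
    (vol : {measure set (borel_type M) -> \bar R}) : Prop :=
  forall i (B : set (borel_type M)), measurable B -> B `<=` chart_dom i ->
    vol B = integral_rV (fun x =>
      (\1_(chart i @` B) x * Num.sqrt (\det (g i x)))%:E).

End RiemannianMeasure.

(* Main.v *)
Require Import Defs.
From HB Require Import structures.
From mathcomp Require Import all_boot all_order all_algebra.
From mathcomp Require Import perm ring lra zify.
From mathcomp Require Import all_classical all_reals all_analysis.
From mathcomp Require Import measurable_realfun.
From mathcomp Require finmap.
Import Order.TTheory GRing.Theory Num.Theory.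
Import numFieldNormedType.Exports.
Local Open Scope ring_scope.

(** On the almost Kähler product M x R (one flat direction added to an adapted
    orthonormal frame) the Kähler form has constant components, so its
    covariant derivative A is algebraic in the connection coefficients.
    Contracting the curvature twice with the Kähler form and once with A gives
    a vector field V, independent of the frame, for which the Bianchi
    identities, the Weitzenböck formula and the decomposition of the curvature
    into types yield the pointwise estimate
      div V >= 4 (N - 2) (tau^* - tau) tau^* + tau^2 / N^2,    N = 2 n + 2.
    Moreover |nabla alpha|^2 = - tau, whence tau <= 0, and the remaining
    components of A have square norm 4 n (tau^* - tau).  Since div V has
    integral 0, either hypothesis forces tau = tau^* = 0, and then A = 0.

    The divergence theorem is obtained without Fubini's theorem and without
    change of variables: a C^1 partition of unity reduces it to fields supported
    in a coordinate cube, where Riemann sums of a derivative telescope. *)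
Set Implicit Arguments.
Unset Strict Implicit.
Unset Printing Implicit Defensive.

(** * Curvature in a moving frame *)

(** The product M x R is never built: its flat direction is a zero row added to the matrix of an
    orthonormal frame, so the extra derivation is zero and all functions still live on M. Such a
    frame is linearly dependent, hence the Jacobi identity for its bracket coefficients cannot be
    read off the brackets and has to be carried along as data. The identities are proved over an
    arbitrary commutative ring with derivations, later the smooth functions on a small open set.

    The weights in V = 2 Y - 2 Z + X are dictated by the wish that no derivative of the curvature
    survives in div V: the second Bianchi identity turns 2 div Y into minus a term with the
    derivative of the contracted curvature, which X cancels, while div Z has no such term because a
    parallel Ricci tensor makes the curvature divergence-free.

    The term tau^2 / N^2 is what excludes tau < 0 when the integral of [taustar] is nonnegative: the
    other term would only give that [taustar] vanishes. It comes from the part of the curvature that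
    is quadratic in A, together with |A|^2 >= - 2 tau. *)

Section MatrixEntries.
Variables (F : comPzRingType) (m n : nat).
Implicit Types A B : 'M[F]_(m, n).
Lemma addmxE A B i j : (A + B) i j = A i j + B i j. Proof. by rewrite mxE. Qed.
Lemma oppmxE A i j : (- A) i j = - A i j. Proof. by rewrite mxE. Qed.
Lemma scalemxE a A i j : (a *: A) i j = a * A i j. Proof. by rewrite mxE. Qed.
Lemma zeromxE i j : (0 : 'M[F]_(m, n)) i j = 0. Proof. by rewrite mxE. Qed.
End MatrixEntries.

Ltac mx_atom t k :=
  lazymatch t with
  | ?A + ?B => first [mx_atom A k | mx_atom B k]
  | - ?A => mx_atom A k
  | ?a *: ?A => mx_atom A k
  | 0 => fail
  | _ => tryif is_var t then fail else k t
  end.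

Ltac mxring_with gen :=
  repeat match goal with |- ?L = ?R => first [mx_atom L gen | mx_atom R gen] end;
  apply/matrixP => ? ?; rewrite ?(addmxE, oppmxE, scalemxE, zeromxE);
  repeat match goal with |- context [@fun_of_matrix ?R ?m ?n ?M ?i ?j] =>
    generalize (@fun_of_matrix R m n M i j); intro end; ring.

(* Abstracting the atoms up to conversion is slow and only a fallback. *)
Ltac mxring := first
  [ mxring_with ltac:(fun t => generalize t; intro)
  | mxring_with ltac:(fun t => let x := fresh "X" in set x := t; clearbody x) ].

Definition br (F : comPzRingType) (N : nat) : 'M[F]_N -> 'M[F]_N -> 'M[F]_N :=
  locked (fun X Y => X *m Y - Y *m X).

Lemma br_def (F : comPzRingType) (N : nat) (X Y : 'M[F]_N) :
  br X Y = X *m Y - Y *m X.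
Proof. by rewrite /br -lock. Qed.

Definition ip (F : comPzRingType) (N : nat) (X Y : 'M[F]_N) : F := \tr (X *m Y^T).

Ltac mulsimp :=
  rewrite ?(mulmxDl, mulmxDr, mulmxBl, mulmxBr, mulNmx, mulmxN, mulmxA, mulmx0, mul0mx).

Lemma trmx_sub (F : comPzRingType) (m n : nat) (X Y : 'M[F]_(m, n)) :
  (X - Y)^T = X^T - Y^T.
Proof. by apply/matrixP => i j; rewrite !mxE. Qed.

Section InnerProduct.
Variables (F : comPzRingType) (N : nat).
Implicit Types X Y Z : 'M[F]_N.

Lemma ipE X Y : ip X Y = \sum_k \sum_l X k l * Y k l.
Proof.
rewrite /ip /mxtrace; apply: eq_bigr => k _; rewrite mxE.
by apply: eq_bigr => l _; rewrite mxE.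
Qed.

Lemma ipC X Y : ip X Y = ip Y X.
Proof. by rewrite /ip -mxtrace_tr trmx_mul trmxK. Qed.

Lemma ipDl X Y Z : ip (X + Y) Z = ip X Z + ip Y Z.
Proof. by rewrite /ip mulmxDl mxtraceD. Qed.
Lemma ipNl X Z : ip (- X) Z = - ip X Z.
Proof. by rewrite /ip mulNmx raddfN. Qed.
Lemma ipBl X Y Z : ip (X - Y) Z = ip X Z - ip Y Z.
Proof. by rewrite ipDl ipNl. Qed.
Lemma ipZl a X Z : ip (a *: X) Z = a * ip X Z.
Proof. by rewrite /ip -scalemxAl mxtraceZ. Qed.
Lemma ip0l Z : ip 0 Z = 0. Proof. by rewrite /ip mul0mx mxtrace0. Qed.
Lemma ip_suml (J : Type) (r : seq J) (P : pred J) (X : J -> 'M[F]_N) Z :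
  ip (\sum_(j <- r | P j) X j) Z = \sum_(j <- r | P j) ip (X j) Z.
Proof.
by rewrite /ip mulmx_suml raddf_sum.
Qed.
Lemma ipDr X Y Z : ip Z (X + Y) = ip Z X + ip Z Y.
Proof. by rewrite ipC ipDl !(ipC Z). Qed.
Lemma ipNr X Z : ip Z (- X) = - ip Z X.
Proof. by rewrite ipC ipNl (ipC Z). Qed.
Lemma ipBr X Y Z : ip Z (X - Y) = ip Z X - ip Z Y.
Proof. by rewrite ipDr ipNr. Qed.
Lemma ipZr a X Z : ip Z (a *: X) = a * ip Z X.
Proof. by rewrite ipC ipZl (ipC Z). Qed.
Lemma ip_sumr (J : Type) (r : seq J) (P : pred J) (X : J -> 'M[F]_N) Z :
  ip Z (\sum_(j <- r | P j) X j) = \sum_(j <- r | P j) ip Z (X j).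
Proof. by rewrite ipC ip_suml; apply: eq_bigr => j _; rewrite ipC. Qed.

End InnerProduct.

Lemma sum3_rot (V : nmodType) (N : nat) (f : 'I_N -> 'I_N -> 'I_N -> V) :
  \sum_a \sum_b \sum_c f a b c = \sum_a \sum_b \sum_c f c a b.
Proof.
under [RHS]eq_bigr => a _ do rewrite exchange_big /=.
by rewrite [RHS]exchange_big.
Qed.

(* A frame of vector fields, acting on functions as derivations, and the
   coefficients [G a b e] of a metric torsion-free connection in it; for an
   orthonormal frame, [c a b e = G a b e - G b a e] are the coefficients of the
   Lie brackets. *)
Record connection_frame (F : comPzRingType) (N : nat) := ConnectionFrame {
  fder : 'I_N -> {additive F -> F};
  fcon : 'I_N -> 'M[F]_N;
  fderM : forall a x y, fder a (x * y) = fder a x * y + x * fder a y;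
  fcon_skew : forall a, (fcon a)^T = - fcon a;
  fder_comm : forall a b f, fder a (fder b f) - fder b (fder a f) =
    \sum_e (fcon a b e - fcon b a e) * fder e f;
  fjacobi : forall a b d s,
    let c a b e := fcon a b e - fcon b a e in
    let j a b d := fder a (c b d s) + \sum_e c b d e * c a e s in
    j a b d + j b d a + j d a b = 0 }.

Section FrameCalculus.
Variables (F : comPzRingType) (N : nat) (fr : connection_frame F N).
Local Notation I := 'I_N.
Local Notation E := (fder fr).
Local Notation G := (fcon fr).

Definition torsion_coef a b e : F := G a b e - G b a e.
Local Notation c := torsion_coef.

Let EM : forall a x y, E a (x * y) = E a x * y + x * E a y := @fderM _ _ fr.
Let G_skew : forall a, (G a)^T = - G a := @fcon_skew _ _ fr.
Let E_comm : forall a b f,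
  E a (E b f) - E b (E a f) = \sum_e c a b e * E e f := @fder_comm _ _ fr.

Definition jacobi_coef a b d s : F := E a (c b d s) + \sum_e c b d e * c a e s.
Let jacobi : forall a b d s,
  jacobi_coef a b d s + jacobi_coef b d a s + jacobi_coef d a b s = 0 :=
  @fjacobi _ _ fr.

Definition Em a (X : 'M[F]_N) : 'M[F]_N := map_mx (E a) X.

Lemma E0 a : E a 0 = 0. Proof. exact: raddf0. Qed.

Lemma EmD a X Y : Em a (X + Y) = Em a X + Em a Y.
Proof. by apply/matrixP => i j; rewrite !mxE raddfD. Qed.
Lemma EmN a X : Em a (- X) = - Em a X.
Proof. by apply/matrixP => i j; rewrite !mxE raddfN. Qed.
Lemma EmB a X Y : Em a (X - Y) = Em a X - Em a Y.
Proof. by rewrite EmD EmN. Qed.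
Lemma EmZ a f X : Em a (f *: X) = E a f *: X + f *: Em a X.
Proof. by apply/matrixP => i j; rewrite !mxE EM. Qed.
Lemma Em_mul a X Y : Em a (X *m Y) = Em a X *m Y + X *m Em a Y.
Proof.
apply/matrixP => i j; rewrite !mxE raddf_sum -big_split /=.
by apply: eq_bigr => k _; rewrite EM !mxE.
Qed.
Lemma Em_tr a X : Em a X^T = (Em a X)^T.
Proof. by rewrite /Em map_trmx. Qed.
Lemma Em_comm a b X : Em a (Em b X) - Em b (Em a X) = \sum_e c a b e *: Em e X.
Proof.
apply/matrixP => i j; rewrite !mxE E_comm summxE.
by apply: eq_bigr => e _; rewrite !mxE.
Qed.
Lemma E_tr a X : E a (\tr X) = \tr (Em a X).
Proof. by rewrite /mxtrace raddf_sum; apply: eq_bigr => i _; rewrite mxE. Qed.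

Lemma br_suml (J : Type) (r : seq J) (P : pred J) (X : J -> 'M[F]_N) Z :
  br (\sum_(j <- r | P j) X j) Z = \sum_(j <- r | P j) br (X j) Z.
Proof.
rewrite br_def mulmx_suml mulmx_sumr -sumrB; apply: eq_bigr => j _.
by rewrite br_def.
Qed.

Lemma brZl a (X Z : 'M[F]_N) : br (a *: X) Z = a *: br X Z.
Proof. by rewrite !br_def -scalemxAl -scalemxAr -scalerBr. Qed.

(** Since [G p] is skew, its actions on the two slots of a bilinear form combine into a commutator
    of matrices. *)
Definition cov : I -> 'M[F]_N -> 'M[F]_N :=
  locked (fun p X => Em p X - br (G p) X).

Lemma cov_def p X : cov p X = Em p X - br (G p) X.
Proof. by rewrite /cov -lock. Qed.

Lemma covD p X Y : cov p (X + Y) = cov p X + cov p Y.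
Proof. by rewrite !cov_def !br_def EmD; mulsimp; mxring. Qed.
Lemma covN p X : cov p (- X) = - cov p X.
Proof. by rewrite !cov_def !br_def EmN; mulsimp; mxring. Qed.
Lemma covB p X Y : cov p (X - Y) = cov p X - cov p Y.
Proof. by rewrite covD covN. Qed.
Lemma cov0 p : cov p 0 = 0.
Proof. by rewrite -[X in cov p X](subrr 0) covB subrr. Qed.
Lemma covZ p f X : cov p (f *: X) = E p f *: X + f *: cov p X.
Proof. by rewrite !cov_def !br_def EmZ -scalemxAl -scalemxAr; mxring. Qed.
Lemma cov_sum p (J : Type) (r : seq J) (P : pred J) (X : J -> 'M[F]_N) :
  cov p (\sum_(j <- r | P j) X j) = \sum_(j <- r | P j) cov p (X j).
Proof. by rewrite (big_morph _ (covD p) (cov0 p)). Qed.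

(** [Rm a b k l] is g(R(e_a, e_b) e_k, e_l). The bracket has a minus sign because row k of [G b]
    holds the components of the derivative of e_k, so composing derivatives reverses the order of
    the matrices. *)
Definition Rm : I -> I -> 'M[F]_N := locked (fun a b =>
  Em a (G b) - Em b (G a) - br (G a) (G b) - \sum_e c a b e *: G e).

Lemma Rm_def a b :
  Rm a b = Em a (G b) - Em b (G a) - br (G a) (G b) - \sum_e c a b e *: G e.
Proof. by rewrite /Rm -lock. Qed.

(** Ricci identity. As [cov] does not correct for the direction of differentiation, the bracket
    coefficients remain on the right. *)
Lemma cov_comm a b X :
  cov a (cov b X) - cov b (cov a X) =
  \sum_e c a b e *: cov e X - br (Rm a b) X.
Proof.
have -> : \sum_e c a b e *: cov e X =
    (Em a (Em b X) - Em b (Em a X)) - br (\sum_e c a b e *: G e) X.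
  rewrite Em_comm br_suml -sumrB; apply: eq_bigr => e _.
  by rewrite !cov_def scalerBr brZl.
rewrite Rm_def; set T := \sum_e _; rewrite !cov_def !br_def !EmB !Em_mul.
mulsimp.
mxring.
Qed.

Lemma cov_ip p X Y : E p (ip X Y) = ip (cov p X) Y + ip X (cov p Y).
Proof.
rewrite /ip E_tr Em_mul Em_tr !cov_def !br_def.
rewrite !trmx_sub !trmx_mul G_skew.
mulsimp; rewrite ?opprK ?opprB ?opprD ?opprK !(mxtraceD, raddfN) /=.
rewrite -(mulmxA (G p)) (mxtrace_mulC (G p)); ring.
Qed.

Lemma torsion_coefC a b e : c b a e = - c a b e.
Proof. by rewrite /c opprB. Qed.

Lemma Rm_antisym a b : Rm b a = - Rm a b.
Proof.
rewrite !Rm_def !br_def; have -> : \sum_e c b a e *: G e = - \sum_e c a b e *: G e.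
  by rewrite -sumrN; apply: eq_bigr => e _; rewrite torsion_coefC scaleNr.
set T := \sum_e _; mxring.
Qed.

Lemma br_skew (X Y : 'M[F]_N) : X^T = - X -> Y^T = - Y -> (br X Y)^T = - br X Y.
Proof.
move=> hX hY; rewrite !br_def trmx_sub !trmx_mul hX hY; mulsimp.
by rewrite ?opprK; mxring.
Qed.

Lemma Em_skew p (X : 'M[F]_N) : X^T = - X -> (Em p X)^T = - Em p X.
Proof. by move=> hX; rewrite -Em_tr hX EmN. Qed.

Lemma cov_skew p (X : 'M[F]_N) : X^T = - X -> (cov p X)^T = - cov p X.
Proof.
move=> hX; rewrite !cov_def trmx_sub Em_skew //. rewrite br_skew //; mxring.
Qed.

Lemma Rm_skew a b : (Rm a b)^T = - Rm a b.
Proof.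
rewrite !Rm_def trmx_sub trmx_sub (trmx_sub (Em a _)) (br_skew (G_skew a) (G_skew b)) !Em_skew //.
have -> : (\sum_e c a b e *: G e)^T = - \sum_e c a b e *: G e.
  rewrite linear_sum /= -sumrN; apply: eq_bigr => e _.
  by rewrite linearZ /= G_skew scalerN.
set T := \sum_e _; mxring.
Qed.

Lemma skewE (X : 'M[F]_N) k l : X^T = - X -> X l k = - X k l.
Proof. by move=> /matrixP /(_ k l); rewrite !mxE. Qed.

Lemma G_skewE p k l : G p l k = - G p k l.
Proof. exact/skewE/G_skew. Qed.

Lemma RmE a b k l : Rm a b k l =
  E a (G b k l) - E b (G a k l)
  - (\sum_e G a k e * G b e l - \sum_e G b k e * G a e l)
  - \sum_e c a b e * G e k l.
Proof.
rewrite !Rm_def !br_def !mxE; congr (_ - _); rewrite summxE.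
by apply: eq_bigr => e _; rewrite mxE.
Qed.

(** The terms with derivatives of [G] are those of the Jacobi identity for the bracket coefficients;
    the quadratic terms agree by the expansion [H]. *)
Lemma bianchi1 a b d s : Rm a b d s + Rm b d a s + Rm d a b s = 0.
Proof.
rewrite -[RHS](jacobi a b d s) /jacobi_coef !RmE /c !raddfB /=.
have H : \sum_e (
  - (G a d e * G b e s - G b d e * G a e s) - (G a b e - G b a e) * G e d s
  - (G b a e * G d e s - G d a e * G b e s) - (G b d e - G d b e) * G e a s
  - (G d b e * G a e s - G a b e * G d e s) - (G d a e - G a d e) * G e b s)
  = \sum_e ((G b d e - G d b e) * (G a e s - G e a s)
  + (G d a e - G a d e) * (G b e s - G e b s)
  + (G a b e - G b a e) * (G d e s - G e d s)).
  by apply: eq_bigr => e _; ring.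
move: H; rewrite !(big_split, sumrN) /= => /eqP.
rewrite -subr_eq0 => /eqP H; apply/eqP; rewrite -subr_eq0; apply/eqP.
by rewrite -[RHS]H; ring.
Qed.
End FrameCalculus.

(** * Second Bianchi identity, symmetries of the curvature and its divergence *)

Section SecondBianchi.
Variables (F : comPzRingType) (N : nat) (fr : connection_frame F N).
Local Notation I := 'I_N.
Local Notation E := (fder fr).
Local Notation G := (fcon fr).
Local Notation c := (torsion_coef fr).
Local Notation Em := (Em fr).
Local Notation cov := (cov fr).
Local Notation R := (Rm fr).

Definition nabR : I -> I -> I -> 'M[F]_N := locked (fun p q r =>
  cov p (R q r) - \sum_s G p q s *: R s r - \sum_s G p r s *: R q s).

Lemma nabR_def p q r : nabR p q r =
  cov p (R q r) - \sum_s G p q s *: R s r - \sum_s G p r s *: R q s.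
Proof. by rewrite /nabR -lock. Qed.

Let ctorsion a b : 'M[F]_N := \sum_e c a b e *: G e.

Let U p q r := cov p (Em q (G r) - Em r (G q) - br (G q) (G r)).

Let cov_ctorsion p q r : cov p (ctorsion q r) =
  \sum_e c q r e *: (Em p (G e) - br (G p) (G e)) + \sum_e E p (c q r e) *: G e.
Proof.
rewrite cov_sum -big_split /=; apply: eq_bigr => e _.
by rewrite covZ cov_def addrC.
Qed.

Let cyclicU p q r : U p q r + U q r p + U r p q =
  \sum_e c p q e *: Em e (G r) + \sum_e c q r e *: Em e (G p)
  + \sum_e c r p e *: Em e (G q).
Proof.
rewrite -!Em_comm /U !cov_def !br_def !EmB !Em_mul.
repeat match goal with |- context [Em fr ?p ?X] =>
  generalize (Em fr p X); intro end.
move: (G p) (G q) (G r) => Gp Gq Gr.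
mulsimp; mxring.
Qed.

Let T p q r := \sum_e c p q e *: (Em e (G r) - Em r (G e) + br (G r) (G e))
  - \sum_e E r (c p q e) *: G e.

Let sum_cR p q r : \sum_s c p q s *: R s r =
  T p q r + \sum_e jacobi_coef fr r p q e *: G e.
Proof.
have -> : \sum_s c p q s *: R s r =
    \sum_s c p q s *: (Em s (G r) - Em r (G s) + br (G r) (G s))
    + \sum_e (\sum_s c p q s * c r s e) *: G e.
  have -> : \sum_e (\sum_s c p q s * c r s e) *: G e =
      \sum_s c p q s *: ctorsion r s.
    transitivity (\sum_e \sum_s (c p q s * c r s e) *: G e).
      by apply: eq_bigr => e _; rewrite scaler_suml.
    rewrite exchange_big /=; apply: eq_bigr => s _.
    by rewrite /ctorsion scaler_sumr; apply: eq_bigr => e _; rewrite scalerA.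
  rewrite -big_split /=; apply: eq_bigr => s _.
  have -> : ctorsion r s = - ctorsion s r.
    rewrite /ctorsion -sumrN; apply: eq_bigr => e _.
    by rewrite torsion_coefC scaleNr.
  by rewrite !Rm_def -/(ctorsion s r) !br_def; mxring.
rewrite /T -addrA; congr (_ + _).
rewrite -sumrN -big_split /=; apply: eq_bigr => e _.
by rewrite /jacobi_coef; mxring.
Qed.

Let cyclic_covR p q r : cov p (R q r) + cov q (R r p) + cov r (R p q) =
  T p q r + T q r p + T r p q.
Proof.
have covR a b d : cov a (R b d) = U a b d - cov a (ctorsion b d).
  by rewrite Rm_def covB.
rewrite !covR.
transitivity ((U p q r + U q r p + U r p q) - (cov p (ctorsion q r)
   + cov q (ctorsion r p) + cov r (ctorsion p q))); first by mxring.
rewrite cyclicU !cov_ctorsion /T.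
have H a b d : \sum_e c a b e *: (Em e (G d) - Em d (G e) + br (G d) (G e)) =
   \sum_e c a b e *: Em e (G d)
   - \sum_e c a b e *: (Em d (G e) - br (G d) (G e)).
  by rewrite -sumrB; apply: eq_bigr => e _; mxring.
rewrite !H; mxring.
Qed.

(** The curvature without its bracket term satisfies a cyclic identity up to bracket coefficients
    ([cyclicU]). The corrections in the two form slots combine, the connection being torsion-free,
    into bracket coefficients times curvature, and the excess is a cyclic sum of Jacobi terms. *)
Lemma bianchi2 p q r : nabR p q r + nabR q r p + nabR r p q = 0.
Proof.
have H a b d : \sum_s G a b s *: R s d + \sum_s G b a s *: R d s =
    \sum_s c a b s *: R s d.
  rewrite -big_split; apply: eq_bigr => s _ /=.
  by rewrite (Rm_antisym _ s d) /torsion_coef; mxring.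
rewrite !nabR_def.
transitivity ((cov p (R q r) + cov q (R r p) + cov r (R p q))
  - ((\sum_s G p q s *: R s r + \sum_s G q p s *: R r s)
   + (\sum_s G q r s *: R s p + \sum_s G r q s *: R p s)
   + (\sum_s G r p s *: R s q + \sum_s G p r s *: R q s))); first by mxring.
rewrite !H cyclic_covR !sum_cR.
transitivity (- \sum_e (jacobi_coef fr r p q e + jacobi_coef fr p q r e
   + jacobi_coef fr q r p e) *: G e).
  have -> : \sum_e (jacobi_coef fr r p q e + jacobi_coef fr p q r e
      + jacobi_coef fr q r p e) *: G e = \sum_e jacobi_coef fr r p q e *: G e
      + \sum_e jacobi_coef fr p q r e *: G e
      + \sum_e jacobi_coef fr q r p e *: G e.
    by rewrite -!big_split; apply: eq_bigr => e _ /=; mxring.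
  by mxring.
apply/eqP; rewrite oppr_eq0; apply/eqP; apply: big1 => e _.
by rewrite (fjacobi fr) scale0r.
Qed.

Lemma nabR_antisym p q r : nabR p r q = - nabR p q r.
Proof.
rewrite !nabR_def (Rm_antisym _ q r) covN.
have H a b : \sum_s G p a s *: R b s = - \sum_s G p a s *: R s b.
  rewrite -sumrN; apply: eq_bigr => s _.
  by rewrite (Rm_antisym _ s b) scalerN.
by rewrite (H q r) (H r q); mxring.
Qed.

End SecondBianchi.

Section RicciTensor.
Variables (F : comPzRingType) (N : nat) (fr : connection_frame F N).
Hypothesis F_torsionfree : forall x : F, x + x = 0 -> x = 0.
Local Notation E := (fder fr).
Local Notation G := (fcon fr).
Local Notation cov := (cov fr).
Local Notation R := (Rm fr).
Local Notation nabR := (nabR fr).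

Lemma Rm_pair a b d s : R a b d s = R d s a b.
Proof.
have skew i j k l : R i j l k = - R i j k l by apply: skewE; exact: Rm_skew.
have anti i j k l : R j i k l = - R i j k l by rewrite Rm_antisym oppmxE.
have B := bianchi1 fr.
(* The four cyclic identities with one index fixed add up to twice the claim. *)
apply/eqP; rewrite -subr_eq0; apply/eqP; apply: F_torsionfree.
transitivity ((R a b d s + R b d a s + R d a b s)
  + (R b d s a + R d s b a + R s b d a)
  - (R d s a b + R s a d b + R a d s b)
  - (R s a b d + R a b s d + R b s a d)); last by rewrite !B; ring.
rewrite (skew b d a s) (skew d s a b) (anti b s d a) (skew b s a d).
rewrite (anti d a s b) (skew d a b s) (skew s a b d) (skew a b d s).
ring.
Qed.

End RicciTensor.

Section ContractedBianchi.
Variables (F : comPzRingType) (N : nat) (fr : connection_frame F N).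
Hypothesis F_torsionfree : forall x : F, x + x = 0 -> x = 0.
Local Notation E := (fder fr).
Local Notation G := (fcon fr).
Local Notation cov := (cov fr).
Local Notation R := (Rm fr).
Local Notation nabR := (nabR fr).

Lemma covE p X k l : cov p X k l =
  E p (X k l) - \sum_s G p k s * X s l - \sum_s G p l s * X k s.
Proof.
rewrite !cov_def !br_def !mxE.
have -> : \sum_j X k j * G p j l = - \sum_s G p l s * X k s.
  by rewrite -sumrN; apply: eq_bigr => s _; rewrite (G_skewE fr p l s); ring.
ring.
Qed.

Lemma nabRE p a b k l : nabR p a b k l =
  E p (R a b k l) - \sum_s G p a s * R s b k l - \sum_s G p b s * R a s k l
  - \sum_s G p k s * R a b s l - \sum_s G p l s * R a b k s.
Proof.
rewrite !nabR_def.
have -> : forall X Y Z : 'M[F]_N, (X - Y - Z) k l = X k l - Y k l - Z k l.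
  by move=> X Y Z; rewrite !mxE.
rewrite covE !summxE.
have -> : \sum_s (G p a s *: R s b) k l = \sum_s G p a s * R s b k l.
  by apply: eq_bigr => s _; rewrite mxE.
have -> : \sum_s (G p b s *: R a s) k l = \sum_s G p b s * R a s k l.
  by apply: eq_bigr => s _; rewrite mxE.
ring.
Qed.

Lemma nabR_pair p a b k l : nabR p a b k l = nabR p k l a b.
Proof.
have P := Rm_pair fr F_torsionfree.
rewrite (nabRE p a b k l) (nabRE p k l a b) (P a b k l).
have -> : \sum_s G p a s * R s b k l = \sum_s G p a s * R k l s b.
  by apply: eq_bigr => s _; rewrite P.
have -> : \sum_s G p b s * R a s k l = \sum_s G p b s * R k l a s.
  by apply: eq_bigr => s _; rewrite P.
have -> : \sum_s G p k s * R a b s l = \sum_s G p k s * R s l a b.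
  by apply: eq_bigr => s _; rewrite P.
have -> : \sum_s G p l s * R a b k s = \sum_s G p l s * R k s a b.
  by apply: eq_bigr => s _; rewrite P.
ring.
Qed.

Definition Ric : 'M[F]_N := \matrix_(k, m) \sum_p R p k m p.

Lemma Rm_skewE a b k l : R a b l k = - R a b k l.
Proof. by apply: skewE; exact: Rm_skew. Qed.
Lemma Rm_antisymE a b k l : R b a k l = - R a b k l.
Proof. by rewrite Rm_antisym oppmxE. Qed.

Lemma nabR_skewE p a b k l : nabR p a b l k = - nabR p a b k l.
Proof.
by rewrite nabR_pair (nabR_pair p a b k l) nabR_antisym oppmxE.
Qed.
Lemma nabR_antisymE p a b k l : nabR p b a k l = - nabR p a b k l.
Proof. by rewrite nabR_antisym oppmxE. Qed.

(** Contraction commutes with covariant differentiation because the corrections in the two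
    contracted slots cancel by skewness of [G k]. *)
Lemma nabR_trace k l q : \sum_p nabR k p l q p = cov k Ric l q.
Proof.
rewrite covE !mxE raddf_sum /=.
have -> : \sum_s G k l s * Ric s q = \sum_p \sum_s G k l s * R p s q p.
  rewrite exchange_big; apply: eq_bigr => s _ /=.
  by rewrite mxE mulr_sumr.
have -> : \sum_s G k q s * Ric l s = \sum_p \sum_s G k q s * R p l s p.
  rewrite exchange_big; apply: eq_bigr => s _ /=.
  by rewrite mxE mulr_sumr.
transitivity (\sum_p (E k (R p l q p) - \sum_s G k l s * R p s q p
    - \sum_s G k q s * R p l s p)
  - (\sum_p \sum_s G k p s * R s l q p + \sum_p \sum_s G k p s * R p l q s)).
  rewrite -big_split -sumrB; apply: eq_bigr => p _ /=.
  rewrite nabRE; ring.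
rewrite [X in X + _ = _]sumrB sumrB.
have -> : \sum_p \sum_s G k p s * R s l q p =
    - \sum_p \sum_s G k p s * R p l q s.
  rewrite exchange_big -sumrN; apply: eq_bigr => p _ /=.
  rewrite -sumrN; apply: eq_bigr => s _.
  by rewrite (G_skewE fr k p s); ring.
ring.
Qed.

Hypothesis Ric_parallel : forall k, cov k Ric = 0.

(** Pair symmetry moves the contracted index into the second pair; tracing the second Bianchi
    identity then leaves only derivatives of the Ricci tensor. *)
Lemma divR q : \sum_p nabR p p q = 0.
Proof.
apply/matrixP => k l; rewrite summxE mxE.
transitivity (- (cov k Ric l q) + cov l Ric k q); last first.
  by rewrite !Ric_parallel !mxE; ring.
rewrite -!nabR_trace -sumrN -big_split; apply: eq_bigr => p _ /=.
rewrite nabR_pair.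
have sum3E (X Y Z : 'M[F]_N) : X + Y + Z = 0 ->
    forall i j, X i j + Y i j + Z i j = 0.
  by move=> XYZ i j; rewrite -!addmxE XYZ mxE.
have H := sum3E _ _ _ (bianchi2 fr p k l) p q.
transitivity (- (nabR k l p p q + nabR l p k p q)).
  by apply/eqP; rewrite -subr_eq0 opprK addrA H.
rewrite (nabR_antisymE k p l) (nabR_skewE k p l q p) (nabR_skewE l p k q p).
ring.
Qed.

End ContractedBianchi.

(** * The vector field V and its divergence *)

Section Divergence.
Variables (F : comPzRingType) (N : nat) (fr : connection_frame F N).
Hypothesis F_torsionfree : forall x : F, x + x = 0 -> x = 0.
Local Notation I := 'I_N.
Local Notation E := (fder fr).
Local Notation G := (fcon fr).
Local Notation Em := (Em fr).
Local Notation cov := (cov fr).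
Local Notation R := (Rm fr).
Local Notation nabR := (nabR fr).

Definition nabv (V : I -> F) p r : F := E p (V r) - \sum_s G p r s * V s.

Definition nabm : (I -> 'M[F]_N) -> I -> I -> 'M[F]_N := locked (fun T p q =>
  cov p (T q) - \sum_s G p q s *: T s).

Lemma nabm_def T p q : nabm T p q = cov p (T q) - \sum_s G p q s *: T s.
Proof. by rewrite /nabm -lock. Qed.

Definition fdiv (V : I -> F) : F := \sum_p nabv V p p.

(** Leibniz rule for a contraction: the corrections in the summed index q cancel by skewness of
    [G p]. *)
Lemma nabv_contr (U : I -> 'M[F]_N) p r :
  nabv (fun r => \sum_q ip (R r q) (U q)) p r =
  \sum_q (ip (nabR p r q) (U q) + ip (R r q) (nabm U p q)).
Proof.
rewrite /nabv raddf_sum /=.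
transitivity (\sum_q (ip (cov p (R r q)) (U q) + ip (R r q) (cov p (U q)))
  - \sum_q \sum_s G p r s * ip (R s q) (U q)).
  congr (_ - _); first by apply: eq_bigr => q _; rewrite cov_ip.
  by rewrite exchange_big; apply: eq_bigr => s _ /=; rewrite mulr_sumr.
have H : \sum_q \sum_s G p q s * ip (R r s) (U q)
    + \sum_q \sum_s G p q s * ip (R r q) (U s) = 0.
  rewrite [X in X + _]exchange_big -big_split big1 // => q _ /=.
  rewrite -big_split big1 // => s _ /=.
  by rewrite (G_skewE fr p q s); ring.
rewrite -[LHS]subr0 -[X in _ - X = _]H -!sumrB -big_split -sumrB.
apply: eq_bigr => q _ /=; rewrite nabR_def !nabm_def !ipBl ipBr. rewrite !ip_suml ip_sumr.
have -> : \sum_s ip (G p r s *: R s q) (U q) =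
  \sum_s G p r s * ip (R s q) (U q).
  by apply: eq_bigr => s _; rewrite ipZl.
have -> : \sum_s ip (G p q s *: R r s) (U q) =
  \sum_s G p q s * ip (R r s) (U q).
  by apply: eq_bigr => s _; rewrite ipZl.
have -> : \sum_s ip (R r q) (G p q s *: U s) =
  \sum_s G p q s * ip (R r q) (U s).
  by apply: eq_bigr => s _; rewrite ipZr.
ring.
Qed.

Lemma fdivD V W : fdiv (fun p => V p + W p) = fdiv V + fdiv W.
Proof.
rewrite /fdiv -big_split; apply: eq_bigr => p _ /=.
rewrite /nabv raddfD /=.
have -> : \sum_s G p p s * (V s + W s) =
    \sum_s G p p s * V s + \sum_s G p p s * W s.
  by rewrite -big_split; apply: eq_bigr => s _; rewrite mulrDr.
ring.
Qed.

Lemma fdivN V : fdiv (fun p => - V p) = - fdiv V.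
Proof.
rewrite /fdiv -sumrN; apply: eq_bigr => p _ /=.
rewrite /nabv raddfN /=.
have -> : \sum_s G p p s * - V s = - \sum_s G p p s * V s.
  by rewrite -sumrN; apply: eq_bigr => s _; rewrite mulrN.
ring.
Qed.

Variable Om : 'M[F]_N.
Hypothesis Om_const : forall p, Em p Om = 0.
Hypothesis Om_skew : Om^T = - Om.

(** First and second covariant derivatives of the Kähler form, its rough Laplacian [tL], and its
    image [tP] under the curvature operator. *)
Definition tA q : 'M[F]_N := cov q Om.
Definition tS p q : 'M[F]_N := nabm tA p q.
Definition tL : 'M[F]_N := \sum_p tS p p.
Definition tP : 'M[F]_N := \sum_p \sum_r Om p r *: R p r.

Lemma tA_skew q : (tA q)^T = - tA q.
Proof. exact: cov_skew. Qed.

(** The correction of [tS] in the slot q absorbs the bracket coefficients of the Ricci identity. *)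
Lemma tS_comm p q : tS p q - tS q p = - br (R p q) Om.
Proof.
transitivity ((cov p (cov q Om) - cov q (cov p Om))
  - \sum_e torsion_coef fr p q e *: tA e).
  have -> : \sum_e torsion_coef fr p q e *: tA e =
      \sum_s G p q s *: tA s - \sum_s G q p s *: tA s.
    by rewrite -sumrB; apply: eq_bigr => s _; rewrite scalerBl.
  by rewrite /tS !nabm_def -!/(tA _); mxring.
by rewrite cov_comm -/tA; mxring.
Qed.

Hypothesis tA_cyc : forall p k l, tA p k l + tA k l p + tA l p k = 0.
Hypothesis tA_div : forall r, \sum_p tA p p r = 0.
Hypothesis R_div : forall q, \sum_p nabR p p q = 0.

Let y r := \sum_q ip (R r q) (tA q).
Definition vY p := \sum_r Om p r * y r.
Definition vZ p := \sum_q ip (R p q) (\sum_s Om q s *: tA s).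
Definition vX p := ip tP (tA p).

(** What is left of div V besides the Laplacian term: a curvature term quadratic in [tA], and a term
    [tK] quadratic in the curvature, which is where the antisymmetric part of [tS] ends up. *)
Definition tRAA : F := \sum_s \sum_p \sum_q tA s p q * ip (R p q) (tA s).
Definition tK : F :=
  \sum_r \sum_q \sum_s Om q s * ip (R r q) (- br (R s r) Om).

Let OS1 := \sum_p \sum_r \sum_q Om p r * ip (R r q) (tS p q).
Let OS2 := \sum_p \sum_q \sum_s Om q s * ip (R p q) (tS p s).

Lemma E_Om p k l : E p (Om k l) = 0.
Proof. by have /matrixP/(_ k l) := Om_const p; rewrite !mxE. Qed.

Lemma tAE p k l :
  tA p k l = - \sum_s G p k s * Om s l - \sum_s G p l s * Om k s.
Proof. by rewrite /tA covE E_Om sub0r. Qed.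

(** The term in which [Om] is differentiated drops out because the form is coclosed ([tA_div]). *)
Lemma fdiv_vY : fdiv vY = \sum_p \sum_r Om p r * nabv y p r.
Proof.
transitivity (\sum_p (\sum_r (tA p p r * y r + Om p r * nabv y p r))).
  apply: eq_bigr => p _; rewrite /nabv /vY raddf_sum /=.
  have -> : \sum_s G p p s * (\sum_r Om s r * y r) =
      \sum_r (\sum_s G p p s * Om s r) * y r.
    transitivity (\sum_s \sum_r G p p s * Om s r * y r).
      by apply: eq_bigr => s _; rewrite mulr_sumr;
        apply: eq_bigr => r _; rewrite mulrA.
    by rewrite exchange_big; apply: eq_bigr => r _ /=; rewrite mulr_suml.
  have H : \sum_r (\sum_s G p r s * Om p s) * y r
    + \sum_r Om p r * (\sum_s G p r s * y s) = 0.
    transitivity (\sum_r \sum_s G p r s * Om p s * y r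
      + \sum_r \sum_s G p r s * Om p r * y s).
      congr (_ + _); apply: eq_bigr => r _; first by rewrite mulr_suml.
      by rewrite mulr_sumr; apply: eq_bigr => s _; ring.
    rewrite [X in X + _]exchange_big -big_split big1 // => r _ /=.
    rewrite -big_split big1 // => s _ /=.
    by rewrite (G_skewE fr p r s); ring.
  rewrite -[LHS]subr0 -[X in _ - X = _]H -big_split -!sumrB.
  apply: eq_bigr => r _ /=.
  rewrite fderM E_Om tAE; ring.
have -> : forall f g : I -> I -> F, \sum_p \sum_r (f p r + g p r) =
    \sum_p \sum_r f p r + \sum_p \sum_r g p r.
  by move=> f g; rewrite -big_split; apply: eq_bigr => p _; rewrite big_split.
rewrite exchange_big [X in X + _]big1 ?add0r // => r _.
by rewrite -mulr_suml tA_div mul0r.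
Qed.

Lemma cov_tP q : cov q tP =
  \sum_p \sum_r (tA q p r *: R p r + Om p r *: nabR q p r).
Proof.
rewrite /tP cov_sum.
transitivity (\sum_p \sum_r Om p r *: cov q (R p r)).
  apply: eq_bigr => p _; rewrite cov_sum; apply: eq_bigr => r _.
  by rewrite covZ E_Om scale0r add0r.
have H1 : \sum_p \sum_r (\sum_s G q p s * Om s r) *: R p r =
    - \sum_p \sum_r Om p r *: (\sum_s G q p s *: R s r).
  transitivity (\sum_p \sum_r \sum_s (G q p s * Om s r) *: R p r).
    by apply: eq_bigr => p _; apply: eq_bigr => r _; rewrite scaler_suml.
  rewrite exchange_big /= [in RHS]exchange_big /= -sumrN.
  apply: eq_bigr => r _; rewrite exchange_big -sumrN /=.
  apply: eq_bigr => p _; rewrite scaler_sumr -sumrN.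
  apply: eq_bigr => s _; rewrite scalerA (G_skewE fr q p s).
  by rewrite mulNr scaleNr mulrC.
have H2 : \sum_p \sum_r (\sum_s G q r s * Om p s) *: R p r =
    - \sum_p \sum_r Om p r *: (\sum_s G q r s *: R p s).
  rewrite -sumrN; apply: eq_bigr => p _.
  transitivity (\sum_r \sum_s (G q r s * Om p s) *: R p r).
    by apply: eq_bigr => r _; rewrite scaler_suml.
  rewrite exchange_big -sumrN; apply: eq_bigr => r _ /=.
  rewrite scaler_sumr -sumrN; apply: eq_bigr => s _.
  by rewrite scalerA (G_skewE fr q r s) mulNr scaleNr mulrC.
transitivity (\sum_p \sum_r Om p r *: cov q (R p r)
  - (\sum_p \sum_r (\sum_s G q p s * Om s r) *: R p r
     + \sum_p \sum_r Om p r *: (\sum_s G q p s *: R s r))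
  - (\sum_p \sum_r (\sum_s G q r s * Om p s) *: R p r
     + \sum_p \sum_r Om p r *: (\sum_s G q r s *: R p s))).
  by rewrite H1 H2 !addNr !subr0.
rewrite -!big_split -!sumrB; apply: eq_bigr => p _ /=.
rewrite -!big_split -!sumrB; apply: eq_bigr => r _ /=.
by rewrite tAE nabR_def; mxring.
Qed.

Lemma fdiv_vX : fdiv vX = \sum_p ip (cov p tP) (tA p) + ip tP tL.
Proof.
rewrite /tL ip_sumr -big_split; apply: eq_bigr => p _ /=.
rewrite /nabv /vX cov_ip /tS !nabm_def ipBr ip_sumr addrA; congr (_ - _).
by apply: eq_bigr => s _; rewrite ipZr.
Qed.

(** Antisymmetry of [Om] together with the second Bianchi identity replaces twice the contraction of
    [Om p r] with [nabR p r q] by minus that with [nabR q p r]. The latter is the derivative of [tP]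
    up to the term in which [Om] itself is differentiated, and that term is [tRAA]. *)
Lemma twice_fdiv_vY : fdiv vY + fdiv vY =
  - \sum_q ip (cov q tP) (tA q) + tRAA + (OS1 + OS1).
Proof.
rewrite fdiv_vY.
have -> : \sum_p \sum_r Om p r * nabv y p r =
    \sum_q ip (\sum_p \sum_r Om p r *: nabR p r q) (tA q) + OS1.
  transitivity (\sum_p \sum_r \sum_q Om p r * ip (nabR p r q) (tA q) + OS1).
    rewrite /OS1 -big_split; apply: eq_bigr => p _ /=.
    rewrite -big_split; apply: eq_bigr => r _ /=.
    rewrite /y nabv_contr mulr_sumr -big_split; apply: eq_bigr => q _ /=.
    by rewrite mulrDr.
  congr (_ + _).
  transitivity (\sum_p \sum_q \sum_r Om p r * ip (nabR p r q) (tA q)).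
    by apply: eq_bigr => p _; rewrite exchange_big.
  rewrite exchange_big; apply: eq_bigr => q _ /=.
  rewrite ip_suml; apply: eq_bigr => p _.
  by rewrite ip_suml; apply: eq_bigr => r _; rewrite ipZl.
rewrite addrACA -big_split; congr (_ + _).
rewrite /tRAA -sumrN -big_split; apply: eq_bigr => q _ /=.
rewrite -ipDl.
have -> : \sum_p \sum_r tA q p r * ip (R p r) (tA q) =
    ip (\sum_p \sum_r tA q p r *: R p r) (tA q).
  rewrite ip_suml; apply: eq_bigr => p _.
  by rewrite ip_suml; apply: eq_bigr => r _; rewrite ipZl.
rewrite -ipNl -ipDl; congr (ip _ _); rewrite cov_tP.
rewrite [X in X + _ = _]exchange_big -big_split -sumrN -big_split.
apply: eq_bigr => p _ /=; rewrite -!big_split -sumrN -big_split.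
apply: eq_bigr => r _ /=.
have H := bianchi2 fr p r q.
rewrite (skewE p r Om_skew) (nabR_antisym fr r q p).
have -> : nabR q p r = - nabR p r q - nabR r q p.
  by rewrite -[RHS]addr0 -[X in _ + X]H; mxring.
by mxring.
Qed.

(** The derivative of the curvature is contracted to its divergence and vanishes. In the remaining
    term, antisymmetry of the curvature in p, q allows one to replace [tA p q s] by half of
    [tA p q s - tA q p s], which the cyclic identity equates with [- tA s p q]. *)
Lemma twice_fdiv_vZ : fdiv vZ + fdiv vZ = - tRAA + (OS2 + OS2).
Proof.
pose B q := \sum_s Om q s *: tA s.
have nabB p q : nabm B p q =
    \sum_s (tA p q s *: tA s + Om q s *: tS p s).
  rewrite !nabm_def /B cov_sum.
  have -> : \sum_s G p q s *: (\sum_r Om s r *: tA r) =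
      \sum_r (\sum_s G p q s * Om s r) *: tA r.
    transitivity (\sum_s \sum_r (G p q s * Om s r) *: tA r).
      by apply: eq_bigr => s _; rewrite scaler_sumr;
        apply: eq_bigr => r _; rewrite scalerA.
    by rewrite exchange_big; apply: eq_bigr => r _ /=; rewrite scaler_suml.
  have H : \sum_r (\sum_s G p r s * Om q s) *: tA r
    + \sum_r Om q r *: (\sum_s G p r s *: tA s) = 0.
    transitivity (\sum_r \sum_s (G p r s * Om q s) *: tA r
      + \sum_r \sum_s (G p r s * Om q r) *: tA s).
      congr (_ + _); apply: eq_bigr => r _; first by rewrite scaler_suml.
      by rewrite scaler_sumr; apply: eq_bigr => s _; rewrite scalerA mulrC.
    rewrite [X in X + _]exchange_big -big_split big1 // => r _ /=.
    rewrite -big_split big1 // => s _ /=.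
    by rewrite (G_skewE fr p r s) mulNr scaleNr addNr.
  rewrite -[LHS]subr0 -[X in _ - X = _]H -big_split -!sumrB.
  apply: eq_bigr => r _ /=; rewrite covZ E_Om tAE /tS !nabm_def.
  by mxring.
have -> : fdiv vZ = OS2 + \sum_p \sum_q \sum_s tA p q s * ip (R p q) (tA s).
  transitivity (\sum_p \sum_q (ip (nabR p p q) (B q) + ip (R p q) (nabm B p q))).
    by apply: eq_bigr => p _; rewrite nabv_contr.
  transitivity (\sum_p \sum_q ip (nabR p p q) (B q)
     + \sum_p \sum_q ip (R p q) (nabm B p q)).
    by rewrite -big_split; apply: eq_bigr => p _; rewrite big_split.
  rewrite exchange_big [X in X + _]big1 ?add0r; last first.
    by move=> q _; rewrite -ip_suml R_div ip0l.
  rewrite /OS2 -big_split; apply: eq_bigr => p _ /=.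
  rewrite -big_split; apply: eq_bigr => q _ /=.
  rewrite nabB ip_sumr -big_split; apply: eq_bigr => s _ /=.
  by rewrite ipDr !ipZr addrC.
rewrite addrACA [RHS]addrC; congr (_ + _).
rewrite {1}exchange_big -big_split /tRAA -sumrN.
transitivity (\sum_p \sum_q \sum_s - tA s p q * ip (R p q) (tA s)).
  apply: eq_bigr => p _; rewrite -big_split; apply: eq_bigr => q _ /=.
  rewrite -big_split; apply: eq_bigr => s _ /=.
  rewrite (Rm_antisym fr p q) ipNl.
  have -> : - tA s p q = tA p q s - tA q p s.
    rewrite (skewE s p (tA_skew q)) -[RHS]subr0 -(tA_cyc p q s); ring.
  ring.
transitivity (\sum_s \sum_p \sum_q - tA s p q * ip (R p q) (tA s)).
  exact/esym/(sum3_rot (fun s p q => - tA s p q * ip (R p q) (tA s))).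
apply: eq_bigr => s _; rewrite -sumrN; apply: eq_bigr => p _.
by rewrite -sumrN; apply: eq_bigr => q _; rewrite mulNr.
Qed.

Definition divV p := vY p + vY p - (vZ p + vZ p) + vX p.

(** The derivatives of [tP] cancel between X and 2 Y. Apart from [tL], second derivatives of [Om]
    occur only in OS1 - OS2, where they are antisymmetrized and hence are curvature terms. *)
Lemma fdiv_main : fdiv divV = ip tP tL + (tRAA + tRAA) + (tK + tK).
Proof.
rewrite /divV fdivD fdivD fdivN !fdivD twice_fdiv_vY twice_fdiv_vZ fdiv_vX.
have H : tK = OS1 - OS2.
  have -> : OS1 = \sum_r \sum_q \sum_s Om s r * ip (R r q) (tS s q).
    rewrite /OS1 [LHS](sum3_rot (fun p r q => Om p r * ip (R r q) (tS p q))).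
    by [].
  have -> : \sum_r \sum_q \sum_s Om s r * ip (R r q) (tS s q) =
      \sum_r \sum_q \sum_s Om q s * ip (R r q) (tS s r).
    rewrite exchange_big; apply: eq_bigr => r _ /=.
    apply: eq_bigr => q _; apply: eq_bigr => s _.
    by rewrite (skewE q s Om_skew) (Rm_antisym fr r q) ipNl mulrNN.
  rewrite /OS2 /tK -sumrB; apply: eq_bigr => r _.
  rewrite -sumrB; apply: eq_bigr => q _.
  rewrite -sumrB; apply: eq_bigr => s _.
  by rewrite -tS_comm ipBr mulrBr.
rewrite H; ring.
Qed.

End Divergence.

(** * Consequences of the complex structure for the derivatives of the Kähler form *)

Lemma tSE (F : comPzRingType) (N : nat) (fr : connection_frame F N)
    (Om : 'M[F]_N) p q k l :
  tS fr Om p q k l = fder fr p (tA fr Om q k l)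
  - \sum_m fcon fr p q m * tA fr Om m k l
  - \sum_m fcon fr p k m * tA fr Om q m l
  - \sum_m fcon fr p l m * tA fr Om q k m.
Proof.
rewrite /tS nabm_def addmxE oppmxE covE summxE.
have -> : \sum_s (fcon fr p q s *: tA fr Om s) k l =
    \sum_m fcon fr p q m * tA fr Om m k l.
  by apply: eq_bigr => s _; rewrite scalemxE.
ring.
Qed.

(* [sgn_inv] encodes an orthogonal complex structure that permutes the frame up
   to sign: [J e_a = kap a * e_(sg a)]. *)
Section TypeIdentities.
Variables (F : comPzRingType) (N : nat) (fr : connection_frame F N).
Hypothesis F_torsionfree : forall x : F, x + x = 0 -> x = 0.
Local Notation I := 'I_N.
Local Notation E := (fder fr).
Local Notation G := (fcon fr).
Local Notation R := (Rm fr).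

Variables (sg : I -> I) (kb : I -> bool).
Hypothesis sgK : involutive sg.
Hypothesis kb_sg : forall a, kb (sg a) = ~~ kb a.
Local Notation kap a := ((-1) ^+ kb a : F).

Definition Omat : 'M[F]_N := \matrix_(a, b) (kap a * (b == sg a)%:R).
Local Notation Om := Omat.
Local Notation A := (tA fr Om).
Local Notation S := (tS fr Om).

Lemma kapN a : kap (sg a) = - kap a.
Proof. by rewrite kb_sg; case: (kb a); rewrite /= ?opprK. Qed.
Lemma kap2 a : kap a * kap a = 1.
Proof. by case: (kb a); rewrite /= ?mulrNN mulr1. Qed.

Lemma sum_sg (V : nmodType) (f : I -> V) : \sum_a f (sg a) = \sum_a f a.
Proof.
by rewrite [RHS](reindex sg) //=; apply: onW_bij; exists sg.
Qed.

Lemma Omat_suml (f : I -> F) p : \sum_r Om p r * f r = kap p * f (sg p).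
Proof.
rewrite (bigD1 (sg p)) //= big1 ?addr0 ?mxE ?eqxx ?mulr1 // => r Hr.
by rewrite mxE (negPf Hr) mulr0 mul0r.
Qed.

Lemma Omat_skew : Om^T = - Om.
Proof.
apply/matrixP => a b; rewrite !mxE.
have -> : (a == sg b) = (b == sg a).
  by apply/eqP/eqP => ->; rewrite sgK.
case: eqP => [->|_]; last by rewrite !mulr0 oppr0.
by rewrite kapN mulNr.
Qed.

Lemma Omat_sumr (f : I -> F) p : \sum_r Om r p * f r = - (kap p * f (sg p)).
Proof.
rewrite -Omat_suml -sumrN; apply: eq_bigr => r _.
by rewrite (skewE p r Omat_skew) mulNr.
Qed.

Lemma fder1 p : E p 1 = 0.
Proof.
have := fderM fr p 1 1; rewrite !mulr1 mul1r => H.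
by apply: (addrI (E p 1)); rewrite -H addr0.
Qed.

Lemma fder_kap p a : E p (kap a) = 0.
Proof. by case: (kb a); rewrite ?expr0 ?expr1 ?raddfN /= fder1 ?oppr0. Qed.

Lemma Omat_const p : Em fr p Om = 0.
Proof.
apply/matrixP => a b; rewrite !mxE fderM fder_kap.
have -> : E p (b == sg a)%:R = 0 by case: eqP; rewrite ?fder1 ?raddf0.
by rewrite mul0r mulr0 addr0.
Qed.

Lemma A_skewE p k l : A p l k = - A p k l.
Proof. by apply: skewE; exact: tA_skew Omat_skew p. Qed.

Lemma AE p k l : A p k l = kap l * G p k (sg l) + kap k * G p (sg k) l.
Proof.
rewrite tAE; last exact: Omat_const.
have -> : \sum_s G p k s * Om s l = \sum_s Om s l * G p k s.
  by apply: eq_bigr => s _; rewrite mulrC.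
have -> : \sum_s G p l s * Om k s = \sum_s Om k s * G p l s.
  by apply: eq_bigr => s _; rewrite mulrC.
by rewrite Omat_sumr Omat_suml (G_skewE fr p (sg k) l); ring.
Qed.

(** The derivative of J anticommutes with J: [A p] is, up to sign, the commutator of [G p] with
    [Om], and the square of [Om] is minus the identity. *)
Lemma A_J23 p k l : kap k * A p (sg k) l = kap l * A p k (sg l).
Proof.
rewrite !AE !sgK !kapN.
transitivity (kap k * kap l * G p (sg k) (sg l) - (kap k * kap k) * G p k l).
  ring.
transitivity (kap k * kap l * G p (sg k) (sg l) - (kap l * kap l) * G p k l).
  by rewrite !kap2.
ring.
Qed.

Hypothesis A_cyc : forall p k l, A p k l + A k l p + A l p k = 0.

(** A closed Kähler form is quasi-Kähler. The cyclic identity is used at (p, k, l) and at the three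
    triples with J applied to two entries; once [A_J23] has gathered the occurrences of J, the
    signed sum of the four leaves twice the claim. *)
Lemma A_J12 p k l : A p k l + kap p * kap k * A (sg p) (sg k) l = 0.
Proof.
apply: F_torsionfree.
have J23 q a b : kap a * kap b * A q (sg a) (sg b) = - A q a b.
  rewrite -mulrA mulrCA (A_J23 q a (sg b)) sgK kapN.
  by rewrite mulrA mulrN kap2 mulN1r.
have H1 := A_cyc p k l.
have H2 := A_cyc (sg p) (sg k) l.
have H3 := A_cyc (sg p) k (sg l).
have H4 := A_cyc p (sg k) (sg l).
have e1 : kap k * kap p * A l (sg k) (sg p) = - A l k p := J23 l k p.
pose a' := kap p * kap k * A (sg p) (sg k) l.
pose b' := kap k * kap l * A (sg k) (sg l) p.
pose c' := kap l * kap p * A (sg l) (sg p) k.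
have K2 : a' + b' - A l p k = 0.
  transitivity (kap p * kap k * (A (sg p) (sg k) l + A (sg k) l (sg p)
     + A l (sg p) (sg k))); last by rewrite H2 mulr0.
  have -> : b' = kap p * kap k * A (sg k) l (sg p).
    by rewrite /b' -mulrA (A_J23 (sg k) l p); ring.
  by rewrite -(J23 l p k) /a'; ring.
have K3 : a' - A k l p + c' = 0.
  transitivity (kap p * kap l * (A (sg p) k (sg l) + A k (sg l) (sg p)
     + A (sg l) (sg p) k)); last by rewrite H3 mulr0.
  have -> : a' = kap p * kap l * A (sg p) k (sg l).
    by rewrite /a' -mulrA (A_J23 (sg p) k l) mulrA.
  by rewrite -(J23 k l p) /c'; ring.
have K4 : - A p k l + b' + c' = 0.
  transitivity (kap k * kap l * (A p (sg k) (sg l) + A (sg k) (sg l) p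
     + A (sg l) p (sg k))); last by rewrite H4 mulr0.
  have -> : c' = kap k * kap l * A (sg l) p (sg k).
    by rewrite /c' -mulrA (A_J23 (sg l) p k); ring.
  by rewrite -(J23 p k l) /b'; ring.
rewrite -/a'.
transitivity ((a' + b' - A l p k) + (a' - A k l p + c') - (- A p k l + b' + c')
  + (A p k l + A k l p + A l p k)); last by rewrite K2 K3 K4 H1; ring.
ring.
Qed.

Lemma A_J1 p k l : kap p * A (sg p) k l = kap k * A p (sg k) l.
Proof.
have := A_J12 p (sg k) l; rewrite sgK kapN => H.
transitivity (kap k * A p (sg k) l
   - kap k * (A p (sg k) l + kap p * - kap k * A (sg p) k l)).
  transitivity (kap p * (kap k * kap k) * A (sg p) k l); last by ring.
  by rewrite kap2 mulr1.
by rewrite H mulr0 subr0.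
Qed.

(** By [A_J12] the trace changes sign when the summation index is moved by J, which only permutes
    the frame. *)
Lemma A_div r : \sum_p A p p r = 0.
Proof.
apply: F_torsionfree.
rewrite -{1}sum_sg -big_split big1 // => p _ /=.
by have := A_J12 p p r; rewrite kap2 mul1r addrC.
Qed.

(** This is the derivative of [A_J12]: were J parallel, [S p] would inherit the symmetry of [A], so
    the defect contains a derivative of J and is quadratic in [A]. *)
Lemma S_J23 p q k l : S p q k l + kap q * kap k * S p (sg q) (sg k) l =
  \sum_m kap m * (A p q (sg m) * A m k l + A p k (sg m) * A q m l).
Proof.
rewrite !tSE.
have -> : kap q * kap k * (E p (A (sg q) (sg k) l)
    - \sum_m G p (sg q) m * A m (sg k) l - \sum_m G p (sg k) m * A (sg q) m l
    - \sum_m G p l m * A (sg q) (sg k) m) =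
  - E p (A q k l) - \sum_m kap q * kap k * G p (sg q) m * A m (sg k) l
  - \sum_m kap q * kap k * G p (sg k) m * A (sg q) m l
  + \sum_m G p l m * A q k m.
  rewrite !mulrBr; congr (_ - _ - _ + _).
  - have H : A q k l = - (kap q * kap k * A (sg q) (sg k) l).
      by apply/eqP; rewrite -addr_eq0 A_J12.
    by rewrite H raddfN opprK !fderM !fder_kap; ring.
  - by rewrite mulr_sumr; apply: eq_bigr => m _; rewrite mulrA.
  - by rewrite mulr_sumr; apply: eq_bigr => m _; rewrite mulrA.
  - rewrite mulr_sumr -sumrN; apply: eq_bigr => m _.
    have H : A q k m = - (kap q * kap k * A (sg q) (sg k) m).
      by apply/eqP; rewrite -addr_eq0 A_J12.
    by rewrite H; ring.
have -> : \sum_m kap q * kap k * G p (sg q) m * A m (sg k) l =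
    - \sum_m kap q * kap m * G p (sg q) (sg m) * A m k l.
  rewrite -sum_sg -sumrN; apply: eq_bigr => m _.
  have H : A m k l = - (kap m * kap k * A (sg m) (sg k) l).
    by apply/eqP; rewrite -addr_eq0 A_J12.
  rewrite H.
  transitivity (kap q * (kap m * kap m) * kap k * G p (sg q) (sg m) *
    A (sg m) (sg k) l); last by ring.
  by rewrite kap2; ring.
have -> : \sum_m kap q * kap k * G p (sg k) m * A (sg q) m l =
    - \sum_m kap k * kap m * G p (sg k) (sg m) * A q m l.
  rewrite -sum_sg -sumrN; apply: eq_bigr => m _.
  have H : A q m l = - (kap q * kap m * A (sg q) (sg m) l).
    by apply/eqP; rewrite -addr_eq0 A_J12.
  rewrite H.
  transitivity (kap q * (kap m * kap m) * kap k * G p (sg k) (sg m) *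
    A (sg q) (sg m) l); last by ring.
  by rewrite kap2; ring.
transitivity (\sum_m (kap q * kap m * G p (sg q) (sg m) * A m k l
   - G p q m * A m k l)
  + \sum_m (kap k * kap m * G p (sg k) (sg m) * A q m l
     - G p k m * A q m l)).
  by rewrite !sumrB; ring.
rewrite -big_split; apply: eq_bigr => m _ /=.
rewrite (AE p q (sg m)) (AE p k (sg m)) sgK kapN.
transitivity (kap q * kap m * G p (sg q) (sg m) * A m k l
  - (kap m * kap m) * G p q m * A m k l
  + (kap k * kap m * G p (sg k) (sg m) * A q m l
  - (kap m * kap m) * G p k m * A q m l)); last by ring.
by rewrite kap2; ring.
Qed.

End TypeIdentities.

Section CurvatureTypes.
Variables (F : comPzRingType) (N : nat) (fr : connection_frame F N).
Hypothesis F_torsionfree : forall x : F, x + x = 0 -> x = 0.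
Local Notation I := 'I_N.
Local Notation E := (fder fr).
Local Notation G := (fcon fr).
Local Notation R := (Rm fr).
Variables (sg : I -> I) (kb : I -> bool).
Hypothesis sgK : involutive sg.
Hypothesis kb_sg : forall a, kb (sg a) = ~~ kb a.
Local Notation kap a := ((-1) ^+ kb a : F).
Local Notation Om := (Omat F sg kb).
Local Notation A := (tA fr Om).
Local Notation S := (tS fr Om).
Hypothesis A_cyc : forall p k l, A p k l + A k l p + A l p k = 0.
Let kapN := kapN F kb_sg.
Let kap2 := kap2 F kb.
Let J23 := A_J23 fr sgK kb_sg.
Let J1 := A_J1 F_torsionfree sgK kb_sg A_cyc.
Let SJ := S_J23 F_torsionfree sgK kb_sg A_cyc.

(** The quadratic expression in [A] by which one type component of the curvature is given; its trace
    over p = k, q = l is |A|^2. *)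
Definition tQ p q k l : F := \sum_m A m p q * A m k l.

Lemma tS_comm_Omat p q k l : S p q k l - S q p k l =
  kap l * R p q k (sg l) + kap k * R p q (sg k) l.
Proof.
have H X Y i j : (X - Y : 'M[F]_N) i j = X i j - Y i j by rewrite !mxE.
rewrite -H (tS_comm fr Om) br_def opprB H !mxE.
have -> : \sum_m R p q k m * Om m l = \sum_m Om m l * R p q k m.
  by apply: eq_bigr => s _; rewrite mulrC.
by rewrite Omat_suml (Omat_sumr sgK kb_sg); ring.
Qed.

Let W p q k l : F := \sum_m A p q m * A m k l.
Let W2 p q k l : F := \sum_m A p k m * A q m l.
Let M p q k l := S p q k l + kap q * kap k * S p (sg q) (sg k) l.

Let kapM3 p q k l : kap k * M p q (sg k) l = W p q k l - W2 p q k l.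
Proof.
have -> : W p q k l = \sum_m A p q (sg m) * A (sg m) k l.
  by rewrite /W -(sum_sg sgK).
rewrite /M SJ -sumrB mulr_sumr; apply: eq_bigr => m _.
transitivity (kap m * (A p q (sg m) * (kap k * A m (sg k) l)
  + (kap k * A p (sg k) (sg m)) * A q m l)); first by ring.
rewrite -J1 J23 sgK kapN.
transitivity ((kap m * kap m) * (A p q (sg m) * A (sg m) k l
  - A p k m * A q m l)); first by ring.
by rewrite kap2 mul1r.
Qed.

Let kapM1 p q k l : kap p * M (sg p) q k l = - W p q k l - W2 p q k l.
Proof.
rewrite /M SJ /W /W2 -sumrN -sumrB mulr_sumr; apply: eq_bigr => m _.
transitivity (kap m * ((kap p * A (sg p) q (sg m)) * A m k l
  + (kap p * A (sg p) k (sg m)) * A q m l)); first by ring.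
rewrite !J1 !J23 sgK kapN.
transitivity (- (kap m * kap m) * (A p q m * A m k l + A p k m * A q m l)).
  ring.
by rewrite kap2; ring.
Qed.

(* The left-hand side is 8 times the projection of [R] to the forms that are
   J-anti-invariant in both pairs and J-invariant in the second and third
   slots; on that component the curvature is algebraic in [A]. *)
Lemma R_mixed_type p q k l :
  R p q k l - kap p * kap q * R (sg p) (sg q) k l
  - kap k * kap l * R p q (sg k) (sg l)
  + kap p * kap q * kap k * kap l * R (sg p) (sg q) (sg k) (sg l)
  + kap p * kap k * R (sg p) q (sg k) l + kap p * kap l * R (sg p) q k (sg l)
  + kap q * kap k * R p (sg q) (sg k) l + kap q * kap l * R p (sg q) k (sg l)
  = 2 * tQ p q k l.
Proof.
pose C a b d e := S a b d e - S b a d e.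
(* Each commutator [C] of second derivatives yields two of the eight curvature terms
   ([tS_comm_Omat]). *)
transitivity (- kap k * C p q (sg k) l + kap p * C (sg p) q k l
  + kap q * C p (sg q) k l + kap p * kap q * kap k * C (sg p) (sg q) (sg k) l).
  rewrite /C !tS_comm_Omat !sgK !kapN.
  by case: (kb p); case: (kb q); case: (kb k); case: (kb l);
    rewrite ?expr0 ?expr1; ring.
(* Regrouped so that second derivatives occur only in the pairs [M], which [S_J23] makes quadratic
   in [A]. *)
transitivity (- (kap k * M p q (sg k) l) + kap p * M (sg p) q k l
  + kap k * M q p (sg k) l - kap q * M (sg q) p k l).
  rewrite /M /C !sgK !kapN.
  by case: (kb p); case: (kb q); case: (kb k); rewrite ?expr0 ?expr1; ring.
rewrite !kapM3 !kapM1.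
transitivity (- 2 * (W p q k l - W q p k l)); first by ring.
rewrite /W /tQ -sumrB !mulr_sumr; apply: eq_bigr => m _.
have := A_cyc p q m.
rewrite (A_skewE fr sgK kb_sg q p m) => H.
transitivity (2 * (A m p q * A m k l
  - (A p q m + - A q p m + A m p q) * A m k l)); first by ring.
by rewrite H mul0r subr0.
Qed.

End CurvatureTypes.

(** * The Weitzenböck formula for a closed and coclosed 2-form *)

Section Weitzenbock.
Variables (F : comPzRingType) (N : nat) (fr : connection_frame F N).
Hypothesis F_torsionfree : forall x : F, x + x = 0 -> x = 0.
Local Notation I := 'I_N.
Local Notation E := (fder fr).
Local Notation G := (fcon fr).
Local Notation R := (Rm fr).
Variable Om : 'M[F]_N.
Hypothesis Om_const : forall p, Em fr p Om = 0.
Hypothesis Om_skew : Om^T = - Om.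
Local Notation A := (tA fr Om).
Local Notation S := (tS fr Om).
Hypothesis A_cyc : forall p k l, A p k l + A k l p + A l p k = 0.
Hypothesis A_div : forall r, \sum_p A p p r = 0.

Lemma tS_skewE p q k l : S p q l k = - S p q k l.
Proof.
rewrite !tSE.
have -> : A q l k = - A q k l by apply: skewE; exact: tA_skew.
have -> : \sum_m G p q m * A m l k = - \sum_m G p q m * A m k l.
  rewrite -sumrN; apply: eq_bigr => m _.
  by rewrite (skewE k l (tA_skew fr Om_skew m)) mulrN.
have -> : \sum_m G p k m * A q l m = - \sum_m G p k m * A q m l.
  rewrite -sumrN; apply: eq_bigr => m _.
  by rewrite (skewE m l (tA_skew fr Om_skew q)) mulrN.
have -> : \sum_m G p l m * A q m k = - \sum_m G p l m * A q k m.
  rewrite -sumrN; apply: eq_bigr => m _.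
  by rewrite (skewE k m (tA_skew fr Om_skew q)) mulrN.
rewrite raddfN /=; ring.
Qed.

Lemma tS_cyc p q k l : S p q k l + S p k l q + S p l q k = 0.
Proof.
rewrite !tSE.
transitivity (E p (A q k l + A k l q + A l q k)
  - \sum_m G p q m * (A m k l + A k l m + A l m k)
  - \sum_m G p k m * (A q m l + A m l q + A l q m)
  - \sum_m G p l m * (A q k m + A k m q + A m q k)).
  rewrite !raddfD /=.
  have H a (f g h : I -> F) : \sum_m G p a m * (f m + g m + h m) =
      \sum_m G p a m * f m + \sum_m G p a m * g m + \sum_m G p a m * h m.
    by rewrite -!big_split; apply: eq_bigr => m _ /=; ring.
  by rewrite !H; ring.
rewrite A_cyc raddf0 !big1 ?subr0 // => m _.
- have -> : A q k m + A k m q + A m q k = 0 by rewrite -(A_cyc q k m).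
  by rewrite mulr0.
- have -> : A q m l + A m l q + A l q m = 0 by rewrite -(A_cyc q m l).
  by rewrite mulr0.
- by rewrite A_cyc mulr0.
Qed.

Lemma tS_div k l : \sum_p S k p p l = 0.
Proof.
transitivity (E k (\sum_p A p p l) - \sum_m G k l m * \sum_p A p p m).
  rewrite raddf_sum /=.
  have -> : \sum_m G k l m * \sum_p A p p m =
      \sum_p \sum_m G k l m * A p p m.
    by rewrite exchange_big; apply: eq_bigr => m _ /=; rewrite mulr_sumr.
  have H : \sum_p \sum_m G k p m * A m p l + \sum_p \sum_m G k p m * A p m l = 0.
    rewrite [X in X + _]exchange_big -big_split big1 // => p _ /=.
    rewrite -big_split big1 // => m _ /=.
    by rewrite (G_skewE fr k p m); ring.
  rewrite -[RHS]subr0 -[X in _ = _ - X]H -big_split -!sumrB.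
  by apply: eq_bigr => p _ /=; rewrite tSE; ring.
rewrite A_div raddf0 big1 ?subrr // => m _.
by rewrite A_div mulr0.
Qed.

(** Closedness rewrites [S p p k l] as [S p k p l - S p l p k]. Interchanging the derivatives costs
    curvature terms, and what remains, such as [S k p p l], sums to zero by coclosedness. *)
Lemma weitzenbock : tL fr Om = tP fr Om + Ric fr *m Om + Om *m Ric fr.
Proof.
have S_comm p q k l : S p q k l - S q p k l =
    - \sum_m R p q k m * Om m l + \sum_m Om k m * R p q m l.
  have H X Y i j : (X - Y : 'M[F]_N) i j = X i j - Y i j by rewrite !mxE.
  by rewrite -H (tS_comm fr Om) br_def opprB H !mxE addrC.
have Rskew := Rm_skewE fr.
have Ranti := Rm_antisymE fr.
have Rpair := Rm_pair fr F_torsionfree.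
have R_cyc p k m l : R p k m l - R p l m k = R p m k l.
  have H := bianchi1 fr m l k p.
  rewrite (Rpair p k m l) (Rpair p l m k) (Rpair p m k l).
  rewrite (Rskew m l k p) (Rskew m k l p) (Ranti k m l p).
  rewrite (Rskew k l m p) (Ranti l k m p).
  transitivity (R l k m p - (R m l k p + R l k m p + R k m l p)); first by ring.
  by rewrite H; ring.
have Ric_sym k m : Ric fr m k = Ric fr k m.
  by rewrite !mxE; apply: eq_bigr => p _; rewrite Rpair Rskew Ranti opprK.
apply/matrixP => k l.
have -> : tL fr Om k l = \sum_p (S p k p l - S k p p l)
    - \sum_p (S p l p k - S l p p k).
  rewrite /tL summxE [X in _ = X - _]sumrB [X in _ = _ - X]sumrB.
  rewrite !tS_div !subr0 -sumrB; apply: eq_bigr => p _.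
  have := tS_cyc p p k l; rewrite (tS_skewE p k p l) => H.
  transitivity ((S p p k l + - S p k p l + S p l p k) + S p k p l - S p l p k).
    ring.
  by rewrite H; ring.
have SC a b : \sum_p (S p a p b - S a p p b) =
    \sum_m Ric fr a m * Om m b + \sum_p \sum_m Om p m * R p a m b.
  transitivity (\sum_p (- \sum_m R p a p m * Om m b + \sum_m Om p m * R p a m b)).
    by apply: eq_bigr => p _; rewrite S_comm.
  rewrite big_split; congr (_ + _); rewrite sumrN exchange_big -sumrN.
  apply: eq_bigr => m _ /=; rewrite mxE -mulr_suml -mulNr -sumrN.
  by congr (_ * _); apply: eq_bigr => p _; rewrite Rskew opprK.
rewrite !SC !addmxE !mxE /tP summxE.
have -> : \sum_m Ric fr l m * Om m k = - \sum_m Om k m * Ric fr m l.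
  rewrite -sumrN; apply: eq_bigr => m _.
  by rewrite (skewE k m Om_skew) Ric_sym; ring.
have -> : \sum_p (\sum_r Om p r *: R p r) k l =
    \sum_p \sum_m Om p m * R p k m l - \sum_p \sum_m Om p m * R p l m k.
  rewrite -sumrB; apply: eq_bigr => p _; rewrite summxE -sumrB.
  by apply: eq_bigr => m _; rewrite mxE -mulrBr R_cyc.
ring.
Qed.
End Weitzenbock.

(** * The pointwise estimate *)

(* Four-tensors as functions on quadruples of indices; [act a] is the complex
   structure [J] acting on the slot [a]. *)
Section FourTensors.
Variables (K : realFieldType) (N : nat).
Local Notation I := 'I_N.
Variables (sg : I -> I) (kb : I -> bool).
Hypothesis sgK : involutive sg.
Hypothesis kb_sg : forall a, kb (sg a) = ~~ kb a.
Local Notation T := (I * I * I * I)%type.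
Implicit Types f g h : T -> K.

Definition dot4 f g : K := \sum_x f x * g x.

Lemma dot4C f g : dot4 f g = dot4 g f.
Proof. by apply: eq_bigr => x _; rewrite mulrC. Qed.

Lemma dot4_ge0 f : 0 <= dot4 f f.
Proof. by apply: sumr_ge0 => x _; rewrite -expr2 sqr_ge0. Qed.

Let flip (a : 'I_4) (x : T) : T :=
  let: (p, q, k, l) := x in
  match val a with
  | 0 => (sg p, q, k, l) | 1 => (p, sg q, k, l)
  | 2 => (p, q, sg k, l) | _ => (p, q, k, sg l) end.

Let sign (a : 'I_4) (x : T) : K :=
  let: (p, q, k, l) := x in
  match val a with
  | 0 => (-1) ^+ kb p | 1 => (-1) ^+ kb q
  | 2 => (-1) ^+ kb k | _ => (-1) ^+ kb l end.

Definition act a f : T -> K := fun x => sign a x * f (flip a x).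

Let flipK a : involutive (flip a).
Proof.
move=> [[[p q] k] l]; rewrite /flip.
by case: a => -[|[|[|m]]] Hm /=; rewrite sgK.
Qed.

Let sign_flip a x : sign a (flip a x) = - sign a x.
Proof.
case: x => [[[p q] k] l]; rewrite /sign /flip.
by case: a => -[|[|[|m]]] Hm /=; rewrite kb_sg; case: (kb _);
  rewrite /= ?expr0 ?expr1 ?opprK.
Qed.

Lemma dot4_act a f g : dot4 (act a f) g = - dot4 f (act a g).
Proof.
rewrite /dot4 -sumrN (reindex (flip a)) /=; last first.
  by apply: onW_bij; exists (flip a); exact: flipK.
apply: eq_bigr => x _; rewrite /act flipK sign_flip; ring.
Qed.

Lemma dot4_act2 a b f g : dot4 (act a (act b f)) g = dot4 f (act b (act a g)).
Proof. by rewrite dot4_act dot4_act opprK. Qed.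

Local Notation i1 := (ord0 : 'I_4).
Local Notation i2 := (Ordinal (isT : 1 < 4)%N).
Local Notation i3 := (Ordinal (isT : 2 < 4)%N).
Local Notation i4 := (Ordinal (isT : 3 < 4)%N).

(** Expansion of (1 - J1 J2)(1 - J3 J4)(1 + e J2 J3), where Ja is J in the slot a. The three factors
    commute and, for e = 1 or e = - 1, each is twice an orthogonal projection; so this is 8 times
    the projection to the tensors of type e. *)
Definition mixed_sum (e : K) f : T -> K := fun x =>
  f x - act i1 (act i2 f) x - act i3 (act i4 f) x
  + act i1 (act i2 (act i3 (act i4 f))) x
  + e * (act i1 (act i3 f) x + act i1 (act i4 f) x
         + act i2 (act i3 f) x + act i2 (act i4 f) x).

Lemma dot4_mixed_sum e f g : dot4 f (mixed_sum e g) = dot4 f g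
  - dot4 f (act i1 (act i2 g)) - dot4 f (act i3 (act i4 g))
  + dot4 f (act i1 (act i2 (act i3 (act i4 g))))
  + e * (dot4 f (act i1 (act i3 g)) + dot4 f (act i1 (act i4 g))
         + dot4 f (act i2 (act i3 g)) + dot4 f (act i2 (act i4 g))).
Proof.
rewrite /dot4 -!sumrN -!big_split mulr_sumr -big_split.
by apply: eq_bigr => x _; rewrite /mixed_sum /=; ring.
Qed.

Lemma eq_dot4r f g h : g =1 h -> dot4 f g = dot4 f h.
Proof. by move=> gh; apply: eq_bigr => x _; rewrite gh. Qed.

Lemma dot4Zr c f g : dot4 f (fun x => c * g x) = c * dot4 f g.
Proof. by rewrite /dot4 mulr_sumr; apply: eq_bigr => x _; ring. Qed.

(* [h] is anti-invariant under [J] in the pairs of slots (1,2) and (3,4), and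
   has eigenvalue [e] for the mixed pairs. *)
Definition has_type e h :=
  [/\ act i1 (act i2 h) =1 (fun x => - 1 * h x),
      act i3 (act i4 h) =1 (fun x => - 1 * h x) &
      act i2 (act i3 h) =1 (fun x => e * h x)].

Let act_ext a f g : f =1 g -> act a f =1 act a g.
Proof. by move=> fg x; rewrite /act fg. Qed.

Lemma act_lin a c f : act a (fun x => c * f x) =1 (fun x => c * act a f x).
Proof. by move=> x; rewrite /act; ring. Qed.

Lemma act_sqr a f : act a (act a f) =1 (fun x => - 1 * f x).
Proof.
move=> x; rewrite /act sign_flip flipK mulrA mulrN.
congr (- _ * _); case: x => [[[p q] k] l]; rewrite /sign.
by case: a => -[|[|[|m]]] Hm /=; case: (kb _); rewrite ?expr0 ?expr1; ring.
Qed.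

Lemma act_comm a b f : act a (act b f) =1 act b (act a f).
Proof.
move=> [[[p q] k] l]; rewrite /act /sign /flip.
by case: a => -[|[|[|[|m]]]] // Hm /=; case: b => -[|[|[|[|m']]]] // Hm' /=;
  rewrite ?kb_sg; ring.
Qed.

Lemma has_type_mixed e h : has_type e h ->
  [/\ act i1 (act i3 h) =1 (fun x => e * h x),
      act i1 (act i4 h) =1 (fun x => e * h x),
      act i2 (act i4 h) =1 (fun x => e * h x) &
      act i1 (act i2 (act i3 (act i4 h))) =1 h].
Proof.
move=> [h12 h34 h23].
have e21 : act i2 h =1 act i1 h.
  move=> x; have := act_sqr i1 (act i2 h) x.
  by rewrite (act_ext i1 h12) act_lin => H; move: H; lra.
have e43 : act i4 h =1 act i3 h.
  move=> x; have := act_sqr i3 (act i4 h) x.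
  by rewrite (act_ext i3 h34) act_lin => H; move: H; lra.
have h13 : act i1 (act i3 h) =1 (fun x => e * h x).
  move=> x; rewrite act_comm -(act_ext i3 e21) act_comm; exact: h23.
split=> //.
- by move=> x; rewrite (act_ext i1 e43).
- by move=> x; rewrite (act_ext i2 e43).
- move=> x; rewrite (act_ext i1 (act_ext i2 h34)).
  by rewrite (act_ext i1 (act_lin i2 _ _)) act_lin h12; ring.
Qed.

Lemma dot4_type e f h : has_type e h -> e * e = 1 ->
  dot4 (mixed_sum e f) h = 8 * dot4 f h.
Proof.
move=> ht ee; have [h13 h14 h24 h1234] := has_type_mixed ht.
have [h12 h34 h23] := ht.
rewrite dot4C dot4_mixed_sum.
have D a b c : act b (act a h) =1 (fun x => c * h x) ->
    dot4 h (act a (act b f)) = c * dot4 f h.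
  by move=> H; rewrite dot4C dot4_act2 (eq_dot4r _ H) dot4Zr.
have sw a b c : act a (act b h) =1 (fun x => c * h x) ->
    act b (act a h) =1 (fun x => c * h x).
  by move=> H x; rewrite act_comm H.
rewrite (D _ _ _ (sw _ _ _ h12)) (D _ _ _ (sw _ _ _ h34)).
rewrite (D _ _ _ (sw _ _ _ h13)) (D _ _ _ (sw _ _ _ h14)).
rewrite (D _ _ _ (sw _ _ _ h23)) (D _ _ _ (sw _ _ _ h24)).
have -> : dot4 h (act i1 (act i2 (act i3 (act i4 f)))) = dot4 f h.
  rewrite dot4C dot4_act2 dot4_act2; apply: eq_dot4r => x.
  rewrite (act_ext i4 (act_ext i3 (sw _ _ _ h12))).
  by rewrite (act_ext i4 (act_lin i3 _ _)) act_lin (sw _ _ _ h34); ring.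
rewrite (dot4C h f).
transitivity (dot4 f h * (4 + 4 * (e * e))); first by ring.
by rewrite ee; ring.
Qed.

Lemma mixed_sum_type f : has_type (- 1) (mixed_sum (- 1) f).
Proof.
split=> -[[[p q] k] l]; rewrite /mixed_sum /act /sign /flip /= !sgK !kb_sg;
by case: (kb p); case: (kb q); case: (kb k); case: (kb l);
  rewrite /= ?expr0 ?expr1; ring.
Qed.

(* Here [f] is the curvature and [h] is algebraic in the covariant derivative
   of the complex structure. *)
Lemma curvature_type_bound f h :
  (forall p q k l, f (q, p, k, l) = - f (p, q, k, l)) ->
  (forall p q k l, f (p, q, l, k) = - f (p, q, k, l)) ->
  has_type 1 h -> mixed_sum 1 f =1 (fun x => 2 * h x) ->
  dot4 f h = 4^-1 * dot4 h h /\
  dot4 f (act i2 (act i4 f)) + dot4 f (act i2 (act i3 f)) <= 8^-1 * dot4 h h.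
Proof.
move=> f12 f34 ht fh.
have e1 : dot4 f h = 4^-1 * dot4 h h.
  have := dot4_type f ht (mulr1 1).
  by rewrite dot4C (eq_dot4r _ fh) dot4Zr; lra.
split=> //.
(* The opposite type component is not controlled, but its square norm is nonnegative. By the
   antisymmetries of [f] all four mixed products have one value x. The terms without e add up to
   some B, with B + 4 x = |h|^2 / 2 and B - 4 x >= 0; hence 2 x <= |h|^2 / 8. *)
pose g := mixed_sum (- 1) f.
have g0 : 0 <= dot4 f g.
  have m1 : -1 * -1 = 1 :> K by rewrite mulrNN mulr1.
  have := dot4_type f (mixed_sum_type f) m1.
  by have := dot4_ge0 g; rewrite -/g; lra.
have e2 : dot4 f (mixed_sum 1 f) = 2 * dot4 f h.
  by rewrite (eq_dot4r _ fh) dot4Zr.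
pose w12 (x : T) : T := let: (p, q, k, l) := x in (q, p, k, l).
pose w34 (x : T) : T := let: (p, q, k, l) := x in (p, q, l, k).
have w12K : involutive w12 by move=> [[[p q] k] l].
have w34K : involutive w34 by move=> [[[p q] k] l].
have s13 : dot4 f (act i1 (act i3 f)) = dot4 f (act i2 (act i3 f)).
  rewrite /dot4 (reindex w12) /=; last by apply: onW_bij; exists w12.
  apply: eq_bigr => -[[[p q] k] l] _; rewrite /act /sign /flip /=.
  by rewrite f12 (f12 p (sg q) (sg k) l); ring.
have s14 : dot4 f (act i1 (act i4 f)) = dot4 f (act i2 (act i4 f)).
  rewrite /dot4 (reindex w12) /=; last by apply: onW_bij; exists w12.
  apply: eq_bigr => -[[[p q] k] l] _; rewrite /act /sign /flip /=.
  by rewrite f12 (f12 p (sg q) k (sg l)); ring.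
have s23 : dot4 f (act i2 (act i3 f)) = dot4 f (act i2 (act i4 f)).
  rewrite /dot4 (reindex w34) /=; last by apply: onW_bij; exists w34.
  apply: eq_bigr => -[[[p q] k] l] _; rewrite /act /sign /flip /=.
  by rewrite f34 (f34 p (sg q) k (sg l)); ring.
move: g0 e2 e1; rewrite /g !dot4_mixed_sum s13 s14 s23.
lra.
Qed.

End FourTensors.

Lemma dot4E (K : realFieldType) (N : nat)
    (f g : 'I_N * 'I_N * 'I_N * 'I_N -> K) :
  dot4 f g = \sum_p \sum_q \sum_k \sum_l f (p, q, k, l) * g (p, q, k, l).
Proof.
by rewrite !pair_bigA /=; apply: eq_bigr => -[[[p q] k] l] _.
Qed.

Lemma cauchy_schwarz_sum (K : realFieldType) (J : finType) (f g : J -> K) :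
  (\sum_x f x * g x) ^+ 2 <= (\sum_x f x * f x) * (\sum_x g x * g x).
Proof.
set a := \sum_x f x * f x; set b := \sum_x f x * g x; set c := \sum_x g x * g x.
have a0 : 0 <= a by apply: sumr_ge0 => x _; rewrite -expr2 sqr_ge0.
have H s t : 0 <= s ^+ 2 * a + 2 * (s * t) * b + t ^+ 2 * c.
  have -> : s ^+ 2 * a + 2 * (s * t) * b + t ^+ 2 * c =
      \sum_x (s * f x + t * g x) ^+ 2.
    by rewrite !mulr_sumr -!big_split; apply: eq_bigr => x _ /=; ring.
  by apply: sumr_ge0 => x _; exact: sqr_ge0.
have [a_eq0|a_neq0] := eqVneq a 0.
  have fb x : f x = 0.
    have /allP/(_ x (mem_index_enum x)) : all (fun x => true ==> (f x * f x == 0))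
        (index_enum J).
      rewrite -psumr_eq0; last by move=> y _; rewrite -expr2 sqr_ge0.
      by rewrite -/a a_eq0.
    by rewrite /= mulf_eq0 orbb => /eqP.
  by rewrite /b big1 ?expr0n /= ?a_eq0 ?mul0r // => x _; rewrite fb mul0r.
have a_gt0 : 0 < a by rewrite lt_def a_neq0.
have := H (- b) a.
have -> : (- b) ^+ 2 * a + 2 * (- b * a) * b + a ^+ 2 * c =
    a * (a * c - b ^+ 2) by ring.
by rewrite pmulr_rge0 // subr_ge0.
Qed.

(** * The lower bound for the divergence of V *)

Section AlmostKahlerEstimate.
Variables (F : comPzRingType) (N : nat) (fr : connection_frame F N).
Hypothesis F_torsionfree : forall x : F, x + x = 0 -> x = 0.
Local Notation I := 'I_N.
Local Notation E := (fder fr).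
Local Notation G := (fcon fr).
Local Notation R := (Rm fr).
Variables (sg : I -> I) (kb : I -> bool) (z : I).
Hypothesis sgK : involutive sg.
Hypothesis kb_sg : forall a, kb (sg a) = ~~ kb a.
Hypothesis kb_z : kb z = true.
Local Notation kap a := ((-1) ^+ kb a : F).
Local Notation Om := (Omat F sg kb).
Local Notation A := (tA fr Om).
Local Notation S := (tS fr Om).
Hypothesis A_cyc : forall p k l, A p k l + A k l p + A l p k = 0.
(* [z] is the direction of the flat factor in the product M x R. *)
Hypothesis G_z : forall a b, G a b z = 0.
Variable tauF : F.
Hypothesis tauF_const : forall a, E a tauF = 0.
Hypothesis RicE : forall k m,
  Ric fr k m = if (k == m) && (k != z) then tauF else 0.
Variables (K : realFieldType) (ev : {rmorphism F -> K}).

Let Om_const := Omat_const fr sg kb.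
Let Om_skew := Omat_skew F sgK kb_sg.
Let A_div := A_div F_torsionfree sgK kb_sg A_cyc.

Lemma R_z a b c : R a b c z = 0.
Proof.
rewrite RmE !G_z !raddf0 !big1 ?(subrr, subr0, oppr0, addr0) // => e _.
- by rewrite G_z mulr0.
- by rewrite G_z mulr0.
- by rewrite G_z mulr0.
Qed.

(** Ric is tau times the projection off the direction z, and this projection is parallel because z
    is. *)
Lemma Ric_parallel p : cov fr p (Ric fr) = 0.
Proof.
apply/matrixP => k l; rewrite covE zeromxE.
have -> : E p (Ric fr k l) = 0.
  by rewrite RicE; case: ifP; rewrite ?tauF_const ?raddf0.
have -> : \sum_s G p k s * Ric fr s l = if l != z then G p k l * tauF else 0.
  rewrite (bigD1 l) //= big1 ?addr0 => [|s sl].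
    by rewrite RicE eqxx /=; case: ifP; rewrite ?mulr0.
  by rewrite RicE (negPf sl) mulr0.
have -> : \sum_s G p l s * Ric fr k s = if k != z then G p l k * tauF else 0.
  rewrite (bigD1 k) //= big1 ?addr0 => [|s sl].
    by rewrite RicE eqxx /=; case: ifP; rewrite ?mulr0.
  by rewrite RicE eq_sym (negPf sl) mulr0.
rewrite (G_skewE fr p k l).
case: (eqVneq k z) => [->|kz] /=; case: (eqVneq l z) => [->|lz] /=.
- ring.
- by rewrite (G_skewE fr p l z) G_z; ring.
- by rewrite (G_skewE fr p z k) ?G_z (G_skewE fr p k z) G_z; ring.
- ring.
Qed.

Let R_div := divR F_torsionfree Ric_parallel.

Lemma divV_identity : fdiv fr (divV fr Om) =
  ip (tP fr Om) (tL fr Om) + (tRAA fr Om + tRAA fr Om) + (tK fr Om + tK fr Om).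
Proof. exact: fdiv_main. Qed.

Let fR (x : I * I * I * I) : K :=
  let: (p, q, k, l) := x in ev (R p q k l).
Let fQ (x : I * I * I * I) : K :=
  let: (p, q, k, l) := x in ev (tQ fr sg kb p q k l).

Let kapE a : ev (kap a) = (-1) ^+ kb a.
Proof. by rewrite rmorph_sign. Qed.

Let J23 := A_J23 fr sgK kb_sg.
Let J1 := A_J1 F_torsionfree sgK kb_sg A_cyc.

Let A_J23' m p q : kap p * (kap q * A m (sg p) (sg q)) = - A m p q.
Proof.
transitivity (kap q * (kap p * A m (sg p) (sg q))); first by ring.
by rewrite J23 sgK (kapN F kb_sg) mulNr mulrN mulrA kap2 mul1r.
Qed.

(** The mixed eigenvalue is 1 because [J1] transfers the J of the second and of the third slot to
    the summation index of [tQ], where J only permutes the terms up to a sign that is squared. *)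
Let fQ_type : has_type sg kb 1 fQ.
Proof.
split=> -[[[p q] k] l]; rewrite /act /fQ /=.
- rewrite -!kapE -!rmorphM mulN1r -rmorphN /tQ !mulr_sumr -sumrN.
  congr (ev _); apply: eq_bigr => m _; rewrite -mulNr -A_J23'; ring.
- rewrite -!kapE -!rmorphM mulN1r -rmorphN /tQ !mulr_sumr -sumrN.
  congr (ev _); apply: eq_bigr => m _; rewrite -mulrN -A_J23'; ring.
- rewrite mul1r -!kapE -!rmorphM /tQ !mulr_sumr -[X in _ = ev X](sum_sg sgK).
  congr (ev _); apply: eq_bigr => m _.
  transitivity ((kap q * A m p (sg q)) * (kap k * A m (sg k) l)); first by ring.
  rewrite -J23 -!J1.
  transitivity ((kap m * kap m) * (A (sg m) p q * A (sg m) k l)); first by ring.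
  by rewrite kap2 mul1r.
Qed.

Let fR_mixed : mixed_sum sg kb 1 fR =1 (fun x => 2 * fQ x).
Proof.
move=> [[[p q] k] l]; rewrite /mixed_sum /act /fR /fQ /=.
have := congr1 ev (R_mixed_type F_torsionfree sgK kb_sg A_cyc p q k l).
have -> : ev (2 * tQ fr sg kb p q k l) = 2 * ev (tQ fr sg kb p q k l).
  by rewrite rmorphM rmorph_nat.
by rewrite !(rmorphD, rmorphN, rmorphM, kapE) => <-; ring.
Qed.

Let fR_bound : dot4 fR fQ = 4^-1 * dot4 fQ fQ /\ _ :=
  curvature_type_bound sgK kb_sg
    (fun p q k l => etrans (congr1 ev (Rm_antisymE fr p q k l)) (rmorphN ev _))
    (fun p q k l => etrans (congr1 ev (Rm_skewE fr p q k l)) (rmorphN ev _))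
    fQ_type fR_mixed.

Let ev_tRAA : ev (tRAA fr Om) = dot4 fR fQ.
Proof.
rewrite dot4E /tRAA /fR /fQ.
transitivity (ev (\sum_p \sum_q \sum_s A s p q * ip (R p q) (A s))).
  by congr (ev _); exact: (sum3_rot (fun s p q => A s p q * ip (R p q) (A s))).
rewrite rmorph_sum; apply: eq_bigr => p _.
rewrite rmorph_sum; apply: eq_bigr => q _.
have -> : \sum_s A s p q * ip (R p q) (A s) =
    \sum_k \sum_l R p q k l * tQ fr sg kb p q k l.
  transitivity (\sum_s \sum_k \sum_l A s p q * (R p q k l * A s k l)).
    apply: eq_bigr => s _; rewrite ipE mulr_sumr; apply: eq_bigr => k _.
    by rewrite mulr_sumr.
  rewrite exchange_big; apply: eq_bigr => k _ /=.
  rewrite exchange_big; apply: eq_bigr => l _ /=.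
  by rewrite /tQ mulr_sumr; apply: eq_bigr => m _; ring.
rewrite rmorph_sum; apply: eq_bigr => k _.
by rewrite rmorph_sum; apply: eq_bigr => l _; rewrite rmorphM.
Qed.

Local Notation i2 := (Ordinal (isT : 1 < 4)%N).
Local Notation i3 := (Ordinal (isT : 2 < 4)%N).
Local Notation i4 := (Ordinal (isT : 3 < 4)%N).

(** Contraction with [Om] puts J into the second slot, and the commutator with [Om] puts it into the
    third or the fourth. *)
Let ev_tK : ev (tK fr Om) = - (dot4 fR (act sg kb i2 (act sg kb i4 fR))
  + dot4 fR (act sg kb i2 (act sg kb i3 fR))).
Proof.
rewrite !dot4E -big_split /tK rmorph_sum -sumrN; apply: eq_bigr => r _ /=.
rewrite -big_split rmorph_sum -sumrN; apply: eq_bigr => q _ /=.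
rewrite Omat_suml ipE mulr_sumr -big_split rmorph_sum -sumrN.
apply: eq_bigr => k _ /=.
rewrite mulr_sumr -big_split rmorph_sum -sumrN; apply: eq_bigr => l _ /=.
have H X Y i j : (X - Y : 'M[F]_N) i j = X i j - Y i j by rewrite !mxE.
rewrite -(tS_comm fr Om) H (tS_comm_Omat fr sgK kb_sg) /act /=.
rewrite (Rm_antisymE fr r) (Rm_antisymE fr r).
by rewrite !(rmorphD, rmorphN, rmorphM, kapE); ring.
Qed.

(** The contribution of [tRAA] is 2 |Q|^2 / 4, that of [tK] is at least - 2 |Q|^2 / 8. *)
Let ev_R_terms : 4^-1 * dot4 fQ fQ <=
  ev (tRAA fr Om + tRAA fr Om + (tK fr Om + tK fr Om)).
Proof.
have [h1 h2] := fR_bound.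
rewrite !rmorphD /= ev_tRAA ev_tK h1; move: h2.
set a := dot4 fR _; set b := dot4 fR _; set c := dot4 fQ fQ; lra.
Qed.

Definition normA : F := \sum_p ip (A p) (A p).
(** This is |nabla alpha|^2: the index [sg z] is that of the Reeb direction, and by [tAz] the
    entries used here are the components of its derivative. *)
Definition normAz : F := \sum_p \sum_m A p m z * A p m z.

Let sz : sg (sg z) = z := sgK z.
Let kb_sz : kb (sg z) = false. Proof. by rewrite kb_sg kb_z. Qed.
Let sz_neq : sg z != z.
Proof. by apply/eqP => H; move: kb_sz; rewrite H kb_z. Qed.

Let OmzE a : Om a z = if a == sg z then 1 else 0.
Proof.
rewrite mxE; have -> : (z == sg a) = (a == sg z).
  by apply/eqP/eqP => ->; rewrite sgK.
by case: eqP => [->|_]; rewrite ?kb_sz ?expr0 ?mulr1 ?mulr0.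
Qed.

Lemma weitzenbockE k l : tL fr Om k l =
  tP fr Om k l + ((k != z)%:R + (l != z)%:R) * (tauF * Om k l).
Proof.
rewrite (weitzenbock F_torsionfree Om_skew A_cyc A_div) !addmxE !mxE.
have -> : \sum_j Ric fr k j * Om j l = (k != z)%:R * (tauF * Om k l).
  rewrite (bigD1 k) //= big1 ?addr0 => [|s sk].
    by rewrite RicE eqxx /=; case: ifP => _; rewrite ?mul0r ?mul1r.
  by rewrite RicE eq_sym (negPf sk) mul0r.
have -> : \sum_j Om k j * Ric fr j l = (l != z)%:R * (tauF * Om k l).
  rewrite (bigD1 l) //= big1 ?addr0 => [|s sk].
    by rewrite RicE eqxx /=; case: ifP => _; rewrite ?mulr0 ?mul0r ?mul1r // mulrC.
  by rewrite RicE (negPf sk) mulr0.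
by rewrite !mxE; ring.
Qed.

Lemma tP_z k : tP fr Om k z = 0.
Proof.
rewrite /tP summxE big1 // => p _; rewrite summxE big1 // => r _.
by rewrite mxE R_z mulr0.
Qed.

Lemma tP_zl k : tP fr Om z k = 0.
Proof.
rewrite /tP summxE big1 // => p _; rewrite summxE big1 // => r _.
by rewrite mxE (Rm_skewE fr p r k z) R_z oppr0 mulr0.
Qed.

Lemma tAz p m : A p m z = G p (sg z) m.
Proof.
rewrite (AE fr sgK kb_sg) G_z mulr0 addr0 kb_z expr1.
by rewrite (G_skewE fr p (sg z) m); ring.
Qed.

(** Bochner formula for alpha, read off the Weitzenböck formula at the entry (sg z, z). There [tP]
    vanishes, one of the two Ricci terms survives and gives tau, and the Laplacian reduces to minus
    a sum of squares because [A p (sg z) z] = 0. *)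
Lemma normAzE : normAz = - tauF.
Proof.
have A0 p : A p (sg z) z = 0.
  rewrite tAz; apply: F_torsionfree.
  by rewrite {1}(G_skewE fr p (sg z) (sg z)) addNr.
have : tL fr Om (sg z) z = tauF.
  by rewrite weitzenbockE tP_z OmzE sz_neq !eqxx /=; ring.
move=> <-; rewrite /normAz /tL summxE -sumrN; apply: eq_bigr => p _.
rewrite tSE A0 raddf0.
rewrite [X in _ - X - _ - _]big1; last by move=> m _; rewrite A0 mulr0.
rewrite [X in _ - X]big1; last first.
  by move=> m _; rewrite (G_skewE fr p m z) G_z oppr0 mul0r.
rewrite !(subr0, sub0r) opprK; apply: eq_bigr => m _.
by rewrite {1}tAz.
Qed.

Lemma ip_Om_tA p : ip Om (A p) = 0.
Proof.
apply: F_torsionfree; rewrite {1}ipC /tA -cov_ip ipE raddf_sum big1 // => k _.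
rewrite raddf_sum big1 // => l _; rewrite fderM (E_Om Om_const) mul0r mulr0.
by rewrite addr0.
Qed.

(** Second derivative of the constant |Om|^2. *)
Lemma ip_Om_tL : ip Om (tL fr Om) = - normA.
Proof.
rewrite /tL ip_sumr -sumrN; apply: eq_bigr => p _.
rewrite /tS nabm_def ipBr ip_sumr big1 ?subr0 => [|s _]; last first.
  by rewrite ipZr ip_Om_tA mulr0.
have := cov_ip fr p Om (A p); rewrite ip_Om_tA raddf0 -/(tA fr Om p) => H.
by rewrite -[LHS]subr0 H; ring.
Qed.

Let tau := ev tauF.
(** The constant combines three factors: the star-Ricci form is - [tP] / 2 ([star_ricci]), a sum
    over ordered pairs is twice the inner product of 2-forms, and 1 / n = 2 / (N - 2). *)
Definition taustar_of : K := - (2 * (N%:R - 2))^-1 * ev (ip (tP fr Om) Om).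
Local Notation t := taustar_of.

Let m2 : K := N%:R - 2.
Hypothesis m2_gt0 : 0 < m2.

Let L k l := ev (tL fr Om k l).
(** The components of omega alone: the part alpha /\ dt of [Om] is removed. *)
Let Oz k l : K := if (k != z) && (l != z) then ev (Om k l) else 0.
Let f := \sum_k \sum_l Oz k l * L k l.

Let PE k l : ev (tP fr Om k l) =
  if (k != z) && (l != z) then L k l - 2 * tau * Oz k l else 0.
Proof.
rewrite /L /Oz.
case: (eqVneq k z) => [->|kz] /=; first by rewrite tP_zl rmorph0.
case: (eqVneq l z) => [->|lz] /=; first by rewrite tP_z rmorph0.
rewrite weitzenbockE kz lz !rmorphD !rmorphM !rmorphD /= rmorph1 /tau; ring.
Qed.

Let sumOO : \sum_k \sum_l Oz k l * Oz k l = m2.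
Proof.
transitivity (\sum_k (if (k != z) && (k != sg z) then 1 else 0 : K)).
  apply: eq_bigr => k _.
  rewrite (bigD1 (sg k)) //= big1 ?addr0 => [|l lk]; last first.
    by rewrite /Oz mxE (negPf lk) mulr0 rmorph0; case: ifP; rewrite mulr0.
  rewrite /Oz (_ : (sg k != z) = (k != sg z)); last first.
    by congr (~~ _); apply/eqP/eqP => [<-|->]; rewrite sgK.
  case: ifP => _; last by rewrite mulr0.
  by rewrite mxE eqxx mulr1 -rmorphM kap2 rmorph1.
rewrite -big_mkcond /= sumr_const /m2.
have -> : #|[pred k | (k != z) && (k != sg z)]| = (N - 2)%N.
  have := fintype.cardC [set z; sg z]; rewrite cards2 eq_sym sz_neq card_ord.
  move=> /(congr1 (subn^~ 2%N)); rewrite addKn => <-.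
  by apply: eq_card => k; rewrite !inE negb_or.
rewrite natrB //.
have := max_card (mem [set z; sg z]).
by rewrite cards2 eq_sym sz_neq card_ord.
Qed.

Let ip_PO : ev (ip (tP fr Om) Om) = f - 2 * tau * m2.
Proof.
rewrite -sumOO /f ipE rmorph_sum mulr_sumr -sumrB; apply: eq_bigr => k _ /=.
rewrite rmorph_sum mulr_sumr -sumrB; apply: eq_bigr => l _ /=.
by rewrite rmorphM PE /Oz; case: ifP => [->|_]; ring.
Qed.

Let ip_PL : ev (ip (tP fr Om) (tL fr Om)) =
  \sum_k \sum_l (if (k != z) && (l != z) then L k l else 0) ^+ 2 - 2 * tau * f.
Proof.
rewrite /f ipE rmorph_sum mulr_sumr -sumrB; apply: eq_bigr => k _ /=.
rewrite rmorph_sum mulr_sumr -sumrB; apply: eq_bigr => l _ /=.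
by rewrite rmorphM PE /Oz -/(L k l); case: ifP => [->|_]; ring.
Qed.

Let f_le : f ^+ 2 <=
  m2 * \sum_k \sum_l (if (k != z) && (l != z) then L k l else 0) ^+ 2.
Proof.
pose g (x : I * I) := if (x.1 != z) && (x.2 != z) then L x.1 x.2 else 0.
have -> : f = \sum_x Oz x.1 x.2 * g x.
  rewrite /f pair_bigA; apply: eq_bigr => x _.
  by rewrite /Oz /g; case: ifP => _; rewrite ?mul0r.
have -> : \sum_k \sum_l (if (k != z) && (l != z) then L k l else 0) ^+ 2 =
    \sum_x g x * g x.
  by rewrite pair_bigA; apply: eq_bigr => x _; rewrite expr2.
by rewrite -sumOO pair_bigA; exact: cauchy_schwarz_sum.
Qed.

(** Minus the product of [Om] with the Laplacian; besides [f], the two entries at z and [sg z]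
    contribute tau each. *)
Let ev_normA : ev normA = - f - 2 * tau.
Proof.
have -> : normA = - ip Om (tL fr Om) by rewrite ip_Om_tL opprK.
have Lsz : L (sg z) z = tau.
  by rewrite /L weitzenbockE tP_z OmzE sz_neq !eqxx /=; congr (ev _); ring.
have Lzs : L z (sg z) = - tau.
  rewrite /L weitzenbockE tP_zl eqxx sz_neq (skewE (sg z) z Om_skew) OmzE eqxx.
  by rewrite -rmorphN; congr (ev _); rewrite /=; ring.
have H : ev (ip Om (tL fr Om)) = f + 2 * tau.
  rewrite ipE rmorph_sum.
  transitivity (\sum_k (\sum_l Oz k l * L k l
    + (if k == z then tau else 0) + (if k == sg z then tau else 0))).
    apply: eq_bigr => k _; rewrite rmorph_sum /=.
    rewrite (bigD1 (sg k)) //= [X in _ + X]big1 ?addr0; last first.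
      by move=> l lk; rewrite mxE (negPf lk) mulr0 mul0r rmorph0.
    rewrite [in RHS](bigD1 (sg k)) //= [X in _ + X + _ + _]big1 ?addr0; last first.
      by move=> l lk; rewrite /Oz mxE (negPf lk) mulr0 rmorph0;
        case: ifP; rewrite mul0r.
    rewrite rmorphM -/(L k (sg k)) /Oz.
    have [->|kz] := eqVneq k z.
      rewrite ?eqxx /= Lzs mxE eqxx kb_z rmorphM rmorph_sign rmorph_nat.
      by rewrite (eq_sym z) (negPf sz_neq) /= expr1; ring.
    have [->|ksz] := eqVneq k (sg z).
      rewrite sz ?eqxx ?andbF mul0r Lsz mxE sz eqxx kb_sz rmorphM rmorph_sign.
      by rewrite /= expr0; ring.
    suff -> : sg k != z by ring.
    by apply: contraNneq ksz => <-; rewrite sgK.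
  by rewrite !big_split /= -!big_mkcond /= !big_pred1_eq /f; ring.
by rewrite rmorphN H; ring.
Qed.

(** By skewness every square in |nabla alpha|^2 occurs in |A|^2 twice, once in the column z and once
    in the row z. *)
Let ev_normA_ge : - 2 * tau <= ev normA.
Proof.
have -> : - 2 * tau = 2 * ev normAz.
  by rewrite normAzE rmorphN /tau; ring.
rewrite /normA /normAz !rmorph_sum mulr_sumr; apply: ler_sum => p _.
have -> : ev (ip (A p) (A p)) = \sum_k \sum_l ev (A p k l * A p k l).
  by rewrite ipE rmorph_sum; apply: eq_bigr => k _; rewrite rmorph_sum.
rewrite rmorph_sum.
have Azz : A p z z = 0 by rewrite tAz G_z.
have le_sq (i j : I) : 0 <= ev (A p i j * A p i j).
  by rewrite rmorphM -expr2 sqr_ge0.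
have zrow : \sum_l ev (A p z l * A p z l) = \sum_m ev (A p m z * A p m z).
  by apply: eq_bigr => m _; rewrite (A_skewE fr sgK kb_sg p m z) mulrNN.
rewrite [leRHS](bigD1 z) //= zrow.
have -> : 2 * \sum_m ev (A p m z * A p m z) =
  \sum_m ev (A p m z * A p m z) + \sum_(m | m != z) ev (A p m z * A p m z).
  rewrite [in RHS](bigD1 z) //= [in LHS](bigD1 z) //= Azz mulr0 rmorph0; ring.
rewrite lerD2l; apply: ler_sum => k _.
rewrite (bigD1 z) //= lerDl.
by apply: sumr_ge0.
Qed.

(** |A|^2 is a sum of N^2 entries of Q, so the Cauchy-Schwarz inequality with the constant function
    1 applies. *)
Let quartic_ge : ev normA ^+ 2 <= N%:R ^+ 2 * dot4 fQ fQ.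
Proof.
have -> : ev normA = \sum_p \sum_q fQ (p, q, p, q).
  rewrite /normA rmorph_sum /fQ /tQ.
  transitivity (\sum_p \sum_k \sum_l ev (A p k l * A p k l)).
    apply: eq_bigr => p _; rewrite ipE rmorph_sum; apply: eq_bigr => k _.
    by rewrite rmorph_sum.
  rewrite exchange_big; apply: eq_bigr => k _ /=.
  rewrite exchange_big; apply: eq_bigr => l _ /=.
  by rewrite rmorph_sum.
rewrite pair_bigA /=.
have := cauchy_schwarz_sum (fun x : I * I => 1) (fun x => fQ (x.1, x.2, x.1, x.2)).
have -> : \sum_(x : I * I) 1 * 1 = N%:R ^+ 2 :> K.
  by rewrite mulr1 sumr_const card_prod card_ord natrM expr2.
have -> : \sum_(x : I * I) 1 * fQ (x.1, x.2, x.1, x.2) =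
    \sum_(x : I * I) fQ (x.1, x.2, x.1, x.2).
  by apply: eq_bigr => x _; rewrite mul1r.
move=> /le_trans; apply; apply: ler_wpM2l; first exact: sqr_ge0.
rewrite dot4E -(pair_bigA _ (fun p q => fQ (p, q, p, q) * fQ (p, q, p, q))) /=.
apply: ler_sum => p _; apply: ler_sum => q _.
rewrite (bigD1 p) //= (bigD1 q) //= -addrA lerDl.
apply: addr_ge0; first by apply: sumr_ge0 => l _; rewrite -expr2 sqr_ge0.
by apply: sumr_ge0 => k _; apply: sumr_ge0 => l _; rewrite -expr2 sqr_ge0.
Qed.

Lemma ev_normAE : ev normA = 2 * m2 * (t - tau) - 2 * tau.
Proof.
rewrite ev_normA /taustar_of -/m2 ip_PO.
by field; rewrite gt_eqF.
Qed.

Lemma tau_le0 : tau <= 0.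
Proof.
have : 0 <= ev normAz.
  rewrite /normAz rmorph_sum sumr_ge0 // => p _.
  by rewrite rmorph_sum sumr_ge0 // => m _; rewrite rmorphM -expr2 sqr_ge0.
by rewrite normAzE rmorphN /tau; lra.
Qed.

(** With f = - 2 m2 (t - tau), the Laplacian term is at least f^2 / m2 - 2 tau f = 4 m2 (t - tau) t.
    The curvature terms are at least |Q|^2 / 4 >= |A|^4 / (4 N^2), and |A|^2 >= - 2 tau >= 0. *)
Lemma divV_estimate :
  4 * m2 * (t - tau) * t + tau ^+ 2 / N%:R ^+ 2 <= ev (fdiv fr (divV fr Om)).
Proof.
rewrite divV_identity -addrA rmorphD.
have N0 : (0 : K) < N%:R ^+ 2.
  by rewrite exprn_gt0 //; move: m2_gt0; rewrite /m2; lra.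
have fE : f = - 2 * m2 * (t - tau).
  by move: ev_normA; rewrite ev_normAE; lra.
apply: lerD.
  rewrite ip_PL.
  set s := \sum_k _; have fs : f ^+ 2 <= m2 * s := f_le.
  suff : m2 * (4 * m2 * (t - tau) * t) <= m2 * (s - 2 * tau * f).
    by rewrite ler_pM2l.
  move: fs; rewrite fE; set d := t - tau.
  have -> : t = d + tau by rewrite /d subrK.
  by move: m2 s tau d => a b c d; lra.
apply: le_trans ev_R_terms.
rewrite ler_pdivrMr //.
have : 4 * tau ^+ 2 <= ev normA ^+ 2.
  have -> : 4 * tau ^+ 2 = (- 2 * tau) ^+ 2 by ring.
  rewrite ler_sqr ?nnegrE ?ev_normA_ge //; have := tau_le0.
    lra.
  by have := ev_normA_ge; lra.
move: quartic_ge; set q := dot4 _ _; set a := ev normA ^+ 2; lra.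
Qed.

Lemma tA_eq0 : t = 0 -> tau = 0 -> forall p k l, ev (A p k l) = 0.
Proof.
move=> t0 tau0 p k l; have := ev_normAE.
rewrite t0 tau0 subrr !mulr0 subr0 => H.
have ge0 q i : 0 <= \sum_j ev (A q i j * A q i j).
  by apply: sumr_ge0 => j _; rewrite rmorphM -expr2 sqr_ge0.
have : \sum_p \sum_k \sum_l ev (A p k l * A p k l) = 0.
  rewrite -[RHS]H /normA rmorph_sum; apply: eq_bigr => q _.
  by rewrite ipE rmorph_sum; apply: eq_bigr => i _; rewrite rmorph_sum.
move/eqP; rewrite psumr_eq0 => [|q _]; last by apply: sumr_ge0.
move=> /allP/(_ p (mem_index_enum _)) /=; rewrite psumr_eq0 //.
move=> /allP/(_ k (mem_index_enum _)) /=; rewrite psumr_eq0 => [|j _]; last first.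
  by rewrite rmorphM -expr2 sqr_ge0.
move=> /allP/(_ l (mem_index_enum _)) /=.
by rewrite rmorphM mulf_eq0 orbb => /eqP.
Qed.

End AlmostKahlerEstimate.

Local Open Scope classical_set_scope.
Local Open Scope ring_scope.

(** * Calculus on open subsets of Euclidean space *)

Section RowNorm.
Variables (R : realType) (m : nat).
Implicit Types x y : 'rV[R]_m.

Lemma coord_norm_le x j : `|x 0 j| <= `|x|.
Proof.
rewrite [leRHS]/Num.Def.normr /= mx_normrE.
by apply: (le_bigmax _ (fun ij : 'I_1 * 'I_m => `|x ij.1 ij.2|) (0, j)).
Qed.

Lemma row_norm_le x (e : R) : 0 <= e -> (forall j, `|x 0 j| <= e) -> `|x| <= e.
Proof.
move=> e0 xe; rewrite [leLHS]/Num.Def.normr /= mx_normrE.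
by apply: bigmax_le => // -[i j] _ /=; rewrite ord1.
Qed.

Lemma row_norm_lt x (e : R) : 0 < e -> (forall j, `|x 0 j| < e) -> `|x| < e.
Proof.
move=> e0 xe; rewrite [ltLHS]/Num.Def.normr /= mx_normrE.
by apply: bigmax_lt => // -[i j] _ /=; rewrite ord1.
Qed.

End RowNorm.

Section MeanValue.
Variables (R : realType) (V : normedModType R).
Implicit Types (f : V -> R) (x v : V).

Lemma line_derive f x v t : derivable f (t *: v + x) v ->
  is_derive t 1 (fun h : R => f (h *: v + x)) ('D_v f (t *: v + x)).
Proof.
have E : (fun h : R => h^-1 *: (((fun h => f (h *: v + x)) \o shift t) (h *: 1)
     - f (t *: v + x))) =
   (fun h => h^-1 *: ((f \o shift (t *: v + x)) (h *: v) - f (t *: v + x))).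
  apply/funext => h /=; congr (_ *: (f _ - _)).
  by rewrite scalerDl [h *: (1 : R)]mulr1 addrA.
move=> df; apply: DeriveDef; first by rewrite /derivable E.
by rewrite /derive E.
Qed.

(** The increment [s] may have either sign, so the intermediate point is located by its absolute
    value only. *)
Lemma mean_value f x v (s : R) :
  (forall c : R, `|c| <= `|s| -> derivable f (c *: v + x) v) ->
  exists2 c, `|c| <= `|s| & f (s *: v + x) - f x = s * 'D_v f (c *: v + x).
Proof.
move=> df; pose g (t : R) := f (t *: v + x).
have g0 : g 0 = f x by rewrite /g scale0r add0r.
have dg (c : R) : `|c| <= `|s| -> is_derive c 1 g ('D_v f (c *: v + x)).
  by move=> cs; apply: line_derive; exact: df.
have cont (a b : R) : (forall c, c \in `[a, b]%R -> `|c| <= `|s|) ->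
    {within `[a, b], continuous g}.
  move=> H; apply: derivable_within_continuous => c cab.
  by have [] := dg c (H c cab).
have [s0|s0] := leP 0 s.
  have H c : c \in `[0, s]%R -> `|c| <= `|s|.
    by rewrite in_itv /= => /andP[c0 cs]; rewrite !ger0_norm.
  have [c cs e] := MVT_segment s0 (fun c cs => dg c (H c (subset_itv_oo_cc cs)))
    (cont _ _ H).
  by exists c; [exact: H|rewrite -/(g s) -g0 e subr0 mulrC].
have H c : c \in `[s, 0]%R -> `|c| <= `|s|.
  rewrite in_itv /= => /andP[cs c0].
  by rewrite !ler0_norm ?lerN2 // (le_trans cs).
have [c cs e] := MVT_segment (ltW s0)
  (fun c cs => dg c (H c (subset_itv_oo_cc cs))) (cont _ _ H).
exists c; first exact: H.
by rewrite -/(g s) -g0 -[LHS]opprB e sub0r mulrN opprK mulrC.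
Qed.

End MeanValue.

Lemma continuous_sum (T : topologicalType) (R : realType) (J : Type)
    (r : seq J) (P : pred J) (f : J -> T -> R) (x : T) :
  (forall j, {for x, continuous (f j)}) ->
  {for x, continuous (fun y => \sum_(j <- r | P j) f j y)}.
Proof.
move=> cf; elim: r => [|j r IH].
  have -> : (fun y => \sum_(j <- [::] | P j) f j y) = cst 0.
    by apply/funext => y; rewrite big_nil.
  exact: cvg_cst.
have -> : (fun y => \sum_(i <- j :: r | P i) f i y) =
    (fun y => (if P j then f j y else 0) + \sum_(i <- r | P i) f i y).
  by apply/funext => y; rewrite big_cons; case: ifP; rewrite ?add0r.
apply: cvgD => //; case: (P j); [exact: cf|exact: cvg_cst].
Qed.

Section ContinuousPartials.
Variables (R : realType) (m : nat).
Local Notation vec := 'rV[R]_m.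
Implicit Types (f : vec -> R) (x v : vec).

(** Vertices of the staircase path from 0 to [h]; consecutive ones differ in a single coordinate. *)
Let cut (h : vec) (k : nat) : vec := \row_j (if (j < k)%N then h 0 j else 0).

Let grad f x (h : vec) : R := \sum_j h 0 j * 'D_'e_j f x.

Let grad_linear f x : linear (grad f x).
Proof.
move=> a u v; rewrite /grad scaler_sumr -big_split; apply: eq_bigr => j _ /=.
by rewrite !mxE /= mulrDl -mulrA.
Qed.

(** [Ck] only speaks of directional derivatives, while the chain rule needs the Fréchet derivative.
    Along the staircase path each increment is a partial derivative at a nearby point, by the mean
    value theorem. *)
Lemma differentiable_C1 f x (U : set vec) : open U -> U x ->
  (forall j y, U y -> derivable f y 'e_j) ->
  (forall j, {for x, continuous ('D_'e_j f)}) ->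
  differentiable f x.
Proof.
move=> oU Ux df cf.
pose L := HB.pack_for {linear vec -> R} (grad f x)
  (GRing.isLinear.Build _ _ _ _ _ (grad_linear f x)).
have Lc : continuous L.
  move=> y; apply: continuous_sum => j.
  by apply: (cvgM (@coord_continuous R 1 m 0 j y) (cvg_cst _)).
suff expand : forall e : R, 0 < e -> \forall h \near (0 : vec),
    `|f (h + x) - (f x + grad f x h)| <= e * `|h|.
  have ex : (f : vec -> R^o) \o shift x =
      cst (f x : R^o) + (L : vec -> R^o) +o_ (0 : vec) id.
    by apply/eqaddoP => e e0; exact: expand.
  have dL := @diff_unique R vec R f L x Lc ex.
  by apply/diff_locallyP; rewrite dL.
move=> e e0; move: e0 => /posnumP-[{}e].
have [r r0 Ur] : exists2 r : R, 0 < r & forall y, `|y| < r -> U (y + x).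
  have /nbhs_ballP[r /= r0 rU] := open_nbhs_nbhs (conj oU Ux).
  exists r => // y yr; apply: rU; rewrite -ball_normE /= distrC.
  by rewrite addrK.
(* An equal share of the error for each coordinate; the successor keeps the quotient meaningful in
   dimension 0. *)
pose d : R := e%:num / m.+1%:R.
have d0 : 0 < d by rewrite divr_gt0.
have [s s0 sD] : exists2 s : R, 0 < s & forall y j, `|y| < s ->
    `|'D_'e_j f (y + x) - 'D_'e_j f x| < d.
  have : \forall y \near nbhs x, forall j : 'I_m, `|'D_'e_j f y - 'D_'e_j f x| < d.
    apply: filter_forall => j.
    have /cvgrPdist_lt/(_ d d0) := cf j.
    by apply: filterS => y; rewrite distrC.
  move=> /nbhs_ballP[s /= s0 sD]; exists s => // y j ys.
  by apply: sD; rewrite -ball_normE /= distrC addrK.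
have rs0 : 0 < Num.min r s by rewrite lt_min r0 s0.
apply/nbhs_ballP; exists (Num.min r s) => //= h.
rewrite -ball_normE /= sub0r normrN lt_min => /andP[hr hs].
have cutS (j : 'I_m) : cut h j.+1 = h 0 j *: 'e_j + cut h j.
  apply/rowP => i; rewrite !mxE ltnS leq_eqVlt eqxx /=.
  have -> : (val i == val j) = (i == j) by [].
  by case: eqVneq => [->|ij] /=; rewrite ?ltnn ?mulr1 ?addr0 ?mulr0 ?add0r.
have small (j : 'I_m) (c : R) : `|c| <= `|h 0 j| -> `|c *: 'e_j + cut h j| <= `|h|.
  move=> ch; apply: row_norm_le => // i; rewrite !mxE eqxx /=.
  case: eqVneq => [->|ij] /=.
    by rewrite ltnn mulr1 addr0 (le_trans ch) ?coord_norm_le.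
  rewrite mulr0 add0r; case: ifP => _; first exact: coord_norm_le.
  by rewrite normr0.
have step (j : 'I_m) : `|f (cut h j.+1 + x) - f (cut h j + x)
    - h 0 j * 'D_'e_j f x| <= `|h| * d.
  rewrite cutS -(addrA (h 0 j *: 'e_j)).
  have [c cs ->] := @mean_value _ _ f (cut h j + x) 'e_j (h 0 j)
    (fun c cs => df j _ (eq_ind_r U (Ur _ (le_lt_trans (small j c cs) hr))
       (addrA _ _ _))).
  rewrite -mulrBr normrM ler_pM ?coord_norm_le // ltW // addrA sD //.
  exact: le_lt_trans (small j c cs) hs.
have tele : f (h + x) - f x =
    \sum_(j < m) (f (cut h j.+1 + x) - f (cut h j + x)).
  rewrite -(big_mkord xpredT (fun j => f (cut h j.+1 + x) - f (cut h j + x))).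
  rewrite telescope_sumr //; congr (f _ - f _).
    by congr (_ + _); apply/rowP => i; rewrite mxE ltn_ord.
  by rewrite -[LHS]add0r; congr (_ + _); apply/rowP => i; rewrite !mxE ltn0.
have -> : f (h + x) - (f x + grad f x h) =
    \sum_(j < m) (f (cut h j.+1 + x) - f (cut h j + x) - h 0 j * 'D_'e_j f x).
  by rewrite sumrB -tele opprD addrA.
rewrite (le_trans (ler_norm_sum _ _ _)) //.
apply: (le_trans (ler_sum _ (fun j _ => step j))).
rewrite sumr_const card_ord -mulr_natr /d.
have -> : `|h| * (e%:num / m.+1%:R) * m%:R = e%:num * `|h| * (m%:R / m.+1%:R).
  ring.
rewrite ler_piMr ?mulr_ge0 // ler_pdivrMr // mul1r ler_nat.
exact: leqnSn.
Qed.

End ContinuousPartials.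

Section CkGeneral.
Variables (R : realType) (m : nat) (V : normedModType R).
Local Notation vec := 'rV[R]_m.
Implicit Types (U : set vec) (f g : vec -> V).

Lemma Ck_continuous k U f x : Ck k U f -> U x -> {for x, continuous f}.
Proof. by case: k => [|k] [cf _]; exact: cf. Qed.

Lemma Ck_derivable k U f x v : Ck k.+1 U f -> U x -> derivable f x v.
Proof. by move=> [_ /(_ v)[df _]]; exact: df. Qed.

Lemma Ck_derive k U f v : Ck k.+1 U f -> Ck k U ('D_v f).
Proof. by move=> [_ /(_ v)[]]. Qed.

Lemma CkW k U f : Ck k.+1 U f -> Ck k U f.
Proof.
elim: k f => [|k IH] f [cf df]; first by split.
by split=> // v; have [dfv Dfv] := df v; split=> //; exact: IH.
Qed.

Lemma Ck_sub k U U' f : U' `<=` U -> Ck k U f -> Ck k U' f.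
Proof.
move=> UU'; elim: k f => [|k IH] f [cf df]; [split=> // x /UU'|split=> [x /UU'|v]].
- exact: cf.
- exact: cf.
- have [dfv Dfv] := df v; split; last exact: IH.
  by move=> x /UU'; exact: dfv.
Qed.

Lemma Ck_eq k U f g : open U -> (forall x, U x -> f x = g x) ->
  Ck k U f -> Ck k U g.
Proof.
move=> oU; have nfg f' g' x : (forall x, U x -> f' x = g' x) -> U x ->
    \forall y \near x, f' y = g' y :> V.
  move=> fg Ux; have /filterS : nbhs x U by exact: open_nbhs_nbhs.
  by apply=> y; exact: fg.
elim: k f g => [|k IH] f g fg [cf df]; [split=> // x Ux|split=> [x Ux|v]].
- suff : g @ x --> g x by [].
  rewrite -(fg x Ux).
  apply: cvg_trans (cf x Ux).
  by apply: (@near_eq_cvg _ _ (nbhs x) _ f g); exact: nfg.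
- suff : g @ x --> g x by [].
  rewrite -(fg x Ux).
  apply: cvg_trans (cf x Ux).
  by apply: (@near_eq_cvg _ _ (nbhs x) _ f g); exact: nfg.
- have [dfv Dfv] := df v; split.
    by move=> x Ux; apply: near_eq_derivable (dfv x Ux); exact: nfg.
  by apply: IH Dfv => x Ux; apply: near_eq_derive; exact: nfg.
Qed.

Lemma Ck_cst k U (c : V) : Ck k U (fun=> c).
Proof.
have cc (x : vec) (a : V) : {for x, continuous (fun=> a)}.
  exact: (@cst_continuous _ _ a x).
elim: k c => [|k IH] c; first by split=> // x _; exact: cc.
split=> [x _|v]; first exact: cc.
split; first (move=> x _; exact: (@derivable_cst _ _ _ c x v)).
have -> : 'D_v (fun=> c) = (fun=> 0) by apply/funext => x; exact: derive_cst.
exact: IH.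
Qed.

Lemma Ck_add k U f g : open U -> Ck k U f -> Ck k U g ->
  Ck k U (fun x => f x + g x).
Proof.
move=> oU; elim: k f g => [|k IH] f g [cf df] [cg dg]; [split=> // x Ux|split=> [x Ux|v]].
- exact: (continuousD (cf x Ux) (cg x Ux)).
- exact: (continuousD (cf x Ux) (cg x Ux)).
- have [dfv Dfv] := df v; have [dgv Dgv] := dg v; split.
    by move=> x Ux; apply: derivableD; [exact: dfv|exact: dgv].
  apply: Ck_eq (IH _ _ Dfv Dgv) => // x Ux.
  by rewrite -[RHS]/('D_v (f + g) x) deriveD //; [exact: dfv|exact: dgv].
Qed.

Lemma Ck_opp k U f : open U -> Ck k U f -> Ck k U (fun x => - f x).
Proof.
move=> oU; elim: k f => [|k IH] f [cf df]; [split=> // x Ux|split=> [x Ux|v]].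
- exact: (continuousN (cf x Ux)).
- exact: (continuousN (cf x Ux)).
- have [dfv Dfv] := df v; split.
    by move=> x Ux; apply: derivableN; exact: dfv.
  apply: Ck_eq (IH _ Dfv) => // x Ux.
  by rewrite -[RHS]/('D_v (- f) x) deriveN //; exact: dfv.
Qed.

Lemma Ck_sum k U (J : Type) (r : seq J) (P : pred J) (f : J -> vec -> V) :
  open U -> (forall j, Ck k U (f j)) ->
  Ck k U (fun x => \sum_(j <- r | P j) f j x).
Proof.
move=> oU cf; elim: r => [|j r IH].
  by apply: Ck_eq (Ck_cst k U 0) => // x _; rewrite big_nil.
have [Pj|Pj] := boolP (P j).
  by apply: Ck_eq (Ck_add oU (cf j) IH) => // x _; rewrite big_cons Pj.
by apply: Ck_eq IH => // x _; rewrite big_cons (negPf Pj).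
Qed.

End CkGeneral.

Section CkScalar.
Variables (R : realType) (m : nat).
Local Notation vec := 'rV[R]_m.
Implicit Types (U : set vec) (f g : vec -> R).

Lemma Ck_mul k U f g : open U -> Ck k U f -> Ck k U g ->
  Ck k U (fun x => f x * g x).
Proof.
move=> oU; elim: k f g => [|k IH] f g cf cg.
  split=> // x Ux.
  exact: (continuousM (Ck_continuous cf Ux) (Ck_continuous cg Ux)).
split=> [x Ux|v].
  exact: (continuousM (Ck_continuous cf Ux) (Ck_continuous cg Ux)).
split.
  by move=> x Ux; apply: derivableM; [exact: Ck_derivable cf Ux|exact: Ck_derivable cg Ux].
have H := Ck_add oU (IH _ _ (CkW cf) (Ck_derive v cg))
  (IH _ _ (CkW cg) (Ck_derive v cf)).
apply: Ck_eq H => // x Ux.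
rewrite -[RHS]/('D_v (f * g) x) deriveM //.
  exact: Ck_derivable cf Ux.
exact: Ck_derivable cg Ux.
Qed.

Lemma Ck_inv k U f : open U -> (forall x, U x -> f x != 0) -> Ck k U f ->
  Ck k U (fun x => (f x)^-1).
Proof.
move=> oU f0; elim: k => [|k IH] cf.
  by split=> // x Ux; exact: (continuousV (f0 x Ux) (Ck_continuous cf Ux)).
split=> [x Ux|v]; first exact: (continuousV (f0 x Ux) (Ck_continuous cf Ux)).
split.
  by move=> x Ux; apply: derivableV; [exact: f0|exact: Ck_derivable cf Ux].
have i := IH (CkW cf).
have H := Ck_opp oU (Ck_mul oU (Ck_mul oU i i) (Ck_derive v cf)).
apply: Ck_eq H => // x Ux.
rewrite (@deriveV _ _ f) ?f0 //; last exact: Ck_derivable cf Ux.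
rewrite -expr2 exprVn -mulNr; congr (_ * _).
Qed.

Lemma Ck_differentiable U f x : open U -> Ck 1 U f -> U x -> differentiable f x.
Proof.
move=> oU cf Ux; apply: (differentiable_C1 oU Ux).
  by move=> j y Uy; exact: Ck_derivable cf Uy.
by move=> j; exact: Ck_continuous (Ck_derive _ cf) Ux.
Qed.

Lemma Ck_sqrt k U f : open U -> (forall x, U x -> 0 < f x) -> Ck k U f ->
  Ck k U (fun x => Num.sqrt (f x)).
Proof.
move=> oU f0.
have sc x : U x -> {for x, continuous f} ->
    {for x, continuous (fun x => Num.sqrt (f x))}.
  move=> Ux cf; apply: (@continuous_comp _ _ _ f (@Num.sqrt R)) => //.
  exact: sqrt_continuous.
elim: k => [|k IH] cf.
  by split=> // x Ux; apply: sc => //; exact: Ck_continuous cf Ux.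
split=> [x Ux|v]; first by apply: sc => //; exact: Ck_continuous cf Ux.
have C1 : Ck 1 U f.
  by split=> [x Ux|w]; [exact: Ck_continuous cf Ux|split=> [x Ux|];
    [exact: Ck_derivable cf Ux|split=> // x Ux;
     exact: Ck_continuous (Ck_derive w cf) Ux]].
have ds x : U x -> is_diff (f x) (@Num.sqrt R)
    (fun h => h * (2 * Num.sqrt (f x))^-1).
  move=> Ux; have d1 := is_derive1_sqrt (f0 x Ux).
  have dd : differentiable (@Num.sqrt R) (f x).
    by apply/derivable1_diffP; exact: ex_derive.
  apply: DiffDef => //.
  rewrite diff1E // derive1E derive_val; apply/funext => h.
  by [].
have Ds x : U x -> derivable (fun x => Num.sqrt (f x)) x v /\
    'D_v (fun x => Num.sqrt (f x)) x = 'D_v f x * (2 * Num.sqrt (f x))^-1.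
  move=> Ux; have df := Ck_differentiable oU C1 Ux.
  have dsx := ds x Ux.
  have dc : differentiable (@Num.sqrt R \o f) x.
    by apply: differentiable_comp => //; exact: ex_diff.
  split; first exact: diff_derivable.
  rewrite -[LHS]/('D_v (@Num.sqrt R \o f) x) deriveE // diff_comp //.
  by rewrite /= (@diff_val _ _ _ _ _ _ _ dsx) deriveE.
split; first by move=> x Ux; exact: (Ds x Ux).1.
have H2 : Ck k U (fun x => 2 * Num.sqrt (f x)).
  by apply: Ck_mul => //; [exact: Ck_cst|exact/IH/CkW].
have H : Ck k U (fun x => 'D_v f x * (2 * Num.sqrt (f x))^-1).
  apply: Ck_mul => //; first exact: Ck_derive.
  by apply: Ck_inv => // x Ux; rewrite mulf_neq0 // gt_eqF // sqrtr_gt0 f0.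
by apply: Ck_eq H => // x Ux; rewrite (Ds x Ux).2.
Qed.

Lemma derive_row U f x v : open U -> Ck 1 U f -> U x ->
  'D_v f x = \sum_j v 0 j * 'D_'e_j f x.
Proof.
move=> oU cf Ux; have df := Ck_differentiable oU cf Ux.
rewrite deriveE // {1}(row_sum_delta v) linear_sum.
by apply: eq_bigr => j _; rewrite linearZ /= deriveE.
Qed.

Lemma Ck_coord k U j : open U -> Ck k U (fun x : vec => x 0 j).
Proof.
move=> oU; case: k => [|k]; first by split=> // x _; exact: coord_continuous.
split=> [x _|v]; first exact: coord_continuous.
have D x : is_derive x v (fun y : vec => y 0 j) (v 0 j).
  have L_lin : linear (fun y : vec => y 0 j) by move=> a y z; rewrite !mxE.
  pose L := HB.pack_for {linear vec -> R} (fun y : vec => y 0 j)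
    (GRing.isLinear.Build _ _ _ _ _ L_lin).
  have Lc : continuous L by exact: coord_continuous.
  have dx : differentiable L x by exact: linear_differentiable.
  apply: DeriveDef; first by apply: diff_derivable; exact: dx.
  by rewrite (@deriveE _ _ _ L x v dx) (@diff_lin _ _ _ L x Lc).
split; first by move=> x _; exact: (@ex_derive _ _ _ _ _ _ _ (D x)).
by apply: Ck_eq (Ck_cst k U (v 0 j)) => // x _; rewrite (@derive_val _ _ _ _ _ _ _ (D x)).
Qed.

Lemma derive_coord (x v : vec) j : 'D_v (fun y : vec => y 0 j) x = v 0 j.
Proof.
have L_lin : linear (fun y : vec => y 0 j) by move=> a y z; rewrite !mxE.
pose L := HB.pack_for {linear vec -> R} (fun y : vec => y 0 j)
  (GRing.isLinear.Build _ _ _ _ _ L_lin).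
have Lc : continuous L by exact: coord_continuous.
have dx : differentiable L x by exact: linear_differentiable.
by rewrite (@deriveE _ _ _ L x v dx) (@diff_lin _ _ _ L x Lc).
Qed.

Let tri (e a b c : R) : `|c - a| < e / 2 -> `|c - b| < e / 2 -> `|a - b| <= e.
Proof.
move=> ca cb; rewrite -(subrKA c) (splitr e).
by rewrite (le_trans (ler_normD _ _)) // lerD // ltW // distrC.
Qed.

(* Both mixed derivatives are limits of the second difference quotients. *)
Lemma schwarz_derive U f x u v : open U -> Ck 2 U f -> U x ->
  'D_u ('D_v f) x = 'D_v ('D_u f) x.
Proof.
move=> oU cf Ux.
apply/eqP; rewrite -subr_eq0 -normr_eq0; apply/eqP/le_anti.
rewrite normr_ge0 andbT; apply/ler_addgt0Pr => e e0; rewrite add0r.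
have e2 : 0 < e / 2 by rewrite divr_gt0.
have near_xy w1 w2 : exists2 r : R, 0 < r & forall y, `|y - x| < r ->
    U y /\ `|'D_w1 ('D_w2 f) y - 'D_w1 ('D_w2 f) x| < e / 2.
  have c2 := Ck_continuous (Ck_derive w1 (Ck_derive w2 cf)) Ux.
  have /cvgrPdist_lt/(_ _ e2) h1 := c2.
  have h2 : nbhs x U by exact: open_nbhs_nbhs.
  have h : nbhs x (U `&` [set t | `|'D_w1 ('D_w2 f) x - 'D_w1 ('D_w2 f) t| < e / 2]).
    exact: filterI h2 h1.
  have /nbhs_ballP[r /= r0 rB] := h.
  exists r => // y; rewrite distrC => yr.
  have [Uy hy] : (U `&` [set t | `|'D_w1 ('D_w2 f) x - 'D_w1 ('D_w2 f) t| < e / 2]) y.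
    by apply: rB; rewrite -ball_normE.
  split; [exact: Uy|rewrite distrC; exact: hy].
have [r1 r10 H1] := near_xy u v; have [r2 r20 H2] := near_xy v u.
pose r := Num.min r1 r2.
have r0 : 0 < r by rewrite lt_min r10 r20.
(* With this size, the parallelogram spanned by s u and s v stays within r / 2 of x; the summand 1
   covers u = v = 0. *)
pose s := r / (`|u| + `|v| + 1) / 2.
have K0 : 0 < `|u| + `|v| + 1 by rewrite ltr_wpDl // addr_ge0.
have s0 : 0 < s by rewrite !divr_gt0.
have small (c d : R) : `|c| <= `|s| -> `|d| <= `|s| ->
    `|(c *: u + (d *: v + x)) - x| < r.
  move=> cs ds; rewrite addrA addrK.
  apply: (@le_lt_trans _ _ (s * (`|u| + `|v| + 1))).
    rewrite (le_trans (ler_normD _ _)) // !normrZ.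
    rewrite (gtr0_norm s0) in cs ds.
    have h1 : `|c| * `|u| <= s * `|u| by apply: ler_wpM2r.
    have h2 : `|d| * `|v| <= s * `|v| by apply: ler_wpM2r.
    lra.
  rewrite /s -mulrA [2^-1 * _]mulrC mulrA divfK ?gt_eqF //.
  by rewrite ltr_pdivrMr // ltr_pMr // ltr1n.
have sr c d : `|c| <= `|s| -> `|d| <= `|s| -> U (c *: u + (d *: v + x)).
  move=> cs ds; have := small c d cs ds; rewrite lt_min => /andP[h _].
  exact: (H1 _ h).1.
have z0 : `|0 : R| <= `|s| by rewrite normr0.
have ss : `|s| <= `|s| by [].
have cf1 := CkW cf.
have der w y : U y -> derivable f y w by move=> Uy; exact: Ck_derivable cf1 Uy.
have derD w w' y : U y -> derivable ('D_w f) y w'.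
  by move=> Uy; exact: Ck_derivable (Ck_derive w cf) Uy.
(* The same second difference is treated twice by the mean value theorem, in either order of the
   directions. *)
pose Delta := f (s *: u + (s *: v + x)) - f (s *: u + x) - f (s *: v + x) + f x.
have [c1 [d1 [c1s d1s E1]]] : exists c d, [/\ `|c| <= `|s|, `|d| <= `|s| &
    Delta = s * (s * 'D_u ('D_v f) (c *: u + (d *: v + x)))].
  pose g y := f (s *: u + y) - f y.
  have dg (c : R) : `|c| <= `|s| -> is_derive (c *: v + x) v g
      ('D_v f (s *: u + (c *: v + x)) - 'D_v f (c *: v + x)).
    move=> cs; have U1 := sr s c ss cs.
    have U2 : U (c *: v + x) by have := sr 0 c z0 cs; rewrite scale0r add0r.
    have e1 : (fun h : R => h^-1 *: (((fun y => f (s *: u + y)) \o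
        shift (c *: v + x)) (h *: v) - f (s *: u + (c *: v + x)))) =
       (fun h : R => h^-1 *: ((f \o shift (s *: u + (c *: v + x))) (h *: v)
        - f (s *: u + (c *: v + x)))).
      apply/funext => h /=; congr (_ *: (f _ - _)).
      by rewrite addrCA.
    have d1 : is_derive (c *: v + x) v (fun y => f (s *: u + y))
        ('D_v f (s *: u + (c *: v + x))).
      apply: DeriveDef; first by rewrite /derivable e1; exact: der.
      by rewrite /derive e1.
    have d2 : is_derive (c *: v + x) v f ('D_v f (c *: v + x)).
      by apply: DeriveDef => //; exact: der.
    exact: is_deriveB.
  have [d ds E] := @mean_value _ _ g x v s
    (fun c cs => @ex_derive _ _ _ _ _ _ _ (dg c cs)).
  have [c cs E'] := @mean_value _ _ ('D_v f) (d *: v + x) u s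
    (fun c cs => derD v u _ (sr c d cs ds)).
  exists c, d; split; [exact: cs|exact: ds|].
  rewrite (@derive_val _ _ _ _ _ _ _ (dg d ds)) E' in E.
  by rewrite -E /g /Delta; ring.
have [c2 [d2 [c2s d2s E2]]] : exists c d, [/\ `|c| <= `|s|, `|d| <= `|s| &
    Delta = s * (s * 'D_v ('D_u f) (c *: u + (d *: v + x)))].
  pose g y := f (s *: v + y) - f y.
  have dg (c : R) : `|c| <= `|s| -> is_derive (c *: u + x) u g
      ('D_u f (s *: v + (c *: u + x)) - 'D_u f (c *: u + x)).
    move=> cs; have U1 : U (s *: v + (c *: u + x)).
      by rewrite addrCA; exact: sr.
    have U2 : U (c *: u + x).
      by have := sr c 0 cs z0; rewrite scale0r add0r.
    have e1 : (fun h : R => h^-1 *: (((fun y => f (s *: v + y)) \o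
        shift (c *: u + x)) (h *: u) - f (s *: v + (c *: u + x)))) =
       (fun h : R => h^-1 *: ((f \o shift (s *: v + (c *: u + x))) (h *: u)
        - f (s *: v + (c *: u + x)))).
      apply/funext => h /=; congr (_ *: (f _ - _)).
      by rewrite addrCA.
    have dd1 : is_derive (c *: u + x) u (fun y => f (s *: v + y))
        ('D_u f (s *: v + (c *: u + x))).
      apply: DeriveDef; first by rewrite /derivable e1; exact: der.
      by rewrite /derive e1.
    have dd2 : is_derive (c *: u + x) u f ('D_u f (c *: u + x)).
      by apply: DeriveDef => //; exact: der.
    exact: is_deriveB.
  have [c cs E] := @mean_value _ _ g x u s
    (fun c cs => @ex_derive _ _ _ _ _ _ _ (dg c cs)).
  have Usr (d : R) : `|d| <= `|s| -> U (d *: v + (c *: u + x)).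
    by move=> ds; rewrite addrCA; exact: sr.
  have [d ds E'] := @mean_value _ _ ('D_u f) (c *: u + x) v s
    (fun d ds => derD u v _ (Usr d ds)).
  exists c, d; split; [exact: cs|exact: ds|].
  rewrite (@derive_val _ _ _ _ _ _ _ (dg c cs)) E' in E.
  rewrite [c *: u + _]addrCA -E /g /Delta [s *: v + (s *: u + x)]addrCA; ring.
have E3 : 'D_u ('D_v f) (c1 *: u + (d1 *: v + x)) =
    'D_v ('D_u f) (c2 *: u + (d2 *: v + x)).
  have sn : s != 0 by rewrite gt_eqF.
  exact: (mulfI sn (mulfI sn (etrans (esym E1) E2))).
have := small c1 d1 c1s d1s; rewrite lt_min => /andP[/H1[_ h1] _].
have := small c2 d2 c2s d2s; rewrite lt_min => /andP[_ /H2[_ h2]].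
rewrite E3 in h1.
exact: (tri h1 h2).
Qed.

End CkScalar.

Section CkMatrix.
Variables (R : realType) (m a b : nat).
Local Notation vec := 'rV[R]_m.
Implicit Types (U : set vec) (f : vec -> 'M[R]_(a, b)).

Lemma continuous_mxP f (x : vec) :
  (forall i j, {for x, continuous (fun y => f y i j)}) -> {for x, continuous f}.
Proof.
move=> cf; apply/(@cvgrPdist_le _ _ _ (nbhs x) (nbhs_filter x)) => e e0.
have : \forall y \near nbhs x, forall ij : 'I_a * 'I_b,
    `|f x ij.1 ij.2 - f y ij.1 ij.2| <= e.
  apply: filter_forall => -[i j] /=.
  by have /cvgrPdist_le/(_ e e0) := cf i j.
apply: (@filterS _ (nbhs x) (nbhs_filter x)) => y H.
rewrite [leLHS]/Num.Def.normr /= mx_normrE.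
apply: bigmax_le => [|ij _]; first exact: ltW.
by rewrite !mxE; exact: H.
Qed.

Lemma continuous_mx_coord f (x : vec) i j : {for x, continuous f} ->
  {for x, continuous (fun y => f y i j)}.
Proof.
move=> cf; apply: (@continuous_comp _ _ _ f (fun M : 'M[R]_(a, b) => M i j)) => //.
exact: coord_continuous.
Qed.

Lemma Ck_mxP k U f : open U ->
  Ck k U f <-> (forall i j, Ck k U (fun x => f x i j)).
Proof.
move=> oU; split.
  elim: k f => [|k IH] f [cf df] i j.
    by split=> // x Ux; apply: continuous_mx_coord; exact: cf.
  split=> [x Ux|v]; first by apply: continuous_mx_coord; exact: cf.
  have [dfv Dfv] := df v; split.
    by move=> x Ux; have /derivable_mxP := dfv x Ux; apply.
  apply: Ck_eq (IH _ Dfv i j) => // x Ux.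
  by rewrite derive_mx ?mxE //; exact: dfv.
elim: k f => [|k IH] f H.
  by split=> // x Ux; apply: continuous_mxP => i j; exact: Ck_continuous (H i j) Ux.
have dfv x v : U x -> derivable f x v.
  by move=> Ux; apply/derivable_mxP => i j; exact: Ck_derivable (H i j) Ux.
split=> [x Ux|v].
  by apply: continuous_mxP => i j; exact: Ck_continuous (H i j) Ux.
split; first by move=> x; exact: dfv.
apply: IH => i j; apply: Ck_eq (Ck_derive v (H i j)) => // x Ux.
by rewrite derive_mx ?mxE //; exact: dfv.
Qed.

Lemma derive_mxE U f x v i j : Ck 1 U f -> U x ->
  'D_v f x i j = 'D_v (fun y => f y i j) x.
Proof. by move=> cf Ux; rewrite derive_mx ?mxE //; exact: Ck_derivable cf Ux. Qed.

End CkMatrix.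

Section Composition.
Variables (R : realType) (p m : nat).
Implicit Types (phi : 'rV[R]_p -> 'rV[R]_m) (f : 'rV[R]_m -> R).

Lemma differentiable_row phi x :
  (forall j, differentiable (fun y => phi y 0 j) x) -> differentiable phi x.
Proof.
move=> dphi.
have -> : phi = \sum_(j < m) (fun y => phi y 0 j *: ('e_j : 'rV[R]_m)).
  by apply/funext => y; rewrite fct_sumE -row_sum_delta.
by apply: differentiable_sum => j; exact: differentiableZl.
Qed.

Lemma derive_comp (U : set 'rV[R]_p) (W : set 'rV[R]_m) phi f x v :
  open U -> open W -> Ck 1 U phi -> Ck 1 W f -> U x -> W (phi x) ->
  derivable (f \o phi) x v /\
  'D_v (f \o phi) x = 'D_('D_v phi x) f (phi x).
Proof.
move=> oU oW cphi cf Ux Wx.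
have df := Ck_differentiable oW cf Wx.
have dphi : differentiable phi x.
  apply: differentiable_row => j.
  by apply: (Ck_differentiable oU) Ux; move/Ck_mxP : cphi; apply.
have dc : differentiable (f \o phi) x by exact: differentiable_comp.
split; first exact: diff_derivable.
by rewrite deriveE // diff_comp // [in RHS]deriveE // [in RHS]deriveE.
Qed.

Lemma Ck_comp k (U : set 'rV[R]_p) (W : set 'rV[R]_m) phi f :
  open U -> open W -> (forall x, U x -> W (phi x)) -> Ck k U phi -> Ck k W f ->
  Ck k U (f \o phi).
Proof.
move=> oU oW UW; elim: k f => [|k IH] f cphi cf.
  split=> // x Ux; apply: continuous_comp.
    exact: Ck_continuous cphi Ux.
  exact: Ck_continuous cf (UW x Ux).
have C1 (q : nat) (S : set 'rV[R]_q) (V : normedModType R) (h : 'rV[R]_q -> V) :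
    Ck k.+1 S h -> Ck 1 S h.
  move=> ch; split=> [x Sx|w]; first exact: Ck_continuous ch Sx.
  split; first by move=> x Sx; exact: Ck_derivable ch Sx.
  by split=> // x Sx; exact: Ck_continuous (Ck_derive w ch) Sx.
have cphi1 := C1 _ _ _ _ cphi; have cf1 := C1 _ _ _ _ cf.
split=> [x Ux|v].
  apply: continuous_comp; first exact: Ck_continuous cphi Ux.
  exact: Ck_continuous cf (UW x Ux).
split.
  by move=> x Ux; have [] := derive_comp v oU oW cphi1 cf1 Ux (UW x Ux).
have H : Ck k U (fun x => \sum_(j < m) 'D_v phi x 0 j * ('D_'e_j f \o phi) x).
  apply: Ck_sum => // j; apply: Ck_mul => //.
    by have /Ck_mxP := Ck_derive v cphi; apply.
  by apply: IH; [exact: CkW|exact: Ck_derive].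
apply: Ck_eq H => // x Ux.
have [_ ->] := derive_comp v oU oW cphi1 cf1 Ux (UW x Ux).
by rewrite (derive_row _ oW cf1 (UW x Ux)).
Qed.

End Composition.

Section SmoothRing.
Variables (R : realType) (m : nat).
Local Notation vec := 'rV[R]_m.
Implicit Types (U : set vec) (f g : vec -> R).

Lemma smooth_on_eq (V : normedModType R) U (f g : vec -> V) : open U ->
  (forall x, U x -> f x = g x) -> smooth_on U f -> smooth_on U g.
Proof. by move=> oU fg sf k; apply: Ck_eq (sf k). Qed.

(* The smooth functions on the open set [U], extended by zero: equality of
   functions on [U] becomes Leibniz equality. *)
Record smooth_fun (U : {O : set vec | open O}) := SmoothFun {
  sfun :> vec -> R;
  sfun_smooth : smooth_on (sval U) sfun;
  sfun_out : forall x, ~ sval U x -> sfun x = 0 }.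

Variable U : {O : set vec | open O}.
Local Notation "'O'" := (sval U).
Local Notation F := (smooth_fun U).

Lemma sfun_eq (f g : F) : (forall x, O x -> f x = g x) -> f = g.
Proof.
case: f g => f sf f0 [g sg g0] /= fg.
have e : f = g.
  apply/funext => x; have [Ox|nOx] := pselect (O x); first exact: fg.
  by rewrite f0 // g0.
by case: _ / e sg g0 => sg g0; congr SmoothFun; exact: Prop_irrelevance.
Qed.

Definition restr f : vec -> R := fun x => if pselect (O x) then f x else 0.

Lemma restrE f x : O x -> restr f x = f x.
Proof. by rewrite /restr; case: pselect. Qed.

Lemma restr_out f x : ~ O x -> restr f x = 0.
Proof. by rewrite /restr; case: pselect. Qed.

Lemma restr_smooth f : smooth_on O f -> smooth_on O (restr f).
Proof.
by apply: smooth_on_eq => [|x Ox]; [exact: svalP U|rewrite restrE].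
Qed.

Definition mk_sfun f (sf : smooth_on O f) : F :=
  SmoothFun (restr_smooth sf) (@restr_out f).

Lemma mk_sfunE f (sf : smooth_on O f) x : O x -> mk_sfun sf x = f x.
Proof. exact: restrE. Qed.

HB.instance Definition _ := gen_eqMixin F.
HB.instance Definition _ := gen_choiceMixin F.

Let oO : open O := svalP U.

Let zero_smooth : smooth_on O (fun=> 0 : R).
Proof. by move=> k; exact: Ck_cst. Qed.
Let one_smooth : smooth_on O (fun=> 1 : R).
Proof. by move=> k; exact: Ck_cst. Qed.
Let add_smooth (f g : F) : smooth_on O (fun x => f x + g x).
Proof. by move=> k; apply: Ck_add oO (sfun_smooth f k) (sfun_smooth g k). Qed.
Let opp_smooth (f : F) : smooth_on O (fun x => - f x).
Proof. by move=> k; apply: Ck_opp oO (sfun_smooth f k). Qed.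
Let mul_smooth (f g : F) : smooth_on O (fun x => f x * g x).
Proof. by move=> k; apply: Ck_mul oO (sfun_smooth f k) (sfun_smooth g k). Qed.

Definition sfun0 : F := mk_sfun zero_smooth.
Definition sfun1 : F := mk_sfun one_smooth.
Definition sfun_add (f g : F) : F := mk_sfun (add_smooth f g).
Definition sfun_opp (f : F) : F := mk_sfun (opp_smooth f).
Definition sfun_mul (f g : F) : F := mk_sfun (mul_smooth f g).

Let addA : associative sfun_add.
Proof. by move=> f g h; apply: sfun_eq => x Ox; rewrite !mk_sfunE // addrA. Qed.
Let addC : commutative sfun_add.
Proof. by move=> f g; apply: sfun_eq => x Ox; rewrite !mk_sfunE // addrC. Qed.
Let add0 : left_id sfun0 sfun_add.
Proof. by move=> f; apply: sfun_eq => x Ox; rewrite !mk_sfunE // add0r. Qed.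
Let addN : left_inverse sfun0 sfun_opp sfun_add.
Proof. by move=> f; apply: sfun_eq => x Ox; rewrite !mk_sfunE // addNr. Qed.
HB.instance Definition _ := GRing.isZmodule.Build F addA addC add0 addN.

Let mulA : associative sfun_mul.
Proof. by move=> f g h; apply: sfun_eq => x Ox; rewrite !mk_sfunE // mulrA. Qed.
Let mulC : commutative sfun_mul.
Proof. by move=> f g; apply: sfun_eq => x Ox; rewrite !mk_sfunE // mulrC. Qed.
Let mul1 : left_id sfun1 sfun_mul.
Proof. by move=> f; apply: sfun_eq => x Ox; rewrite !mk_sfunE // mul1r. Qed.
Let mulDl : left_distributive sfun_mul sfun_add.
Proof. by move=> f g h; apply: sfun_eq => x Ox; rewrite !mk_sfunE // mulrDl. Qed.
HB.instance Definition _ :=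
  GRing.Zmodule_isComPzRing.Build F mulA mulC mul1 mulDl.

Lemma sfunD (f g : F) x : O x -> (f + g) x = f x + g x.
Proof. exact: mk_sfunE. Qed.
Lemma sfunN (f : F) x : O x -> (- f) x = - f x.
Proof. exact: mk_sfunE. Qed.
Lemma sfunM (f g : F) x : O x -> (f * g) x = f x * g x.
Proof. exact: mk_sfunE. Qed.
Lemma sfun_1 x : O x -> (1 : F) x = 1.
Proof. exact: mk_sfunE. Qed.
Lemma sfun_0 x : (0 : F) x = 0.
Proof. by rewrite /= /restr; case: pselect. Qed.

Section Evaluation.
Variables (x : vec) (Ox : O x).
Definition sev (f : F) : R := f x.
Let sev_additive : nmod_morphism sev.
Proof. by split=> [|f g]; rewrite /sev ?sfun_0 ?sfunD. Qed.
Let sev_mult : monoid_morphism sev.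
Proof. by split=> [|f g]; rewrite /sev ?sfun_1 ?sfunM. Qed.
Definition sev_rmorph : {rmorphism F -> R} :=
  HB.pack_for {rmorphism F -> R} sev
    (GRing.isNmodMorphism.Build _ _ sev sev_additive)
    (GRing.isMonoidMorphism.Build _ _ sev sev_mult).
End Evaluation.

End SmoothRing.

(** * Frames and changes of coordinates *)

Section MatrixDerivation.
Variables (F : comPzRingType) (d : {additive F -> F}).
Hypothesis dM : forall x y, d (x * y) = d x * y + x * d y.

Lemma map_mx_derM (p q r : nat) (X : 'M[F]_(p, q)) (Y : 'M[F]_(q, r)) :
  map_mx d (X *m Y) = map_mx d X *m Y + X *m map_mx d Y.
Proof.
apply/matrixP => i j; rewrite !mxE raddf_sum -big_split /=.
by apply: eq_bigr => k _; rewrite dM !mxE.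
Qed.

Lemma map_mx_derD (p q : nat) (X Y : 'M[F]_(p, q)) :
  map_mx d (X + Y) = map_mx d X + map_mx d Y.
Proof. by apply/matrixP => i j; rewrite !mxE raddfD. Qed.

Lemma map_mx_derB (p q : nat) (X Y : 'M[F]_(p, q)) :
  map_mx d (X - Y) = map_mx d X - map_mx d Y.
Proof. by apply/matrixP => i j; rewrite !mxE raddfB. Qed.

Lemma map_mx_derZ (p q : nat) f (X : 'M[F]_(p, q)) :
  map_mx d (f *: X) = d f *: X + f *: map_mx d X.
Proof. by apply/matrixP => i j; rewrite !mxE dM. Qed.

Lemma map_mx_der_sum (p q : nat) (J : Type) (r : seq J) (P : pred J)
    (X : J -> 'M[F]_(p, q)) :
  map_mx d (\sum_(j <- r | P j) X j) = \sum_(j <- r | P j) map_mx d (X j).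
Proof.
apply/matrixP => i j; rewrite mxE !summxE raddf_sum.
by apply: eq_bigr => k _; rewrite mxE.
Qed.

End MatrixDerivation.

Section CoordinateFrame.
Variables (F : comPzRingType) (m N : nat).
Variable pd : 'I_m -> {additive F -> F}.
Hypothesis pdM : forall i x y, pd i (x * y) = pd i x * y + x * pd i y.
Hypothesis pd_comm : forall i j f, pd i (pd j f) = pd j (pd i f).
Variable crd : 'I_m -> F.
Hypothesis pd_crd : forall i j, pd i (crd j) = (i == j)%:R.

Variables g ginv : 'M[F]_m.
Hypothesis g_sym : g^T = g.
Hypothesis ginvK : ginv *m g = 1%:M.
Variable half : F.
Hypothesis half2 : half + half = 1.

Variable E : 'M[F]_(N, m).
Hypothesis E_complete : E^T *m E = ginv.
Hypothesis E_gram : forall i, map_mx (pd i) (E *m g *m E^T) = 0.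

Let L i : 'M[F]_m := \matrix_(j, k)
  (half * (pd i (g j k) + pd j (g i k) - pd k (g i j))).

(** [Gam i j k] is the Christoffel symbol with lower indices i, j and upper index k; half of the
    Koszul expression is taken with an element [half] of the ring. *)
Definition Gam i : 'M[F]_m := L i *m ginv.

Let gK : g *m ginv = 1%:M. Proof. exact: mulmx1C. Qed.

Let ginv_sym : ginv^T = ginv.
Proof. by rewrite -E_complete trmx_mul trmxK. Qed.

Let g_symE j k : g j k = g k j.
Proof. by rewrite -[in LHS]g_sym mxE. Qed.

Lemma Gam_torsion i j k : Gam i j k = Gam j i k.
Proof.
rewrite !mxE; apply: eq_bigr => l _; congr (_ * _).
by rewrite !mxE (g_symE j i); ring.
Qed.

Lemma Gam_metric i : map_mx (pd i) g = Gam i *m g + g *m (Gam i)^T.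
Proof.
rewrite /Gam trmx_mul ginv_sym mulmxA gK mul1mx -mulmxA ginvK mulmx1.
apply/matrixP => j k; rewrite !mxE (g_symE k j).
rewrite -[LHS]mul1r -half2; ring.
Qed.

Let Ed a (f : F) : F := \sum_i E a i * pd i f.
Let Ed_additive a : zmod_morphism (Ed a).
Proof.
move=> f h; rewrite /Ed -sumrB; apply: eq_bigr => i _.
by rewrite raddfB mulrBr.
Qed.
Definition fieldder a : {additive F -> F} :=
  locked (HB.pack_for {additive F -> F} (Ed a)
    (GRing.isZmodMorphism.Build _ _ (Ed a) (Ed_additive a))).
Local Notation D := fieldder.

Lemma fieldderE a f : D a f = \sum_i E a i * pd i f.
Proof. by rewrite /fieldder -lock. Qed.

Lemma fieldderM a x y : D a (x * y) = D a x * y + x * D a y.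
Proof.
rewrite !fieldderE mulr_suml mulr_sumr -big_split; apply: eq_bigr => i _ /=.
by rewrite pdM; ring.
Qed.

Lemma map_fieldder (p q : nat) a (X : 'M[F]_(p, q)) :
  map_mx (D a) X = \sum_i E a i *: map_mx (pd i) X.
Proof.
apply/matrixP => j k; rewrite mxE summxE fieldderE.
by apply: eq_bigr => i _; rewrite !mxE.
Qed.

Definition Gama a : 'M[F]_m := \sum_i E a i *: Gam i.

Lemma Gama_metric a : map_mx (D a) g = Gama a *m g + g *m (Gama a)^T.
Proof.
rewrite map_fieldder /Gama linear_sum /= mulmx_suml mulmx_sumr -big_split.
apply: eq_bigr => i _ /=.
by rewrite Gam_metric linearZ /= -scalemxAl -scalemxAr scalerDr.
Qed.

(** The entry (b, e) is g(nabla_a e_b, e_e), the vectors being the rows of [E]. *)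
Definition framecon a : 'M[F]_N :=
  (map_mx (D a) E + E *m Gama a) *m g *m E^T.
Local Notation G := framecon.

Let gEE : g *m E^T *m E = 1%:M.
Proof. by rewrite -mulmxA E_complete gK. Qed.

Lemma framecon_gauge a : map_mx (D a) E = G a *m E - E *m Gama a.
Proof.
rewrite /G -!mulmxA (mulmxA g) gEE mulmx1.
by rewrite addrK.
Qed.

(** The Gram matrix of [E] is the projection off the zero vectors. That the coefficients absorb it
    replaces the linear independence of the frame. *)
Lemma framecon_D a : G a *m (E *m g *m E^T) = G a.
Proof.
rewrite /G -!mulmxA; congr (_ *m _).
by rewrite !mulmxA gEE mul1mx.
Qed.

Let D_gram a : map_mx (D a) (E *m g *m E^T) = 0.
Proof. by rewrite map_fieldder big1 // => i _; rewrite E_gram scaler0. Qed.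

(** The symmetric part of [G a] is the derivative of the Gram matrix, which is constant. *)
Lemma framecon_skew a : (G a)^T = - G a.
Proof.
apply/eqP; rewrite -addr_eq0; apply/eqP.
have trD (p q : nat) (X Y : 'M[F]_(p, q)) : (X + Y)^T = X^T + Y^T.
  by apply/matrixP => i j; rewrite !mxE.
rewrite -[RHS](D_gram a) !(map_mx_derM (fieldderM a)) Gama_metric -map_trmx.
rewrite /G; move: (map_mx (D a) E) (Gama a) => X Y.
rewrite !trmx_mul trD trmxK g_sym trmx_mul.
rewrite !(mulmxDl, mulmxDr) !mulmxA.
by mxring.
Qed.

Let c a b e := G a b e - G b a e.

Let bracket a b k : D a (E b k) - D b (E a k) = \sum_e c a b e * E e k.
Proof.
have H a' b' : D a' (E b' k) = (G a' *m E) b' k - (E *m Gama a') b' k.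
  have /matrixP/(_ b' k) := framecon_gauge a'.
  by rewrite mxE addmxE oppmxE.
have S : (E *m Gama a) b k = (E *m Gama b) a k.
  rewrite !mxE.
  transitivity (\sum_j \sum_i E b j * (E a i * Gam i j k)).
    apply: eq_bigr => j _; rewrite /Gama summxE mulr_sumr.
    by apply: eq_bigr => i _; rewrite scalemxE.
  rewrite exchange_big; apply: eq_bigr => j _ /=; rewrite summxE mulr_sumr.
  by apply: eq_bigr => i _; rewrite scalemxE Gam_torsion; ring.
rewrite !H S !mxE -[RHS]addr0.
transitivity (\sum_j G a b j * E j k - \sum_j G b a j * E j k); first by ring.
by rewrite -sumrB addr0; apply: eq_bigr => e _; rewrite mulrBl.
Qed.

Lemma framecon_comm a b f : D a (D b f) - D b (D a f) =
  \sum_e (G a b e - G b a e) * D e f.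
Proof.
have H a' b' : D a' (D b' f) =
    \sum_k D a' (E b' k) * pd k f + \sum_k \sum_i E b' k * (E a' i * pd i (pd k f)).
  rewrite (fieldderE b') raddf_sum -big_split; apply: eq_bigr => k _ /=.
  transitivity (D a' (E b' k) * pd k f + E b' k * D a' (pd k f)).
    exact: fieldderM.
  by congr (_ + _); rewrite fieldderE mulr_sumr.
rewrite !H.
have -> : \sum_k \sum_i E b k * (E a i * pd i (pd k f)) =
    \sum_k \sum_i E a k * (E b i * pd i (pd k f)).
  rewrite exchange_big; apply: eq_bigr => k _ /=; apply: eq_bigr => i _.
  by rewrite pd_comm; ring.
transitivity (\sum_k (D a (E b k) - D b (E a k)) * pd k f).
  under [RHS]eq_bigr do rewrite mulrBl.
  by rewrite sumrB; ring.
under eq_bigr do rewrite bracket mulr_suml.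
rewrite exchange_big; apply: eq_bigr => e _ /=.
by rewrite fieldderE mulr_sumr; apply: eq_bigr => k _; rewrite mulrA.
Qed.

Let jac a b d s := D a (c b d s) + \sum_e c b d e * c a e s.

(** The Jacobi identity for derivations gives J s contracted with D s f equal to 0 for every f, and
    the coordinate functions as f turn this into [J *m E] = 0. This does not determine [J] for a
    dependent frame, but [J] also absorbs the Gram matrix, which has [E] as a left factor. *)
Lemma framecon_jacobi a b d s : jac a b d s + jac b d a s + jac d a b s = 0.
Proof.
pose J : 'rV[F]_N := \row_s (jac a b d s + jac b d a s + jac d a b s).
pose crow a b : 'rV[F]_N := \row_s c a b s.
have crowD a' b' : crow a' b' *m (E *m g *m E^T) = crow a' b'.
  have -> : crow a' b' = row b' (G a') - row a' (G b').
    have rowE (M : 'M[F]_N) a0 i : row a0 M 0 i = M a0 i by rewrite mxE.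
    by apply/rowP => i; rewrite addmxE oppmxE !rowE mxE.
  by rewrite mulmxBl -!row_mul !framecon_D.
pose jrow a b d : 'rV[F]_N := \row_s jac a b d s.
have jrowE a' b' d' : jrow a' b' d' =
    map_mx (D a') (crow b' d') + \sum_e c b' d' e *: crow a' e.
  apply/rowP => i; rewrite !mxE summxE /jac; congr (_ + _).
  by apply: eq_bigr => e _; rewrite !mxE.
have jrowD a' b' d' : jrow a' b' d' *m (E *m g *m E^T) = jrow a' b' d'.
  rewrite jrowE mulmxDl mulmx_suml; congr (_ + _).
    have := congr1 (map_mx (D a')) (crowD b' d').
    by rewrite (map_mx_derM (fieldderM a')) D_gram mulmx0 addr0.
  by apply: eq_bigr => e _; rewrite -scalemxAl crowD.
have JE : J = jrow a b d + jrow b d a + jrow d a b.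
  by apply/rowP => i; rewrite !mxE.
suff J0 : J *m E = 0.
  have : J = 0.
    have -> : J = J *m (E *m g *m E^T) by rewrite JE !mulmxDl !jrowD.
    by rewrite !mulmxA J0 !mul0mx.
  by move/rowP/(_ s); rewrite !mxE.
have Jf f : \sum_s J 0 s * D s f = 0.
  have K a' b' d' : D a' (D b' (D d' f) - D d' (D b' f))
      - (D b' (D d' (D a' f)) - D d' (D b' (D a' f))) =
      \sum_s jac a' b' d' s * D s f.
    rewrite !framecon_comm raddf_sum /=.
    transitivity (\sum_s D a' (c b' d' s) * D s f
      + \sum_e c b' d' e * (D a' (D e f) - D e (D a' f))).
      rewrite -sumrB -big_split; apply: eq_bigr => e _ /=.
      by rewrite fieldderM -/(c b' d' e); ring.
    have -> : \sum_e c b' d' e * (D a' (D e f) - D e (D a' f)) =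
        \sum_s (\sum_e c b' d' e * c a' e s) * D s f.
      under eq_bigr do rewrite framecon_comm mulr_sumr.
      rewrite exchange_big; apply: eq_bigr => s' _ /=; rewrite mulr_suml.
      by apply: eq_bigr => e _; rewrite mulrA.
    rewrite -big_split; apply: eq_bigr => s' _ /=.
    by rewrite -mulrDl.
  transitivity (\sum_s jac a b d s * D s f + \sum_s jac b d a s * D s f
     + \sum_s jac d a b s * D s f).
    by rewrite -!big_split; apply: eq_bigr => s' _ /=; rewrite mxE; ring.
  by rewrite -!K !raddfB /=; ring.
apply/rowP => l; rewrite !mxE -[RHS](Jf (crd l)); apply: eq_bigr => s' _.
congr (_ * _); rewrite fieldderE (bigD1 l) //= pd_crd eqxx mulr1.
by rewrite big1 ?addr0 // => i il; rewrite pd_crd (negPf il) mulr0.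
Qed.

Definition coord_frame : connection_frame F N :=
  @ConnectionFrame F N fieldder framecon fieldderM framecon_skew
    framecon_comm framecon_jacobi.

End CoordinateFrame.

(* A metric in local coordinates, with a frame that is orthonormal up to zero
   vectors. *)
Record framed_chart (F : comPzRingType) (m N : nat) := FramedChart {
  pd : 'I_m -> {additive F -> F};
  pdM : forall i x y, pd i (x * y) = pd i x * y + x * pd i y;
  pd_comm : forall i j f, pd i (pd j f) = pd j (pd i f);
  crd : 'I_m -> F;
  pd_crd : forall i j, pd i (crd j) = (i == j)%:R;
  gm : 'M[F]_m;
  gminv : 'M[F]_m;
  gm_sym : gm^T = gm;
  gminvK : gminv *m gm = 1%:M;
  half : F;
  half2 : half + half = 1;
  fvec : 'M[F]_(N, m);
  fvec_complete : fvec^T *m fvec = gminv;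
  fvec_gram : forall i, map_mx (pd i) (fvec *m gm *m fvec^T) = 0 }.

Section FramedChart.
Variables (F : comPzRingType) (m N : nat) (K : framed_chart F m N).
Local Notation pd := (pd K).
Local Notation g := (gm K).
Local Notation E := (fvec K).
Local Notation em i := (map_mx (pd i)).

Definition chart_frame : connection_frame F N :=
  coord_frame (@pdM _ _ _ K) (@pd_comm _ _ _ K) (@pd_crd _ _ _ K)
    (@gm_sym _ _ _ K) (@gminvK _ _ _ K) (@half2 _ _ _ K)
    (@fvec_complete _ _ _ K) (@fvec_gram _ _ _ K).
Local Notation fr := chart_frame.
Local Notation D := (fder fr).
Local Notation G := (fcon fr).

Definition chris i : 'M[F]_m := Gam pd g (gminv K) (half K) i.
Definition chrisa a : 'M[F]_m := \sum_i E a i *: chris i.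

Lemma fderE a f : D a f = \sum_i E a i * pd i f.
Proof. exact: fieldderE. Qed.

Lemma chris_torsion i j k : chris i j k = chris j i k.
Proof. exact/Gam_torsion/gm_sym. Qed.

Lemma chris_metric i : em i g = chris i *m g + g *m (chris i)^T.
Proof.
exact: (Gam_metric pd (gm_sym K) (gminvK K) (half2 K) (fvec_complete K) i).
Qed.

Lemma gauge a : map_mx (D a) E = G a *m E - E *m chrisa a.
Proof.
have H := framecon_gauge pd (gminvK K) (half K) (fvec_complete K) a.
exact: H.
Qed.

Lemma fcon_gram a : G a *m (E *m g *m E^T) = G a.
Proof.
have H := framecon_D pd (gminvK K) (half K) (fvec_complete K) a.
exact: H.
Qed.

Lemma map_fder (p q : nat) a (X : 'M[F]_(p, q)) :
  map_mx (D a) X = \sum_i E a i *: em i X.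
Proof. exact: map_fieldder. Qed.

Lemma fderE_bracket a b k : D a (E b k) - D b (E a k) =
  \sum_e torsion_coef fr a b e * E e k.
Proof.
have H a' b' : D a' (E b' k) = (G a' *m E) b' k - (E *m chrisa a') b' k.
  have /matrixP/(_ b' k) := gauge a'.
  by rewrite mxE addmxE oppmxE.
have S : (E *m chrisa a) b k = (E *m chrisa b) a k.
  rewrite !mxE.
  transitivity (\sum_j \sum_i E b j * (E a i * chris i j k)).
    apply: eq_bigr => j _; rewrite /chrisa summxE mulr_sumr.
    by apply: eq_bigr => i _; rewrite scalemxE.
  rewrite exchange_big; apply: eq_bigr => j _ /=; rewrite summxE mulr_sumr.
  by apply: eq_bigr => i _; rewrite scalemxE chris_torsion; ring.
rewrite !H S.
transitivity ((G a *m E) b k - (G b *m E) a k); first by ring.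
rewrite 2!mxE -sumrB; apply: eq_bigr => e _.
by rewrite /torsion_coef mulrBl.
Qed.

Definition Rc i j : 'M[F]_m :=
  em i (chris j) - em j (chris i) - br (chris i) (chris j).

Definition Rca a b : 'M[F]_m := \sum_i \sum_j (E a i * E b j) *: Rc i j.

Let dm_comm (p q : nat) a b (X : 'M[F]_(p, q)) :
  map_mx (D a) (map_mx (D b) X) - map_mx (D b) (map_mx (D a) X) =
  \sum_e torsion_coef fr a b e *: map_mx (D e) X.
Proof.
apply/matrixP => i j; rewrite summxE.
transitivity (D a (D b (X i j)) - D b (D a (X i j))).
  by rewrite addmxE oppmxE; congr (_ - _); rewrite mxE [in LHS]mxE.
rewrite (fder_comm fr); apply: eq_bigr => e _.
by rewrite scalemxE [in RHS]mxE.
Qed.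

(** By [gauge] the matrix [E] intertwines the frame connection with the coordinate one, so the
    commutator of two derivatives of [E] can be expanded on both sides; the difference of the two
    curvatures is what has to vanish. *)
Lemma Rm_fvec a b : Rm fr a b *m E = E *m Rca a b.
Proof.
have dM := fderM fr.
have key : (Em fr a (G b) - Em fr b (G a) - br (G a) (G b)) *m E
    - E *m (map_mx (D a) (chrisa b) - map_mx (D b) (chrisa a)
       - br (chrisa a) (chrisa b)) =
    \sum_e torsion_coef fr a b e *: map_mx (D e) E.
  rewrite -dm_comm !gauge.
  have B d (X Y : 'M[F]_(N, m)) : map_mx (D d) (X - Y) = map_mx (D d) X - map_mx (D d) Y.
    exact: map_mx_derB.
  rewrite !B (map_mx_derM (dM a) (G b) E) (map_mx_derM (dM a) E (chrisa b)).
  rewrite (map_mx_derM (dM b) (G a) E) (map_mx_derM (dM b) E (chrisa a)).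
  rewrite !gauge /Em !br_def.
  move: (map_mx (D a) (G b)) (map_mx (D b) (G a)) (map_mx (D a) (chrisa b))
    (map_mx (D b) (chrisa a)) (G a) (G b) (chrisa a) (chrisa b) E.
  move=> X1 X2 X3 X4 X5 X6 X7 X8 X9.
  by mulsimp; mxring.
have Esum : E *m (\sum_e torsion_coef fr a b e *: chrisa e) =
    (\sum_e torsion_coef fr a b e *: G e) *m E
    - \sum_e torsion_coef fr a b e *: map_mx (D e) E.
  rewrite mulmx_sumr mulmx_suml -sumrB; apply: eq_bigr => e _.
  by rewrite gauge -scalemxAl -scalemxAr; mxring.
have RcaE : Rca a b = map_mx (D a) (chrisa b) - map_mx (D b) (chrisa a)
    - br (chrisa a) (chrisa b) - \sum_e torsion_coef fr a b e *: chrisa e.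
  have dchris a' b' : map_mx (D a') (chrisa b') =
      \sum_j D a' (E b' j) *: chris j
      + \sum_i \sum_j (E a' i * E b' j) *: em i (chris j).
    rewrite /chrisa map_mx_der_sum exchange_big -big_split.
    apply: eq_bigr => j _ /=; rewrite (map_mx_derZ (dM _)); congr (_ + _).
    rewrite map_fder scaler_sumr; apply: eq_bigr => i _.
    by rewrite scalerA mulrC.
  rewrite !dchris.
  have -> : \sum_e torsion_coef fr a b e *: chrisa e =
      \sum_j D a (E b j) *: chris j - \sum_j D b (E a j) *: chris j.
    transitivity (\sum_j (D a (E b j) - D b (E a j)) *: chris j); last first.
      by rewrite -sumrB; apply: eq_bigr => j _; rewrite scalerBl.
    under [RHS]eq_bigr do rewrite fderE_bracket scaler_suml.
    rewrite exchange_big; apply: eq_bigr => e _ /=.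
    by rewrite /chrisa scaler_sumr; apply: eq_bigr => j _; rewrite scalerA.
  have -> : br (chrisa a) (chrisa b) =
      \sum_i \sum_j (E a i * E b j) *: br (chris i) (chris j).
    have H1 a' b' : chrisa a' *m chrisa b' =
        \sum_i \sum_j (E a' i * E b' j) *: (chris i *m chris j).
      rewrite /chrisa mulmx_suml; apply: eq_bigr => i _.
      rewrite mulmx_sumr; apply: eq_bigr => j _.
      by rewrite -scalemxAl -scalemxAr scalerA.
    rewrite br_def !H1 [X in _ - X]exchange_big -sumrB; apply: eq_bigr => i _ /=.
    rewrite -sumrB; apply: eq_bigr => j _.
    by rewrite br_def scalerBr [E b j * _]mulrC.
  rewrite /Rca /Rc.
  have -> : \sum_i \sum_j (E b i * E a j) *: em i (chris j) =
      \sum_i \sum_j (E a i * E b j) *: em j (chris i).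
    rewrite exchange_big; apply: eq_bigr => i _ /=; apply: eq_bigr => j _.
    by rewrite mulrC.
  transitivity (\sum_i \sum_j (E a i * E b j) *: em i (chris j)
    - \sum_i \sum_j (E a i * E b j) *: em j (chris i)
    - \sum_i \sum_j (E a i * E b j) *: br (chris i) (chris j)); last by mxring.
  rewrite -!sumrB; apply: eq_bigr => i _; rewrite -!sumrB.
  by apply: eq_bigr => j _; rewrite !scalerBr.
rewrite Rm_def mulmxBl RcaE [in RHS]mulmxBr Esum -key.
by mulsimp; mxring.
Qed.

Lemma Rm_gram a b : Rm fr a b *m (E *m g *m E^T) = Rm fr a b.
Proof.
have dM := fderM fr.
have D0 d : map_mx (D d) (E *m g *m E^T) = 0.
  by rewrite map_fder big1 // => i _; rewrite fvec_gram scaler0.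
have H d d' : map_mx (D d) (G d') *m (E *m g *m E^T) = map_mx (D d) (G d').
  have := congr1 (map_mx (D d)) (fcon_gram d').
  by rewrite (map_mx_derM (dM d)) D0 mulmx0 addr0.
rewrite Rm_def br_def !mulmxBl /Em !H -!(mulmxA (G _)) !fcon_gram.
congr (_ - _); rewrite mulmx_suml; apply: eq_bigr => e _.
by rewrite -scalemxAl fcon_gram.
Qed.

Lemma RmE_coord a b : Rm fr a b = E *m Rca a b *m g *m E^T.
Proof. by rewrite -[LHS]Rm_gram !mulmxA Rm_fvec. Qed.

Lemma Ric_coord (tau : F) :
  (forall j p, \sum_k Rc k j p k = tau * g j p) ->
  forall k l, Ric fr k l = tau * (E *m g *m E^T) k l.
Proof.
move=> ric k l; rewrite mxE.
transitivity (\sum_p \sum_i \sum_j E k j * ((E *m Rc i j *m g *m E^T) l p * E p i)).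
  apply: eq_bigr => p _; rewrite RmE_coord /Rca.
  rewrite !(mulmx_sumr, mulmx_suml) summxE; apply: eq_bigr => i _.
  rewrite !(mulmx_sumr, mulmx_suml) summxE; apply: eq_bigr => j _.
  by rewrite -scalemxAr -!scalemxAl scalemxE; ring.
rewrite exchange_big /=.
transitivity (\sum_i \sum_j E k j * (E *m Rc i j) l i).
  apply: eq_bigr => i _; rewrite exchange_big; apply: eq_bigr => j _ /=.
  rewrite -mulr_sumr; congr (_ * _).
  have gEE : g *m E^T *m E = 1%:M.
    by rewrite -mulmxA fvec_complete; apply: mulmx1C; exact: gminvK.
  transitivity ((E *m Rc i j *m g *m E^T *m E) l i); first by rewrite [RHS]mxE.
  by rewrite -!mulmxA (mulmxA g) gEE mulmx1.
rewrite exchange_big /=.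
transitivity (\sum_j \sum_p E k j * (E l p * (tau * g j p))).
  apply: eq_bigr => j _; rewrite -mulr_sumr -mulr_sumr; congr (_ * _).
  transitivity (\sum_i \sum_p E l p * Rc i j p i).
    by apply: eq_bigr => i _; rewrite mxE.
  by rewrite exchange_big; apply: eq_bigr => p _ /=; rewrite -mulr_sumr ric.
rewrite mxE mulr_sumr exchange_big; apply: eq_bigr => p _ /=.
rewrite !mxE mulr_suml mulr_sumr; apply: eq_bigr => j _.
by ring.
Qed.

Variable W : 'M[F]_m.
Variable al : 'rV[F]_m.
Variable z : 'I_N.
Hypothesis E_z : forall i, E z i = 0.

Definition nabW i : 'M[F]_m := em i W - chris i *m W - W *m (chris i)^T.
Definition nabal i : 'rV[F]_m := em i al - al *m (chris i)^T.

Let acol : 'cV[F]_N := E *m al^T.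
Let ez : 'rV[F]_N := delta_mx 0 z.

(** The components of omega + alpha /\ dt, where [ez] is the covector of the flat direction. *)
Definition Omext : 'M[F]_N := E *m W *m E^T + acol *m ez - ez^T *m acol^T.

Lemma fcon_z a b : G a b z = 0.
Proof.
rewrite -fcon_gram mulmxA mxE big1 // => i _.
by rewrite [_^T _ _]mxE E_z mulr0.
Qed.

Definition nabWf p : 'M[F]_m := \sum_i E p i *: nabW i.
Definition nabalf p : 'rV[F]_m := \sum_i E p i *: nabal i.

(** Both [ez] and the flat direction are parallel, so the derivative falls on omega and alpha
    separately and the block shape of [Omext] is preserved. *)
Lemma tA_mx p : tA fr Omext p =
  E *m nabWf p *m E^T + E *m (nabalf p)^T *m ez - ez^T *m nabalf p *m E^T.
Proof.
have dM := fderM fr.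
have Gz : G p *m ez^T = 0.
  apply/matrixP => a b; rewrite mxE zeromxE big1 // => i _.
  have -> : ez^T i b = (i == z)%:R by rewrite mxE /ez mxE (ord1 b) eqxx.
  case: eqVneq => [->|_]; last by rewrite mulr0.
  by rewrite fcon_z mul0r.
have zG : ez *m G p = 0.
  by apply: trmx_inj; rewrite trmx_mul (fcon_skew fr) mulNmx Gz oppr0 trmx0.
have dez : map_mx (D p) ez = 0.
  apply/matrixP => a b; rewrite !mxE.
  by case: (_ && _); rewrite ?fder1 ?raddf0.
have trB (n1 n2 : nat) (X Y : 'M[F]_(n1, n2)) : (X - Y)^T = X^T - Y^T.
  by apply/matrixP => i j; rewrite !mxE.
have dET : map_mx (D p) E^T = - (E^T *m G p) - (chrisa p)^T *m E^T.
  rewrite -map_trmx gauge trB (trmx_mul (G p) E) (trmx_mul E (chrisa p)).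
  by rewrite (fcon_skew fr) mulmxN.
have trS : (chrisa p)^T = \sum_i E p i *: (chris i)^T.
  apply/matrixP => a b; rewrite mxE /chrisa !summxE; apply: eq_bigr => i _.
  by rewrite !scalemxE [in RHS]mxE.
pose w := nabWf p.
pose v := nabalf p.
have wE : w = map_mx (D p) W - chrisa p *m W - W *m (chrisa p)^T.
  rewrite /w /nabWf map_fder trS mulmx_sumr /chrisa mulmx_suml -!sumrB.
  apply: eq_bigr => i _; rewrite /nabW !scalerBr.
  by rewrite -scalemxAl -scalemxAr.
have vE : v = map_mx (D p) al - al *m (chrisa p)^T.
  rewrite /v /nabalf map_fder trS mulmx_sumr -!sumrB.
  apply: eq_bigr => i _; rewrite /nabal !scalerBr.
  by rewrite -scalemxAr.
have dacol : map_mx (D p) acol = G p *m acol + E *m v^T.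
  rewrite /acol (map_mx_derM (dM p)) gauge -map_trmx vE trB trmx_mul trmxK.
  by mulsimp; mxring.
rewrite -/w -/v.
rewrite /tA cov_def br_def /Em /Omext.
have B (n1 n2 : nat) (X Y : 'M[F]_(n1, n2)) :
  map_mx (D p) (X - Y) = map_mx (D p) X - map_mx (D p) Y by exact: map_mx_derB.
have A (n1 n2 : nat) (X Y : 'M[F]_(n1, n2)) :
  map_mx (D p) (X + Y) = map_mx (D p) X + map_mx (D p) Y by exact: map_mx_derD.
rewrite B A (map_mx_derM (dM p) acol ez) (map_mx_derM (dM p) ez^T acol^T).
rewrite (map_mx_derM (dM p) (E *m W) E^T) (map_mx_derM (dM p) E W) dET gauge.
rewrite -!map_trmx dez dacol wE.
have trD (n1 n2 : nat) (X Y : 'M[F]_(n1, n2)) : (X + Y)^T = X^T + Y^T.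
  by apply/matrixP => i j; rewrite !mxE.
rewrite trD (trmx_mul (G p)) (trmx_mul E v^T) trmxK (fcon_skew fr) trmx0.
clear vE dacol dez; move: Gz zG.
move: (map_mx (D p) W) (G p) (chrisa p) acol v ez.
move=> W' Gp C a v' e Gz zG.
rewrite !(mulmxDl, mulmxDr, mulmxBl, mulmxBr, mulmxN, mulNmx, mulmx0, mul0mx).
rewrite !mulmxA -(mulmxA a e Gp) zG Gz mulmx0 mul0mx; mxring.
Qed.

Lemma tA_coord p k l : tA fr Omext p k l =
  \sum_i \sum_j \sum_q E p i * E k j * E l q * nabW i j q
  + (l == z)%:R * \sum_i \sum_j E p i * E k j * nabal i 0 j
  - (k == z)%:R * \sum_i \sum_j E p i * E l j * nabal i 0 j.
Proof.
pose w := nabWf p.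
pose v := nabalf p.
rewrite tA_mx -/w -/v.
have entW : (E *m w *m E^T) k l =
    \sum_i \sum_j \sum_q E p i * E k j * E l q * nabW i j q.
  rewrite /w /nabWf mulmx_sumr mulmx_suml summxE; apply: eq_bigr => i _.
  rewrite -scalemxAr -scalemxAl scalemxE mxE mulr_sumr.
  rewrite [RHS]exchange_big; apply: eq_bigr => q _ /=.
  rewrite !mxE mulr_suml mulr_sumr; apply: eq_bigr => j _; ring.
have entv a : (E *m v^T) a 0 = \sum_i \sum_j E p i * E a j * nabal i 0 j.
  rewrite mxE [RHS]exchange_big; apply: eq_bigr => j _ /=.
  rewrite mxE /v /nabalf summxE mulr_sumr; apply: eq_bigr => i _.
  by rewrite scalemxE; ring.
have ent1 : (E *m v^T *m ez) k l = (l == z)%:R * (E *m v^T) k 0.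
  have ezE : ez 0 l = (l == z)%:R by rewrite /ez mxE eqxx.
  by rewrite mxE big_ord1 ezE mulrC.
have ent2 : (ez^T *m v *m E^T) k l = (k == z)%:R * (E *m v^T) l 0.
  have ezE : ez^T k 0 = (k == z)%:R by rewrite mxE /ez mxE eqxx.
  rewrite -mulmxA mxE big_ord1 ezE; congr (_ * _).
  by rewrite -[v *m E^T]trmxK trmx_mul trmxK mxE.
by rewrite addmxE addmxE oppmxE entW ent1 ent2 !entv.
Qed.

Hypothesis W_skew : W^T = - W.
Hypothesis W_closed : forall i j q,
  pd i (W j q) + pd j (W q i) + pd q (W i j) = 0.
Hypothesis al_closed : forall i j, pd i (al 0 j) = pd j (al 0 i).

Lemma nabal_sym i j : nabal i 0 j = nabal j 0 i.
Proof.
rewrite !addmxE !oppmxE; congr (_ - _).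
  by rewrite mxE [RHS]mxE; exact: al_closed.
rewrite [LHS]mxE [RHS]mxE; apply: eq_bigr => k _.
by congr (_ * _); rewrite mxE chris_torsion [in RHS]mxE.
Qed.

Lemma nabW_cyc i j q : nabW i j q + nabW j q i + nabW q i j = 0.
Proof.
have H a b d : nabW a b d = pd a (W b d) - \sum_k chris a b k * W k d
    - \sum_k W b k * chris a d k.
  rewrite !addmxE !oppmxE; congr (_ - _ - _); first by rewrite mxE.
    by rewrite mxE.
  by rewrite mxE; apply: eq_bigr => k _; rewrite [_^T _ _]mxE.
rewrite !H.
have Wsk a b : W b a = - W a b by exact: skewE.
have K1 a b d : \sum_k chris a b k * W k d + \sum_k W d k * chris b a k = 0.
  rewrite -big_split big1 // => k _ /=.
  by rewrite (Wsk k d) (chris_torsion a b); ring.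
transitivity ((pd i (W j q) + pd j (W q i) + pd q (W i j))
  - (\sum_k chris i j k * W k q + \sum_k W q k * chris j i k)
  - (\sum_k chris j q k * W k i + \sum_k W i k * chris q j k)
  - (\sum_k chris q i k * W k j + \sum_k W j k * chris i q k)).
  ring.
by rewrite W_closed !K1; ring.
Qed.

(** Closedness of omega + alpha /\ dt: the terms with omega cancel cyclically, those with alpha
    because nabla alpha is symmetric. *)
Lemma tA_coord_cyc p k l :
  tA fr Omext p k l + tA fr Omext k l p + tA fr Omext l p k = 0.
Proof.
rewrite !tA_coord.
have -> : \sum_i \sum_j E l i * E k j * nabal i 0 j =
    \sum_i \sum_j E k i * E l j * nabal i 0 j.
  rewrite exchange_big; apply: eq_bigr => i _ /=; apply: eq_bigr => j _.
  by rewrite nabal_sym; ring.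
have -> : \sum_i \sum_j E l i * E p j * nabal i 0 j =
    \sum_i \sum_j E p i * E l j * nabal i 0 j.
  rewrite exchange_big; apply: eq_bigr => i _ /=; apply: eq_bigr => j _.
  by rewrite nabal_sym; ring.
have -> : \sum_i \sum_j E k i * E p j * nabal i 0 j =
    \sum_i \sum_j E p i * E k j * nabal i 0 j.
  rewrite exchange_big; apply: eq_bigr => i _ /=; apply: eq_bigr => j _.
  by rewrite nabal_sym; ring.
have -> : \sum_i \sum_j \sum_q E k i * E l j * E p q * nabW i j q =
    \sum_i \sum_j \sum_q E p i * E k j * E l q * nabW j q i.
  rewrite [RHS](sum3_rot (fun i j q => E p i * E k j * E l q * nabW j q i)).
  by apply: eq_bigr => i _; apply: eq_bigr => j _; apply: eq_bigr => q _; ring.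
have -> : \sum_i \sum_j \sum_q E l i * E p j * E k q * nabW i j q =
    \sum_i \sum_j \sum_q E p i * E k j * E l q * nabW q i j.
  rewrite [LHS](sum3_rot (fun i j q => E l i * E p j * E k q * nabW i j q)).
  by apply: eq_bigr => i _; apply: eq_bigr => j _; apply: eq_bigr => q _; ring.
set s1 := \sum_i \sum_j \sum_q E p i * E k j * E l q * nabW i j q.
set s2 := \sum_i \sum_j \sum_q E p i * E k j * E l q * nabW j q i.
set s3 := \sum_i \sum_j \sum_q E p i * E k j * E l q * nabW q i j.
have S : s1 + s2 + s3 = 0.
  rewrite /s1 /s2 /s3 -!big_split big1 // => i _ /=.
  rewrite -!big_split big1 // => j _ /=; rewrite -!big_split big1 // => q _ /=.
  transitivity (E p i * E k j * E l q * (nabW i j q + nabW j q i + nabW q i j)).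
    ring.
  by rewrite nabW_cyc mulr0.
rewrite -[RHS]S; ring.
Qed.

End FramedChart.

(** * The field V and its divergence in coordinates *)

Section JacobiFormula.
Variables (F : comPzRingType) (d : {additive F -> F}).
Hypothesis dM : forall x y, d (x * y) = d x * y + x * d y.

Lemma der_prod (J : finType) (f : J -> F) :
  d (\prod_j f j) = \sum_i d (f i) * \prod_(j | j != i) f j.
Proof.
have d1 : d 1 = 0.
  have H := dM 1 1; rewrite !mulr1 mul1r in H.
  by apply: (addrI (d 1)); rewrite addr0 -H.
have H (r : seq J) : uniq r -> d (\prod_(j <- r) f j) =
    \sum_(i <- r) d (f i) * \prod_(j <- r | j != i) f j.
  elim: r => [|a r IH] /=; first by rewrite !big_nil d1.
  case/andP => ar ur; rewrite big_cons dM IH // [RHS]big_cons big_cons eqxx /=.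
  congr (_ * _ + _).
    rewrite big_seq [RHS]big_seq_cond; apply: eq_bigl => j.
    by case: eqVneq => [->|_]; rewrite ?(negPf ar) ?andbT.
  rewrite mulr_sumr; apply: eq_big_seq => i ir; rewrite big_cons.
  case: eqVneq => [ai|_]; first by rewrite ai ir in ar.
  by rewrite /=; ring.
by rewrite H ?index_enum_uniq.
Qed.

(** Differentiating the i-th factor of every permutation term gives the determinant with its i-th
    row differentiated, which is then expanded along that row. *)
Lemma der_det (m : nat) (A : 'M[F]_m) :
  d (\det A) = \tr (\adj A *m map_mx d A).
Proof.
have B i : \sum_j d (A i j) * cofactor A i j =
    \sum_(s : 'S_m) (-1) ^+ s * (d (A i (s i)) * \prod_(j | j != i) A j (s j)).
  pose C : 'M[F]_m := \matrix_(k, j) if k == i then d (A i j) else A k j.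
  transitivity (\det C).
    rewrite (expand_det_row _ i); apply: eq_bigr => j _.
    rewrite mxE eqxx; congr (_ * _); rewrite /cofactor; congr (_ * \det _).
    by apply/matrixP => k l; rewrite !mxE eq_sym (negPf (neq_lift _ _)).
  apply: eq_bigr => s _; congr (_ * _); rewrite (bigD1 i) //= mxE eqxx.
  by congr (_ * _); apply: eq_bigr => j /negPf ji; rewrite mxE ji.
have -> : \tr (\adj A *m map_mx d A) = \sum_i \sum_j d (A i j) * cofactor A i j.
  rewrite mxtrace_mulC; apply: eq_bigr => i _; rewrite mxE.
  by apply: eq_bigr => j _; rewrite !mxE.
under eq_bigr do rewrite B.
rewrite exchange_big raddf_sum; apply: eq_bigr => s _ /=.
rewrite -mulr_sumr -der_prod dM.
have -> : d ((-1) ^+ s) = 0; last by rewrite mul0r add0r.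
have d1 : d 1 = 0.
  have H := dM 1 1; rewrite !mulr1 mul1r in H.
  by apply: (addrI (d 1)); rewrite addr0 -H.
by case: (odd_perm s); rewrite ?raddfN d1 ?oppr0.
Qed.

End JacobiFormula.

(* The vector field [divV], written in coordinates: [gi] is
   the inverse metric, [Rc] the curvature, [W] the 2-form and [nW] its covariant
   derivative. *)
Section CoordinateField.
Variables (F : comPzRingType) (m : nat).
Variables (gi W : 'M[F]_m) (Rc : 'I_m -> 'I_m -> 'M[F]_m) (nW : 'I_m -> 'M[F]_m).

Definition vc_h i j k : F := \tr (Rc i j *m (nW k)^T *m gi).
Definition vc_gWg : 'M[F]_m := gi *m W *m gi.
Definition vc_y : 'cV[F]_m := \col_i \sum_j \sum_k gi j k * vc_h i j k.
Definition vc_z : 'cV[F]_m := \col_i \sum_j \sum_k vc_gWg j k * vc_h i j k.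
Definition vc_x : 'cV[F]_m := \col_i \sum_j \sum_k vc_gWg j k * vc_h j k i.
Definition vc : 'cV[F]_m :=
  gi *m (W *m gi *m (vc_y + vc_y) - (vc_z + vc_z) + vc_x).
End CoordinateField.

Lemma vc_map (F F' : comPzRingType) (m : nat) (h : {rmorphism F -> F'})
    (gi W : 'M[F]_m) (Rc : 'I_m -> 'I_m -> 'M[F]_m) (nW : 'I_m -> 'M[F]_m) :
  map_mx h (vc gi W Rc nW) =
  vc (map_mx h gi) (map_mx h W) (fun i j => map_mx h (Rc i j))
     (fun i => map_mx h (nW i)).
Proof.
have H i j k : h (vc_h gi Rc nW i j k) =
    vc_h (map_mx h gi) (fun i j => map_mx h (Rc i j)) (fun i => map_mx h (nW i)) i j k.
  by rewrite /vc_h -trace_map_mx !map_mxM map_trmx.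
have G : map_mx h (vc_gWg gi W) = vc_gWg (map_mx h gi) (map_mx h W).
  by rewrite /vc_gWg !map_mxM.
have Gij i j : h (vc_gWg gi W i j) = vc_gWg (map_mx h gi) (map_mx h W) i j.
  by rewrite -G [RHS]mxE.
rewrite /vc !map_mxM; congr (_ *m _).
rewrite map_mxD map_mxB !map_mxD !map_mxM map_mxD.
have -> : map_mx h (vc_y gi Rc nW) =
  vc_y (map_mx h gi) (fun i j => map_mx h (Rc i j)) (fun i => map_mx h (nW i)).
  apply/matrixP => i o; rewrite !mxE rmorph_sum; apply: eq_bigr => j _.
  by rewrite rmorph_sum; apply: eq_bigr => k _; rewrite rmorphM H [in RHS]mxE.
have -> : map_mx h (vc_z gi W Rc nW) =
  vc_z (map_mx h gi) (map_mx h W) (fun i j => map_mx h (Rc i j)) (fun i => map_mx h (nW i)).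
  apply/matrixP => i o; rewrite !mxE rmorph_sum; apply: eq_bigr => j _.
  by rewrite rmorph_sum; apply: eq_bigr => k _; rewrite rmorphM H Gij.
have -> : map_mx h (vc_x gi W Rc nW) =
  vc_x (map_mx h gi) (map_mx h W) (fun i j => map_mx h (Rc i j)) (fun i => map_mx h (nW i)).
  apply/matrixP => i o; rewrite !mxE rmorph_sum; apply: eq_bigr => j _.
  by rewrite rmorph_sum; apply: eq_bigr => k _; rewrite rmorphM H Gij.
by [].
Qed.

Section FieldOfFrame.
Variables (F : comPzRingType) (m N : nat) (K : framed_chart F m N).
Local Notation pd := (pd K).
Local Notation g := (gm K).
Local Notation gi := (gminv K).
Local Notation E := (fvec K).
Local Notation fr := (chart_frame K).
Local Notation D := (fder fr).
Local Notation G := (fcon fr).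
Variables (W : 'M[F]_m) (al : 'rV[F]_m) (z : 'I_N).
Hypothesis E_z : forall i, E z i = 0.
Local Notation Om := (Omext K W al z).
Let ez : 'rV[F]_N := delta_mx 0 z.
Local Notation h := (vc_h gi (Rc K) (nabW K W)).

Let ezE : ez *m E = 0.
Proof.
apply/matrixP => i j; rewrite mxE zeromxE big1 // => k _.
have -> : ez i k = (k == z)%:R by rewrite /ez mxE (ord1 i) eqxx.
by case: eqVneq => [->|_]; rewrite ?E_z ?mulr0 ?mul0r.
Qed.

Let Eez : E^T *m ez^T = 0.
Proof. by apply: trmx_inj; rewrite trmx_mul !trmxK ezE trmx0. Qed.

Let gEE : g *m E^T *m E = 1%:M.
Proof. by rewrite -mulmxA fvec_complete; apply: mulmx1C; exact: gminvK. Qed.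

(** The part of [tA] that involves nabla alpha is orthogonal to the curvature, which has no
    component along z; only nabla omega remains. *)
Lemma ip_R_A r q s : ip (Rm fr r q) (tA fr Om s) =
  \sum_i \sum_j \sum_k E r i * E q j * E s k * h i j k.
Proof.
transitivity (\tr (Rca K r q *m (nabWf K W s)^T *m gi)).
  rewrite tA_mx // RmE_coord -/ez.
  have H (Y : 'M[F]_m) (v : 'rV[F]_m) w :
      ip (E *m Y *m E^T) (E *m w *m E^T + E *m v^T *m ez - ez^T *m v *m E^T) =
      \tr (Y *m (E^T *m E) *m w^T *m (E^T *m E)).
    rewrite ipBr ipDr /ip !trmx_mul !trmxK.
    have -> : \tr (E *m Y *m E^T *m (ez^T *m (v *m E^T))) = 0.
      by rewrite -!mulmxA (mulmxA E^T) Eez mul0mx !mulmx0 mxtrace0.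
    have -> : \tr (E *m Y *m E^T *m (E *m (v^T *m ez))) = 0.
      by rewrite mxtrace_mulC -!mulmxA (mulmxA ez) ezE !(mul0mx, mulmx0) mxtrace0.
    by rewrite addr0 subr0 -!mulmxA [LHS]mxtrace_mulC -!mulmxA.
  have -> : E *m Rca K r q *m g *m E^T = E *m (Rca K r q *m g) *m E^T.
    by rewrite !mulmxA.
  have gK := mulmx1C (gminvK K).
  by rewrite H fvec_complete -(mulmxA _ g) gK mulmx1.
rewrite /Rca !mulmx_suml raddf_sum; apply: eq_bigr => i _ /=.
rewrite !mulmx_suml raddf_sum; apply: eq_bigr => j _ /=.
have -> : (nabWf K W s)^T = \sum_k E s k *: (nabW K W k)^T.
  apply/matrixP => a b; rewrite mxE /nabWf !summxE; apply: eq_bigr => k _.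
  by rewrite !scalemxE [in RHS]mxE.
rewrite mulmx_sumr mulmx_suml raddf_sum; apply: eq_bigr => k _ /=.
by rewrite -!scalemxAl -scalemxAr -!scalemxAl !mxtraceZ mulrA.
Qed.

Let EOmE : E^T *m Om *m E = vc_gWg gi W.
Proof.
rewrite /Omext -/ez !(mulmxDr, mulmxDl, mulmxBr, mulmxBl, mulmxN, mulNmx).
rewrite -!mulmxA ezE !mulmx0 (mulmxA E^T ez^T) Eez mul0mx subr0 addr0.
by rewrite fvec_complete !mulmxA fvec_complete /vc_gWg.
Qed.

Let sum_gi j k : \sum_q E q j * E q k = gi j k.
Proof.
rewrite -(fvec_complete K) mxE; apply: eq_bigr => q _.
by rewrite [_^T _ _]mxE.
Qed.

Let sum_Om j k : \sum_q \sum_s Om q s * (E q j * E s k) = vc_gWg gi W j k.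
Proof.
rewrite -EOmE mxE exchange_big; apply: eq_bigr => s _ /=.
rewrite mxE mulr_suml; apply: eq_bigr => q _.
by rewrite [_^T _ _]mxE; ring.
Qed.

(** The left side is the vector with frame components [divV]; its z component is lost, the row z of
    [E] being zero. Sums over the frame become contractions with the inverse metric by completeness
    of [E]. *)
Lemma divV_vc : E^T *m (\col_p divV fr Om p) = vc gi W (Rc K) (nabW K W).
Proof.
pose y := vc_y gi (Rc K) (nabW K W); pose zz := vc_z gi W (Rc K) (nabW K W).
pose xx := vc_x gi W (Rc K) (nabW K W).
have Hy p : vY fr Om p = (Om *m (E *m y)) p 0.
  rewrite /vY mxE; apply: eq_bigr => r _; congr (_ * _).
  transitivity (\sum_q \sum_i \sum_j \sum_k E r i * E q j * E q k * h i j k).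
    by apply: eq_bigr => q _; rewrite ip_R_A.
  rewrite exchange_big mxE; apply: eq_bigr => i _ /=.
  rewrite exchange_big mxE mulr_sumr; apply: eq_bigr => j _ /=.
  rewrite exchange_big mulr_sumr; apply: eq_bigr => k _ /=.
  rewrite -sum_gi mulr_suml mulr_sumr; apply: eq_bigr => q _; ring.
have Hz p : vZ fr Om p = (E *m zz) p 0.
  transitivity (\sum_q \sum_s \sum_i \sum_j \sum_k
      Om q s * (E p i * E q j * E s k * h i j k)).
    apply: eq_bigr => q _; rewrite ip_sumr; apply: eq_bigr => s _.
    rewrite ipZr ip_R_A mulr_sumr; apply: eq_bigr => i _.
    rewrite mulr_sumr; apply: eq_bigr => j _.
    by rewrite mulr_sumr.
  transitivity (\sum_q \sum_i \sum_s \sum_j \sum_k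
      Om q s * (E p i * E q j * E s k * h i j k)).
    by apply: eq_bigr => q _; rewrite exchange_big.
  rewrite exchange_big mxE; apply: eq_bigr => i _ /=.
  transitivity (\sum_q \sum_j \sum_s \sum_k
      Om q s * (E p i * E q j * E s k * h i j k)).
    by apply: eq_bigr => q _; rewrite exchange_big.
  rewrite exchange_big mxE mulr_sumr; apply: eq_bigr => j _ /=.
  transitivity (\sum_q \sum_k \sum_s
      Om q s * (E p i * E q j * E s k * h i j k)).
    by apply: eq_bigr => q _; rewrite exchange_big.
  rewrite exchange_big mulr_sumr; apply: eq_bigr => k _ /=.
  rewrite -sum_Om mulr_suml mulr_sumr; apply: eq_bigr => q _.
  rewrite mulr_suml mulr_sumr; apply: eq_bigr => s _; ring.
have Hx p : vX fr Om p = (E *m xx) p 0.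
  transitivity (\sum_q \sum_s \sum_i \sum_j \sum_k
      Om q s * (E q i * E s j * E p k * h i j k)).
    rewrite /vX /tP ip_suml; apply: eq_bigr => q _; rewrite ip_suml.
    apply: eq_bigr => s _.
    rewrite ipZl ip_R_A mulr_sumr; apply: eq_bigr => i _.
    rewrite mulr_sumr; apply: eq_bigr => j _.
    by rewrite mulr_sumr.
  transitivity (\sum_i \sum_j \sum_k \sum_q \sum_s
      Om q s * (E q i * E s j * E p k * h i j k)).
    under eq_bigr => q _ do rewrite exchange_big.
    rewrite exchange_big; apply: eq_bigr => i _ /=.
    under eq_bigr => q _ do rewrite exchange_big.
    rewrite exchange_big; apply: eq_bigr => j _ /=.
    under eq_bigr => q _ do rewrite exchange_big.
    by rewrite exchange_big.
  transitivity (\sum_i \sum_j \sum_k E p k * (vc_gWg gi W i j * h i j k)).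
    apply: eq_bigr => i _; apply: eq_bigr => j _; apply: eq_bigr => k _.
    rewrite -sum_Om mulr_suml mulr_sumr; apply: eq_bigr => q _.
    rewrite mulr_suml mulr_sumr; apply: eq_bigr => s _; ring.
  rewrite (sum3_rot (fun i j k => E p k * (vc_gWg gi W i j * h i j k))).
  rewrite (sum3_rot (fun a b c => E p b * (vc_gWg gi W c a * h c a b))).
  rewrite mxE; apply: eq_bigr => k _; rewrite mxE mulr_sumr.
  by apply: eq_bigr => i _; rewrite mulr_sumr.
have -> : \col_p divV fr Om p =
    Om *m (E *m y) + Om *m (E *m y) - (E *m zz + E *m zz) + E *m xx.
  apply/matrixP => p o; rewrite (ord1 o) mxE /divV Hy Hz Hx.
  by rewrite addmxE addmxE oppmxE !addmxE.
rewrite /vc -/y -/zz -/xx.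
have -> : E^T *m (Om *m (E *m y) + Om *m (E *m y) - (E *m zz + E *m zz) + E *m xx)
  = E^T *m Om *m E *m (y + y) - E^T *m E *m (zz + zz) + E^T *m E *m xx.
  move: (Om) y zz xx {Hy Hz Hx} => O y zz xx.
  rewrite !(mulmxN, mulmxDr, mulmxA); mxring.
rewrite EOmE fvec_complete /vc_gWg.
by move: y zz xx {Hy Hz Hx} => y zz xx; rewrite !(mulmxN, mulmxDr, mulmxA).
Qed.

(** The frame divergence has to agree with the coordinate one for any V, so all that matters is the
    divergence of each frame vector. *)
Lemma fdiv_coord (V : 'I_N -> F) :
  fdiv fr V = \sum_k pd k ((E^T *m (\col_p V p)) k 0)
    + \sum_k \tr (chris K k) * (E^T *m (\col_p V p)) k 0.
Proof.
have Vc k : (E^T *m (\col_p V p)) k 0 = \sum_p E p k * V p.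
  by rewrite mxE; apply: eq_bigr => p _; rewrite !mxE.
(* The divergence of e_b is the trace of nabla e_b, that is, the sum of [G a b a], which is minus
   the sum of [G a a b]. *)
have divE b : \sum_k pd k (E b k) =
    - \sum_a G a a b - \sum_j E b j * \tr (chris K j).
  have dE a k : \sum_i E a i * pd i (E b k) =
      \sum_e G a b e * E e k - \sum_j E b j * \sum_i E a i * chris K i j k.
    have /matrixP/(_ b k) := gauge K a.
    rewrite mxE addmxE oppmxE fderE mxE [in X in _ - X]mxE => ->.
    congr (_ - _); apply: eq_bigr => j _; congr (_ * _).
    by rewrite /chrisa summxE; apply: eq_bigr => i _; rewrite scalemxE.
  have dl i k : \sum_a E a i * (g *m E^T) k a = (k == i)%:R.
    have /matrixP/(_ k i) := gEE; rewrite mxE [RHS]mxE => <-.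
    by apply: eq_bigr => a _; rewrite mulrC.
  transitivity (\sum_k \sum_a (g *m E^T) k a * \sum_i E a i * pd i (E b k)).
    apply: eq_bigr => k _.
    transitivity (\sum_i (k == i)%:R * pd i (E b k)).
      rewrite (bigD1 k) //= eqxx mul1r big1 ?addr0 // => i ik.
      by rewrite eq_sym (negPf ik) mul0r.
    under eq_bigr => i _ do rewrite -dl mulr_suml.
    rewrite exchange_big; apply: eq_bigr => a _ /=; rewrite mulr_sumr.
    by apply: eq_bigr => i _; ring.
  under eq_bigr => k _ do under eq_bigr => a _ do rewrite dE mulrBr.
  under eq_bigr => k _ do rewrite sumrB.
  rewrite sumrB; congr (_ - _).
    rewrite exchange_big -sumrN; apply: eq_bigr => a _ /=.
    transitivity ((G a *m (E *m g *m E^T)) b a).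
      rewrite -(mulmxA E g) [RHS]mxE.
      under eq_bigr => k _ do rewrite mulr_sumr.
      rewrite exchange_big; apply: eq_bigr => e _ /=.
      by rewrite [(E *m (g *m E^T)) _ _]mxE mulr_sumr; apply: eq_bigr => k _; ring.
    by rewrite fcon_gram; apply: skewE; exact: fcon_skew.
  transitivity (\sum_k \sum_j E b j * \sum_i (k == i)%:R * chris K i j k).
    apply: eq_bigr => k _.
    under eq_bigr => a _ do rewrite mulr_sumr.
    rewrite exchange_big; apply: eq_bigr => j _ /=.
    transitivity (\sum_a \sum_i E b j * (E a i * (g *m E^T) k a * chris K i j k)).
      apply: eq_bigr => a _; rewrite !mulr_sumr; apply: eq_bigr => i _; ring.
    rewrite exchange_big mulr_sumr; apply: eq_bigr => i _ /=.
    by rewrite -mulr_sumr -mulr_suml dl.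
  rewrite exchange_big; apply: eq_bigr => j _ /=; rewrite -mulr_sumr.
  congr (_ * _); apply: eq_bigr => k _.
  rewrite (bigD1 k) //= eqxx mul1r big1 ?addr0 => [|i ik].
    exact: chris_torsion.
  by rewrite eq_sym (negPf ik) mul0r.
under [X in _ = X + _]eq_bigr => k _ do rewrite Vc raddf_sum /=.
rewrite exchange_big /=.
transitivity (\sum_p ((\sum_k E p k * pd k (V p)) + V p * (\sum_k pd k (E p k)))
   + \sum_p V p * \sum_j E p j * \tr (chris K j)).
  rewrite -big_split /= /fdiv.
  transitivity (\sum_p D p (V p) - \sum_p \sum_s G p p s * V s).
    by rewrite -sumrB.
  rewrite [X in _ - X]exchange_big -sumrB; apply: eq_bigr => p _ /=.
  rewrite divE fderE -mulr_suml; ring.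
congr (_ + _).
  apply: eq_bigr => p _; rewrite mulr_sumr -big_split; apply: eq_bigr => k _ /=.
  by rewrite pdM; ring.
under [RHS]eq_bigr => k _ do rewrite Vc mulr_sumr.
rewrite [RHS]exchange_big; apply: eq_bigr => p _ /=; rewrite mulr_sumr.
by apply: eq_bigr => k _; ring.
Qed.

(** With [fdiv_coord] this puts the divergence into the form of a sum of partial derivatives, once
    the density sqrt (det g) is multiplied in. *)
Lemma pd_det k :
  pd k (\det g) = \det g * (\tr (chris K k) + \tr (chris K k)).
Proof.
rewrite (der_det (@pdM _ _ _ K k)) chris_metric.
have adjE : \adj g = \det g *: gi.
  rewrite -[LHS](mulmx1) -(mulmx1C (gminvK K)) mulmxA mul_adj_mx.
  by rewrite mul_scalar_mx.
have gK := mulmx1C (gminvK K).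
rewrite adjE -scalemxAl mxtraceZ mulmxDr raddfD /=; congr (_ * (_ + _)).
  by rewrite mxtrace_mulC -mulmxA gK mulmx1.
by rewrite mulmxA gminvK mul1mx mxtrace_tr.
Qed.

End FieldOfFrame.

(* [vc] only involves a metric and a 2-form, not the frame. *)
Record metric_chart (F : comPzRingType) (m : nat) := MetricChart {
  mpd : 'I_m -> {additive F -> F};
  mpdM : forall i x y, mpd i (x * y) = mpd i x * y + x * mpd i y;
  mpd_comm : forall i j f, mpd i (mpd j f) = mpd j (mpd i f);
  mg : 'M[F]_m;
  mginv : 'M[F]_m;
  mg_sym : mg^T = mg;
  mginvK : mginv *m mg = 1%:M;
  mhalf : F;
  mhalf2 : mhalf + mhalf = 1;
  mW : 'M[F]_m }.

Section MetricChart.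
Variables (F : comPzRingType) (m : nat) (C : metric_chart F m).
Definition mGam i : 'M[F]_m :=
  locked (Gam (mpd C) (mg C) (mginv C) (mhalf C) i).
Lemma mGam_def i : mGam i = Gam (mpd C) (mg C) (mginv C) (mhalf C) i.
Proof. by rewrite /mGam -lock. Qed.
Definition mRc i j : 'M[F]_m :=
  map_mx (mpd C i) (mGam j) - map_mx (mpd C j) (mGam i) - br (mGam i) (mGam j).
Definition mnabW i : 'M[F]_m :=
  map_mx (mpd C i) (mW C) - mGam i *m mW C - mW C *m (mGam i)^T.
Definition mvc : 'cV[F]_m := vc (mginv C) (mW C) mRc mnabW.

Lemma mGam_torsion i j k : mGam i j k = mGam j i k.
Proof. by rewrite !mGam_def; exact/Gam_torsion/mg_sym. Qed.

Lemma mGam_metric i :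
  map_mx (mpd C i) (mg C) = mGam i *m mg C + mg C *m (mGam i)^T.
Proof.
rewrite mGam_def /Gam trmx_mul.
have gK := mulmx1C (mginvK C).
have gE j k : mg C k j = mg C j k by rewrite -{1}(mg_sym C) mxE.
have giT : (mginv C)^T = mginv C.
  have H : (mginv C)^T *m mg C = 1%:M.
    by rewrite -{1}(mg_sym C) -trmx_mul gK trmx1.
  by rewrite -[LHS]mulmx1 -gK mulmxA H mul1mx.
rewrite giT mulmxA gK mul1mx -mulmxA mginvK mulmx1.
apply/matrixP => j k; rewrite !mxE (gE k j).
by rewrite -[LHS]mul1r -(mhalf2 C); ring.
Qed.
End MetricChart.

(** * Tensoriality of the coordinate expression of V *)

Section ChangeOfCoordinates.
Variables (F F' : comPzRingType) (m : nat).
Variables (C : metric_chart F m) (C' : metric_chart F' m).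
Variables (h : {rmorphism F' -> F}) (J : 'M[F]_m).
Local Notation em i := (map_mx (mpd C i)).
Local Notation em' a := (map_mx (mpd C' a)).
Local Notation H := (map_mx h).
Hypothesis chain : forall i f, mpd C i (h f) = \sum_a J i a * h (mpd C' a f).
Hypothesis J_sym : forall i j a, mpd C i (J j a) = mpd C j (J i a).
Hypothesis gJ : mg C = J *m H (mg C') *m J^T.
Hypothesis WJ : mW C = J *m H (mW C') *m J^T.
Local Notation G1 := (mGam C).
Let GJ i : 'M[F]_m := \sum_a J i a *: H (mGam C' a).
Let dM i := @mpdM _ _ C i.

Let em_map (p q : nat) i (X : 'M[F']_(p, q)) :
  em i (H X) = \sum_a J i a *: H (em' a X).
Proof.
apply/matrixP => k l; rewrite mxE [in LHS]mxE chain summxE.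
by apply: eq_bigr => a _; rewrite scalemxE !mxE.
Qed.

Let twofree (x : F) : x + x = 0 -> x = 0.
Proof. by move=> x0; rewrite -[x]mul1r -(mhalf2 C) mulrDl -mulrDr x0 mulr0. Qed.

(** The inverse of the Jacobian, read off the transformation law of the metric. *)
Let Ji : 'M[F]_m := H (mg C') *m J^T *m mginv C.
Let JJi : J *m Ji = 1%:M.
Proof. by rewrite /Ji !mulmxA -gJ (mulmx1C (mginvK C)). Qed.
Let JiJ : Ji *m J = 1%:M.
Proof. exact: mulmx1C JJi. Qed.

Let gam_metric' a : H (em' a (mg C')) =
  H (mGam C' a) *m H (mg C') + H (mg C') *m (H (mGam C' a))^T.
Proof. by rewrite mGam_metric map_mxD !map_mxM -map_trmx. Qed.

Let JG_sym i j c : (J *m GJ i) j c = (J *m GJ j) i c.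
Proof.
have E i' j' : (J *m GJ i') j' c =
    \sum_b \sum_a J j' b * (J i' a * h (mGam C' a b c)).
  rewrite mxE; apply: eq_bigr => b _; rewrite /GJ summxE mulr_sumr.
  by apply: eq_bigr => a _; rewrite scalemxE mxE.
rewrite !E exchange_big; apply: eq_bigr => a _ /=; apply: eq_bigr => b _.
by rewrite mGam_torsion; ring.
Qed.

(* Both sides of the transformation law of the Christoffel symbols define a
   torsion-free metric connection. *)
Lemma Gam_change i : em i J = G1 i *m J - J *m GJ i.
Proof.
pose g' := H (mg C').
pose T i := (G1 i *m J - J *m GJ i - em i J) *m g' *m J^T.
have g'T : g'^T = g' by rewrite /g' map_trmx mg_sym.
have GJT i' : (GJ i')^T = \sum_a J i' a *: (H (mGam C' a))^T.
  apply/matrixP => k l; rewrite mxE /GJ !summxE; apply: eq_bigr => a _.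
  by rewrite !scalemxE [in RHS]mxE.
have Tanti i' : (T i')^T = - T i'.
  apply/eqP; rewrite -addr_eq0; apply/eqP.
  have key : em i' (mg C) = em i' J *m g' *m J^T
      + J *m (GJ i' *m g' + g' *m (GJ i')^T) *m J^T + J *m g' *m (em i' J)^T.
    rewrite gJ -/g' (map_mx_derM (dM i')) (map_mx_derM (dM i') J g') -map_trmx.
    have -> : em i' g' = GJ i' *m g' + g' *m (GJ i')^T.
      rewrite /g' em_map GJT mulmx_sumr /GJ mulmx_suml -big_split.
      apply: eq_bigr => a _ /=.
      by rewrite gam_metric' scalerDr -scalemxAl -scalemxAr.
    by rewrite mulmxDl.
  move: key; rewrite mGam_metric gJ -/g' => key.
  rewrite /T !trmx_mul !trmx_sub !trmx_mul trmxK g'T.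
  clear T g'T; move: key; move: (G1 i') (GJ i') (em i' J) g' => X Y Z g0.
  rewrite !mulmxA !(mulmxDl, mulmxDr, mulmxBl, mulmxBr, mulNmx, mulmxN) !mulmxA => key.
  rewrite -[RHS](subrr (X *m J *m g0 *m J^T + J *m g0 *m J^T *m X^T)) {2}key.
  mxring.
have Tsym i' j k : T i' j k = T j i' k.
  rewrite mxE [RHS]mxE; apply: eq_bigr => l _; congr (_ * _).
  rewrite mxE [RHS]mxE; apply: eq_bigr => b _; congr (_ * _).
  rewrite !addmxE !oppmxE JG_sym; congr (_ - _ - _).
    by rewrite mxE [RHS]mxE; apply: eq_bigr => c _; rewrite mGam_torsion.
  by rewrite mxE [RHS]mxE; exact: J_sym.
(* A tensor symmetric in its first two and antisymmetric in its last two indices equals its own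
   negative after the six alternating exchanges. *)
have T0 i' j k : T i' j k = 0.
  have anti a b c : T a c b = - T a b c by apply: skewE; exact: Tanti.
  apply: twofree.
  have e : T i' j k = - T i' j k.
    rewrite {1}Tsym anti (Tsym j k) anti opprK (Tsym k i') anti.
    by rewrite (Tsym i' j) .
  by rewrite {1}e addNr.
have {T0} T0 : T i = 0 by apply/matrixP => j k; rewrite T0 zeromxE.
have : T i *m (mginv C *m J) = 0 by rewrite T0 mul0mx.
rewrite /T -!mulmxA (mulmxA (J^T)) (mulmxA g') (mulmxA g' (J^T)) -/Ji JiJ mulmx1.
by move/eqP; rewrite subr_eq0 => /eqP ->.
Qed.

Let RJ i j : 'M[F]_m := \sum_a \sum_b (J i a * J j b) *: H (mRc C' a b).

(** Differentiate [Gam_change] once more: the equality of the mixed derivatives of the Jacobian is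
    the transformation law of the curvature. *)
Lemma Rc_change i j : mRc C i j *m J = J *m RJ i j.
Proof.
have dGJ i' j' : em i' (GJ j') = \sum_b mpd C i' (J j' b) *: H (mGam C' b)
    + \sum_a \sum_b (J i' a * J j' b) *: H (em' a (mGam C' b)).
  rewrite /GJ map_mx_der_sum [X in _ + X]exchange_big -big_split.
  apply: eq_bigr => b _ /=; rewrite (map_mx_derZ (dM i')) em_map scaler_sumr.
  by congr (_ + _); apply: eq_bigr => a _; rewrite scalerA mulrC.
have RJE : RJ i j = em i (GJ j) - em j (GJ i) - br (GJ i) (GJ j).
  rewrite !dGJ.
  have -> : br (GJ i) (GJ j) =
      \sum_a \sum_b (J i a * J j b) *: H (br (mGam C' a) (mGam C' b)).
    have H1 i' j' : GJ i' *m GJ j' = \sum_a \sum_b (J i' a * J j' b) *: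
        (H (mGam C' a) *m H (mGam C' b)).
      rewrite /GJ mulmx_suml; apply: eq_bigr => a _.
      rewrite mulmx_sumr; apply: eq_bigr => b _.
      by rewrite -scalemxAl -scalemxAr scalerA.
    rewrite br_def !H1 [X in _ - X]exchange_big -sumrB; apply: eq_bigr => a _ /=.
    rewrite -sumrB; apply: eq_bigr => b _.
    by rewrite br_def map_mxB !map_mxM scalerBr [J j b * _]mulrC.
  have -> : \sum_b mpd C i (J j b) *: H (mGam C' b) =
      \sum_b mpd C j (J i b) *: H (mGam C' b).
    by apply: eq_bigr => b _; rewrite J_sym.
  have -> : \sum_a \sum_b (J j a * J i b) *: H (em' a (mGam C' b)) =
      \sum_a \sum_b (J i a * J j b) *: H (em' b (mGam C' a)).
    rewrite exchange_big; apply: eq_bigr => a _ /=; apply: eq_bigr => b _.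
    by rewrite mulrC.
  transitivity (\sum_a \sum_b (J i a * J j b) *: H (em' a (mGam C' b))
    - \sum_a \sum_b (J i a * J j b) *: H (em' b (mGam C' a))
    - \sum_a \sum_b (J i a * J j b) *: H (br (mGam C' a) (mGam C' b))); last by mxring.
  rewrite -!sumrB; apply: eq_bigr => a _; rewrite -!sumrB.
  apply: eq_bigr => b _; rewrite -!scalerBr; congr (_ *: _).
  by rewrite /mRc !map_mxB.
have comm : em i (em j J) = em j (em i J).
  by apply/matrixP => k l; rewrite !mxE mpd_comm.
have B d (X Y : 'M[F]_m) : em d (X - Y) = em d X - em d Y by exact: map_mx_derB.
move: comm; rewrite (Gam_change j) (Gam_change i) !B.
rewrite (map_mx_derM (dM i) (G1 j) J) (map_mx_derM (dM i) J (GJ j)).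
rewrite (map_mx_derM (dM j) (G1 i) J) (map_mx_derM (dM j) J (GJ i)).
rewrite (Gam_change j) (Gam_change i) RJE /mRc !br_def.
move: (em i (G1 j)) (em j (G1 i)) (em i (GJ j)) (em j (GJ i)) (G1 i) (G1 j)
  (GJ i) (GJ j) => X1 X2 X3 X4 X5 X6 X7 X8.
rewrite !(mulmxDl, mulmxDr, mulmxBl, mulmxBr, mulNmx, mulmxN) !mulmxA => key.
apply/eqP; rewrite -subr_eq0; apply/eqP; move/eqP: key; rewrite -subr_eq0 => /eqP.
move=> key; rewrite -[RHS]key; mxring.
Qed.

Lemma nabW_change i :
  mnabW C i = J *m (\sum_a J i a *: H (mnabW C' a)) *m J^T.
Proof.
pose w := H (mW C').
have GJT : (GJ i)^T = \sum_a J i a *: (H (mGam C' a))^T.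
  apply/matrixP => k l; rewrite mxE /GJ !summxE; apply: eq_bigr => a _.
  by rewrite !scalemxE [in RHS]mxE.
have -> : \sum_a J i a *: H (mnabW C' a) = em i w - GJ i *m w - w *m (GJ i)^T.
  rewrite /w em_map GJT mulmx_sumr /GJ mulmx_suml -!sumrB.
  apply: eq_bigr => a _ /=.
  by rewrite /mnabW !map_mxB !map_mxM -map_trmx !scalerBr -scalemxAl -scalemxAr.
rewrite /mnabW WJ -/w (map_mx_derM (dM i)) (map_mx_derM (dM i) J w).
rewrite -map_trmx (Gam_change i) trmx_sub (trmx_mul J (GJ i)) (trmx_mul (G1 i) J).
move: (w) (em i w) (GJ i) (G1 i) => X1 X2 X3 X4.
rewrite !(mulmxDl, mulmxDr, mulmxBl, mulmxBr, mulNmx, mulmxN) !mulmxA; mxring.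
Qed.

(** Each of the three summands of [vc] is a full contraction of tensors whose laws are known, up to
    one free index; [contr] moves the Jacobians of the contracted indices into the inverse metric or
    the raised 2-form. *)
Lemma mvc_change : J^T *m mvc C = map_mx h (mvc C').
Proof.
have giJ : J^T *m mginv C *m J = H (mginv C').
  have giK : H (mg C') *m H (mginv C') = 1%:M.
    by rewrite -map_mxM (mulmx1C (mginvK C')) map_mx1.
  transitivity (H (mginv C') *m (Ji *m J)); last by rewrite JiJ mulmx1.
  by rewrite /Ji !mulmxA (mulmx1C giK) mul1mx.
rewrite /mvc vc_map.
set gi' := H (mginv C') in giJ *; set W' := H (mW C').
set R' := fun i j => H (mRc C' i j); set n' := fun i => H (mnabW C' i).
have RE i j : mRc C i j = J *m RJ i j *m Ji.
  by rewrite -Rc_change -mulmxA JJi mulmx1.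
have hE i j k : vc_h (mginv C) (mRc C) (mnabW C) i j k =
    \sum_a \sum_b \sum_c J i a * J j b * J k c * vc_h gi' R' n' a b c.
  have e (X Y : 'M[F]_m) : \tr (J *m X *m Ji *m (J *m Y *m J^T)^T *m mginv C) =
      \tr (X *m Y^T *m gi').
    move: (Ji) JiJ => Ji' Ji'J.
    rewrite !trmx_mul trmxK -giJ -!mulmxA mxtrace_mulC -!mulmxA.
    by rewrite (mulmxA Ji') Ji'J mul1mx.
  rewrite /vc_h RE nabW_change e /RJ !mulmx_suml raddf_sum.
  apply: eq_bigr => a _ /=; rewrite !mulmx_suml raddf_sum.
  apply: eq_bigr => b _ /=.
  have -> : (\sum_c J k c *: H (mnabW C' c))^T = \sum_c J k c *: (n' c)^T.
    apply/matrixP => p q; rewrite mxE !summxE; apply: eq_bigr => c _.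
    by rewrite !scalemxE [in RHS]mxE.
  rewrite mulmx_sumr mulmx_suml raddf_sum; apply: eq_bigr => c _ /=.
  by rewrite -!scalemxAl -scalemxAr -!scalemxAl !mxtraceZ mulrA.
have gWg : J^T *m vc_gWg (mginv C) (mW C) *m J = vc_gWg gi' W'.
  by rewrite /vc_gWg WJ -/W' -giJ !mulmxA.
have contr (X X' : 'M[F]_m) (f : 'I_m -> 'I_m -> 'I_m -> F) :
    J^T *m X *m J = X' -> forall a,
    \sum_j \sum_k \sum_b \sum_c X j k * (J j b * J k c * f a b c) =
    \sum_b \sum_c X' b c * f a b c.
  move=> <- a.
  transitivity (\sum_b \sum_j \sum_k \sum_c X j k * (J j b * J k c * f a b c)).
    under eq_bigr => j _ do rewrite exchange_big.
    by rewrite exchange_big.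
  apply: eq_bigr => b _.
  transitivity (\sum_c \sum_j \sum_k X j k * (J j b * J k c * f a b c)).
    under eq_bigr => j _ do rewrite exchange_big.
    by rewrite exchange_big.
  apply: eq_bigr => c _; rewrite exchange_big mxE mulr_suml.
  apply: eq_bigr => k _ /=; rewrite mxE !mulr_suml; apply: eq_bigr => j _.
  by rewrite [_^T _ _]mxE; ring.
have yE : vc_y (mginv C) (mRc C) (mnabW C) = J *m vc_y gi' R' n'.
  apply/matrixP => i o; rewrite (ord1 o) mxE [RHS]mxE.
  transitivity (\sum_j \sum_k \sum_a \sum_b \sum_c
     J i a * (mginv C j k * (J j b * J k c * vc_h gi' R' n' a b c))).
    apply: eq_bigr => j _; apply: eq_bigr => k _; rewrite hE mulr_sumr.
    apply: eq_bigr => a _; rewrite mulr_sumr; apply: eq_bigr => b _.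
    by rewrite mulr_sumr; apply: eq_bigr => c _; ring.
  under eq_bigr => j _ do rewrite exchange_big.
  rewrite exchange_big; apply: eq_bigr => a _ /=; rewrite mxE.
  rewrite -(contr _ _ (vc_h gi' R' n') giJ) !mulr_sumr; apply: eq_bigr => j _.
  rewrite mulr_sumr; apply: eq_bigr => k _; rewrite mulr_sumr.
  by apply: eq_bigr => b _; rewrite mulr_sumr.
have zE : vc_z (mginv C) (mW C) (mRc C) (mnabW C) = J *m vc_z gi' W' R' n'.
  apply/matrixP => i o; rewrite (ord1 o) mxE [RHS]mxE.
  transitivity (\sum_j \sum_k \sum_a \sum_b \sum_c
     J i a * (vc_gWg (mginv C) (mW C) j k
       * (J j b * J k c * vc_h gi' R' n' a b c))).
    apply: eq_bigr => j _; apply: eq_bigr => k _; rewrite hE mulr_sumr.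
    apply: eq_bigr => a _; rewrite mulr_sumr; apply: eq_bigr => b _.
    by rewrite mulr_sumr; apply: eq_bigr => c _; ring.
  under eq_bigr => j _ do rewrite exchange_big.
  rewrite exchange_big; apply: eq_bigr => a _ /=; rewrite mxE.
  rewrite -(contr _ _ (vc_h gi' R' n') gWg) !mulr_sumr; apply: eq_bigr => j _.
  rewrite mulr_sumr; apply: eq_bigr => k _; rewrite mulr_sumr.
  by apply: eq_bigr => b _; rewrite mulr_sumr.
have xE : vc_x (mginv C) (mW C) (mRc C) (mnabW C) = J *m vc_x gi' W' R' n'.
  apply/matrixP => i o; rewrite (ord1 o) mxE [RHS]mxE.
  transitivity (\sum_j \sum_k \sum_a \sum_b \sum_c
     J i a * (vc_gWg (mginv C) (mW C) j k
       * (J j b * J k c * vc_h gi' R' n' b c a))).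
    apply: eq_bigr => j _; apply: eq_bigr => k _; rewrite hE.
    pose f a b c := J j a * J k b * J i c * vc_h gi' R' n' a b c.
    rewrite (sum3_rot f) (sum3_rot (fun a b c => f c a b)) mulr_sumr.
    apply: eq_bigr => a _; rewrite mulr_sumr; apply: eq_bigr => b _.
    by rewrite mulr_sumr; apply: eq_bigr => c _; rewrite /f; ring.
  under eq_bigr => j _ do rewrite exchange_big.
  rewrite exchange_big; apply: eq_bigr => a _ /=; rewrite mxE.
  rewrite -(contr _ _ (fun a b c => vc_h gi' R' n' b c a) gWg) !mulr_sumr.
  apply: eq_bigr => j _.
  rewrite mulr_sumr; apply: eq_bigr => k _; rewrite mulr_sumr.
  by apply: eq_bigr => b _; rewrite mulr_sumr.
rewrite /vc yE zE xE WJ -/W'.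
move: (vc_y _ _ _) (vc_z _ _ _ _) (vc_x _ _ _ _) => y z x.
have -> : J *m W' *m J^T *m mginv C *m (J *m y + J *m y)
    - (J *m z + J *m z) + J *m x = J *m (W' *m gi' *m (y + y) - (z + z) + x).
  rewrite -giJ !(mulmxN, mulmxDr, mulmxA); mxring.
by rewrite !mulmxA giJ.
Qed.

End ChangeOfCoordinates.

Lemma derive_eq_on (R : realType) (m : nat) (V : normedModType R)
    (U : set 'rV[R]_m) (f g : 'rV[R]_m -> V) x v :
  open U -> (forall y, U y -> f y = g y) -> U x -> 'D_v f x = 'D_v g x.
Proof.
move=> oU fg Ux; apply: near_eq_derive.
have /filterS : nbhs x U by exact: open_nbhs_nbhs.
by apply=> y; exact: fg.
Qed.

Lemma map_mx_rsum (A B : pzRingType) (h : {rmorphism A -> B}) (p q : nat)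
    (J : Type) (r : seq J) (P : pred J) (X : J -> 'M[A]_(p, q)) :
  map_mx h (\sum_(j <- r | P j) X j) = \sum_(j <- r | P j) map_mx h (X j).
Proof.
apply/matrixP => i j; rewrite mxE !summxE rmorph_sum.
by apply: eq_bigr => k _; rewrite mxE.
Qed.

(** * Smooth functions on an open set as a ring with derivations *)

Section SmoothFunctions.
Variables (R : realType) (m : nat).
Local Notation vec := 'rV[R]_m.
Variable U : {O : set vec | open O}.
Local Notation O := (sval U).
Local Notation F := (smooth_fun U).
Let oO : open O := svalP U.

Lemma smooth_derive (f : vec -> R) v : smooth_on O f -> smooth_on O ('D_v f).
Proof. by move=> sf k; exact: Ck_derive (sf k.+1). Qed.

Definition pdS_fun : 'I_m -> F -> F := locked (fun j f =>
  mk_sfun (smooth_derive 'e_j (@sfun_smooth _ _ _ f))).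

Let pdS_funE j (f : F) x : O x -> pdS_fun j f x = 'D_'e_j f x.
Proof. by rewrite /pdS_fun -lock; exact: mk_sfunE. Qed.

Let sder (f : F) x v : O x -> derivable f x v.
Proof. by move=> Ox; exact: Ck_derivable (@sfun_smooth _ _ _ f 1%N) Ox. Qed.

Let pdS_additive j : zmod_morphism (pdS_fun j).
Proof.
move=> f h; apply: sfun_eq => x Ox.
rewrite sfunD // sfunN // !pdS_funE //.
rewrite -deriveB; [|exact: sder|exact: sder].
apply: (derive_eq_on _ oO) => // y Oy; by rewrite sfunD // sfunN.
Qed.

Definition pdS (j : 'I_m) : {additive F -> F} :=
  HB.pack_for {additive F -> F} (pdS_fun j)
    (GRing.isZmodMorphism.Build _ _ (pdS_fun j) (pdS_additive j)).

Lemma pdSE j (f : F) x : O x -> pdS j f x = 'D_'e_j f x.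
Proof. exact: pdS_funE. Qed.

Lemma pdSM j (f h : F) : pdS j (f * h) = pdS j f * h + f * pdS j h.
Proof.
apply: sfun_eq => x Ox; rewrite sfunD // !sfunM // !pdSE //.
transitivity ('D_'e_j ((f : vec -> R) * (h : vec -> R)) x).
  by apply: (derive_eq_on _ oO) => // y Oy; rewrite sfunM.
rewrite deriveM; [|exact: sder|exact: sder].
by rewrite addrC /GRing.scale /= [h x * _]mulrC.
Qed.

Lemma pdS_comm i j (f : F) : pdS i (pdS j f) = pdS j (pdS i f).
Proof.
apply: sfun_eq => x Ox.
have H k l : pdS k (pdS l f) x = 'D_'e_k ('D_'e_l f) x.
  rewrite (pdSE k (pdS l f) Ox); apply: (derive_eq_on _ oO) Ox => y Oy.
  exact: pdSE.
have S := schwarz_derive 'e_i 'e_j oO (@sfun_smooth _ _ _ f 2%N) Ox.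
exact: etrans (H i j) (etrans S (esym (H j i))).
Qed.

Let cst_smooth (c : R) : smooth_on O (fun=> c).
Proof. by move=> k; exact: Ck_cst. Qed.
Definition cstS c : F := mk_sfun (cst_smooth c).

Lemma cstSE c x : O x -> cstS c x = c.
Proof. exact: mk_sfunE. Qed.

Lemma pd_cstS j c : pdS j (cstS c) = 0.
Proof.
apply: sfun_eq => x Ox; rewrite pdSE // sfun_0.
rewrite (derive_eq_on 'e_j oO (g := fun=> c)) //.
  exact: derive_cst.
by move=> y Oy; rewrite cstSE.
Qed.

Let coord_smooth j : smooth_on O (fun x : vec => x 0 j).
Proof. by move=> k; exact: Ck_coord. Qed.
Definition crdS j : F := mk_sfun (coord_smooth j).

Lemma pd_crdS i j : pdS i (crdS j) = (i == j)%:R.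
Proof.
apply: sfun_eq => x Ox; rewrite pdSE //.
rewrite (derive_eq_on 'e_i oO (g := fun y => y 0 j)) //; last first.
  by move=> y Oy; rewrite mk_sfunE.
rewrite derive_coord mxE eqxx eq_sym.
by case: (_ == _); rewrite ?sfun_1 ?sfun_0.
Qed.

Definition halfS : F := cstS 2^-1.
Lemma halfS2 : halfS + halfS = 1.
Proof.
apply: sfun_eq => x Ox; rewrite sfunD // cstSE // sfun_1 //.
by rewrite [RHS](splitr 1) !div1r.
Qed.

Lemma sfun_torsionfree (f : F) : f + f = 0 -> f = 0.
Proof.
move=> ff; apply: sfun_eq => x Ox.
have /(congr1 (fun h : F => h x)) := ff; rewrite sfunD // sfun_0.
by move=> H; lra.
Qed.

Section Lift.
Variables (a b : nat) (f : vec -> 'M[R]_(a, b)).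
Hypothesis sf : smooth_on O f.
Let entry_smooth i j : smooth_on O (fun x => f x i j).
Proof. by move=> k; exact: (proj1 (Ck_mxP k f oO) (sf k) i j). Qed.
Definition liftS : 'M[F]_(a, b) := \matrix_(i, j) mk_sfun (entry_smooth i j).
Lemma liftSE x (Ox : O x) : map_mx (sev_rmorph Ox) liftS = f x.
Proof. by apply/matrixP => i j; rewrite mxE mxE; exact: mk_sfunE. Qed.
End Lift.

Lemma ev_eq (f h : F) : (forall x (Ox : O x), sev_rmorph Ox f = sev_rmorph Ox h) -> f = h.
Proof. by move=> fh; apply: sfun_eq => x Ox; exact: (fh x Ox). Qed.

Lemma ev_mx_eq (a b : nat) (X Y : 'M[F]_(a, b)) :
  (forall x (Ox : O x), map_mx (sev_rmorph Ox) X = map_mx (sev_rmorph Ox) Y) ->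
  X = Y.
Proof.
move=> XY; apply/matrixP => i j; apply: ev_eq => x Ox.
by have /matrixP/(_ i j) := XY x Ox; rewrite !mxE.
Qed.

Lemma derive_evmx (a b : nat) (X : 'M[F]_(a, b)) (f : vec -> 'M[R]_(a, b)) x
    (Ox : O x) u :
  (forall y (Oy : O y), f y = map_mx (sev_rmorph Oy) X) ->
  'D_u f x = \sum_i u 0 i *: map_mx (sev_rmorph Ox) (map_mx (pdS i) X).
Proof.
move=> fX.
have cX k l : Ck 1 O (fun y => f y k l).
  apply: (Ck_eq oO) (@sfun_smooth _ _ _ (X k l) 1%N) => y Oy.
  by rewrite (fX y Oy) mxE.
have cf : Ck 1 O f by exact: (proj2 (Ck_mxP 1 f oO) cX).
apply/matrixP => k l; rewrite (derive_mxE _ _ _ cf) //.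
rewrite (derive_row _ oO (cX k l)) // summxE; apply: eq_bigr => i _.
rewrite !mxE; congr (_ * _).
rewrite [RHS](pdSE i (X k l) Ox); apply: (derive_eq_on _ oO) => // y Oy.
by rewrite (fX y Oy) mxE.
Qed.

End SmoothFunctions.

(** * Analytic definitions expressed in the ring of smooth functions *)

Section Links.
Variables (R : realType) (m : nat).
Local Notation vec := 'rV[R]_m.
Variable U : {O : set vec | open O}.
Local Notation O := (sval U).
Local Notation F := (smooth_fun U).
Let oO : open O := svalP U.
Variables (g W : vec -> 'M[R]_m) (al : vec -> vec).
Hypothesis sg : smooth_on O g.
Hypothesis sW : smooth_on O W.
Hypothesis sal : smooth_on O al.
Hypothesis g_symm : forall x, O x -> (g x)^T = g x.
Hypothesis g_det : forall x, O x -> 0 < \det (g x).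

Local Notation gF := (liftS sg).

Lemma ev_det x (Ox : O x) : sev_rmorph Ox (\det gF) = \det (g x).
Proof. by rewrite -det_map_mx liftSE. Qed.

Let det_neq0 x : O x -> (\det gF : F) x != 0.
Proof. by move=> Ox; have := ev_det Ox; rewrite /= /sev => ->; rewrite gt_eqF // g_det. Qed.

Let detV_smooth : smooth_on O (fun x => ((\det gF : F) x)^-1).
Proof. by move=> k; apply: (Ck_inv oO det_neq0); exact: sfun_smooth. Qed.
Definition detVS : F := mk_sfun detV_smooth.

Let det_gt0 x : O x -> 0 < (\det gF : F) x.
Proof. by move=> Ox; have := ev_det Ox; rewrite /= /sev => ->; rewrite g_det. Qed.

Let sqrtdet_smooth : smooth_on O (fun x => Num.sqrt ((\det gF : F) x)).
Proof. by move=> k; apply: (Ck_sqrt oO det_gt0); exact: sfun_smooth. Qed.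
Definition sqrtdetS : F := mk_sfun sqrtdet_smooth.

Lemma sqrtdetSE x : O x -> sqrtdetS x = Num.sqrt (\det (g x)).
Proof.
by move=> Ox; rewrite /sqrtdetS mk_sfunE //; have := ev_det Ox; rewrite /= /sev => ->.
Qed.

Lemma sqrtdetS_sqr : sqrtdetS * sqrtdetS = \det gF.
Proof.
apply: sfun_eq => x Ox; rewrite sfunM // mk_sfunE // -expr2 sqr_sqrtr //.
by rewrite ltW // det_gt0.
Qed.

Definition ginvS : 'M[F]_m := detVS *: \adj gF.

Lemma ginvSK : ginvS *m gF = 1%:M.
Proof.
rewrite /ginvS -scalemxAl mul_adj_mx -mul_scalar_mx -scalar_mxM.
congr (_%:M); apply: sfun_eq => x Ox; rewrite sfunM // mk_sfunE // sfun_1 //.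
by rewrite mulVf // det_neq0.
Qed.

Lemma ginvSE x (Ox : O x) : map_mx (sev_rmorph Ox) ginvS = invmx (g x).
Proof.
have H : map_mx (sev_rmorph Ox) ginvS *m g x = 1%:M.
  by rewrite -(liftSE sg Ox) -map_mxM ginvSK map_mx1.
have gu : g x \in unitmx by rewrite unitmxE unitfE gt_eqF // g_det.
by rewrite -[LHS]mulmx1 -(mulmxV gu) mulmxA H mul1mx.
Qed.

Lemma gS_sym : gF^T = gF.
Proof. by apply: ev_mx_eq => x Ox; rewrite -map_trmx !liftSE g_symm. Qed.

Definition chartS : metric_chart F m :=
  MetricChart (@pdSM R m U) (@pdS_comm R m U) gS_sym ginvSK (halfS2 U)
    (liftS sW).
Local Notation C := chartS.

Local Notation ev Ox := (map_mx (sev_rmorph Ox)).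

Lemma christoffelE x (Ox : O x) u v :
  christoffel g x u v = v *m \sum_i u 0 i *: ev Ox (mGam C i).
Proof.
pose D i := 'D_'e_i g x.
have cg1 : Ck 1 O g by exact: sg.
have Dg w : 'D_w g x = \sum_i w 0 i *: D i.
  have H := derive_evmx Ox w (fun y Oy => esym (liftSE sg Oy)).
  rewrite H; apply: eq_bigr => i _; congr (_ *: _).
  have H' := derive_evmx Ox 'e_i (fun y Oy => esym (liftSE sg Oy)).
  rewrite /D H' (bigD1 i) //= big1 ?addr0 => [|k ki].
    by rewrite mxE !eqxx scale1r.
  by rewrite mxE (negPf ki) andbF scale0r.
have DE i j k : ev Ox (map_mx (pdS U i) gF) j k = D i j k.
  rewrite /D (derive_mxE _ _ _ cg1 Ox) !mxE [LHS]pdSE //.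
  by apply: (derive_eq_on _ oO) => // y Oy; rewrite mk_sfunE.
have e2 (B : 'M[R]_m) (a b : vec) : ev2 B a b = \sum_j a 0 j * \sum_k B j k * b 0 k.
  rewrite /ev2 -mulmxA mxE; apply: eq_bigr => j _; congr (_ * _).
  by rewrite mxE; apply: eq_bigr => k _; rewrite [_^T _ _]mxE.
have se (k : 'I_m) (f : 'I_m -> R) : \sum_l f l * ('e_k : vec) 0 l = f k.
  rewrite (bigD1 k) //= mxE !eqxx mulr1 big1 ?addr0 // => l lk.
  by rewrite mxE (negPf lk) andbF mulr0.
rewrite /christoffel.
under eq_bigr => i _ do rewrite mGam_def /Gam map_mxM ginvSE scalemxAl.
rewrite -mulmx_suml mulmxA; congr (_ *m _); apply/rowP => k.
rewrite [LHS]mxE [RHS]mxE.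
transitivity (\sum_j v 0 j * \sum_i u 0 i * (2^-1 * (D i j k + D j i k - D k i j))); last first.
  apply: eq_bigr => j _; rewrite summxE; congr (_ * _); apply: eq_bigr => i _.
  rewrite scalemxE [in RHS]mxE [in RHS]mxE; congr (_ * _).
  have DE' a b c : sev_rmorph Ox (pdS U a (gF b c)) = D a b c.
    by rewrite -DE !mxE.
  by rewrite rmorphM rmorphB rmorphD !DE'; congr (_ * _); exact/esym/cstSE.
transitivity (\sum_j \sum_i v 0 j * (u 0 i * (2^-1 * (D i j k + D j i k - D k i j)))); last first.
  by apply: eq_bigr => j _; rewrite mulr_sumr.
have -> : ev2 ('D_u g x) v 'e_k = \sum_j \sum_i v 0 j * (u 0 i * D i j k).
  rewrite e2; apply: eq_bigr => j _; rewrite se Dg summxE mulr_sumr.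
  by apply: eq_bigr => i _; rewrite scalemxE.
have -> : ev2 ('D_v g x) u 'e_k = \sum_j \sum_i v 0 j * (u 0 i * D j i k).
  rewrite e2 exchange_big; apply: eq_bigr => i _ /=; rewrite se Dg summxE mulr_sumr.
  by apply: eq_bigr => j _; rewrite scalemxE; ring.
have -> : ev2 ('D_'e_k g x) u v = \sum_j \sum_i v 0 j * (u 0 i * D k i j).
  rewrite e2 exchange_big; apply: eq_bigr => i _ /=; rewrite mulr_sumr.
  by apply: eq_bigr => j _; rewrite /D; ring.
rewrite -big_split -sumrB mulr_sumr; apply: eq_bigr => j _ /=.
rewrite -big_split -sumrB mulr_sumr; apply: eq_bigr => i _ /=.
by ring.
Qed.

Let cstmx (a b : nat) (X : 'M[R]_(a, b)) : 'M[F]_(a, b) := map_mx (cstS U) X.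
Let ev_cstmx (a b : nat) (X : 'M[R]_(a, b)) x (Ox : O x) : ev Ox (cstmx X) = X.
Proof. by apply/matrixP => i j; rewrite !mxE; exact: cstSE. Qed.
Let pd_cstmx (a b : nat) (X : 'M[R]_(a, b)) i : map_mx (pdS U i) (cstmx X) = 0.
Proof. by apply/matrixP => k l; rewrite !mxE; exact: pd_cstS. Qed.

Let nabla_cst y v w : nabla g (cst v) (cst w) y = christoffel g y v w.
Proof. by rewrite /nabla /= derive_cst add0r. Qed.

(** For constant fields the Lie bracket vanishes and the coefficients have zero derivative, so only
    derivatives and products of Christoffel matrices remain. *)
Lemma curvatureE x (Ox : O x) u v w :
  curvature g x u v w =
  w *m \sum_i \sum_j (u 0 i * v 0 j) *: ev Ox (mRc C i j).
Proof.
have nE v' w' : nabla g (cst v') (cst w') = (fun y => christoffel g y v' w').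
  by apply/funext => y; exact: nabla_cst.
have dN u' v' w' : nabla g (cst u') (nabla g (cst v') (cst w')) x =
    w' *m (\sum_i \sum_j (u' 0 i * v' 0 j) *: ev Ox (map_mx (pdS U i) (mGam C j)))
    + w' *m (\sum_j v' 0 j *: ev Ox (mGam C j))
         *m (\sum_i u' 0 i *: ev Ox (mGam C i)).
  rewrite nE {1}/nabla /=; congr (_ + _); last first.
    by rewrite (christoffelE Ox) (christoffelE Ox).
  pose X := cstmx w' *m \sum_j cstS U (v' 0 j) *: mGam C j.
  have XE y (Oy : O y) : christoffel g y v' w' = ev Oy X.
    rewrite (christoffelE Oy) /X map_mxM ev_cstmx; congr (_ *m _).
    rewrite map_mx_rsum; apply: eq_bigr => j _.
    by rewrite map_mxZ; congr (_ *: _); exact/esym/cstSE.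
  rewrite (derive_evmx Ox u' XE) mulmx_sumr; apply: eq_bigr => i _.
  rewrite /X (map_mx_derM (pdSM i)) pd_cstmx mul0mx add0r map_mxM ev_cstmx.
  rewrite scalemxAr; congr (_ *m _).
  rewrite map_mx_der_sum map_mx_rsum scaler_sumr; apply: eq_bigr => j _.
  rewrite (map_mx_derZ (pdSM i)) pd_cstS scale0r add0r map_mxZ scalerA.
  by congr (_ * _ *: _); exact: cstSE.
have lie0 : lie (cst u) (cst v) = (cst 0 : vec -> vec).
  by apply/funext => y; rewrite /lie /= !derive_cst subrr.
have n0 : nabla g (lie (cst u) (cst v)) (cst w) x = 0.
  rewrite lie0 nabla_cst (christoffelE Ox) big1 ?mulmx0 // => i _.
  by rewrite mxE scale0r.
rewrite /curvature /Riem n0 !dN subr0.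
have -> : \sum_i \sum_j (u 0 i * v 0 j) *: ev Ox (mRc C i j) =
    \sum_i \sum_j (u 0 i * v 0 j) *: ev Ox (map_mx (pdS U i) (mGam C j))
    - \sum_i \sum_j (v 0 i * u 0 j) *: ev Ox (map_mx (pdS U i) (mGam C j))
    - ((\sum_i u 0 i *: ev Ox (mGam C i)) *m (\sum_j v 0 j *: ev Ox (mGam C j))
       - (\sum_j v 0 j *: ev Ox (mGam C j)) *m (\sum_i u 0 i *: ev Ox (mGam C i))).
  have P (a b : vec) : (\sum_i a 0 i *: ev Ox (mGam C i)) *m
      (\sum_j b 0 j *: ev Ox (mGam C j)) =
      \sum_i \sum_j (a 0 i * b 0 j) *: (ev Ox (mGam C i) *m ev Ox (mGam C j)).
    rewrite mulmx_suml; apply: eq_bigr => i _; rewrite mulmx_sumr.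
    by apply: eq_bigr => j _; rewrite -scalemxAl -scalemxAr scalerA.
  rewrite !P [X in _ - X - _]exchange_big [X in _ - (_ - X)]exchange_big.
  rewrite -!sumrB; apply: eq_bigr => i _; rewrite -!sumrB; apply: eq_bigr => j _.
  rewrite [v 0 j * _]mulrC -!scalerBr; congr (_ *: _).
  by rewrite /mRc br_def !map_mxB !map_mxM.
have key (X Y P Q : 'M[R]_m) : (w *m X + w *m Q *m P) - (w *m Y + w *m P *m Q) =
    w *m (X - Y - (P *m Q - Q *m P)).
  by rewrite !(mulmxDr, mulmxN) !mulmxA; mxring.
exact: key.
Qed.

Lemma derive_ev00 (X : 'M[F]_1) (f : vec -> 'M[R]_1) x (Ox : O x) u :
  (forall y (Oy : O y), f y = ev Oy X) ->
  'D_u (fun y => f y 0 0) x =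
  \sum_i u 0 i * (ev Ox (map_mx (pdS U i) X)) 0 0.
Proof.
move=> fX.
have cf : Ck 1 O f.
  apply: (proj2 (Ck_mxP 1 f oO)) => k l.
  apply: (Ck_eq oO) (@sfun_smooth _ _ _ (X k l) 1%N) => y Oy.
  by rewrite (fX y Oy) mxE.
rewrite -(derive_mxE u 0 0 cf Ox) (derive_evmx Ox u fX) summxE.
by apply: eq_bigr => i _; rewrite scalemxE.
Qed.

Definition nabalS i : 'rV[F]_m :=
  map_mx (pdS U i) (liftS sal) - liftS sal *m (mGam C i)^T.

Lemma nabla1E x (Ox : O x) u v :
  nabla1 g al (cst u) (cst v) x =
  \sum_i u 0 i * (v *m (ev Ox (nabalS i))^T) 0 0.
Proof.
transitivity ('D_u (fun y => ev1 (al y) v) x - ev1 (al x) (christoffel g x u v)).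
  by rewrite /nabla1 nabla_cst.
rewrite (christoffelE Ox).
pose X : 'M[F]_1 := cstmx v *m (liftS sal)^T.
have XE y (Oy : O y) : v *m (al y)^T = ev Oy X.
  by rewrite /X map_mxM -map_trmx ev_cstmx liftSE.
have -> : 'D_u (fun y => ev1 (al y) v) x =
    \sum_i u 0 i * (ev Ox (map_mx (pdS U i) X)) 0 0 := derive_ev00 Ox u XE.
have -> : ev1 (al x) (v *m \sum_i u 0 i *: ev Ox (mGam C i)) =
    \sum_i u 0 i * (v *m ev Ox (mGam C i) *m (al x)^T) 0 0.
  rewrite /ev1 mulmx_sumr mulmx_suml summxE; apply: eq_bigr => i _.
  by rewrite -scalemxAr -scalemxAl scalemxE.
rewrite -sumrB; apply: eq_bigr => i _; rewrite -mulrBr; congr (_ * _).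
rewrite /X (map_mx_derM (pdSM i)) pd_cstmx mul0mx add0r map_mxM ev_cstmx.
rewrite /nabalS map_mxB map_mxM trmx_sub trmx_mul -!map_trmx trmxK liftSE mulmxBr.
by rewrite -mulmxA addmxE oppmxE.
Qed.

Lemma nabla2E x (Ox : O x) u v w :
  nabla2 g W (cst u) (cst v) (cst w) x =
  \sum_i u 0 i * ev2 (ev Ox (mnabW C i)) v w.
Proof.
transitivity ('D_u (fun y => ev2 (W y) v w) x - ev2 (W x) (christoffel g x u v) w
    - ev2 (W x) v (christoffel g x u w)).
  by rewrite /nabla2 !nabla_cst.
rewrite !(christoffelE Ox).
pose X : 'M[F]_1 := cstmx v *m liftS sW *m (cstmx w)^T.
have XE y (Oy : O y) : v *m W y *m w^T = ev Oy X.
  by rewrite /X !map_mxM -map_trmx !ev_cstmx liftSE.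
have -> : 'D_u (fun y => ev2 (W y) v w) x =
    \sum_i u 0 i * (ev Ox (map_mx (pdS U i) X)) 0 0 := derive_ev00 Ox u XE.
have -> : ev2 (W x) (v *m \sum_i u 0 i *: ev Ox (mGam C i)) w =
    \sum_i u 0 i * (v *m ev Ox (mGam C i) *m W x *m w^T) 0 0.
  rewrite /ev2 mulmx_sumr !mulmx_suml summxE; apply: eq_bigr => i _.
  by rewrite -scalemxAr -!scalemxAl scalemxE.
have -> : ev2 (W x) v (w *m \sum_i u 0 i *: ev Ox (mGam C i)) =
    \sum_i u 0 i * (v *m W x *m (ev Ox (mGam C i))^T *m w^T) 0 0.
  have e : (w *m \sum_i u 0 i *: ev Ox (mGam C i))^T =
      \sum_i u 0 i *: ((ev Ox (mGam C i))^T *m w^T).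
    apply/matrixP => k l; rewrite mxE mulmx_sumr !summxE.
    by apply: eq_bigr => i _; rewrite -scalemxAr !scalemxE -trmx_mul [in RHS]mxE.
  rewrite /ev2 e mulmx_sumr summxE; apply: eq_bigr => i _.
  by rewrite -scalemxAr scalemxE !mulmxA.
rewrite -!sumrB; apply: eq_bigr => i _; rewrite -!mulrBr; congr (_ * _).
rewrite /X !(map_mx_derM (pdSM i)) !pd_cstmx mul0mx add0r -map_trmx pd_cstmx.
rewrite trmx0 mulmx0 addr0 !map_mxM -map_trmx !ev_cstmx.
rewrite /ev2 /mnabW !map_mxB !map_mxM -map_trmx liftSE !(mulmxBr, mulmxBl) !mulmxA.
by rewrite !addmxE !oppmxE.
Qed.

Let pd_entry (a b : nat) (f : vec -> 'M[R]_(a, b)) (sf : smooth_on O f) i k l x :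
  O x -> (pdS U i (liftS sf k l) : F) x = 'D_'e_i f x k l.
Proof.
move=> Ox; rewrite pdSE // (derive_mxE 'e_i k l (sf 1%N) Ox).
by apply: (derive_eq_on _ oO) => // y Oy; rewrite mxE mk_sfunE.
Qed.

Let ev1_e (a : vec) k : ev1 a 'e_k = a 0 k.
Proof.
rewrite /ev1 mxE (bigD1 k) //= mxE !eqxx mul1r mxE big1 ?addr0 // => l lk.
by rewrite mxE (negPf lk) andbF mul0r.
Qed.

Let ev2_e (B : 'M[R]_m) j k : ev2 B 'e_j 'e_k = B j k.
Proof. by rewrite /ev2 -rowE trmx_delta -colE !mxE. Qed.

Lemma closed1E : (forall x u v, O x -> extd1 al x u v = 0) ->
  forall i j, pdS U i (liftS sal 0 j) = pdS U j (liftS sal 0 i).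
Proof.
move=> cl i j; apply: sfun_eq => x Ox; rewrite !pd_entry //.
apply/eqP; rewrite -subr_eq0; apply/eqP.
transitivity (extd1 al x 'e_i 'e_j); last exact: cl.
by rewrite /extd1; congr (_ - _); exact/esym/ev1_e.
Qed.

Lemma closed2E : (forall x u v w, O x -> extd2 W x u v w = 0) ->
  forall i j k, pdS U i (liftS sW j k) + pdS U j (liftS sW k i)
    + pdS U k (liftS sW i j) = 0.
Proof.
move=> cl i j k; apply: sfun_eq => x Ox.
rewrite sfun_0 sfunD // sfunD // !pd_entry //.
transitivity (extd2 W x 'e_i 'e_j 'e_k); last exact: cl.
by rewrite /extd2; congr (_ + _ + _); exact/esym/ev2_e.
Qed.

Lemma einsteinE (tau : R) :
  (forall x u v, O x -> ricci g x u v = tau * ev2 (g x) u v) ->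
  forall j p, \sum_k mRc C k j p k = cstS U tau * gF j p.
Proof.
move=> ric j p; apply: ev_eq => x Ox.
have := ric x 'e_j 'e_p Ox; rewrite ev2_e rmorphM rmorph_sum.
have -> : sev_rmorph Ox (gF j p) = g x j p by have /matrixP/(_ j p) := liftSE sg Ox; rewrite mxE.
have -> : sev_rmorph Ox (cstS U tau) = tau by exact: cstSE.
move=> <-; apply: eq_bigr => k _; rewrite (curvatureE Ox).
rewrite (bigD1 k) //= [X in _ *m (_ + X)]big1 ?addr0; last first.
  move=> i ik; rewrite big1 // => l _.
  by rewrite mxE (negPf ik) andbF mul0r scale0r.
rewrite (bigD1 j) //= big1 ?addr0 => [|l lj]; last first.
  by rewrite [X in _ * X]mxE (negPf lj) andbF mulr0 scale0r.
have ee (l : 'I_m) : ('e_l : vec) 0 l = 1 by rewrite mxE !eqxx.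
by rewrite !ee mulr1 scale1r -rowE [RHS]mxE [RHS]mxE.
Qed.

End Links.

(** * Adapted frames *)

Lemma der1 (F : comPzRingType) (d : {additive F -> F}) :
  (forall x y, d (x * y) = d x * y + x * d y) -> d 1 = 0.
Proof.
move=> dM; have H := dM 1 1; rewrite !mulr1 mul1r in H.
by apply: (addrI (d 1)); rewrite addr0 -H.
Qed.

Section StarRicci.
Variables (F : comPzRingType) (N : nat) (fr : connection_frame F N).
Variable Om : 'M[F]_N.
Hypothesis Om_skew : Om^T = - Om.

(** By antisymmetry of [Om] the contraction can be written with either index of the pair in front;
    the sum of the two versions is turned into [tP] by the first Bianchi identity. *)
Lemma star_ricci a b :
  \sum_k (Om *m Rm fr a k) k b + \sum_k (Om *m Rm fr a k) k b = - tP fr Om a b.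
Proof.
set s := \sum_k _.
have sE : s = \sum_k \sum_l Om k l * Rm fr a k l b.
  by apply: eq_bigr => k _; rewrite mxE.
have sE2 : s = \sum_k \sum_l Om k l * Rm fr l a k b.
  rewrite sE exchange_big; apply: eq_bigr => k _ /=; apply: eq_bigr => l _.
  rewrite (Rm_antisym fr a l) oppmxE.
  have -> : Om l k = - Om k l by apply: skewE.
  ring.
have -> : tP fr Om a b = \sum_k \sum_l Om k l * Rm fr k l a b.
  rewrite /tP summxE; apply: eq_bigr => k _; rewrite summxE.
  by apply: eq_bigr => l _; rewrite scalemxE.
rewrite {1}sE sE2 -big_split -sumrN; apply: eq_bigr => k _ /=.
rewrite -big_split -sumrN; apply: eq_bigr => l _ /=.
have B := bianchi1 fr a k l b.
rewrite -mulrDr -mulrN; congr (_ * _).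
by apply/eqP; rewrite -subr_eq0 opprK; apply/eqP; rewrite -[RHS]B; ring.
Qed.
End StarRicci.

Lemma quad_entry (F : comPzRingType) (a b : nat) (A : 'M[F]_(a, b)) (X : 'M[F]_b)
    i j : (A *m X *m A^T) i j = (row i A *m X *m (row j A)^T) 0 0.
Proof.
rewrite !mxE; apply: eq_bigr => k _; rewrite !mxE; congr (_ * _).
by apply: eq_bigr => l _; rewrite !mxE.
Qed.

Lemma sum_pick (V : nmodType) (I : finType) (P : pred I) (c : bool) (i0 : I) (v : V) :
  (forall i, P i = c && (i == i0)) ->
  \sum_i (if P i then v else 0) = if c then v else 0.
Proof.
move=> PE; case: c PE => PE.
  rewrite (bigD1 i0) //= PE eqxx big1 ?addr0 // => i /negPf ii0.
  by rewrite PE ii0.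
by rewrite big1 // => i _; rewrite PE.
Qed.

Section SignedPairing.
Variable n : nat.
Local Notation m := n.*2.+1.
Local Notation N := (m + 1)%N.

(** Pairs 2 k with 2 k + 1, counting from 0. The Reeb direction has index 2 n and is thereby paired
    with the added flat direction 2 n + 1. *)
Definition sgn_nat (k : nat) := if odd k then k.-1 else k.+1.

Lemma sgn_natK : involutive sgn_nat.
Proof.
rewrite /sgn_nat => -[|k] //=.
by case ok: (odd k) => /=; rewrite ok.
Qed.

Lemma sgn_nat_lt k : (k < N)%N -> (sgn_nat k < N)%N.
Proof.
rewrite /sgn_nat; have := odd_double_half k.
by case: (odd k) => /=; lia.
Qed.

Definition sgn (a : 'I_N) : 'I_N := Ordinal (sgn_nat_lt (ltn_ord a)).
Definition sgn_odd (a : 'I_N) : bool := odd a.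
Definition last_dir : 'I_N := rshift m ord0.

Lemma lshift_last (k : 'I_m) : (lshift 1 k == last_dir) = false.
Proof. by rewrite -val_eqE /= ltn_eqF //; have := ltn_ord k; lia. Qed.

Lemma sgnK : involutive sgn.
Proof. by move=> a; apply: val_inj; exact: sgn_natK. Qed.

Lemma sgn_oddN a : sgn_odd (sgn a) = ~~ sgn_odd a.
Proof.
rewrite /sgn_odd /= /sgn_nat; case: (val a) => [|k] //=.
by case ok: (odd k) => /=; rewrite ok.
Qed.

Lemma sgn_odd_last : sgn_odd last_dir = true.
Proof. by rewrite /sgn_odd /= addn0 /= odd_double. Qed.

(** The standard form of omega is a signed permutation matrix: the only summand in which a can occur
    has k = a / 2, rounded down, and the parity of a decides the sign. *)
Lemma pairing_sum (K : comPzRingType) (a b : 'I_m) :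
  \sum_(k < n) (((a == inord k.*2) && (b == inord k.*2.+1))%:R
     - ((a == inord k.*2.+1) && (b == inord k.*2))%:R : K) =
  (-1) ^+ sgn_odd (lshift 1 a) * (lshift 1 b == sgn (lshift 1 a))%:R.
Proof.
have E (P : bool) : P%:R = if P then 1 else 0 :> K by case: P.
have ev (k : 'I_n) (c : 'I_m) : (c == inord k.*2) = (val c == k.*2).
  by rewrite -val_eqE /= inordK //; have := ltn_ord k; lia.
have od (k : 'I_n) (c : 'I_m) : (c == inord k.*2.+1) = (val c == k.*2.+1).
  by rewrite -val_eqE /= inordK //; have := ltn_ord k; lia.
have sE : (lshift 1 b == sgn (lshift 1 a)) = (val b == sgn_nat a).
  by rewrite -val_eqE.
have lb := ltn_ord b; have la := ltn_ord a.
rewrite sE /sgn_odd /= /sgn_nat sumrB.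
have [c1|c1] := boolP ((~~ odd a) && (val b == a.+1)).
  have hd := odd_double_half a.
  have kn : (a./2 < n)%N.
    by move: c1 hd => /andP[/negPf -> /eqP] /=; lia.
  case/andP: (c1) => oa bE.
  have -> : \sum_(k < n) ((a == inord k.*2) && (b == inord k.*2.+1))%:R = 1 :> K.
    under eq_bigr => k _ do rewrite ev od E.
    rewrite (@sum_pick _ _ _ true (Ordinal kn)) // => k.
    rewrite -val_eqE /=; move/eqP: bE => /= ->; move: hd.
    by rewrite ?oa ?(negPf oa) /=; lia.
  rewrite big1 => [|k _]; last first.
    by rewrite ev od; case: eqP => //= h; move: oa; rewrite h /= odd_double.
  by rewrite (negPf oa) bE subr0 expr0 mulr1.
have [c2|c2] := boolP (odd a && (val b == a.-1)).
  have hd := odd_double_half a.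
  have kn : (a./2 < n)%N by move: c2 hd => /andP[-> _] /=; lia.
  case/andP: (c2) => oa bE.
  have -> : \sum_(k < n) ((a == inord k.*2.+1) && (b == inord k.*2))%:R = 1 :> K.
    under eq_bigr => k _ do rewrite ev od E.
    rewrite (@sum_pick _ _ _ true (Ordinal kn)) // => k.
    rewrite -val_eqE /=; move/eqP: bE => /= ->; move: hd.
    by rewrite ?oa ?(negPf oa) /=; lia.
  rewrite big1 => [|k _]; last first.
    by rewrite ev od; case: eqP => //= h; move: oa; rewrite h /= odd_double.
  by rewrite oa bE sub0r expr1 mulr1.
rewrite big1 => [|k _]; last first.
  rewrite ev od; case: eqP => //= h; case: eqP => //= h'.
  by move: c1 => /=; rewrite h h' odd_double eqxx.
rewrite big1 ?subr0 => [|k _]; last first.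
  rewrite ev od; case: eqP => //= h; case: eqP => //= h'.
  by move: c2 => /=; rewrite h h' /= odd_double eqxx.
by move: c1 c2; case: (odd a) => /= c1 c2; rewrite ?(negPf c1) ?(negPf c2) mulr0.
Qed.

End SignedPairing.

Lemma sum_lt_half (V : nmodType) (m : nat) (f : 'I_m -> 'I_m -> V) :
  (forall a b, f a b = f b a) -> (forall a, f a a = 0) ->
  \sum_a \sum_b f a b =
  \sum_(a < m) \sum_(b < m | (a < b)%N) f a b
  + \sum_(a < m) \sum_(b < m | (a < b)%N) f a b.
Proof.
move=> fC f0.
have -> : \sum_a \sum_b f a b = \sum_(a < m) \sum_(b < m | (a < b)%N) f a b
    + \sum_(a < m) \sum_(b < m | (b < a)%N) f a b.
  rewrite -big_split; apply: eq_bigr => a _ /=.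
  rewrite (bigID (fun b : 'I_m => (a < b)%N)) /=; congr (_ + _).
  rewrite (bigD1 a) /=; last by rewrite ltnn.
  rewrite f0 add0r; apply: eq_bigl => b.
  by rewrite -leqNgt [RHS]ltn_neqAle -val_eqE andbC.
congr (_ + _).
under eq_bigr => a _ do rewrite big_mkcond.
rewrite exchange_big; apply: eq_bigr => a _ /=; rewrite [RHS]big_mkcond.
by apply: eq_bigr => b _; case: ifP => // _; exact: fC.
Qed.

Section FramePart.
Variables (F : comPzRingType) (N m : nat) (E : 'M[F]_(N, m)) (z : 'I_N).
Variables (g gi : 'M[F]_m).
Hypothesis EE : E^T *m E = gi.
Hypothesis giK : gi *m g = 1%:M.
Hypothesis E_z : forall i, E z i = 0.
Let ez : 'rV[F]_N := delta_mx 0 z.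

(** As [ez *m E] = 0, multiplying by [E^T] and [E] isolates w, and then multiplying by [E^T] and
    [ez^T] isolates v. *)
Lemma frame_part_eq0 (w : 'M[F]_m) (v : 'rV[F]_m) :
  E *m w *m E^T + E *m v^T *m ez - ez^T *m v *m E^T = 0 -> w = 0 /\ v = 0.
Proof.
have gK := mulmx1C giK.
have ezE : ez *m E = 0.
  apply/matrixP => i j; rewrite mxE zeromxE big1 // => k _.
  have -> : ez i k = (k == z)%:R by rewrite /ez mxE (ord1 i) eqxx.
  by case: eqVneq => [->|_]; rewrite ?E_z ?mulr0 ?mul0r.
have Eez : E^T *m ez^T = 0 by apply: trmx_inj; rewrite trmx_mul !trmxK ezE trmx0.
have ezz : ez *m ez^T = 1%:M.
  apply/matrixP => i j; rewrite (ord1 i) (ord1 j) mxE (bigD1 z) //=.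
  rewrite mxE [X in _ * X]mxE mxE !eqxx mulr1 big1 ?addr0 ?mxE // => k kz.
  by rewrite mxE (negPf kz) mul0r.
set X := (X in X = 0) => X0.
have w0 : w = 0.
  have : E^T *m X *m E = 0 by rewrite X0 mulmx0 mul0mx.
  rewrite /X !(mulmxBr, mulmxDr, mulmxBl, mulmxDl, mulmxN, mulNmx) !mulmxA -!(mulmxA _ ez E) ezE.
  rewrite Eez !mul0mx mulmx0 addr0 subr0 EE -!mulmxA EE => H.
  transitivity (g *m (gi *m (w *m gi)) *m g); last by rewrite H mulmx0 mul0mx.
  by rewrite !mulmxA gK mul1mx -mulmxA giK mulmx1.
split=> //.
have : E^T *m X *m ez^T = 0 by rewrite X0 mulmx0 mul0mx.
rewrite /X w0 mulmx0 mul0mx add0r mulmxBr mulmxBl !mulmxA Eez !mul0mx subr0.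
rewrite -(mulmxA _ ez) ezz mulmx1 EE => H.
apply: trmx_inj; rewrite trmx0; transitivity (g *m (gi *m v^T)).
  by rewrite mulmxA gK mul1mx.
by rewrite H mulmx0.
Qed.

Lemma frame_span_eq0 (p q : nat) (X : 'I_m -> 'M[F]_(p, q)) :
  (forall a, \sum_i E a i *: X i = 0) -> forall j, X j = 0.
Proof.
move=> X0 j; have gK : g *m E^T *m E = 1%:M by rewrite -mulmxA EE (mulmx1C giK).
transitivity (\sum_a (g *m E^T) j a *: \sum_i E a i *: X i); last first.
  by rewrite big1 // => a _; rewrite X0 scaler0.
transitivity (\sum_i (g *m E^T *m E) j i *: X i).
  rewrite gK (bigD1 j) //= mxE eqxx scale1r big1 ?addr0 // => i ij.
  by rewrite mxE eq_sym (negPf ij) scale0r.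
under [RHS]eq_bigr => a _ do rewrite scaler_sumr.
rewrite [RHS]exchange_big; apply: eq_bigr => i _ /=; rewrite mxE scaler_suml.
by apply: eq_bigr => a _; rewrite scalerA.
Qed.
End FramePart.

Section AdaptedFrame.
Variables (R : realType) (n : nat).
Hypothesis n_gt0 : (0 < n)%N.
Local Notation m := n.*2.+1.
Local Notation N := (m + 1)%N.
Local Notation vec := 'rV[R]_m.
Variable U : {O : set vec | open O}.
Local Notation O := (sval U).
Local Notation F := (smooth_fun U).
Let oO : open O := svalP U.
Variables (g W theta : vec -> 'M[R]_m) (al : vec -> vec).
Hypothesis s_g : smooth_on O g.
Hypothesis s_W : smooth_on O W.
Hypothesis s_al : smooth_on O al.
Hypothesis s_th : smooth_on O theta.
Hypothesis g_symm : forall x, O x -> (g x)^T = g x.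
Hypothesis g_det : forall x, O x -> 0 < \det (g x).
Hypothesis W_skew : forall x, O x -> (W x)^T = - W x.
Hypothesis th_on : forall x, O x -> orthonormal_coframe (g x) (theta x).
Hypothesis al_th : forall x, O x -> al x = row ord_max (theta x).
Hypothesis W_th : forall x, O x -> W x =
  \sum_(k < n) wedge (row (inord k.*2) (theta x)) (row (inord k.*2.+1) (theta x)).
Hypothesis al_closed : forall x u v, O x -> extd1 al x u v = 0.
Hypothesis W_closed : forall x u v w, O x -> extd2 W x u v w = 0.
Variable tau : R.
Hypothesis ric : forall x u v, O x -> ricci g x u v = tau * ev2 (g x) u v.

Local Notation gF := (liftS s_g).
Local Notation WF := (liftS s_W).
Local Notation alF := (liftS s_al).
Local Notation thF := (liftS s_th).
Local Notation giF := (ginvS s_g g_det).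
Local Notation C := (chartS s_g s_W g_symm g_det).
Local Notation ev Ox := (map_mx (sev_rmorph Ox)).
Local Notation z := (last_dir n).
Local Notation sg := (@sgn n).
Local Notation kb := (@sgn_odd n).

(** The coframe with its index raised; for an orthonormal coframe this is the dual frame. *)
Definition adE0 : 'M[F]_m := locked (thF *m giF).
Local Notation E0 := adE0.
Let E0_def : E0 = thF *m giF.
Proof. by rewrite /adE0 -lock. Qed.
(** The zero row stands for the flat direction of M x R, which annihilates functions on M. *)
Definition adE : 'M[F]_(N, m) := col_mx E0 0.

Let giT : giF^T = giF.
Proof.
apply: ev_mx_eq => x Ox; rewrite -map_trmx ginvSE trmx_inv.
by rewrite g_symm.
Qed.

Let thgith : thF *m giF *m thF^T = 1%:M.
Proof.
apply: ev_mx_eq => x Ox; rewrite !map_mxM -map_trmx ginvSE !liftSE map_mx1.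
exact: th_on.
Qed.

Let E0T : E0^T = giF *m thF^T.
Proof. by rewrite E0_def trmx_mul giT. Qed.

Let E0th : E0 *m thF^T = 1%:M.
Proof. by rewrite E0_def; exact: thgith. Qed.

Lemma adE_complete : adE^T *m adE = giF.
Proof.
have thE : E0^T *m thF = 1%:M.
  by apply: mulmx1C; rewrite E0T mulmxA.
rewrite /adE tr_col_mx mul_row_col trmx0 mul0mx addr0.
by rewrite {2}E0_def mulmxA thE mul1mx.
Qed.

Let E0gram : E0 *m gF *m E0^T = 1%:M.
Proof.
by rewrite E0T E0_def -(mulmxA thF) ginvSK mulmx1 mulmxA.
Qed.

Lemma adE_gram : adE *m gF *m adE^T = block_mx 1%:M 0 0 0.
Proof.
rewrite /adE mul_col_mx tr_col_mx mul_col_row E0gram trmx0 !mulmx0 !mul0mx.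
by [].
Qed.

Let adE_gram0 i : map_mx (pdS U i) (adE *m gF *m adE^T) = 0.
Proof.
have d1 := der1 (pdSM i).
have d0 : pdS U i 0 = 0 by exact: (raddf0 (pdS U i)).
rewrite adE_gram map_block_mx; apply/matrixP => k l; rewrite zeromxE.
rewrite -[k]splitK -[l]splitK; case: (fintype.split k) => k'; case: (fintype.split l) => l' /=.
- rewrite block_mxEul mxE mxE.
  by case: (k' == l'); rewrite ?mulr1n ?mulr0n; [exact: d1|exact: d0].
- by rewrite block_mxEur mxE mxE; exact: d0.
- by rewrite block_mxEdl mxE mxE; exact: d0.
- by rewrite block_mxEdr mxE mxE; exact: d0.
Qed.

Definition adK : framed_chart F m N :=
  FramedChart (@pdSM R m U) (@pdS_comm R m U) (@pd_crdS R m U)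
    (gS_sym s_g g_symm) (ginvSK s_g g_det) (halfS2 U) adE_complete adE_gram0.
Local Notation fr := (chart_frame adK).

Let adE_z i : adE z i = 0.
Proof. by rewrite /adE /last_dir col_mxEd mxE. Qed.

Lemma Rc_mRc i j : Rc adK i j = mRc C i j.
Proof. by rewrite /mRc !mGam_def. Qed.
Lemma nabW_mnabW i : nabW adK WF i = mnabW C i.
Proof. by rewrite /mnabW !mGam_def. Qed.
Lemma nabal_nabalS i : nabal adK alF i = nabalS s_g s_W s_al g_symm g_det i.
Proof. by rewrite /nabalS !mGam_def. Qed.

Let row_adE a : row (lshift 1 a) adE = row a E0.
Proof. by apply/rowP => i; rewrite mxE [RHS]mxE /adE; exact: col_mxEu. Qed.

Let row_adEz : row z adE = 0.
Proof. by apply/rowP => i; rewrite mxE adE_z mxE. Qed.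

Let wedgeF (a b : 'rV[F]_m) : 'M[F]_m := a^T *m b - b^T *m a.

Let WFE : WF =
  \sum_(k < n) wedgeF (row (inord k.*2) thF) (row (inord k.*2.+1) thF).
Proof.
apply: ev_mx_eq => x Ox; rewrite liftSE (W_th Ox) map_mx_rsum; apply: eq_bigr => k _.
by rewrite /wedge /wedgeF map_mxB !map_mxM -!map_trmx !map_row liftSE.
Qed.

Let alFE : alF = row ord_max thF.
Proof. by apply: ev_mx_eq => x Ox; rewrite map_row !liftSE (al_th Ox). Qed.

Let pair_th a s : (row a E0 *m (row s thF)^T) 0 0 = (a == s)%:R.
Proof.
have /matrixP/(_ a s) := E0th; rewrite [RHS]mxE => <-.
by rewrite !mxE; apply: eq_bigr => k _; rewrite !mxE.
Qed.

(** An adapted coframe makes omega standard on the first 2 n indices; alpha /\ dt pairs the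
    remaining two, so the whole form has constant components. *)
Lemma adOm : Omext adK WF alF z = Omat F sg kb.
Proof.
have dz (o : 'I_1) k : (delta_mx 0 z : 'rV[F]_N) o k = (k == z)%:R.
  by rewrite mxE (ord1 o) eqxx.
have acolE k : (adE *m alF^T) k 0 = (k == lshift 1 ord_max)%:R.
  rewrite -[k]splitK; case: (fintype.split k) => k' /=.
    transitivity ((row k' E0 *m alF^T) 0 0).
      by rewrite -row_adE -row_mul [in RHS]mxE.
    by rewrite alFE pair_th -!val_eqE.
  have -> : rshift m k' = z by rewrite (ord1 k').
  rewrite mxE big1 => [|l _]; last by rewrite adE_z mul0r.
  by rewrite eq_sym lshift_last.
have sgz k : (sg z == lshift 1 k) = (k == ord_max).
  by rewrite -!val_eqE /= /sgn_nat; case: ifP; have := ltn_ord k; lia.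
apply/matrixP => a b; rewrite /Omext addmxE addmxE oppmxE.
have -> : (adE *m alF^T *m (delta_mx 0 z : 'rV[F]_N)) a b =
    (a == lshift 1 ord_max)%:R * (b == z)%:R.
  by rewrite mxE big_ord1 acolE dz.
have -> : ((delta_mx 0 z : 'rV[F]_N)^T *m (adE *m alF^T)^T) a b =
    (a == z)%:R * (b == lshift 1 ord_max)%:R.
  by rewrite mxE big_ord1 [X in X * _]mxE dz [X in _ * X]mxE acolE.
rewrite quad_entry [RHS]mxE.
have zl k : (lshift 1 k == z) = false.
  exact: lshift_last.
have zlC k : (z == lshift 1 k) = false by rewrite eq_sym zl.
rewrite -[a]splitK -[b]splitK.
case: (fintype.split a) => a'; case: (fintype.split b) => b' /=.
- rewrite !zl mulr0 mul0r addr0 subr0 /= !row_adE -pairing_sum.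
  rewrite WFE mulmx_sumr mulmx_suml summxE; apply: eq_bigr => k _.
  rewrite /wedgeF mulmxBr mulmxBl addmxE oppmxE.
  have tw (i j s t : 'I_m) : (row i E0 *m ((row s thF)^T *m row t thF) *m (row j E0)^T) 0 0 =
      ((i == s) && (j == t))%:R.
    rewrite mulmxA -mulmxA mxE big_ord1 pair_th.
    have -> : (row t thF *m (row j E0)^T) 0 0 = (j == t)%:R.
      transitivity (((row j E0 *m (row t thF)^T)^T) 0 0).
        by rewrite trmx_mul trmxK.
      by rewrite mxE pair_th.
    by rewrite -natrM mulnb.
  by rewrite !tw.
- have -> : rshift m b' = z by rewrite (ord1 b').
  rewrite row_adEz trmx0 mulmx0 mxE zl eqxx mul0r subr0 add0r mulr1.
  have -> : (z == sg (lshift 1 a')) = (a' == ord_max).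
    by rewrite -sgz eq_sym (can2_eq (@sgnK n) (@sgnK n)).
  have -> : (lshift 1 a' == lshift 1 ord_max) = (a' == ord_max) by rewrite -!val_eqE.
  case: eqVneq => [->|_]; last by rewrite mulr0.
  by rewrite /sgn_odd /= odd_double expr0 mulr1.
- have -> : rshift m a' = z by rewrite (ord1 a').
  rewrite row_adEz !mul0mx mxE zl mulr0 addr0 eqxx mul1r sub0r sgn_odd_last expr1.
  have -> : (lshift 1 b' == sg z) = (b' == ord_max) by rewrite eq_sym sgz.
  by rewrite mulN1r -!val_eqE.
- have -> : rshift m a' = z by rewrite (ord1 a').
  have -> : rshift m b' = z by rewrite (ord1 b').
  rewrite row_adEz !mul0mx mxE zlC mul0r mulr0 addr0 subr0.
  have -> : (z == sg z) = false.
    by rewrite -val_eqE /= /sgn_nat; case: ifP; lia.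
  by rewrite mulr0.
Qed.

Let sgK : involutive sg := @sgnK n.
Let kb_sg : forall a, kb (sg a) = ~~ kb a := @sgn_oddN n.
Let kb_z : kb z = true := sgn_odd_last n.
Local Notation Om := (Omat F sg kb).
Let Om_skew : Om^T = - Om := Omat_skew F sgK kb_sg.
Let Ftf : forall x : F, x + x = 0 -> x = 0 := @sfun_torsionfree R m U.

Let adK_z : forall i, fvec adK z i = 0.
Proof. exact: adE_z. Qed.

Let W_skewF : WF^T = - WF.
Proof.
by apply: ev_mx_eq => x Ox; rewrite -map_trmx map_mxN liftSE W_skew.
Qed.

Let A_cyc p k l : tA fr Om p k l + tA fr Om k l p + tA fr Om l p k = 0.
Proof.
have H := tA_coord_cyc adK_z W_skewF (closed2E s_W W_closed)
  (closed1E s_al al_closed) p k l.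
by rewrite adOm in H.
Qed.

Let G_z a b : fcon fr a b z = 0.
Proof. exact: (fcon_z adK_z). Qed.

Local Notation tauF := (cstS U tau).

Let tauF_const a : fder fr a tauF = 0.
Proof.
rewrite fderE big1 // => i _.
have -> : pd adK i tauF = 0 by exact: pd_cstS.
by rewrite mulr0.
Qed.

Let RicE k l : Ric fr k l = if (k == l) && (k != z) then tauF else 0.
Proof.
have H : forall j p, \sum_i Rc adK i j p i = tauF * gm adK j p.
  move=> j p; rewrite -(einsteinE s_g s_W g_symm g_det ric j p).
  by apply: eq_bigr => i _; rewrite Rc_mRc.
have zl k' : (lshift 1 k' == z) = false.
  exact: lshift_last.
rewrite (Ric_coord H) (_ : (fvec adK *m gm adK *m (fvec adK)^T) = block_mx 1%:M 0 0 0); last exact: adE_gram.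
rewrite -[k]splitK -[l]splitK.
case: (fintype.split k) => k'; case: (fintype.split l) => l' /=.
- rewrite block_mxEul mxE zl /= andbT (inj_eq (@lshift_inj _ _)).
  by case: (k' == l'); rewrite ?mulr1n ?mulr0n ?mulr1 ?mulr0.
- rewrite block_mxEur mxE mulr0 (ord1 l') lshift_last.
  by [].
- have -> : rshift m k' = z by rewrite (ord1 k').
  by rewrite eqxx andbF /z block_mxEdl mxE mulr0.
- have -> : rshift m k' = z by rewrite (ord1 k').
  by rewrite eqxx andbF /z block_mxEdr mxE mulr0.
Qed.

Let m2_gt0 : (0 : R) < N%:R - 2.
Proof.
have -> : N%:R = n.*2%:R + 2 :> R by rewrite -natrD; congr _%:R; lia.
by rewrite addrK ltr0n double_gt0.
Qed.

Let mvcE : mvc C = vc giF WF (Rc adK) (nabW adK WF).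
Proof.
have eR : mRc C = Rc adK.
  by apply/funext => i; apply/funext => j; exact/esym/Rc_mRc.
have eW : mnabW C = nabW adK WF.
  by apply/funext => i; exact/esym/nabW_mnabW.
exact: (congr2 (fun r w => vc giF WF r w) eR eW).
Qed.

Local Notation sq := (sqrtdetS s_g g_det).

Lemma sqrtdetS_gt0 x : O x -> 0 < sq x.
Proof. by move=> Ox; rewrite (sqrtdetSE s_g g_det Ox) sqrtr_gt0; exact: g_det. Qed.

Lemma ad_fdiv :
  \sum_k pdS U k (sq * mvc C k 0) = sq * fdiv fr (divV fr Om).
Proof.
(* Differentiate sq^2 = det g, use [pd_det], and divide by 2 sq at each point, since the ring of
   functions has no division. *)
have pdsq k : pdS U k sq = sq * \tr (chris adK k).
  have H : pdS U k sq * sq + sq * pdS U k sq =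
      sq * sq * (\tr (chris adK k) + \tr (chris adK k)).
    by rewrite -pdSM (sqrtdetS_sqr s_g g_det); exact: (pd_det adK k).
  apply: ev_eq => x Ox; have s0 : sev_rmorph Ox sq != 0.
    exact: (lt0r_neq0 (sqrtdetS_gt0 Ox)).
  have {}H := congr1 (sev_rmorph Ox) H.
  rewrite !(rmorphD, rmorphM) in H; rewrite rmorphM.
  apply: (mulfI s0); move: H s0.
  move: (sev_rmorph Ox sq) (sev_rmorph Ox _) (sev_rmorph Ox _) => s a t H _.
  by lra.
rewrite -adOm fdiv_coord (divV_vc WF alF adK_z) mvcE mulrDr !mulr_sumr -big_split.
apply: eq_bigr => k _; rewrite (pdSM k sq) pdsq.
rewrite [LHS]addrC -mulrA; exact: erefl.
Qed.

Local Notation ts Ox := (taustar_of fr sg kb (sev_rmorph Ox)).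

Let ev_tau x (Ox : O x) : sev_rmorph Ox tauF = tau.
Proof. exact: cstSE. Qed.

Lemma ad_tau_le0 x : O x -> tau <= 0.
Proof.
move=> Ox; rewrite -(ev_tau Ox).
exact: (tau_le0 Ftf sgK kb_sg kb_z A_cyc G_z RicE).
Qed.

Lemma ad_estimate x (Ox : O x) :
  4 * (N%:R - 2) * (ts Ox - tau) * ts Ox + tau ^+ 2 / N%:R ^+ 2 <=
  (\sum_k pdS U k (sq * mvc C k 0) : F) x / sq x.
Proof.
have H := divV_estimate Ftf sgK kb_sg kb_z A_cyc G_z tauF_const RicE
  (sev_rmorph Ox) m2_gt0.
rewrite ev_tau in H; apply: (le_trans H).
have s0 := sqrtdetS_gt0 Ox.
rewrite ad_fdiv (sfunM _ _ Ox) [X in X / _]mulrC mulfK.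
  exact: lexx.
exact: (lt0r_neq0 s0).
Qed.

(** A smooth local representative of [taustar], from which the continuity of [taustar] is
    deduced. *)
Definition tsF : F :=
  cstS U (- (2 * (N%:R - 2))^-1) * ip (tP fr Om) Om.

Lemma tsFE x (Ox : O x) : tsF x = ts Ox.
Proof. by rewrite /tsF (sfunM _ _ Ox) (cstSE _ Ox). Qed.

Let evE x (Ox : O x) : ev Ox E0 = theta x *m invmx (g x).
Proof. by rewrite E0_def map_mxM liftSE ginvSE. Qed.

Lemma ad_frame x : O x -> orthonormal_frame (g x) (theta x *m invmx (g x)).
Proof.
move=> Ox; have H : ev Ox (E0 *m gF *m E0^T) = 1%:M by rewrite E0gram map_mx1.
rewrite (map_mxM _ (E0 *m gF)) (map_mxM _ E0 gF) -map_trmx (evE Ox) (liftSE s_g Ox) in H.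
exact: H.
Qed.

Lemma ad_parallel x (Ox : O x) : ts Ox = 0 -> tau = 0 ->
  (forall u v, nabla1 g al (cst u) (cst v) x = 0) /\
  (forall u v w, nabla2 g W (cst u) (cst v) (cst w) x = 0).
Proof.
move=> t0 tau0.
have A0 p k l : sev_rmorph Ox (tA fr Om p k l) = 0.
  by apply: (tA_eq0 Ftf sgK kb_sg kb_z A_cyc G_z RicE m2_gt0 t0); rewrite ev_tau.
pose E' := ev Ox adE; pose gi' := ev Ox giF; pose g' := ev Ox gF.
have EE : E'^T *m E' = gi' by rewrite map_trmx -map_mxM adE_complete.
have giK : gi' *m g' = 1%:M by rewrite -map_mxM ginvSK map_mx1.
have E'z i : E' z i = 0 by rewrite mxE adE_z rmorph0.
have H p : ev Ox (nabWf adK WF p) = 0 /\ ev Ox (nabalf adK alF p) = 0.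
  apply: (frame_part_eq0 EE giK E'z).
  have : ev Ox (tA fr Om p) = 0 by apply/matrixP => k l; rewrite mxE A0 mxE.
  rewrite -adOm (tA_mx WF alF adK_z p) map_mxB map_mxD !map_mxM -!map_trmx.
  have -> : ev Ox (delta_mx 0 z : 'rV[F]_N) = delta_mx 0 z.
    by rewrite map_delta_mx.
  by [].
have W0 := frame_span_eq0 EE giK (X := fun i => ev Ox (mnabW C i)).
have a0 := frame_span_eq0 EE giK (X := fun i =>
  ev Ox (nabalS s_g s_W s_al g_symm g_det i)).
have a1 i : ev Ox (nabalS s_g s_W s_al g_symm g_det i) = 0.
  apply: a0 => a.
  rewrite -[RHS](proj2 (H a)) /nabalf map_mx_rsum; apply: eq_bigr => j _.
  by rewrite map_mxZ nabal_nabalS mxE.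
have W1 i : ev Ox (mnabW C i) = 0.
  apply: W0 => a.
  rewrite -[RHS](proj1 (H a)) /nabWf map_mx_rsum; apply: eq_bigr => j _.
  by rewrite map_mxZ nabW_mnabW mxE.
split=> [u v|u v w].
  rewrite (nabla1E s_g s_W s_al g_symm g_det Ox); apply: big1 => i _.
  by rewrite a1 trmx0 mulmx0 mxE mulr0.
rewrite (nabla2E s_g s_W g_symm g_det Ox); apply: big1 => i _.
by rewrite W1 /ev2 mulmx0 mul0mx mxE mulr0.
Qed.

Let OmR k b X : (Om *m (adE *m X *m adE^T)) (lshift 1 k) (lshift 1 b) =
  (row k E0 *m (WF *m giF *m X) *m (row b E0)^T) 0 0.
Proof.
rewrite -adOm /Omext.
have -> : (adE *m WF *m adE^T + adE *m alF^T *m (delta_mx 0 z : 'rV[F]_N)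
    - (delta_mx 0 z : 'rV[F]_N)^T *m (adE *m alF^T)^T) *m (adE *m X *m adE^T) =
    adE *m (WF *m giF *m X) *m adE^T
    - (delta_mx 0 z : 'rV[F]_N)^T *m ((adE *m alF^T)^T *m (adE *m X *m adE^T)).
  have ezE : (delta_mx 0 z : 'rV[F]_N) *m adE = 0.
    by rewrite -rowE row_adEz.
  rewrite -adE_complete mulmxBl mulmxDl.
  rewrite -(mulmxA (adE *m alF^T)) -!(mulmxA adE X) (mulmxA (delta_mx 0 z)) ezE.
  by rewrite mul0mx mulmx0 addr0 !mulmxA.
rewrite addmxE oppmxE quad_entry !row_adE.
rewrite [X in _ - X]mxE big_ord1 [X in X * _]mxE [X in X * _]mxE.
have -> : (lshift 1 k == z) = false.
  exact: lshift_last.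
by rewrite andbF mul0r subr0.
Qed.

(** The sum over the frame of M may be extended by the flat direction, since the curvature with an
    argument z vanishes. *)
Let rhoE x (Ox : O x) a b : let E := theta x *m invmx (g x) in
  rho_star g W x E (row a E) (row b E) =
  sev_rmorph Ox (\sum_k (Om *m Rm fr (lshift 1 a) k) k (lshift 1 b)).
Proof.
move=> E; rewrite /E -(evE Ox).
have RmZ a' : Rm fr a' z = 0.
  rewrite RmE_coord; have -> : Rca adK a' z = 0.
    apply: big1 => i _; apply: big1 => j _; rewrite adK_z mulr0; exact: scale0r.
  by rewrite mulmx0 !mul0mx.
have -> : \sum_k (Om *m Rm fr (lshift 1 a) k) k (lshift 1 b) =
    \sum_(k < m) (Om *m Rm fr (lshift 1 a) (lshift 1 k)) (lshift 1 k) (lshift 1 b).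
  rewrite big_split_ord big_ord1.
  have -> : Rm fr (lshift 1 a) (rshift m ord0) = 0 by exact: RmZ.
  rewrite mulmx0 zeromxE; exact: addr0.
rewrite rmorph_sum; apply: eq_bigr => k _.
pose X := Rca adK (lshift 1 a) (lshift 1 k).
pose Y : 'M[F]_1 := row k E0 *m (WF *m giF *m (X *m gF)) *m (row b E0)^T.
have RmX : Rm fr (lshift 1 a) (lshift 1 k) = adE *m (X *m gF) *m adE^T.
  rewrite RmE_coord -/X.
  exact: (congr1 (mulmx^~ adE^T) (esym (mulmxA adE X gF))).
have -> : (Om *m Rm fr (lshift 1 a) (lshift 1 k)) (lshift 1 k) (lshift 1 b) = Y 0 0.
  by rewrite RmX OmR.
have -> : sev_rmorph Ox (Y 0 0) = (ev Ox Y) 0 0 by rewrite [RHS]mxE.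

rewrite (curvatureE s_g s_W g_symm g_det Ox) /ev2 /Jop /Y /X.
rewrite !map_mxM -map_trmx !map_row !liftSE ginvSE.
have -> : ev Ox (Rca adK (lshift 1 a) (lshift 1 k)) =
   \sum_i \sum_j ((row a (ev Ox E0)) 0 i * (row k (ev Ox E0)) 0 j) *: ev Ox (mRc C i j).
  rewrite /Rca map_mx_rsum; apply: eq_bigr => i _.
  rewrite map_mx_rsum; apply: eq_bigr => j _; rewrite map_mxZ Rc_mRc; congr (_ *: _).
  have rE c l : (row c (ev Ox E0)) 0 l = sev_rmorph Ox (fvec adK (lshift 1 c) l).
    rewrite mxE mxE; congr (sev_rmorph Ox _).
    by rewrite /= /adE col_mxEu.
  by rewrite !rE rmorphM.
by rewrite !mulmxA.
Qed.

Let tP_skew : (tP fr Om)^T = - tP fr Om.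
Proof.
rewrite /tP; apply/matrixP => k l; rewrite mxE oppmxE !summxE -sumrN.
apply: eq_bigr => p _; rewrite !summxE -sumrN; apply: eq_bigr => r _.
by rewrite !scalemxE Rm_skewE mulrN.
Qed.

(** The part alpha /\ dt of [Om] does not contribute to the product with [tP], because the row and
    the column z of [tP] vanish; so the ordered pairs of indices of M suffice. *)
Lemma ad_taustar x (Ox : O x) : let E := theta x *m invmx (g x) in
  n%:R^-1 * form2_inner E (ev2 (W x)) (rho_star g W x E) = ts Ox.
Proof.
move=> E.
pose h := sev_rmorph Ox.
pose f (a b : 'I_m) : R :=
  h (tP fr Om (lshift 1 a) (lshift 1 b)) * h (Om (lshift 1 a) (lshift 1 b)).
have tPC a b : tP fr Om b a = - tP fr Om a b by apply: skewE; exact: tP_skew.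
have OmC a b : Om b a = - Om a b by apply: skewE; exact: Om_skew.
have fC a b : f a b = f b a.
  by rewrite /f (tPC (lshift 1 b)) (OmC (lshift 1 b)) !rmorphN mulrNN.
have f0 a : f a a = 0.
  have : Om (lshift 1 a) (lshift 1 a) = 0.
    by apply: Ftf; rewrite {1}OmC addNr.
  by rewrite /f => ->; rewrite rmorph0 mulr0.
have fE a b : ev2 (W x) (row a E) (row b E) * rho_star g W x E (row a E) (row b E) =
    - (2^-1 * f a b).
  rewrite (rhoE Ox) -/h.
  have s2 := congr1 h (star_ricci fr Om_skew (lshift 1 a) (lshift 1 b)).
  rewrite rmorphD rmorphN in s2.
  have -> : ev2 (W x) (row a E) (row b E) = h (Om (lshift 1 a) (lshift 1 b)).
    have -> : Om (lshift 1 a) (lshift 1 b) = (row a E0 *m WF *m (row b E0)^T) 0 0.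
      rewrite -adOm /Omext addmxE addmxE oppmxE quad_entry !row_adE.
      have zl k : (lshift 1 k == z) = false.
        exact: lshift_last.
      rewrite [X in _ + X - _]mxE big_ord1 [X in _ + _ * X - _]mxE zl andbF mulr0.
      rewrite [X in _ - X]mxE big_ord1 [X in _ - X * _]mxE [X in _ - X * _]mxE zl.
      by rewrite andbF mul0r addr0 subr0.
    rewrite /ev2 /E -(evE Ox) -(liftSE s_W Ox).
    have -> : h ((row a E0 *m WF *m (row b E0)^T) 0 0) =
      (ev Ox (row a E0 *m WF *m (row b E0)^T)) 0 0 by rewrite [RHS]mxE.
    by rewrite !map_mxM -map_trmx !map_row.
  rewrite /f; move: s2; move: (h (\sum_k _)) (h (tP _ _ _ _)) => s t s2.
  have -> : s = - (2^-1 * t) by lra.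
  by ring.
have -> : form2_inner E (ev2 (W x)) (rho_star g W x E) =
    - (2^-1 * \sum_(a < m) \sum_(b < m | (a < b)%N) f a b).
  rewrite /form2_inner mulr_sumr -sumrN; apply: eq_bigr => a _.
  by rewrite mulr_sumr -sumrN; apply: eq_bigr => b _; rewrite fE.
have ipF : ip (tP fr Om) Om = \sum_(a < m) \sum_(b < m)
    tP fr Om (lshift 1 a) (lshift 1 b) * Om (lshift 1 a) (lshift 1 b).
  rewrite ipE big_split_ord big_ord1.
  have -> : \sum_l tP fr Om (rshift m ord0) l * Om (rshift m ord0) l = 0.
    apply: big1 => l _.
    have -> : tP fr Om (rshift m ord0) l = 0 by exact: (tP_zl sg kb G_z).
    exact: mul0r.
  apply: etrans (addr0 _) _.
  apply: eq_bigr => a _; rewrite big_split_ord big_ord1.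
  have -> : tP fr Om (lshift 1 a) (rshift m ord0) = 0 by exact: (tP_z sg kb G_z).
  by rewrite mul0r; exact: addr0.
have ipO : h (ip (tP fr Om) Om) = \sum_a \sum_b f a b.
  rewrite ipF rmorph_sum; apply: eq_bigr => a _.
  by rewrite rmorph_sum; apply: eq_bigr => b _; exact: rmorphM.
rewrite /taustar_of -/h ipO (sum_lt_half fC f0).
have -> : N%:R = n.*2%:R + 2 :> R by rewrite -natrD; congr _%:R; lia.
have n0 : n%:R != 0 :> R by rewrite pnatr_eq0 -lt0n.
move: (\sum_(a < m) _) => S.
rewrite addrK -muln2 natrM.
by field.
Qed.

End AdaptedFrame.

(** * The divergence theorem *)

Section IteratedIntegral.
Variable R : realType.
Local Open Scope ereal_scope.

(** The integral of a nonnegative function is a supremum over simple functions below it, hence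
    monotone without measurability. This allows iterated integrals to be compared without studying
    the inner integrals. *)
Lemma le_integral_nonneg d (T : measurableType d) (mu : {measure set T -> \bar R})
    (f g : T -> \bar R) : (forall x, 0 <= f x) -> (forall x, f x <= g x) ->
  \int[mu]_x f x <= \int[mu]_x g x.
Proof.
move=> f0 fg; have g0 x : 0 <= g x by exact: le_trans (f0 x) (fg x).
rewrite !ge0_integralTE //; apply: ge_ereal_sup => _ [h /= hf <-].
by apply: ereal_sup_ubound; exists h => //= x; exact: le_trans (hf x) (fg x).
Qed.

Lemma integral_rV_ge0 m (f : 'rV[R]_m -> \bar R) : (forall x, 0 <= f x) ->
  0 <= integral_rV f.
Proof.
elim: m f => [|m IH] f f0 /=; first exact: f0.
by apply: integral_ge0 => t _; apply: IH => y; exact: f0.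
Qed.

Lemma le_integral_rV m (f g : 'rV[R]_m -> \bar R) :
  (forall x, 0 <= f x) -> (forall x, f x <= g x) ->
  integral_rV f <= integral_rV g.
Proof.
elim: m f g => [|m IH] f g f0 fg /=; first exact: fg.
apply: le_integral_nonneg => t; first by apply: integral_rV_ge0 => y; exact: f0.
by apply: IH => y; [exact: f0|exact: fg].
Qed.

Lemma eq_integral_rV m (f g : 'rV[R]_m -> \bar R) :
  (forall x, f x = g x) -> integral_rV f = integral_rV g.
Proof. by move=> fg; congr integral_rV; apply/funext. Qed.

Local Close Scope ereal_scope.

Definition box m (a : 'rV[R]_m) (h : R) : set 'rV[R]_m :=
  [set x | forall j, a 0 j <= x 0 j < a 0 j + h].

Lemma integral_rV_box m (a : 'rV[R]_m) (h c : R) : 0 <= h -> 0 <= c ->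
  integral_rV (fun x => (c * \1_(box a h) x)%:E) = (c * h ^+ m)%:E.
Proof.
move=> h0; elim: m a c => [|m IH] a c c0.
  rewrite /= indicE mem_set ?expr0 //.
  by move=> [].
pose I : set R := [set` `[a 0 ord0, a 0 ord0 + h[%R].
pose a' : 'rV[R]_m := \row_j a 0 (lift ord0 j).
have bE t (y : 'rV[R]_m) :
    \1_(box a h) (row_mx (const_mx t : 'rV[R]_1) y) = \1_I t * \1_(box a' h) y :> R.
  rewrite !indicE -natrM mulnb; congr (_%:R); congr nat_of_bool.
  have e0 : (row_mx (const_mx t : 'rV[R]_1) y : 'rV[R]_m.+1) 0 ord0 = t.
    transitivity ((row_mx (const_mx t : 'rV[R]_1) y) 0 (lshift m (ord0 : 'I_1))).
      by congr (fun_of_matrix _ _ _); exact: val_inj.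
    by rewrite row_mxEl mxE.
  have eS j : (row_mx (const_mx t : 'rV[R]_1) y : 'rV[R]_m.+1) 0 (lift ord0 j) = y 0 j.
    transitivity ((row_mx (const_mx t : 'rV[R]_1) y) 0 (rshift 1 j)).
      by congr (fun_of_matrix _ _ _); exact: val_inj.
    by rewrite row_mxEr.
  apply/idP/andP => [|[]].
    rewrite inE /box /= => H; split; rewrite inE /=.
      by have := H ord0; rewrite e0 /I /= in_itv.
    by move=> j; have := H (lift ord0 j); rewrite eS mxE.
  rewrite !inE /I /= in_itv /= => Ht Hy j.
  case: (unliftP ord0 j) => [j' ->|->]; last by rewrite e0.
  by rewrite eS; have := Hy j'; rewrite mxE.
rewrite /=.
have step t : integral_rV (fun y : 'rV[R]_m =>
    (c * \1_(box a h) (row_mx (const_mx t : 'rV[R]_1) y))%:E) =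
    (c * h ^+ m * \1_I t)%:E.
  rewrite -(eq_integral_rV (f := fun y => ((c * \1_I t) * \1_(box a' h) y)%:E)).
    rewrite IH; first by congr (_%:E); ring.
    by apply: mulr_ge0 => //; rewrite indicE.
  by move=> y; rewrite bE mulrA.
under eq_integral => t _ do rewrite step.
have ch0 : 0 <= c * h ^+ m by rewrite mulr_ge0 ?exprn_ge0.
transitivity ((c * h ^+ m)%:E * \int[@lebesgue_measure R]_t (\1_I t)%:E)%E.
  under eq_integral => t _ do rewrite EFinM.
  rewrite ge0_integralZl //.
  by apply/measurable_EFinP; apply: measurable_indic; exact: measurable_itv.
rewrite integral_indic; try exact: measurableT; try exact: measurable_itv.
rewrite setIT; transitivity ((c * h ^+ m)%:E * h%:E)%E; last first.
  by rewrite -EFinM; congr (_%:E); rewrite exprS; ring.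
congr (_ * _)%E.
apply: etrans (lebesgue_measure_itv `[a 0 ord0, a 0 ord0 + h[) _.
rewrite /= lte_fin ltrDl; have [h1|h1] := ltP 0 h.
  by rewrite -EFinD; congr (_%:E); ring.
by have -> : h = 0 by apply/le_anti; rewrite h1 h0.
Qed.

End IteratedIntegral.

Section UniformContinuity.
Variables (R : realType) (m : nat).
Local Notation vec := 'rV[R]_m.

Definition cube (c : vec) (r : R) : set vec :=
  [set x | forall j, `|x 0 j - c 0 j| <= r].

Lemma cube_compact c r : compact (cube c r).
Proof.
have -> : cube c r = [set x | forall j, [set` `[c 0 j - r, c 0 j + r]] (x ord0 j)].
  apply/seteqP; split => x /= H j; have := H j; rewrite /= in_itv /= ler_distl.
    by case/andP => *; apply/andP; split; lra.
  by case/andP => *; apply/andP; split; lra.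
exact: (@rV_compact R m (fun j => [set` `[c 0 j - r, c 0 j + r]])
  (fun j => @segment_compact R _ _)).
Qed.

(** Only x has to lie in Q, not y. A uniform d comes from the near-covering form of compactness,
    applied to positive reals tending to 0. *)
Lemma unif_continuous_compact (U Q : set vec) (f : vec -> R) (e : R) :
  compact Q -> Q `<=` U -> (forall x, U x -> {for x, continuous f}) -> 0 < e ->
  exists2 d, 0 < d & forall x y, Q x -> `|y - x| < d -> `|f y - f x| <= e.
Proof.
move=> cQ QU cf e0.
pose P (d : R) (x : vec) := forall y, `|y - x| < d -> `|f y - f x| <= e.
have nc := proj1 (compact_near_coveringP Q) cQ.
have H : \forall d \near (0 : R)^'+, Q `<=` P d.
  apply: nc => x Qx; have e2 : 0 < e / 2 by rewrite divr_gt0.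
  have := cf x (QU x Qx) => /cvgrPdist_lt/(_ _ e2)/nbhs_ballP[d /= d0 Hd].
  exists (ball x (d / 2), [set t : R | 0 < t < d / 2]).
    split; first by apply: nbhsx_ballx; rewrite divr_gt0.
    have d2 : 0 < d / 2 by rewrite divr_gt0.
    by near=> t; rewrite /=; apply/andP; split; near: t; [exact: nbhs_right_gt|exact: nbhs_right_lt].
  move=> [x' t] /= [xx' /andP[t0 td]] y yx'.
  have B z : `|x - z| < d -> `|f x - f z| < e / 2.
    by move=> xz; apply: Hd; rewrite -ball_normE.
  rewrite -ball_normE /= in xx'.
  have h1 : `|f x - f x'| < e / 2 by apply: B; apply: (lt_trans xx'); lra.
  have h2 : `|f x - f y| < e / 2.
    apply: B; have -> : x - y = (x - x') - (y - x') by rewrite opprB addrA subrK.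
    by apply: le_lt_trans (ler_normB _ _) _; lra.
  have -> : f y - f x' = (f x - f x') - (f x - f y) by ring.
  by apply: le_trans (ler_normB _ _) _; lra.
have [d [d0 Hd]] : exists d : R, 0 < d /\ Q `<=` P d.
  have /filter_ex[d [h1 h2]] : \forall d \near (0 : R)^'+, 0 < d /\ Q `<=` P d.
    near=> d; split; first by near: d; exact: nbhs_right_gt.
    by near: d; exact: H.
  by exists d.
by exists d => // x y Qx; exact: Hd.
Unshelve. all: by end_near. Qed.

End UniformContinuity.

Lemma bounded_compact (R : realType) (T : topologicalType) (U Q : set T) (f : T -> R) :
  compact Q -> Q `<=` U -> (forall x, U x -> {for x, continuous f}) ->
  exists2 B, 0 < B & forall x, Q x -> `|f x| <= B.
Proof.
move=> cQ QU cf.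
pose P (B : R) (x : T) := `|f x| <= B.
have nc := proj1 (compact_near_coveringP Q) cQ.
have H : \forall B \near +oo%R, Q `<=` P B.
  apply: nc => x Qx.
  have := cf x (QU x Qx) => /cvgrPdist_lt/(_ _ ltr01) Hd.
  exists ([set y | `|f x - f y| < 1], [set B : R | `|f x| + 1 < B]).
    by split => //=; exact: nbhs_pinfty_gt.
  move=> [y B] /= [h1 h2]; rewrite /P; have -> : f y = f x - (f x - f y) by ring.
  by apply: le_trans (ler_normB _ _) _; lra.
have /filter_ex[B [h1 h2]] : \forall B \near +oo%R, 0 < B /\ Q `<=` P B.
  near=> B; split; first by near: B; exact: nbhs_pinfty_gt.
  by near: B; exact: H.
by exists B.
Unshelve. all: by end_near. Qed.

Section Borel.
Variables (R : realType) (M : ptopologicalType).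

Lemma open_measurable_borel (A : set M) : open A ->
  measurable (A : set (borel_type M)).
Proof. by move=> oA; exact: sub_sigma_algebra. Qed.

Lemma continuous_measurable_borel (f : M -> R) : continuous f ->
  measurable_fun [set: borel_type M] (f : borel_type M -> R).
Proof.
move=> cf; apply: (measurability _ (RGenOInfty.measurableE R)).
move=> _ [_ [r ->] <-]; rewrite setTI; apply: open_measurable_borel.
by move/continuousP: cf; apply; exact: rray_open.
Qed.

End Borel.

Section ChartBoxes.
Variables (R : realType) (m : nat) (M : ptopologicalType).
Variables (A : smooth_manifold R m M) (i : chart_idx A).
Local Notation vec := 'rV[R]_m.
Local Notation dom := (chart_dom i).

Definition chart_set (S : set vec) : set M := [set p | dom p /\ S (chart i p)].

Lemma chart_set_open (S : set vec) : open S -> open (chart_set S).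
Proof.
move=> oS; rewrite openE => p [dp Sp].
have h1 : nbhs p dom by exact: (open_nbhs_nbhs (conj (chart_dom_open i) dp)).
have h2 : nbhs p (chart i @^-1` S).
  exact: (chart_continuous dp) (open_nbhs_nbhs (conj oS Sp)).
by apply: (@filterS _ (nbhs p) (nbhs_filter p)) (filterI h1 h2) => q [].
Qed.

Lemma coord_lt_open j (c : R) : open [set x : vec | x 0 j < c].
Proof.
have /continuousP H : continuous (fun x : vec => x 0 j) by exact: coord_continuous.
by apply: (H [set t | t < c]); exact: open_lt.
Qed.

(** A half-open box is an intersection of differences of open half-spaces; half-open boxes are used
    because they tile. *)
Lemma chart_box_measurable a h :
  measurable (chart_set (box a h) : set (borel_type M)).
Proof.
pose L j c : set M := chart_set [set x : vec | x 0 j < c].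
have mL j c : measurable (L j c : set (borel_type M)).
  by apply: open_measurable_borel; apply: chart_set_open; exact: coord_lt_open.
pose B : set (borel_type M) :=
  \big[setI/setT]_(j < m) (L j (a 0 j + h) `\` L j (a 0 j)).
have -> : chart_set (box a h) = (chart_set setT : set (borel_type M)) `&` B.
  apply/seteqP; split => p /=.
    case=> dp bp; split=> //; rewrite /B; elim/big_ind: _ => //= j _.
    have /andP[h1 h2] := bp j; split; first by split.
    by case=> _ /=; rewrite ltNge h1.
  case=> -[dp _] Bp; split=> // j.
  have [[_ /= h2] h1] : (L j (a 0 j + h) `\` L j (a 0 j)) p.
    by move: Bp; rewrite /B (bigD1 j) //= => -[].
  by rewrite h2 andbT leNgt; apply/negP => h3; apply: h1.
apply: measurableI.
  by apply: open_measurable_borel; apply: chart_set_open; exact: openT.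
apply: bigsetI_measurable => j _; apply: measurableD; exact: mL.
Qed.

Variables (g : bilinear_field A) (vol : {measure set (borel_type M) -> \bar R}).
Hypothesis vol_g : is_riemannian_measure g vol.

(** The density is compared with constants on the box, so the iterated integral only has to be
    evaluated for multiples of indicators of boxes. *)
Lemma vol_box a h (l L : R) : 0 <= h -> 0 <= l -> box a h `<=` chart_img i ->
  (forall x, box a h x -> l <= Num.sqrt (\det (g i x)) <= L) ->
  ((l * h ^+ m)%:E <= vol (chart_set (box a h)) <= (Num.max L 0 * h ^+ m)%:E)%E.
Proof.
move=> h0 l0 bi lL.
have cb : chart i @` (chart_set (box a h)) = box a h.
  apply/seteqP; split => [_ [p [dp bp] <-] //|x bx].
  by have [p dp px] := bi x bx; exists p => //; split=> //; rewrite px.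
have -> : vol (chart_set (box a h)) = integral_rV (fun x =>
    (\1_(box a h) x * Num.sqrt (\det (g i x)))%:E).
  rewrite -[in RHS]cb; apply: vol_g; first exact: chart_box_measurable.
  by move=> p [].
(* On an empty box the hypothesis does not constrain [L], which may then be negative. *)
have L0 : 0 <= Num.max L 0 by rewrite le_max lexx orbT.
rewrite -(integral_rV_box a h0 l0) -(integral_rV_box a h0 L0).
apply/andP; split; apply: le_integral_rV => x; rewrite lee_fin.
- by rewrite mulr_ge0 // indicE.
- rewrite indicE; have [/set_mem bx|_] := boolP (x \in _); last by rewrite mulr0 mul0r.
  by rewrite mulr1 mul1r; have /andP[] := lL x bx.
- by rewrite mulr_ge0 ?indicE // sqrtr_ge0.
- rewrite indicE; have [/set_mem bx|_] := boolP (x \in _); last by rewrite mulr0 mul0r.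
  by rewrite mulr1 mul1r le_max; have /andP[_ ->] := lL x bx.
Qed.

End ChartBoxes.

(** * Riemann sums over a subdivided cube *)

Section CyclicShift.
Variables (m k : nat).
Local Notation cell := {ffun 'I_m -> 'I_k}.

(** The shift wraps around so as to be a permutation of the cells; the wrapped layer is harmless for
    functions vanishing near the boundary. *)
Definition shift_cell (a : 'I_m) (c : cell) : cell :=
  [ffun j => if j == a then ordS (c j) else c j].

Lemma shift_cell_bij a : bijective (shift_cell a).
Proof.
exists (fun c : cell => [ffun j => if j == a then ord_pred (c j) else c j]) => c;
  apply/ffunP => j; rewrite !ffunE; case: eqP => // _; rewrite ?ordSK ?ord_predK //.
Qed.

Lemma sum_shift_cell (V : nmodType) (a : 'I_m) (f : cell -> V) :
  \sum_c f (shift_cell a c) = \sum_c f c.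
Proof. by rewrite [RHS](reindex (shift_cell a)) //; exact/onW_bij/shift_cell_bij. Qed.
End CyclicShift.

Section DivergenceInCube.
Variables (R : realType) (m : nat) (M : ptopologicalType).
Variables (A : smooth_manifold R m M) (i : chart_idx A).
Local Notation vec := 'rV[R]_m.
Local Notation img := (chart_img i).
Variables (g : bilinear_field A) (vol : {measure set (borel_type M) -> \bar R}).
Hypothesis vol_g : is_riemannian_measure g vol.
Let s (x : vec) := Num.sqrt (\det (g i x)).
Hypothesis s_gt0 : forall x, img x -> 0 < s x.
Hypothesis s_cont : forall x, img x -> {for x, continuous s}.
Variables (c : vec) (rho : R).
Hypothesis rho_gt0 : 0 < rho.
Hypothesis cube_img : cube c (3 * rho) `<=` img.
Let Q := cube c (3 * rho).
Let cQ : compact Q := @cube_compact R m c (3 * rho).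

(** Three radii are in play: functions are supported within rho of the centre, the grid of side h
    fills the cube of radius 2 rho, and the chart contains that of radius 3 rho. Thus, for h < rho,
    all points within h of a corner remain in the chart. *)
Let h (k : nat) : R := 4 * rho / k%:R.
Definition corner (k : nat) (d : {ffun 'I_m -> 'I_k}) : vec :=
  \row_j (c 0 j - 2 * rho + h k * (d j)%:R).

Let h_gt0 k : (0 < k)%N -> 0 < h k.
Proof. by move=> k0; rewrite /h divr_gt0 ?ltr0n ?mulr_gt0. Qed.
Let hk k : (0 < k)%N -> h k * k%:R = 4 * rho.
Proof. by move=> k0; rewrite /h divfK // pnatr_eq0 -lt0n. Qed.

Let h_small (d : R) : 0 < d -> \forall k \near \oo, (0 < k)%N /\ h k < d.
Proof.
move=> d0; near=> k.
have k0 : (0 < k)%N by near: k; exact: nbhs_infty_gt.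
split=> //; rewrite /h ltr_pdivrMr ?ltr0n // -ltr_pdivrMl //.
by near: k; exact: nbhs_infty_gtr.
Unshelve. all: by end_near. Qed.

Let hd_lt k (d : {ffun 'I_m -> 'I_k}) j : (0 < k)%N ->
  0 <= h k * (d j)%:R /\ h k * (d j)%:R + h k <= 4 * rho.
Proof.
move=> k0; have h0 := h_gt0 k0; split.
  by apply: mulr_ge0; [exact: ltW|exact: ler0n].
rewrite -(hk k0) -[X in _ + X]mulr1 -mulrDr; apply: ler_wpM2l; first exact: ltW.
by rewrite natr1 ler_nat.
Qed.

Let norm_step k (b : bool) : (0 < k)%N -> `|h k * b%:R| <= h k.
Proof.
move=> k0; have h0 := h_gt0 k0.
case: b => /=; first by rewrite mulr1n mulr1 gtr0_norm.
by rewrite mulr0n mulr0 normr0 ltW.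
Qed.

Let near_corner k (d : {ffun 'I_m -> 'I_k}) (x : vec) : (0 < k)%N -> h k < rho ->
  (forall j, `|x 0 j - corner d 0 j| <= h k) -> Q x.
Proof.
move=> k0 hr H j; have [h1 h2] := @hd_lt k d j k0; have := H j.
rewrite /corner mxE !ler_distl => /andP[h3 h4]; apply/andP; split; lra.
Qed.

Lemma corner_cube k (d : {ffun 'I_m -> 'I_k}) : (0 < k)%N -> Q (corner d).
Proof.
move=> k0 j; have [h1 h2] := @hd_lt k d j k0; have h0 := h_gt0 k0.
by rewrite /corner mxE ler_distl; apply/andP; split; lra.
Qed.

Let Q_corner k (d : {ffun 'I_m -> 'I_k}) : (0 < k)%N -> h k < rho -> Q (corner d).
Proof.
by move=> k0 hr; apply: (near_corner k0 hr (d := d)) => j; rewrite subrr normr0 ltW ?h_gt0.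
Qed.

Let shifted_corner k (d : {ffun 'I_m -> 'I_k}) (a : 'I_m) (X : vec -> R) :
  (0 < k)%N -> h k < rho ->
  (forall x, img x -> (exists j, rho <= `|x 0 j - c 0 j|) -> X x = 0) ->
  X (h k *: 'e_a + corner d) = X (corner (shift_cell a d)).
Proof.
move=> k0 hr X0; have h0 := h_gt0 k0.
have eE j : (h k *: 'e_a + corner d) 0 j =
    c 0 j - 2 * rho + h k * ((d j)%:R + (j == a)%:R).
  by rewrite !mxE eqxx /=; ring.
have [lt|ge] := ltnP (d a).+1 k.
  congr X; apply/rowP => j; rewrite eE mxE ffunE; congr (_ + _ * _).
  case: eqVneq => [->|_]; last by rewrite addr0.
  rewrite /= modn_small //; exact: natr1.
have da : (d a).+1 = k by apply/eqP; rewrite eqn_leq ge ltn_ord.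
have I1 : img (h k *: 'e_a + corner d).
  apply: cube_img; apply: (near_corner k0 hr (d := d)) => j.
  rewrite [X in `|X - _|]mxE addrK !mxE eqxx /=.
  exact: norm_step.
have I2 : img (corner (shift_cell a d)) by apply: cube_img; exact: Q_corner.
rewrite !X0 //; exists a.
  rewrite mxE ffunE eqxx /= da modnn mulr0 addr0.
  have -> : c 0 a - 2 * rho - c 0 a = - (2 * rho) by ring.
  by rewrite normrN ger0_norm; lra.
rewrite eE eqxx natr1 da hk //.
have -> : c 0 a - 2 * rho + 4 * rho - c 0 a = 2 * rho by ring.
by rewrite ger0_norm; lra.
Qed.

Let card_cell k : #|{ffun 'I_m -> 'I_k}|%:R = k%:R ^+ m :> R.
Proof. by rewrite card_ffun !card_ord natrX. Qed.

Let sum_cell_cst k (x : R) : \sum_(d : {ffun 'I_m -> 'I_k}) x = k%:R ^+ m * x.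
Proof. by rewrite sumr_const -card_cell mulr_natl. Qed.

(* The increments of [X] over all cells telescope. *)
Lemma riemann_derivative a (X : vec -> R) (e : R) : Ck 1 img X ->
  (forall x, img x -> (exists j, rho <= `|x 0 j - c 0 j|) -> X x = 0) -> 0 < e ->
  \forall k \near \oo, `|\sum_(d : {ffun 'I_m -> 'I_k})
     h k ^+ m * 'D_'e_a X (corner d)| <= e.
Proof.
move=> CX X0 e0; pose V := (4 * rho) ^+ m.
have V0 : 0 < V by rewrite exprn_gt0 // mulr_gt0.
have e1 : 0 < e / V by rewrite divr_gt0.
have cD x : img x -> {for x, continuous ('D_'e_a X)}.
  by move=> Ix; exact: Ck_continuous (Ck_derive 'e_a CX) Ix.
have [d0 d0_gt0 Hd] := unif_continuous_compact cQ cube_img cD e1.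
have dm : 0 < Num.min d0 rho by rewrite lt_min d0_gt0.
near=> k.
have [k0 hkd] : (0 < k)%N /\ h k < Num.min d0 rho by near: k; exact: h_small.
move: hkd; rewrite lt_min => /andP[hd hr]; have h0 := h_gt0 k0.
pose Y := 'D_'e_a X.
have step (d : {ffun 'I_m -> 'I_k}) :
    `|h k * Y (corner d) - (X (h k *: 'e_a + corner d) - X (corner d))|
      <= h k * (e / V).
  have Qt t : `|t| <= `|h k| -> Q (t *: 'e_a + corner d).
    rewrite (gtr0_norm h0) => th; apply: (near_corner k0 hr (d := d)) => j.
    rewrite [X in `|X - _|]mxE addrK !mxE eqxx /=.
    by case: (j == a); rewrite ?mulr1 ?mulr0 ?normr0 // ltW.
  have dX t : `|t| <= `|h k| -> derivable X (t *: 'e_a + corner d) 'e_a.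
    by move=> th; apply: (Ck_derivable CX); apply: cube_img; exact: Qt.
  have [t th ->] := mean_value dX.
  rewrite -mulrBr normrM (gtr0_norm h0); apply: ler_wpM2l; first exact: ltW.
  have lt0 : `|t *: 'e_a + corner d - corner d| < d0.
    rewrite addrK; apply: (le_lt_trans _ hd).
    apply: row_norm_le => [|j]; first exact: ltW.
    rewrite !mxE eqxx /= normrM; rewrite (gtr0_norm h0) in th.
    case: (j == a) => /=; rewrite ?mulr1n ?mulr0n ?normr1 ?normr0 ?mulr1 ?mulr0 //.
    exact: ltW.
  have HH := Hd _ _ (@Q_corner k d k0 hr) lt0.
  first [exact: HH | rewrite distrC; exact: HH].
have tele : \sum_(d : {ffun 'I_m -> 'I_k})
    (X (h k *: 'e_a + corner d) - X (corner d)) = 0.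
  rewrite sumrB; apply/eqP; rewrite subr_eq0; apply/eqP.
  rewrite -[RHS](sum_shift_cell a (fun d => X (corner d))).
  by apply: eq_bigr => d _; exact: shifted_corner.
have B : `|h k * \sum_(d : {ffun 'I_m -> 'I_k}) Y (corner d)| <=
    k%:R ^+ m * (h k * (e / V)).
  have -> : h k * \sum_(d : {ffun 'I_m -> 'I_k}) Y (corner d) =
      \sum_(d : {ffun 'I_m -> 'I_k})
        (h k * Y (corner d) - (X (h k *: 'e_a + corner d) - X (corner d))).
    by rewrite [RHS]sumrB tele subr0 mulr_sumr.
  rewrite -sum_cell_cst.
  by apply: le_trans (ler_norm_sum _ _ _) _; apply: ler_sum => d _; exact: step.
rewrite -mulr_sumr.
rewrite normrM (gtr0_norm h0) in B.
have {}B : `|\sum_(d : {ffun 'I_m -> 'I_k}) Y (corner d)| <= k%:R ^+ m * (e / V).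
  by rewrite -(ler_pM2l h0); apply: (le_trans B); rewrite mulrCA.
rewrite normrM ger0_norm; last by apply: exprn_ge0; exact: ltW.
apply: (@le_trans _ _ (h k ^+ m * (k%:R ^+ m * (e / V)))).
  by apply: ler_wpM2l => //; apply: exprn_ge0; exact: ltW.
rewrite mulrA -exprMn hk // -/V mulrCA divff ?mulr1 //.
by rewrite gt_eqF.
Unshelve. all: by end_near. Qed.

Let S0 : exists2 B, 0 < B & forall x, Q x -> `|s x| <= B :=
  bounded_compact cQ cube_img s_cont.

Lemma chart_box_finite a r : box a r `<=` Q -> 0 <= r ->
  (vol (chart_set i (box a r)) < +oo)%E.
Proof.
move=> bQ r0; have [B B0 HB] := S0.
have /(_ _)/andP[|_ H] := vol_box vol_g (a := a) (h := r) (l := 0) (L := B) r0 (lexx 0)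
  (subset_trans bQ cube_img).
  move=> x bx; rewrite sqrtr_ge0 /=.
  by apply: le_trans (ler_norm _) _; apply: HB; exact: bQ.
by apply: (le_lt_trans H); rewrite ltry.
Qed.

Lemma chart_box_pos a r : box a r `<=` img -> 0 < r ->
  (exists2 l, 0 < l & forall x, box a r x -> l <= s x) ->
  (exists B, forall x, box a r x -> s x <= B) ->
  (0 < vol (chart_set i (box a r)))%E.
Proof.
move=> bi r0 [l l0 Hl] [B HB].
have /(_ _)/andP[|H _] := vol_box vol_g (a := a) (h := r) (l := l) (L := B)
   (ltW r0) (ltW l0) bi.
  by move=> x bx; rewrite Hl //= HB.
by apply: (lt_le_trans _ H); rewrite lte_fin mulr_gt0 ?exprn_gt0.
Qed.

Variable psi : M -> R.
Hypothesis psi_cont : continuous psi.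
Hypothesis psi_out : forall p, ~ chart_set i (box (\row_j (c 0 j - 2 * rho)) (4 * rho)) p ->
  psi p = 0.
Variable q : vec -> R.
Hypothesis q_cont : forall x, img x -> {for x, continuous q}.
Hypothesis psi_q : forall p, chart_dom i p -> psi p = q (chart i p).

Definition cell k (d : {ffun 'I_m -> 'I_k}) : set (borel_type M) :=
  chart_set i (box (corner d) (h k)).

Let big_cell k (B : set (borel_type M)) : (0 < k)%N -> h k < rho ->
  B = chart_set i (box (\row_j (c 0 j - 2 * rho)) (4 * rho)) ->
  B = \big[setU/set0]_(d <- index_enum {ffun 'I_m -> 'I_k}) cell d.
Proof.
move=> k0 hr ->; have h0 := h_gt0 k0; apply/seteqP; split => p /=.
  case=> dp bp.
  (* The rescaled coordinate, whose integer part is the index of the cell that contains p. *)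
  pose t j : R := (chart i p 0 j - (c 0 j - 2 * rho)) / h k.
  have tE j : h k * t j = chart i p 0 j - (c 0 j - 2 * rho).
    by rewrite /t mulrC divfK // gt_eqF.
  have t0 j : 0 <= t j.
    have := bp j; rewrite mxE => /andP[u _]; apply: divr_ge0; last exact: ltW.
    by rewrite subr_ge0.
  have tk j : t j < k%:R.
    by rewrite -(ltr_pM2l h0) tE hk //; have := bp j; rewrite mxE; lra.
  have tn j : (Num.trunc (t j) < k)%N.
    have /andP[u1 _] := truncn_itv (t0 j).
    by rewrite -(ltr_nat R); exact: le_lt_trans u1 (tk j).
  pose d : {ffun 'I_m -> 'I_k} := [ffun j => Ordinal (tn j)].
  rewrite (bigD1_seq d) ?mem_index_enum ?index_enum_uniq //=; left; split => // j.
  have /andP[u1 u2] := truncn_itv (t0 j); rewrite mxE ffunE /=.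
  rewrite -(ler_pM2l h0) tE in u1.
  rewrite -(ltr_pM2l h0) tE -natr1 in u2.
  by apply/andP; split; lra.
elim/big_ind: _ => //= [x y Hx Hy []|d _ [dp bp]]; [exact: Hx|exact: Hy|].
split=> // j; have := bp j; have [u1 u2] := @hd_lt k d j k0; rewrite !mxE.
by case/andP => v1 v2; apply/andP; split; lra.
Qed.

Let cell_disjoint k : (0 < k)%N -> trivIset [set` index_enum {ffun 'I_m -> 'I_k}] (@cell k).
Proof.
move=> k0 d d' _ _ [p [[_ bp] [_ bp']]]; have h0 := h_gt0 k0.
apply/ffunP => j; apply: val_inj => /=.
have := bp j; have := bp' j; rewrite !mxE => /andP[u1 u2] /andP[v1 v2].
have lt1 : (d j)%:R < (d' j)%:R + 1 :> R.
  by rewrite -(ltr_pM2l h0) mulrDr mulr1; lra.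
have lt2 : (d' j)%:R < (d j)%:R + 1 :> R.
  by rewrite -(ltr_pM2l h0) mulrDr mulr1; lra.
by move: lt1 lt2; rewrite !natr1 !ltr_nat !ltnS => a b; apply/eqP; rewrite eqn_leq a b.
Qed.

Let cell_Q k (d : {ffun 'I_m -> 'I_k}) x : (0 < k)%N -> h k < rho ->
  box (corner d) (h k) x -> Q x.
Proof.
move=> k0 hr bx; apply: (near_corner k0 hr (d := d)) => j.
by have /andP[? ?] := bx j; rewrite ler_distl; apply/andP; split; lra.
Qed.

Let psi_meas (D : set (borel_type M)) : measurable D ->
  measurable_fun D (psi : borel_type M -> R).
Proof.
move=> mD; apply: (measurable_funS measurableT) => //.
exact: continuous_measurable_borel.
Qed.

Lemma integrable_bounded (D : set (borel_type M)) (f : borel_type M -> R) (B : R) :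
  measurable D -> (vol D < +oo)%E -> measurable_fun D f ->
  (forall p, D p -> `|f p| <= B) -> vol.-integrable D (EFin \o f).
Proof.
move=> mD vD mf fB; apply: measurable_bounded_integrable => //.
exists B; split; first exact: num_real.
by move=> x Bx p Dp /=; apply: (le_trans (fB p Dp)); exact: ltW.
Qed.

(** On a small cell both [q] and the density [s] are nearly constant, and [vol_box] bounds the
    volume of the cell by the density; no change of variables under the integral is needed. *)
Lemma riemann_integral (e : R) : 0 < e ->
  \forall k \near \oo, `|\int[vol]_p psi p
     - \sum_(d : {ffun 'I_m -> 'I_k}) h k ^+ m * (q (corner d) * s (corner d))| <= e.
Proof.
move=> e0; have [S S_gt0 HS] := S0.
have [B B0 HB] := bounded_compact cQ cube_img q_cont.
pose V := (4 * rho) ^+ m.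
have V0 : 0 < V by rewrite exprn_gt0 // mulr_gt0.
(* Per unit of coordinate volume, an oscillation eta of [q] costs at most eta (S + 1), as the
   density is at most S + 1 on average, and an oscillation eta of [s] costs at most eta B. *)
pose C := S + 1 + B; have C0 : 0 < C by rewrite /C; lra.
pose eta := Num.min 1 (e / (V * C)).
have eta0 : 0 < eta by rewrite lt_min ltr01 divr_gt0 // mulr_gt0.
have eta1 : eta <= 1 by rewrite ge_min lexx.
have etae : eta * (V * C) <= e.
  by rewrite -ler_pdivlMr ?mulr_gt0 // ge_min lexx orbT.
have [d1 d1_gt0 Hd1] := unif_continuous_compact cQ cube_img s_cont eta0.
have [d2 d2_gt0 Hd2] := unif_continuous_compact cQ cube_img q_cont eta0.
have dm : 0 < Num.min (Num.min d1 d2) rho by rewrite !lt_min d1_gt0 d2_gt0.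
near=> k.
have [k0 hkd] : (0 < k)%N /\ h k < Num.min (Num.min d1 d2) rho.
  by near: k; exact: h_small.
move: hkd; rewrite !lt_min => /andP[/andP[hd1 hd2] hr]; have h0 := h_gt0 k0.
have hm0 : 0 < h k ^+ m by rewrite exprn_gt0.
have mcell d : measurable (@cell k d) by exact: chart_box_measurable.
have close (d : {ffun 'I_m -> 'I_k}) x : box (corner d) (h k) x ->
    `|x - corner d| < d1 /\ `|x - corner d| < d2.
  move=> bx; have H : `|x - corner d| <= h k.
    apply: row_norm_le => [|j]; first exact: ltW.
    have /andP[u1 u2] := bx j; rewrite !mxE in u1 u2 *.
    by rewrite ler_norml; apply/andP; split; lra.
  by split; exact: le_lt_trans H _.
have cellQ (d : {ffun 'I_m -> 'I_k}) x : box (corner d) (h k) x -> Q x.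
  by move=> bx; exact: (cell_Q k0 hr bx).
have vcell d : (vol (@cell k d) < +oo)%E.
  by apply: chart_box_finite; [exact: cellQ|exact: ltW].
have volE d : `|fine (vol (@cell k d)) - s (corner d) * h k ^+ m| <= eta * h k ^+ m.
  have Qd := @Q_corner k d k0 hr.
  have sd0 := s_gt0 (cube_img Qd).
  have sx x : box (corner d) (h k) x -> `|s x - s (corner d)| <= eta.
    by move=> bx; have [u _] := close d x bx; exact: Hd1.
  have l0 : 0 <= Num.max (s (corner d) - eta) 0 by rewrite le_max lexx orbT.
  have /(_ _)/andP[|H1 H2] := vol_box vol_g (a := corner d) (h := h k)
    (l := Num.max (s (corner d) - eta) 0) (L := s (corner d) + eta) (ltW h0) l0
    (subset_trans (@cellQ d) cube_img).
    move=> x bx; have := sx x bx; rewrite ler_distl => /andP[u1 u2].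
    by rewrite ge_max u1 sqrtr_ge0 u2.
  have fv : vol (@cell k d) \is a fin_num.
    by rewrite ge0_fin_numE //; exact: vcell.
  rewrite -(fineK fv) !lee_fin in H1 H2.
  have m1 : Num.max (s (corner d) + eta) 0 = s (corner d) + eta.
    by apply/max_idPl; lra.
  rewrite m1 in H2.
  have m2 : (s (corner d) - eta) * h k ^+ m <= fine (vol (@cell k d)).
    apply: le_trans H1; apply: ler_wpM2r; first exact: ltW.
    by rewrite le_max lexx.
  by rewrite ler_distl; apply/andP; split; lra.
have psiB d p : @cell k d p -> `|psi p - q (corner d)| <= eta.
  move=> [dp bp]; rewrite psi_q //; have [_ u] := close d _ bp.
  by apply: Hd2 => //; exact: Q_corner.
have psiI d : vol.-integrable (@cell k d) (EFin \o (psi : borel_type M -> R)).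
  apply: (@integrable_bounded _ _ B) => //; first exact: psi_meas.
  by move=> p [dp bp]; rewrite psi_q //; apply: HB; exact: (cellQ d).
have cstI d (r : R) : vol.-integrable (@cell k d) (EFin \o (fun=> r : R)).
  by apply: (@integrable_bounded _ _ `|r|) => // *; exact: measurable_cst.
have intE d : `|\int[vol]_(p in @cell k d) psi p
    - h k ^+ m * (q (corner d) * s (corner d))| <= h k ^+ m * (eta * C).
  have Qd := @Q_corner k d k0 hr.
  have U : \int[vol]_(p in @cell k d) psi p <= (q (corner d) + eta) * fine (vol (@cell k d)).
    rewrite -Rintegral_cst //; apply: le_Rintegral => // p cp.
    by have := psiB d p cp; rewrite ler_distl => /andP[_].
  have L : (q (corner d) - eta) * fine (vol (@cell k d)) <= \int[vol]_(p in @cell k d) psi p.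
    rewrite -Rintegral_cst //; apply: le_Rintegral => // p cp.
    by have := psiB d p cp; rewrite ler_distl => /andP[].
  have := volE d; move: U L; have := HB _ Qd; have := HS _ Qd.
  move: (\int[vol]_(p in _) _) (fine _) (q _) (s (corner d)) (h k ^+ m) hm0
    => I v q0 s0 H H0 sS qB U L vs.
  have v0 : v <= (S + 1) * H.
    have s1 : s0 <= S by exact: le_trans (ler_norm _) sS.
    have : v <= s0 * H + eta * H by move: vs; rewrite ler_distl => /andP[]; lra.
    have := ler_wpM2r (ltW H0) s1; have := ler_wpM2r (ltW H0) eta1; lra.
  have Iv : `|I - q0 * v| <= eta * v by rewrite ler_distl; apply/andP; split; lra.
  have qv : `|q0 * v - q0 * (s0 * H)| <= B * (eta * H).
    by rewrite -mulrBr normrM ler_pM.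
  have -> : I - H * (q0 * s0) = (I - q0 * v) + (q0 * v - q0 * (s0 * H)) by ring.
  apply: le_trans (ler_normD _ _) _; rewrite /C.
  have := ler_wpM2l (ltW eta0) v0; lra.
pose D : set (borel_type M) :=
  chart_set i (box (\row_j (c 0 j - 2 * rho)) (4 * rho)).
have DE := big_cell k0 hr (erefl D).
have mD : measurable D by exact: chart_box_measurable.
have vD : (vol D < +oo)%E.
  apply: chart_box_finite; last by rewrite mulr_ge0 // ltW.
  move=> x bx j; have := bx j; rewrite mxE => /andP[? ?].
  by rewrite ler_distl; apply/andP; split; lra.
have psiT : \int[vol]_p psi p = \int[vol]_(p in D) psi p.
  rewrite [RHS]Rintegral_mkcond; congr (Rintegral _ _ _); apply/funext => p.
  rewrite patchE; case: ifPn => // /negP pD; apply: psi_out => Dp; apply: pD.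
  exact: mem_set.
have -> : \int[vol]_p psi p = \sum_(d : {ffun 'I_m -> 'I_k}) \int[vol]_(p in @cell k d) psi p.
  rewrite psiT /Rintegral DE integral_bigsetU_EFin //.
  - rewrite -sum_fine // => d _; exact: integrable_fin_num (psiI d).
  - exact: index_enum_uniq.
  - exact: cell_disjoint.
  - by apply/measurable_EFinP; rewrite -DE; exact: psi_meas.
rewrite -sumrB; apply: le_trans (ler_norm_sum _ _ _) _.
apply: (@le_trans _ _ (\sum_(d : {ffun 'I_m -> 'I_k}) h k ^+ m * (eta * C))).
  by apply: ler_sum => d _; exact: intE.
rewrite sum_cell_cst mulrA -exprMn [k%:R * _]mulrC hk // -/V.
by rewrite mulrCA.
Unshelve. all: by end_near. Qed.

End DivergenceInCube.

Lemma Ck_local (R : realType) (m : nat) (V : normedModType R) k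
    (U : set 'rV[R]_m) (f : 'rV[R]_m -> V) :
  (forall x, U x -> exists2 U' : set 'rV[R]_m, U' x & Ck k U' f) -> Ck k U f.
Proof.
elim: k f => [|k IH] f H.
  by split=> // x /H[U' Ux cf]; exact: Ck_continuous cf Ux.
split=> [x /H[U' Ux cf]|v]; first exact: Ck_continuous cf Ux.
split=> [x /H[U' Ux cf]|]; first exact: Ck_derivable cf Ux.
by apply: IH => x /H[U' Ux cf]; exists U' => //; exact: Ck_derive.
Qed.

(** * A cutoff function of class C^1 *)

Section SquareCutoff.
Variables (R : realType) (m : nat).
Local Notation vec := 'rV[R]_m.
Implicit Types (U : set vec) (f : vec -> R).

(** Where f vanishes, the difference quotient of f |f| is that of f times |f|, which tends to 0;
    elsewhere f |f| is locally plus or minus f^2. *)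
Lemma derive_mul_norm U f x v : open U -> Ck 1 U f -> U x ->
  derivable (fun y => f y * `|f y|) x v /\
  'D_v (fun y => f y * `|f y|) x = 2 * `|f x| * 'D_v f x.
Proof.
move=> oU cf Ux; have cfx := Ck_continuous cf Ux.
have dfx : derivable f x v by exact: Ck_derivable cf Ux.
have nearpos (h : vec -> R) : {for x, continuous h} -> 0 < h x ->
    \forall y \near x, 0 < h y.
  move=> ch h0; have := ch => /cvgrPdist_lt/(_ _ h0).
  by apply: (@filterS _ (nbhs x) (nbhs_filter x)) => y; rewrite ltr_norml; lra.
have [fp|fn|f0] := ltgtP 0 (f x).
- have e : \forall y \near x, ((f : vec -> R) * (f : vec -> R)) y = f y * `|f y|.
    have := nearpos f cfx fp.
    by apply: (@filterS _ (nbhs x) (nbhs_filter x)) => y fy; rewrite gtr0_norm.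
  have dM : derivable ((f : vec -> R) * (f : vec -> R)) x v by exact: derivableM.
  split; first exact: near_eq_derivable e dM.
  rewrite -(near_eq_derive v e) (deriveM dfx dfx) (gtr0_norm fp) /GRing.scale /=.
  ring.
- have fN : 0 < - f x by rewrite oppr_gt0.
  have e : \forall y \near x, (- ((f : vec -> R) * (f : vec -> R))) y = f y * `|f y|.
    have := nearpos (fun y => - f y) (continuousN cfx) fN.
    apply: (@filterS _ (nbhs x) (nbhs_filter x)) => y fy.
    by rewrite oppr_gt0 in fy; rewrite ltr0_norm // mulrN.
  have dM : derivable ((f : vec -> R) * (f : vec -> R)) x v by exact: derivableM.
  split; first by apply: near_eq_derivable e _; exact: derivableN.
  rewrite -(near_eq_derive v e) (deriveN dM) (deriveM dfx dfx) (ltr0_norm fn) /GRing.scale /=.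
  ring.
have C : (fun h : R => h^-1 *: (((fun y => f y * `|f y|) \o shift x) (h *: v)
    - f x * `|f x|)) @ (0 : R)^' --> (0 : R).
  have c1 : (fun h : R => h^-1 *: ((f \o shift x) (h *: v) - f x)) @ (0 : R)^' --> 'D_v f x.
    exact: dfx.
  have c2 : (fun h : R => `|f (h *: v + x)|) @ (0 : R)^' --> (0 : R).
    have L : (fun h : R => h *: v + x) @ (0 : R) --> x.
      rewrite -[X in _ --> X]add0r -(scale0r v).
      by apply: cvgD; [apply: cvgZr_tmp; exact: cvg_id|exact: cvg_cst].
    have L2 : (fun h : R => f (h *: v + x)) @ (0 : R) --> f x.
      exact: (cvg_comp _ _ L cfx).
    have L3 := cvg_norm L2; rewrite -f0 normr0 in L3.
    move=> S /L3 HS.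
    first [exact: (cvg_within HS) | exact: (nbhs_dnbhs HS) | exact: (cvg_within _ HS)].
  pose G1 := fun h : R => (h^-1 *: ((f \o shift x) (h *: v) - f x)) * `|f (h *: v + x)|.
  have c3 : G1 @ (0 : R)^' --> 'D_v f x * 0 := cvgM c1 c2.
  have E : G1 = (fun h : R => h^-1 *: (((fun y => f y * `|f y|) \o shift x) (h *: v)
      - f x * `|f x|)).
    by apply/funext => h; rewrite /G1 /= -f0 mul0r !subr0 /GRing.scale /= mulrA.
  by rewrite E mulr0 in c3; exact: c3.
split; first by apply/cvg_ex; exists 0; exact: C.
rewrite -f0 normr0 mulr0 mul0r; exact: (cvg_lim _ C).
Qed.

(* Twice the square of the positive part. *)
Definition cutoff (t : R) : R := t * t + t * `|t|.

Lemma cutoff_ge0 t : 0 <= cutoff t.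
Proof.
rewrite /cutoff; have [t0|t0] := leP 0 t; first by rewrite ger0_norm //; nra.
by rewrite ltr0_norm //; nra.
Qed.

Lemma cutoff_gt0 t : 0 < t -> 0 < cutoff t.
Proof. by move=> t0; rewrite /cutoff gtr0_norm //; nra. Qed.

Lemma cutoff_eq0 t : t <= 0 -> cutoff t = 0.
Proof. by move=> t0; rewrite /cutoff ler0_norm // mulrN subrr. Qed.

Lemma Ck_cutoff U f : open U -> Ck 1 U f -> Ck 1 U (fun x => cutoff (f x)).
Proof.
move=> oU cf; apply: (Ck_add oU); first exact: (Ck_mul oU cf cf).
have cn (f' : vec -> R) x : {for x, continuous f'} -> {for x, continuous (fun y => `|f' y|)}.
  move=> c; apply: (@continuous_comp _ _ _ f' (fun t : R => `|t|)); first exact: c.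
  exact: norm_continuous.
split=> [x Ux|v].
  exact: (continuousM (Ck_continuous cf Ux) (cn _ _ (Ck_continuous cf Ux))).
split=> [x Ux|]; first by have [] := derive_mul_norm v oU cf Ux.
have c0 : Ck 0 U (fun x => 2 * `|f x| * 'D_v f x).
  split=> // x Ux.
  apply: continuousM; last exact: (Ck_continuous (Ck_derive v cf) Ux).
  apply: continuousM; first exact: (@cst_continuous _ _ (2 : R) x).
  exact: (cn _ _ (Ck_continuous cf Ux)).
apply: (Ck_eq oU) c0 => x Ux.
by have [_ ->] := derive_mul_norm v oU cf Ux.
Qed.

Lemma derive_bigsum (J : Type) (r : seq J) U (f : J -> vec -> R) x v : open U ->
  (forall j, Ck 1 U (f j)) -> U x ->
  'D_v (fun y => \sum_(j <- r) f j y) x = \sum_(j <- r) 'D_v (f j) x.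
Proof.
move=> oU cf Ux; elim: r => [|j r IH].
  rewrite big_nil (derive_eq_on v oU (g := fun=> 0)) //; first exact: derive_cst.
  by move=> y _; rewrite big_nil.
rewrite big_cons -IH.
transitivity ('D_v (f j + (fun y => \sum_(j <- r) f j y)) x).
  by apply: (derive_eq_on v oU) => // y _; rewrite big_cons.
apply: deriveD; first exact: (Ck_derivable (cf j) Ux).
exact: (Ck_derivable (Ck_sum _ _ oU cf) Ux).
Qed.

(** Polynomial and positive exactly on the open Euclidean ball, which lies in the cube of the same
    radius. *)
Definition bump_arg (c : vec) (rho : R) (y : vec) : R :=
  rho ^+ 2 - \sum_j (y 0 j - c 0 j) ^+ 2.

Lemma Ck_bump_arg U (c : vec) (rho : R) k : open U -> Ck k U (bump_arg c rho).
Proof.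
move=> oU; apply: (Ck_add oU); first exact: Ck_cst.
apply: (Ck_opp oU); apply: (Ck_sum _ _ oU) => j.
have cj : Ck k U (fun y : vec => y 0 j - c 0 j).
  by apply: (Ck_add oU); [exact: Ck_coord|exact: Ck_cst].
exact: (Ck_mul oU cj cj).
Qed.

Lemma bump_arg_le0 (c : vec) (rho : R) (y : vec) : 0 < rho -> (exists j, rho <= `|y 0 j - c 0 j|) ->
  bump_arg c rho y <= 0.
Proof.
move=> r0 [j Hj]; rewrite /bump_arg (bigD1 j) //=.
have h1 : rho ^+ 2 <= (y 0 j - c 0 j) ^+ 2.
  by rewrite -[leRHS]real_normK ?num_real // lerXn2r ?nnegrE // ltW.
have h2 : 0 <= \sum_(l | l != j) (y 0 l - c 0 l) ^+ 2.
  by apply: sumr_ge0 => l _; exact: sqr_ge0.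
lra.
Qed.
End SquareCutoff.

(** * Extension by zero from a chart to the manifold *)

Section ChartExtension.
Variables (R : realType) (m : nat) (M : ptopologicalType).
Variable A : smooth_manifold R m M.
Local Notation vec := 'rV[R]_m.
Local Notation img := (chart_img (A := A)).

Lemma chart_inv_dom (i : chart_idx A) x : img i x -> chart_dom i (chart_inv i x) /\
  chart i (chart_inv i x) = x.
Proof. by move=> [p dp <-]; rewrite chartK. Qed.

Lemma chart_inv_preim_open (j : chart_idx A) (O : set M) : open O ->
  open [set x | img j x /\ O (chart_inv j x)].
Proof.
move=> oO; rewrite openE => x [Ix Ox].
have h1 : nbhs x (img j) by exact: (open_nbhs_nbhs (conj (@chart_img_open _ _ _ A j) Ix)).
have h2 : nbhs x (chart_inv j @^-1` O).
  exact: (chart_inv_continuous Ix) (open_nbhs_nbhs (conj oO Ox)).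
by apply: (@filterS _ (nbhs x) (nbhs_filter x)) (filterI h1 h2) => y [].
Qed.

Variable i : chart_idx A.
Definition chart_ext (f : vec -> R) : M -> R :=
  fun q => if pselect (chart_dom i q) then f (chart i q) else 0.

Lemma chart_extE f q : chart_dom i q -> chart_ext f q = f (chart i q).
Proof. by rewrite /chart_ext; case: pselect. Qed.
Lemma chart_ext_out f q : ~ chart_dom i q -> chart_ext f q = 0.
Proof. by rewrite /chart_ext; case: pselect. Qed.

Variables (c : vec) (r : R).
Hypothesis cube_img : cube c r `<=` img i.
Let K : set M := chart_inv i @` cube c r.

(** K is compact in a Hausdorff space. Its complement and the chart domain are the two open sets on
    which regularity of an extension is checked. *)
Let K_closed : open (~` K).
Proof.
apply: closed_openC; apply: compact_closed; first exact: (manifold_hausdorff A).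
apply: continuous_compact; last exact: (@cube_compact R m c r).
apply: continuous_in_subspaceT => x /set_mem Qx.
exact: (chart_inv_continuous (cube_img Qx)).
Qed.

Let K_dom q : K q -> chart_dom i q.
Proof. by move=> [x Qx <-]; have [] := chart_inv_dom (cube_img Qx). Qed.

Variable f : vec -> R.
Hypothesis f_out : forall x, img i x -> ~ cube c r x -> f x = 0.

Let ext_notK q : ~ K q -> chart_ext f q = 0.
Proof.
move=> nK; have [dq|ndq] := pselect (chart_dom i q); last exact: chart_ext_out.
rewrite chart_extE //; apply: f_out; first by exists q.
by move=> Qq; apply: nK; exists (chart i q) => //; exact: chartK.
Qed.

Lemma chart_ext_continuous : (forall x, img i x -> {for x, continuous f}) ->
  continuous (chart_ext f).
Proof.
move=> cf q; have [dq|ndq] := pselect (chart_dom i q).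
  suff : chart_ext f @ q --> f (chart i q) by rewrite -(chart_extE f dq).
  have Iq : img i (chart i q) by exists q.
  apply: cvg_trans (continuous_comp (chart_continuous dq) (cf _ Iq)).
  apply: (@near_eq_cvg _ _ (nbhs q) _ (f \o chart i) (chart_ext f)).
  have : nbhs q (chart_dom i) by exact: (open_nbhs_nbhs (conj (chart_dom_open i) dq)).
  by apply: (@filterS _ (nbhs q) (nbhs_filter q)) => y dy; rewrite chart_extE.
have nK : (~` K) q by move=> Kq; apply: ndq; exact: K_dom.
suff : chart_ext f @ q --> (0 : R) by rewrite -(chart_ext_out f ndq).
apply: cvg_trans (@cst_continuous M R 0 q).
apply: (@near_eq_cvg _ _ (nbhs q) _ (fun=> 0) (chart_ext f)).
have : nbhs q (~` K) by exact: (open_nbhs_nbhs (conj K_closed nK)).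
by apply: (@filterS _ (nbhs q) (nbhs_filter q)) => y ny; rewrite ext_notK.
Qed.

Lemma transition_on (j : chart_idx A) x : img j x -> chart_dom i (chart_inv j x) ->
  (chart j @` (chart_dom j `&` chart_dom i)) x.
Proof.
move=> Ix dx; have [dj e] := chart_inv_dom Ix.
by exists (chart_inv j x).
Qed.

Lemma transition_open (j : chart_idx A) : open (chart j @` (chart_dom j `&` chart_dom i)).
Proof.
have := chart_inv_preim_open (j := j) (chart_dom_open i).
have -> : [set x | img j x /\ chart_dom i (chart_inv j x)] =
    chart j @` (chart_dom j `&` chart_dom i); last by [].
apply/seteqP; split => x /=; first by case=> Ix; exact: transition_on.
by move=> [p [dj di] <-]; split; [exists p|rewrite chartK].
Qed.

(** Near a point of the domain of chart i, compose with the transition map; near any other point the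
    extension is zero. *)
Lemma chart_ext_Ck (j : chart_idx A) : Ck 1 (img i) f -> Ck 1 (img j) (chart_ext f \o chart_inv j).
Proof.
move=> cf; apply: Ck_local => x Ix.
have [dx|ndx] := pselect (chart_dom i (chart_inv j x)).
  exists (chart j @` (chart_dom j `&` chart_dom i)); first exact: transition_on.
  have H : Ck 1 (chart j @` (chart_dom j `&` chart_dom i))
      (f \o (chart i \o chart_inv j)).
    have tr := @transition_smooth _ _ _ A j i 1%N.
    have TI y : (chart j @` (chart_dom j `&` chart_dom i)) y ->
        img i ((chart i \o chart_inv j) y).
      by move=> [p [dj di] <-]; rewrite /= chartK //; exists p.
    have oI : open (img i) by exact: (@chart_img_open _ _ _ A i).
    have H := @Ck_comp R m m 1 _ (img i) _ f (@transition_open j) oI TI tr cf.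
    exact: H.
  apply: (Ck_eq (@transition_open j)) H => y [p [dj di] <-] /=.
  by rewrite chartK // chart_extE.
exists [set x | img j x /\ (~` K) (chart_inv j x)].
  by split=> // Kx; apply: ndx; exact: K_dom.
apply: (Ck_eq (chart_inv_preim_open (j := j) K_closed)) (Ck_cst _ _ (0 : R)).
by move=> y [Iy nK] /=; rewrite ext_notK.
Qed.

End ChartExtension.

(** * Partition of unity and the global divergence inequality *)

Section DivergenceTheorem.
Variables (R : realType) (m : nat) (M : ptopologicalType).
Variable A : smooth_manifold R m M.
Local Notation vec := 'rV[R]_m.
Local Notation img := (chart_img (A := A)).
Hypothesis M_compact : compact [set: M].
Variables (g : bilinear_field A) (vol : {measure set (borel_type M) -> \bar R}).
Hypothesis vol_g : is_riemannian_measure g vol.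
Let s (i : chart_idx A) (x : vec) := Num.sqrt (\det (g i x)).
Hypothesis s_gt0 : forall i x, img i x -> 0 < s i x.
Hypothesis s_C1 : forall i, Ck 1 (img i) (s i).
Variable V : chart_idx A -> vec -> vec.
Hypothesis V_C1 : forall i a, Ck 1 (img i) (fun x => V i x 0 a).
Hypothesis V_natural : forall i j p, chart_dom i p -> chart_dom j p ->
  V j (chart j p) = dtransition i j p (V i (chart i p)).

Let oI i : open (img i) := @chart_img_open _ _ _ A i.

Let s_cont i x : img i x -> {for x, continuous (s i)}.
Proof. by move=> Ix; exact: (Ck_continuous (s_C1 i) Ix). Qed.

Let cube_choice (p : M) : exists ir : chart_idx A * R,
  [/\ chart_dom ir.1 p, 0 < ir.2 &
      cube (chart ir.1 p) (3 * ir.2) `<=` img ir.1].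
Proof.
have [i dp] := chart_cover A p.
have Ip : img i (chart i p) by exists p.
have /nbhs_ballP[e /= e0 He] : nbhs (chart i p) (img i).
  exact: (open_nbhs_nbhs (conj (@oI i) Ip)).
(* The cube of radius 3 (e / 6) = e / 2 lies in the ball of radius e. *)
exists (i, e / 6); split=> //=; first by rewrite divr_gt0.
move=> x Qx; apply: He; rewrite -ball_normE /=.
apply: row_norm_lt => // j; have := Qx j.
by rewrite !mxE distrC => h; lra.
Qed.

Let cc (p : M) : chart_idx A * R := projT1 (cid (cube_choice p)).
Let ix p := (cc p).1.
Let rd p := (cc p).2.
Let ct p := chart (ix p) p.
Let ix_dom p : chart_dom (ix p) p.
Proof. by rewrite /ix /cc; case: cid => ? []. Qed.
Let rd_gt0 p : 0 < rd p.
Proof. by rewrite /rd /cc; case: cid => ? []. Qed.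
Let cube3 p : cube (ct p) (3 * rd p) `<=` img (ix p).
Proof. by rewrite /ct /ix /rd /cc; case: cid => ? []. Qed.
Let cube_sub p r : r <= 3 * rd p -> cube (ct p) r `<=` img (ix p).
Proof. by move=> hr x Qx; apply: cube3 => j; exact: le_trans (Qx j) hr. Qed.

Let bump p (y : vec) : R := cutoff (bump_arg (ct p) (rd p) y).
Let bump_far p (y : vec) : (exists j, rd p <= `|y 0 j - ct p 0 j|) -> bump p y = 0.
Proof. by move=> H; apply: cutoff_eq0; exact: bump_arg_le0. Qed.
Let bump_out p x : img (ix p) x -> ~ cube (ct p) (rd p) x -> bump p x = 0.
Proof.
move=> _ nQ; apply: bump_far; apply: contrapT => H; apply: nQ => j.
by rewrite leNgt; apply/negP => h; apply: H; exists j; exact: ltW.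
Qed.
Let bump_C1 p U : open U -> Ck 1 U (bump p).
Proof. by move=> oU; apply: (Ck_cutoff oU); exact: Ck_bump_arg. Qed.

Let rd3 p : rd p <= 3 * rd p.
Proof. by have := rd_gt0 p; lra. Qed.

Let B p : M -> R := chart_ext (ix p) (bump p).
Let B_ge0 p q : 0 <= B p q.
Proof.
rewrite /B; have [d|d] := pselect (chart_dom (ix p) q).
  by rewrite chart_extE //; exact: cutoff_ge0.
by rewrite chart_ext_out.
Qed.
Let B_C1 p j : Ck 1 (img j) (B p \o chart_inv j).
Proof.
apply: (chart_ext_Ck (cube_sub (rd3 p)) (@bump_out p)).
by apply: bump_C1; exact: oI.
Qed.

Let patch_set p : set M := chart_set (ix p) [set y | 0 < bump_arg (ct p) (rd p) y].
Let patch_open p : open (patch_set p).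
Proof.
apply: chart_set_open.
have /continuousP H : continuous (bump_arg (ct p) (rd p)).
  move=> x; exact: (Ck_continuous (Ck_bump_arg (ct p) (rd p) 0 openT) (I : setT x)).
by apply: (H [set t | 0 < t]); exact: open_gt.
Qed.
Let patch_self p : patch_set p p.
Proof.
split; first exact: ix_dom.
rewrite /= /bump_arg big1 ?subr0 ?exprn_gt0 // => j _.
by rewrite /ct subrr expr0n.
Qed.

Let finite_cover : exists r : seq M, forall q, exists2 p, p \in r & patch_set p q.
Proof.
move: M_compact; rewrite compact_cover => /(_ M setT patch_set).
case=> [p _|q _|D _ HD]; first exact: patch_open.
  by exists q => //; exact: patch_self.
exists (finmap.enum_fset D) => q; have [p Dp pq] := HD q I.
by exists p.
Qed.

Let pts : seq M := projT1 (cid finite_cover).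
Let ptsP q : exists2 p, p \in pts & patch_set p q.
Proof. by rewrite /pts; case: cid. Qed.

Let tot q := \sum_(p <- pts) B p q.
Let tot_gt0 q : 0 < tot q.
Proof.
have [p Hp [dp pq]] := ptsP q.
have H : B p q <= tot q.
  rewrite /tot (perm_big _ (perm_to_rem Hp)) big_cons lerDl.
  by apply: sumr_ge0 => p' _; exact: B_ge0.
by apply: lt_le_trans H; rewrite /B chart_extE //; exact: cutoff_gt0.
Qed.
Let tot_C1 j : Ck 1 (img j) (tot \o chart_inv j).
Proof.
have H : Ck 1 (img j) (fun x => \sum_(p <- pts) (B p \o chart_inv j) x).
  by apply: Ck_sum; [exact: oI|move=> p; exact: B_C1].
exact: H.
Qed.

(** The partition of unity. It is only C^1, which suffices since just first derivatives of it are
    taken. *)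
Let phi p q := B p q / tot q.
Let phi_ge0 p q : 0 <= phi p q.
Proof. by apply: divr_ge0; [exact: B_ge0|exact: ltW]. Qed.
Let phi_sum q : \sum_(p <- pts) phi p q = 1.
Proof. by rewrite /phi -mulr_suml -/(tot q) divff // gt_eqF. Qed.
Let phi_C1 p j : Ck 1 (img j) (phi p \o chart_inv j).
Proof.
have t0 x : img j x -> (tot \o chart_inv j) x != 0 by move=> _; rewrite /= gt_eqF.
have H := Ck_mul (@oI j) (B_C1 p j) (Ck_inv (@oI j) t0 (tot_C1 j)).
exact: H.
Qed.

Let X p a (x : vec) : R := phi p (chart_inv (ix p) x) * (s (ix p) x * V (ix p) x 0 a).
Let X_C1 p a : Ck 1 (img (ix p)) (X p a).
Proof.
have c2 := Ck_mul (@oI (ix p)) (s_C1 (ix p)) (V_C1 (ix p) a).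
have H := Ck_mul (@oI (ix p)) (phi_C1 p (ix p)) c2.
exact: H.
Qed.
Let X_far p a x : img (ix p) x -> (exists j, rd p <= `|x 0 j - ct p 0 j|) -> X p a x = 0.
Proof.
move=> Ix H; have [d e] := chart_inv_dom Ix.
by rewrite /X /phi /B chart_extE // e bump_far // !mul0r.
Qed.

(** The divergence of [phi p] times V in the chart of p. *)
Let q_ p (x : vec) : R := (\sum_a 'D_'e_a (X p a) x) / s (ix p) x.
Let q_cont p x : img (ix p) x -> {for x, continuous (q_ p)}.
Proof.
move=> Ix; apply: continuousM; last first.
  apply: continuousV; first by rewrite gt_eqF // s_gt0.
  exact: s_cont.
apply: continuous_sum => a.
exact: (Ck_continuous (Ck_derive 'e_a (X_C1 p a)) Ix).
Qed.
Let q_far p x : img (ix p) x -> (exists j, 2 * rd p <= `|x 0 j - ct p 0 j|) -> q_ p x = 0.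
Proof.
move=> Ix [j Hj]; rewrite /q_ big1 ?mul0r // => a _.
pose O' := [set y | img (ix p) y] `&` [set y : vec | rd p < `|y 0 j - ct p 0 j|].
have oO : open O'.
  apply: openI; first exact: oI.
  have cn : continuous (fun y : vec => `|y 0 j - ct p 0 j|).
    move=> y; apply: (@continuous_comp _ _ _ (fun y : vec => y 0 j - ct p 0 j) (fun t : R => `|t|)).
      apply: continuousB; first exact: coord_continuous.
      exact: (@cst_continuous _ _ (ct p 0 j) y).
    exact: norm_continuous.
  move/continuousP : cn => cn; apply: (cn [set t | rd p < t]); exact: open_gt.
have Ox : O' x by split=> //=; have := rd_gt0 p; lra.
rewrite (derive_eq_on 'e_a oO (g := fun=> (0 : R))) //; first exact: derive_cst.
by move=> y [Iy /ltW hy]; apply: X_far => //; exists j.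
Qed.
Let q_out p x : img (ix p) x -> ~ cube (ct p) (2 * rd p) x -> q_ p x = 0.
Proof.
move=> Ix nQ; apply: q_far => //; apply: contrapT => H; apply: nQ => j.
by rewrite leNgt; apply/negP => h; apply: H; exists j; exact: ltW.
Qed.

Let psi p : M -> R := chart_ext (ix p) (q_ p).
Let psi_cont p : continuous (psi p).
Proof.
apply: (chart_ext_continuous (c := ct p) (r := 2 * rd p)) => //.
- by apply: cube_sub; have := rd_gt0 p; lra.
- exact: q_out.
- exact: q_cont.
Qed.

Let psi_out p q : ~ chart_set (ix p)
    (box (\row_j (ct p 0 j - 2 * rd p)) (4 * rd p)) q -> psi p q = 0.
Proof.
move=> nb; rewrite /psi; have [d|d] := pselect (chart_dom (ix p) q); last exact: chart_ext_out.
rewrite chart_extE //; apply: q_far; first by exists q.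
apply: contrapT => H; apply: nb; split=> // j; rewrite mxE.
have : `|chart (ix p) q 0 j - ct p 0 j| < 2 * rd p.
  by rewrite ltNge; apply/negP => h; apply: H; exists j.
by rewrite ltr_norml => /andP[h1 h2]; apply/andP; split; lra.
Qed.

(** The Riemann sums of [psi p] against the density are sums over directions of Riemann sums of
    partial derivatives, and those tend to 0 by telescoping. *)
Lemma int_psi p : \int[vol]_q psi p q = 0.
Proof.
have small e : 0 < e -> `|\int[vol]_q psi p q| <= e.
  (* One share of the error goes to the approximation of the integral and one to each of the m
     directions. *)
  move=> e0; pose e' := e / m.+1%:R.
  have e'0 : 0 < e' by rewrite divr_gt0.
  have psiE q : chart_dom (ix p) q -> psi p q = q_ p (chart (ix p) q).
    by move=> d; rewrite /psi chart_extE.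
  have N1 := riemann_integral vol_g (@s_gt0 (ix p)) (@s_cont (ix p)) (rd_gt0 p)
    (@cube3 p) (@psi_cont p) (@psi_out p) (@q_cont p) psiE e'0.
  have N2 : \forall k \near \oo, forall a, `|\sum_(d : {ffun 'I_m -> 'I_k})
     (4 * rd p / k%:R) ^+ m * 'D_'e_a (X p a) (corner (ct p) (rd p) d)| <= e'.
    apply: filter_forall => a.
    have H := riemann_derivative (rd_gt0 p) (@cube3 p) a (X_C1 p a) (@X_far p a) e'0.
    exact: H.
  have N3 : \forall k \near \oo, forall d : {ffun 'I_m -> 'I_k},
      img (ix p) (corner (ct p) (rd p) d).
    near=> k => d; apply: cube3; apply: corner_cube; first exact: rd_gt0.
    by near: k; exact: nbhs_infty_gt.
  have [k [[h1 h2] h3]] := filter_ex (filterI (filterI N1 N2) N3).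
  set S := (S in `|_ - S|) in h1.
  have SE : S = \sum_a \sum_(d : {ffun 'I_m -> 'I_k})
     (4 * rd p / k%:R) ^+ m * 'D_'e_a (X p a) (corner (ct p) (rd p) d).
    rewrite exchange_big; apply: eq_bigr => d _ /=.
    rewrite -mulr_sumr; congr (_ * _); rewrite /q_ divfK //.
    by rewrite gt_eqF // s_gt0.
  have hS : `|S| <= m%:R * e'.
    rewrite SE; apply: le_trans (ler_norm_sum _ _ _) _.
    have -> : m%:R * e' = \sum_(a < m) e'.
      by rewrite sumr_const card_ord mulr_natl.
    by apply: ler_sum => a _; exact: h2.
  have -> : \int[vol]_q psi p q = (\int[vol]_q psi p q - S) + S by rewrite subrK.
  apply: le_trans (ler_normD _ _) _.
  have -> : e = e' + m%:R * e'.
    have -> : e' + m%:R * e' = m.+1%:R * e' by rewrite -natr1; ring.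
    by rewrite /e' mulrC divfK.
  exact: lerD.
apply/eqP; rewrite -normr_eq0; apply/eqP/le_anti; rewrite normr_ge0 andbT.
by apply/ler_addgt0Pr => e e0; rewrite add0r; exact: small.
Unshelve. all: by end_near. Qed.

Let finite_union (r : seq M) : exists D : set (borel_type M),
  [/\ measurable D, (vol D < +oo)%E & forall p, p \in r ->
      chart_set (ix p) (box (\row_j (ct p 0 j - 2 * rd p)) (4 * rd p)) `<=` D].
Proof.
elim: r => [|p r [D [mD vD HD]]].
  by exists set0; split=> //; rewrite measure0 ltry.
pose C : set (borel_type M) :=
  chart_set (ix p) (box (\row_j (ct p 0 j - 2 * rd p)) (4 * rd p)).
have mC : measurable C by exact: chart_box_measurable.
have vC : (vol C < +oo)%E.
  apply: (chart_box_finite vol_g (@s_cont (ix p)) (@cube3 p)).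
    have := rd_gt0 p => r0 x bx j; have := bx j; rewrite mxE => /andP[h1 h2].
    by rewrite ler_distl; apply/andP; split; lra.
  by have := rd_gt0 p; lra.
exists (C `|` D); split; first exact: measurableU.
  apply: (le_lt_trans (measureU2 _ mC mD)).
  exact: lte_add_pinfty.
move=> p'; rewrite inE => /orP[/eqP -> q Hq|Hp q Hq]; first by left.
by right; exact: (HD p').
Qed.

(** Finitely many patches cover M, and each lies in a box of finite volume. *)
Lemma vol_finite : (vol setT < +oo)%E.
Proof.
have [D [mD vD HD]] := finite_union pts.
suff -> : (setT : set (borel_type M)) = D by [].
apply/seteqP; split=> // q _; have [p Hp [dp pq]] := ptsP q.
apply: (HD p Hp); split=> // j; rewrite mxE.
have : `|chart (ix p) q 0 j - ct p 0 j| < rd p.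
  rewrite ltNge; apply/negP => h.
  by move: pq; rewrite /= ltNge => /negP; apply; apply: bump_arg_le0 => //; exists j.
by have := rd_gt0 p; rewrite ltr_norml => r0 /andP[h1 h2]; apply/andP; split; lra.
Qed.

Lemma continuous_integrable (f : M -> R) : continuous f ->
  vol.-integrable setT (EFin \o (f : borel_type M -> R)).
Proof.
move=> cf; have cf' x : [set: M] x -> {for x, continuous f} by move=> _; exact: cf.
have [B' _ HB] := bounded_compact M_compact (@subset_refl _ setT) cf'.
apply: (integrable_bounded (B := B')) => //.
- exact: vol_finite.
- exact: continuous_measurable_borel.
Qed.

(** If f p > 0, then f >= f p / 2 on a small coordinate box around p, which has positive volume
    because the density is bounded away from zero there. *)
Lemma Rintegral_le0_eq0 (f : M -> R) : continuous f -> (forall p, 0 <= f p) ->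
  \int[vol]_p f p <= 0 -> forall p, f p = 0.
Proof.
move=> cf f0 If p; apply/eqP; rewrite eq_le f0 andbT leNgt; apply/negP => fp.
have [i dp] := chart_cover A p; pose x := chart i p.
have Ix : img i x by exists p.
have ex : chart_inv i x = p by exact: chartK.
have sx := s_gt0 Ix.
have nearlt (h : vec -> R) e : {for x, continuous h} -> 0 < e ->
    \forall y \near x, `|h x - h y| < e.
  by move=> ch e0; have /cvgrPdist_lt/(_ _ e0) := ch.
have cfi : {for x, continuous (f \o chart_inv i)}.
  apply: continuous_comp; first exact: (chart_inv_continuous Ix).
  exact: cf.
have f2 : 0 < f p / 2 by rewrite divr_gt0.
have s2 : 0 < s i x / 2 by rewrite divr_gt0.
have n1 := nearlt _ _ cfi f2; have n2 := nearlt _ _ (s_cont Ix) s2.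
have n3 : nbhs x (img i) by exact: (open_nbhs_nbhs (conj (@oI i) Ix)).
have n4 : nbhs x [set y | (`|(f \o chart_inv i) x - (f \o chart_inv i) y| < f p / 2 /\
    `|s i x - s i y| < s i x / 2) /\ img i y] by exact: (filterI (filterI n1 n2) n3).
have /nbhs_ballP[e /= e0 He] := n4.
pose r := e / 2; have r0 : 0 < r by rewrite divr_gt0.
pose a : vec := \row_j (x 0 j - r / 2).
have Hb y : box a r y -> [/\ f p / 2 <= f (chart_inv i y), s i x / 2 <= s i y,
    s i y <= s i x + s i x / 2 & img i y].
  move=> by_; have /He[[h1 h2] h3] : ball x e y.
    rewrite -ball_normE /=; apply: row_norm_lt => // j.
    by have := by_ j; rewrite !mxE ltr_norml /r => /andP[u1 u2]; apply/andP; split; lra.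
  move: h1 h2; rewrite /= ex !ltr_norml => /andP[u1 u2] /andP[v1 v2].
  by split=> //; lra.
pose Bx : set (borel_type M) := chart_set i (box a r).
have mB : measurable Bx by exact: chart_box_measurable.
have bi : box a r `<=` img i by move=> y /Hb[].
have vB : (0 < vol Bx)%E.
  apply: (chart_box_pos vol_g bi r0).
    by exists (s i x / 2) => // y /Hb[].
  by exists (s i x + s i x / 2) => y /Hb[].
have vBf : (vol Bx < +oo)%E.
  apply: le_lt_trans vol_finite; apply: le_measure; rewrite ?inE //.
have fI := continuous_integrable cf.
have fBI : vol.-integrable Bx (EFin \o (f : borel_type M -> R)).
  exact: (integrableS measurableT mB (@subsetT _ _) fI).
have L1 : f p / 2 * fine (vol Bx) <= \int[vol]_(q in Bx) f q.
  rewrite -Rintegral_cst //; apply: le_Rintegral => //.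
    apply: (integrable_bounded (B := `|f p / 2|)) => //.
  by move=> q [dq bq]; have [h _ _ _] := Hb _ bq; rewrite chartK in h.
have L2 : \int[vol]_(q in Bx) f q <= \int[vol]_q f q.
  rewrite /Rintegral fine_le //.
  - exact: integrable_fin_num fBI.
  - exact: integrable_fin_num fI.
  - apply: ge0_subset_integral => //.
      by apply/measurable_EFinP; exact: continuous_measurable_borel.
    by move=> q _; rewrite lee_fin.
have v0 : 0 < fine (vol Bx) by rewrite fine_gt0 // vB.
have := mulr_gt0 f2 v0; lra.
Qed.

(** Only the comparison with u is required, in each chart separately, so the divergence of V never
    has to be assembled into a function on M. *)
Lemma divergence_inequality (u : M -> R) : continuous u ->
  (forall i x, img i x -> u (chart_inv i x) * s i x <=
     \sum_a 'D_'e_a (fun y => s i y * V i y 0 a) x) ->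
  \int[vol]_p u p <= 0.
Proof.
move=> cu Hu.
have pw q : u q <= \sum_(p <- pts) psi p q.
  have [i0 d0] := chart_cover A q; pose x0 := chart i0 q.
  have I0 : img i0 x0 by exists q.
  have e0 : chart_inv i0 x0 = q by exact: chartK.
  pose dl p := 'D_(V i0 x0) (phi p \o chart_inv i0) x0.
  have dl0 : \sum_(p <- pts) dl p = 0.
    rewrite -(derive_bigsum pts (V i0 x0) (@oI i0) (fun p => phi_C1 p i0) I0).
    rewrite (derive_eq_on (V i0 x0) (@oI i0) (g := fun=> (1 : R))) //; first exact: derive_cst.
    by move=> y _ /=; exact: phi_sum.
  (* The added terms are the part of the divergence of [phi p] times V in which [phi p] is
     differentiated; their sum is the derivative of the constant 1. *)
  have -> : u q = \sum_(p <- pts) (phi p q * u q + dl p).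
    have -> : \sum_(p <- pts) (phi p q * u q + dl p) =
        \sum_(p <- pts) phi p q * u q + \sum_(p <- pts) dl p by exact: big_split.
    by rewrite dl0 -mulr_suml phi_sum mul1r addr0.
  apply: ler_sum => p _ /=.
  (* If q is outside the chart of p, both sides are zero: [phi p] vanishes near q, its support being
     contained in a closed subset of that chart. *)
  have [d|d] := pselect (chart_dom (ix p) q); last first.
    rewrite /psi chart_ext_out // /phi /B chart_ext_out // !mul0r add0r.
    have KC : open (~` (chart_inv (ix p) @` cube (ct p) (rd p))).
      apply: closed_openC; apply: compact_closed; first exact: (manifold_hausdorff A).
      apply: continuous_compact; last exact: (@cube_compact R m (ct p) (rd p)).
      apply: continuous_in_subspaceT => x /set_mem Qx.
      exact: (chart_inv_continuous (cube_sub (rd3 p) Qx)).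
    have nK : (~` (chart_inv (ix p) @` cube (ct p) (rd p))) q.
      move=> [x Qx xq]; apply: d; rewrite -xq.
      by have [] := chart_inv_dom (cube_sub (rd3 p) Qx).
    rewrite /dl (derive_eq_on (V i0 x0) (chart_inv_preim_open (j := i0) KC) (g := fun=> (0 : R))).
    - by rewrite derive_cst.
    - move=> y [Iy nKy] /=; rewrite /phi /B.
      have [d'|d'] := pselect (chart_dom (ix p) (chart_inv i0 y)); last first.
        by rewrite chart_ext_out // mul0r.
      rewrite chart_extE // bump_out ?mul0r //; first by exists (chart_inv i0 y).
      move=> Qy; apply: nKy; exists (chart (ix p) (chart_inv i0 y)) => //.
      exact: chartK.
    - by split=> //; rewrite e0.
  pose i := ix p; pose x := chart i q.
  have Ix : img i x by exists q.
  have ex : chart_inv i x = q by exact: chartK.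
  have sx : 0 < s i x by exact: s_gt0.
  have dlE : dl p = 'D_(V i x) (phi p \o chart_inv i) x.
    have OT := @transition_open _ _ _ A i i0.
    have Tx : (chart i0 @` (chart_dom i0 `&` chart_dom i)) x0 by exists q.
    have tr := @transition_smooth _ _ _ A i0 i 1%N.
    have Wx : img i ((chart i \o chart_inv i0) x0) by rewrite /= e0.
    have [_ H] := derive_comp (V i0 x0) OT (@oI i) tr (phi_C1 p i) Tx Wx.
    rewrite /x (V_natural d0 d) /dtransition -/x0.
    have <- : (chart i \o chart_inv i0) x0 = chart i q by rewrite /= e0.
    rewrite -H; apply: (derive_eq_on (V i0 x0) OT) => // y [q' [dq0 dq] <-] /=.
    by rewrite !chartK.
  rewrite dlE /psi chart_extE // -/i -/x /q_ -/i ler_pdivlMr //.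
  have DX a : 'D_'e_a (X p a) x = phi p q * 'D_'e_a (fun y => s i y * V i y 0 a) x
      + s i x * V i x 0 a * 'D_'e_a (phi p \o chart_inv i) x.
    have c1 := phi_C1 p i.
    have c2 := Ck_mul (@oI i) (s_C1 i) (V_C1 i a).
    have H := deriveM (Ck_derivable c1 Ix (v := 'e_a)) (Ck_derivable c2 Ix (v := 'e_a)).
    have E0 : (phi p \o chart_inv i) x = phi p q by rewrite /= ex.
    by apply: (etrans H); rewrite E0.
  under eq_bigr => a _ do rewrite DX.
  rewrite big_split -mulr_sumr mulrDl; apply: lerD.
    rewrite -mulrA; apply: ler_wpM2l; first exact: phi_ge0.
    by have := Hu i x Ix; rewrite ex.
  rewrite (derive_row _ (@oI i) (phi_C1 p i) Ix) mulr_suml.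
  by apply: ler_sum => a _; rewrite le_eqVlt; apply/orP; left; apply/eqP; ring.
have intS (r : seq M) : \int[vol]_q (\sum_(p <- r) psi p q) = 0 /\
    continuous (fun q => \sum_(p <- r) psi p q).
  split; last by move=> q; apply: continuous_sum => p; exact: psi_cont.
  elim: r => [|p r IH].
    transitivity (\int[vol]_q (0 : R)); last by rewrite Rintegral_cst // mul0r.
    by apply: eq_Rintegral => q _; rewrite big_nil.
  transitivity (\int[vol]_q (psi p q + \sum_(p <- r) psi p q)).
    by apply: eq_Rintegral => q _; rewrite big_cons.
  rewrite RintegralD ?IH ?int_psi ?addr0 //.
    by apply: continuous_integrable; exact: psi_cont.
  apply: continuous_integrable => q; apply: continuous_sum => p'; exact: psi_cont.
have [ES cS] := intS pts.
have iS : vol.-integrable setT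
    (EFin \o ((fun q => \sum_(p <- pts) psi p q) : borel_type M -> R)).
  by apply: continuous_integrable; exact: cS.
rewrite -ES; apply: (le_Rintegral measurableT (continuous_integrable cu) iS).
by move=> q _; exact: pw.
Qed.

End DivergenceTheorem.

(** * Independence of the chart *)

Section Pullback.
Variables (R : realType) (m : nat).
Local Notation vec := 'rV[R]_m.
Variables (U1 U2 : {O : set vec | open O}).
Local Notation O1 := (sval U1).
Local Notation O2 := (sval U2).
Local Notation F1 := (smooth_fun U1).
Local Notation F2 := (smooth_fun U2).
Variable f : vec -> vec.
Hypothesis sf : smooth_on O1 f.
Hypothesis fO : forall x, O1 x -> O2 (f x).
Let oO1 : open O1 := svalP U1.
Let oO2 : open O2 := svalP U2.

Let pull_smooth (a : F2) : smooth_on O1 (a \o f).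
Proof. by move=> k; exact: (Ck_comp oO1 oO2 fO (sf k) (@sfun_smooth _ _ _ a k)). Qed.

Definition pull (a : F2) : F1 := mk_sfun (pull_smooth a).

Lemma pullE (a : F2) x : O1 x -> pull a x = a (f x).
Proof. exact: mk_sfunE. Qed.

Let pull_additive : nmod_morphism pull.
Proof.
split=> [|a b]; apply: sfun_eq => x Ox.
  by rewrite (pullE _ Ox) !sfun_0.
by rewrite (pullE _ Ox) (sfunD _ _ (fO Ox)) (sfunD _ _ Ox) !(pullE _ Ox).
Qed.
Let pull_mult : monoid_morphism pull.
Proof.
split=> [|a b]; apply: sfun_eq => x Ox.
  by rewrite (pullE _ Ox) (sfun_1 (fO Ox)) (sfun_1 Ox).
by rewrite (pullE _ Ox) (sfunM _ _ (fO Ox)) (sfunM _ _ Ox) !(pullE _ Ox).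
Qed.
Definition pull_rmorph : {rmorphism F2 -> F1} :=
  HB.pack_for {rmorphism F2 -> F1} pull
    (GRing.isNmodMorphism.Build _ _ pull pull_additive)
    (GRing.isMonoidMorphism.Build _ _ pull pull_mult).

Definition jac : 'M[F1]_m := \matrix_(i, a) pdS U1 i (liftS sf 0 a).

Lemma jacE i a x : O1 x -> jac i a x = 'D_'e_i f x 0 a.
Proof.
move=> Ox; rewrite mxE (pdSE _ _ Ox) (derive_mxE _ _ _ (sf 1%N) Ox).
apply: (derive_eq_on _ oO1) Ox => y Oy.
by rewrite mxE; exact: mk_sfunE.
Qed.

Let chain i (a : F2) : pdS U1 i (pull_rmorph a) =
  \sum_b jac i b * pull_rmorph (pdS U2 b a).
Proof.
apply: ev_eq => x Ox; rewrite rmorph_sum.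
have e1 : sev_rmorph Ox (pdS U1 i (pull_rmorph a)) = 'D_'e_i (a \o f) x.
  apply: etrans (pdSE i (pull_rmorph a) Ox) _.
  by apply: (derive_eq_on _ oO1) Ox => y Oy; exact: pullE.
have [_ e2] := derive_comp 'e_i oO1 oO2 (sf 1%N) (@sfun_smooth _ _ _ a 1%N) Ox (fO Ox).
rewrite e1 e2 (derive_row _ oO2 (@sfun_smooth _ _ _ a 1%N) (fO Ox)).
apply: eq_bigr => b _; rewrite rmorphM; congr (_ * _).
  exact/esym/jacE.
apply: esym; apply: etrans (pullE (pdS U2 b a) Ox) _.
exact: (pdSE b a (fO Ox)).
Qed.

Let jac_sym i j a : pdS U1 i (jac j a) = pdS U1 j (jac i a).
Proof. by rewrite !mxE; exact: pdS_comm. Qed.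

Variables (g1 W1 g2 W2 : vec -> 'M[R]_m).
Hypothesis s_g1 : smooth_on O1 g1.
Hypothesis s_W1 : smooth_on O1 W1.
Hypothesis s_g2 : smooth_on O2 g2.
Hypothesis s_W2 : smooth_on O2 W2.
Hypothesis g1_symm : forall x, O1 x -> (g1 x)^T = g1 x.
Hypothesis g1_det : forall x, O1 x -> 0 < \det (g1 x).
Hypothesis g2_symm : forall x, O2 x -> (g2 x)^T = g2 x.
Hypothesis g2_det : forall x, O2 x -> 0 < \det (g2 x).
Hypothesis g12 : forall x u v, O1 x ->
  ev2 (g1 x) u v = ev2 (g2 (f x)) ('D_u f x) ('D_v f x).
Hypothesis W12 : forall x u v, O1 x ->
  ev2 (W1 x) u v = ev2 (W2 (f x)) ('D_u f x) ('D_v f x).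
Local Notation C1 := (chartS s_g1 s_W1 g1_symm g1_det).
Local Notation C2 := (chartS s_g2 s_W2 g2_symm g2_det).

Let pull_form (B1 B2 : vec -> 'M[R]_m) (s1 : smooth_on O1 B1) (s2 : smooth_on O2 B2) :
  (forall x u v, O1 x -> ev2 (B1 x) u v = ev2 (B2 (f x)) ('D_u f x) ('D_v f x)) ->
  liftS s1 = jac *m map_mx pull_rmorph (liftS s2) *m jac^T.
Proof.
move=> H; apply: ev_mx_eq => x Ox.
pose Jx := map_mx (sev_rmorph Ox) jac.
have JxE i : row i Jx = 'D_'e_i f x.
  by apply/rowP => a; rewrite mxE mxE; exact: jacE.
have e2 : map_mx (sev_rmorph Ox) (map_mx pull_rmorph (liftS s2)) = B2 (f x).
  rewrite -(liftSE s2 (fO Ox)); apply/matrixP => i j; rewrite mxE mxE [RHS]mxE.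
  exact: pullE.
rewrite !map_mxM -map_trmx e2 liftSE -/Jx; apply/matrixP => i j.
rewrite quad_entry !JxE -/(ev2 _ _ _) -(H x 'e_i 'e_j Ox).
by rewrite /ev2 -rowE trmx_delta -colE !mxE.
Qed.

(** Composition with [f] is a ring morphism between the rings of smooth functions, and the chain
    rule is the hypothesis on derivations in [mvc_change]. *)
Lemma mvc_pull x a : O1 x ->
  mvc C2 a 0 (f x) = \sum_k 'D_'e_k f x 0 a * mvc C1 k 0 x.
Proof.
move=> Ox.
have H := mvc_change (C := C1) (C' := C2) (h := pull_rmorph) (J := jac)
  chain jac_sym (pull_form s_g1 s_g2 g12) (pull_form s_W1 s_W2 W12).
have /matrixP/(_ a 0) := H; rewrite [RHS]mxE => Ha.
have e : mvc C2 a 0 (f x) = sev_rmorph Ox (pull_rmorph (mvc C2 a 0)).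
  exact/esym/pullE.
rewrite e -Ha mxE rmorph_sum; apply: eq_bigr => k _.
rewrite rmorphM; congr (_ * _).
by rewrite [X in sev_rmorph Ox X]mxE; exact: jacE.
Qed.

End Pullback.

(** * The field V on the manifold and the conclusion *)

Section AlmostCokahlerEinstein.
Variables (R : realType) (n : nat).
Hypothesis n_gt0 : (0 < n)%N.
Local Notation m := n.*2.+1.
Local Notation vec := 'rV[R]_m.
Variables (M : ptopologicalType) (A : smooth_manifold R m M).
Variables (alpha : covector_field A) (omega g : bilinear_field A).
Variables (tau : R) (taustar : M -> R).
Hypothesis cok : almost_cokahler alpha omega g.
Hypothesis ein : einstein g tau.
Hypothesis tst : is_tau_star omega g taustar.
Local Notation img := (chart_img (A := A)).
Local Notation N := (n.*2.+1 + 1)%N.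

Let oI i : open (img i) := @chart_img_open _ _ _ A i.
Let s_g i : smooth_on (img i) (g i).
Proof. by have [[_ _ [[h _] _] _] _ _] := cok; exact: h. Qed.
Let s_W i : smooth_on (img i) (omega i).
Proof. by have [[_ [[h _] _] _ _] _ _] := cok; exact: h. Qed.
Let s_al i : smooth_on (img i) (alpha i).
Proof. by have [[[h _] _ _ _] _ _] := cok; exact: h. Qed.
Let g_symm i x : img i x -> (g i x)^T = g i x.
Proof. by have [[_ _ [_ h] _] _ _] := cok; move/h => []. Qed.
Let W_skew i x : img i x -> (omega i x)^T = - omega i x.
Proof. by have [[_ [_ h] _ _] _ _] := cok; exact: h. Qed.

(** An orthonormal coframe theta gives det(theta)^2 / det(g) = 1. *)
Let g_det i x : img i x -> 0 < \det (g i x).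
Proof.
move=> Ix; have [[_ _ _ fr] _ _] := cok.
have [U [th [_ Ux _ _ H]]] := fr i x Ix; have [on _ _] := H x Ux.
have := congr1 determinant on; rewrite det_mulmx det_mulmx det_tr det_inv det1.
set d := \det (th x); set D := \det (g i x) => e.
rewrite -invr_gt0 ltNge; apply/negP => h.
have e' : D^-1 * d ^+ 2 = 1 by rewrite -e; ring.
have : D^-1 * d ^+ 2 <= 0 by apply: mulr_le0_ge0 => //; exact: sqr_ge0.
by rewrite e' ler10.
Qed.

Let UI i : {U : set vec | open U} := exist _ (img i) (@oI i).
Let C i := chartS (U := UI i) (@s_g i) (@s_W i) (@g_symm i) (@g_det i).
Let s i (x : vec) := Num.sqrt (\det (g i x)).
Let V i (x : vec) : vec := \row_a mvc (C i) a 0 x.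

Let s_gt0 i x : img i x -> 0 < s i x.
Proof. by move=> Ix; rewrite sqrtr_gt0; exact: g_det. Qed.

Let s_C1 i : Ck 1 (img i) (s i).
Proof.
apply: (Ck_eq (@oI i) _ (sfun_smooth (sqrtdetS (U := UI i) (@s_g i) (@g_det i)) 1%N)).
by move=> x Ix; exact: sqrtdetSE.
Qed.

Let V_C1 i a : Ck 1 (img i) (fun x => V i x 0 a).
Proof.
apply: (Ck_eq (@oI i) _ (sfun_smooth (mvc (C i) a 0) 1%N)).
by move=> x Ix; rewrite [RHS]mxE.
Qed.

Section Restriction.
Variables (i : chart_idx A) (U : {U : set vec | open U}).
Hypothesis sub : sval U `<=` img i.

Lemma chart_restr_smooth (W : normedModType R) (f : vec -> W) :
  smooth_on (img i) f -> smooth_on (sval U) f.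
Proof. by move=> sf k; exact: (Ck_sub sub (sf k)). Qed.

(** Restriction to a smaller open set is treated as a change of coordinates by the identity, since
    the two fields have entries in different rings. *)
Lemma mvc_restr sg sW gs gd x a : sval U x ->
  mvc (@chartS _ _ U (g i) (omega i) sg sW gs gd) a 0 x = V i x 0 a.
Proof.
move=> Ux; rewrite [RHS]mxE.
have sid : smooth_on (sval U) (id : vec -> vec).
  move=> k; apply/(Ck_mxP k id (svalP U)) => i0 j; rewrite ord1.
  exact: (Ck_coord k j (svalP U)).
have hid (B : vec -> 'M[R]_m) y u v : sval U y ->
    ev2 (B y) u v = ev2 (B (id y)) ('D_u (id : vec -> vec) y) ('D_v (id : vec -> vec) y).
  by move=> _; rewrite (derive_id y u) (derive_id y v).
have H := mvc_pull (U2 := UI i) sid sub sg sW (@s_g i) (@s_W i) gs gd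
  (@g_symm i) (@g_det i) (@hid (g i)) (@hid (omega i)) a Ux.
apply: esym; apply: (etrans H).
have ek k : ('D_'e_k (id : vec -> vec) x) 0 a = (a == k)%:R.
  by rewrite (derive_id x 'e_k) mxE eqxx.
have sum_pick (F : 'I_m -> R) : \sum_k (a == k)%:R * F k = F a.
  rewrite (bigD1 a) //= eqxx mul1r big1 ?addr0 // => k.
  by rewrite eq_sym => /negbTE ->; rewrite mul0r.
apply: (etrans _ (sum_pick (fun k => mvc (chartS sg sW gs gd) k 0 x))).
by apply: eq_bigr => k _; congr (_ * _); exact: ek.
Qed.
End Restriction.

Let V_natural i j p : chart_dom i p -> chart_dom j p ->
  V j (chart j p) = dtransition i j p (V i (chart i p)).
Proof.
move=> di dj; have oT := @transition_open _ _ _ A j i.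
pose T := chart i @` (chart_dom i `&` chart_dom j).
pose U : {U : set vec | open U} := exist _ T oT.
have sub : sval U `<=` img i by move=> x [q [d _] <-]; exists q.
pose f := chart j \o chart_inv i.
have sf : smooth_on (sval U) f := @transition_smooth _ _ _ A i j.
have fK q : chart_dom i q -> f (chart i q) = chart j q by move=> d; rewrite /f /= chartK.
have fO x : sval U x -> sval (UI j) (f x).
  by move=> [q [d d'] <-]; rewrite fK //; exists q.
have Tx : sval U (chart i p) by exists p.
have law (B : bilinear_field A) : is_bilinear B -> forall x u v, sval U x ->
    ev2 (B i x) u v = ev2 (B j (f x)) ('D_u f x) ('D_v f x).
  by move=> [_ h] x u v [q [d d'] <-]; rewrite fK //; exact: h.
have [[_ [bW _] [bg _] _] _ _] := cok.
pose gs x (Ux : sval U x) := g_symm (sub x Ux).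
pose gd x (Ux : sval U x) := g_det (sub x Ux).
have H a := mvc_pull (U2 := UI j) sf fO (chart_restr_smooth sub (@s_g i))
  (chart_restr_smooth sub (@s_W i)) (@s_g j) (@s_W j) gs gd (@g_symm j) (@g_det j)
  (law _ bg) (law _ bW) a Tx.
apply/rowP => a; rewrite [LHS]mxE -(fK _ di); apply: (etrans (H a)).
rewrite /dtransition (derive_mxE _ _ _ (sf 1%N) Tx).
have fa : Ck 1 T (fun y => f y 0 a) := proj1 (Ck_mxP 1 f oT) (sf 1%N) 0 a.
rewrite (derive_row _ oT fa Tx); apply: eq_bigr => k _.
by rewrite (derive_mxE _ _ _ (sf 1%N) Tx) mvc_restr // mulrC.
Qed.

(** Adapted coframes exist only near each point. Everything that depends on one is converted here
    into statements about [taustar] and V, which do not. *)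
Let local_facts i x : img i x ->
  [/\ tau <= 0,
      4 * (N%:R - 2) * (taustar (chart_inv i x) - tau) * taustar (chart_inv i x)
        + tau ^+ 2 / N%:R ^+ 2
      <= (\sum_a 'D_'e_a (fun y => s i y * V i y 0 a) x) / s i x,
      {for x, continuous (taustar \o chart_inv i)} &
      taustar (chart_inv i x) = 0 -> tau = 0 ->
      (forall u v, nabla1 (g i) (alpha i) (cst u) (cst v) x = 0) /\
      (forall u v w, nabla2 (g i) (omega i) (cst u) (cst v) (cst w) x = 0)].
Proof.
move=> Ix; have [[_ _ _ fr] acl Wcl] := cok.
have [D [th [oD Dx sub sth H]]] := fr i x Ix.
pose U : {U : set vec | open U} := exist _ D oD.
have Ux : sval U x := Dx.
have sg' := chart_restr_smooth (U := U) sub (@s_g i).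
have sW' := chart_restr_smooth (U := U) sub (@s_W i).
have sal' := chart_restr_smooth (U := U) sub (@s_al i).
have sth' : smooth_on (sval U) th := sth.
pose gs y (Uy : sval U y) := g_symm (sub y Uy).
pose gd y (Uy : sval U y) := g_det (sub y Uy).
pose Ws y (Uy : sval U y) := W_skew (sub y Uy).
have on y : sval U y -> orthonormal_coframe (g i y) (th y) by move=> /H[].
have al_th y : sval U y -> alpha i y = row ord_max (th y) by move=> /H[].
have W_th y : sval U y -> omega i y =
   \sum_(k < n) wedge (row (inord k.*2) (th y)) (row (inord k.*2.+1) (th y)) by move=> /H[].
have acl' y u v : sval U y -> extd1 (alpha i) y u v = 0 by move=> Uy; exact: (acl i y u v (sub y Uy)).
have Wcl' y u v w : sval U y -> extd2 (omega i) y u v w = 0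
  by move=> Uy; exact: (Wcl i y u v w (sub y Uy)).
have ric y u v : sval U y -> ricci (g i) y u v = tau * ev2 (g i y) u v
  by move=> Uy; exact: (ein u v (sub y Uy)).
(* The value of [taustar] is given for every orthonormal frame, in particular for the one dual to
   the adapted coframe. *)
have tsE y (Uy : sval U y) : taustar (chart_inv i y) = tsF sg' sth' gs gd on y.
  have [d e] := chart_inv_dom (sub y Uy).
  have T := @tst i (chart_inv i y) (th y *m invmx (g i y)) d.
  move: T; cbv zeta; rewrite e => T.
  apply: (etrans (T (ad_frame sg' sth' gs gd on Uy))).
  apply: (etrans (ad_taustar n_gt0 sg' sW' sal' sth' gs gd on al_th W_th Uy)).
  exact: (esym (tsFE sg' sth' gs gd on Uy)).
have E1 := etrans (tsE x Ux) (tsFE sg' sth' gs gd on Ux).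
split.
- exact: (ad_tau_le0 n_gt0 sg' sW' sal' sth' gs gd Ws on al_th W_th acl' Wcl' ric Ux).
- have est := ad_estimate n_gt0 sg' sW' sal' sth' gs gd Ws on al_th W_th acl' Wcl' ric Ux.
  rewrite E1; apply: (le_trans est); rewrite le_eqVlt; apply/orP; left; apply/eqP.
  rewrite (sqrtdetSE sg' gd Ux); congr (_ / _).
  transitivity (sev_rmorph Ux (\sum_k pdS U k (sqrtdetS sg' gd * mvc (chartS sg' sW' gs gd) k 0))).
    by [].
  rewrite rmorph_sum; apply: eq_bigr => k _.
  apply: (etrans (pdSE k (sqrtdetS sg' gd * mvc (chartS sg' sW' gs gd) k 0) Ux)).
  apply: (derive_eq_on 'e_k oD) Dx => y Dy.
  rewrite (sfunM _ _ (Dy : sval U y)) (sqrtdetSE sg' gd (Dy : sval U y)).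
  by rewrite (mvc_restr (U := U) sub sg' sW' gs gd k Dy).
- have c0 : Ck 0 D (taustar \o chart_inv i).
    by apply: (Ck_eq oD _ (sfun_smooth (tsF sg' sth' gs gd on) 0%N)) => y Dy; exact: (esym (tsE y Dy)).
  exact: (Ck_continuous c0 Dx).
- rewrite E1 => t0 tau0.
  exact: (ad_parallel n_gt0 sW' sal' Ws al_th W_th acl' Wcl' ric t0 tau0).
Qed.

Lemma taustar_continuous : continuous taustar.
Proof.
move=> p; have [i d] := chart_cover A p.
have Ix : img i (chart i p) by exists p.
have [_ _ c _] := local_facts Ix.
have H : {for p, continuous ((taustar \o chart_inv i) \o chart i)}.
  by apply: continuous_comp; [exact: (chart_continuous d)|exact: c].
move=> B nB.
have nB' : nbhs (((taustar \o chart_inv i) \o chart i) p) B by rewrite /= chartK.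
have hB : nbhs p [set q | B (taustar (chart_inv i (chart i q)))] := H _ nB'.
have hd : nbhs p (chart_dom i) := open_nbhs_nbhs (conj (@chart_dom_open _ _ _ A i) d).
apply: (@filterS _ (nbhs p) (nbhs_filter p) _ _ _ (filterI hB hd)) => q [h dq].
by move: h; rewrite /= (chartK dq).
Qed.

Variable vol : {measure set (borel_type M) -> \bar R}.
Hypothesis M_compact : compact [set: M].
Hypothesis vol_g : is_riemannian_measure g vol.
Hypothesis tau_sign : 0 <= tau \/ (0 <= \int[vol]_p (taustar p)%:E)%E.

(** As tau <= 0, either hypothesis makes the term - tau [taustar] of the estimate nonnegative after
    integration. The rest is a sum of squares with integral at most 0, so it vanishes at every
    point. *)
Lemma tau_taustar_eq0 : tau = 0 /\ forall p, taustar p = 0.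
Proof.
have tau_le0 : tau <= 0.
  have [i d] := chart_cover A (point : M).
  have Ix : img i (chart i point) by exists point.
  by have [h _ _ _] := local_facts Ix.
have ct := taustar_continuous.
pose k : R := 4 * (N%:R - 2); pose b : R := tau ^+ 2 / N%:R ^+ 2.
have N4 : 4 <= N%:R :> R by rewrite ler_nat; lia.
have k_gt0 : 0 < k by rewrite /k; lra.
have b_ge0 : 0 <= b by rewrite /b divr_ge0 // ?sqr_ge0 // exprn_ge0 // ler0n.
(* The lower bound is split into squares [w] and a part linear in [taustar], whose integral has a
   known sign. *)
pose w p := k * (taustar p * taustar p) + b.
pose u p := w p + - (k * tau) * taustar p.
have cst_c (a : R) : continuous (fun _ : M => a) by move=> p; exact: (@cst_continuous _ _ a p).
have addc (f h : M -> R) : continuous f -> continuous h -> continuous (fun p => f p + h p).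
  by move=> cf ch p; apply: cvgD; [exact: cf|exact: ch].
have mulc (f h : M -> R) : continuous f -> continuous h -> continuous (fun p => f p * h p).
  by move=> cf ch p; apply: cvgM; [exact: cf|exact: ch].
have cl (a : R) : continuous (fun p => a * taustar p) := mulc _ _ (cst_c a) ct.
have cw : continuous w := addc _ _ (mulc _ _ (cst_c k) (mulc _ _ ct ct)) (cst_c b).
have cu : continuous u := addc _ _ cw (cl _).
have int_u : \int[vol]_p u p <= 0.
  apply: (divergence_inequality M_compact vol_g s_gt0 s_C1 V_C1 V_natural cu) => i x Ix.
  have [_ h _ _] := local_facts Ix; rewrite -ler_pdivlMr; last exact: s_gt0.
  apply: le_trans h; rewrite le_eqVlt; apply/orP; left; apply/eqP.
  by rewrite /u /w /k /b; ring.
have it := continuous_integrable M_compact vol_g s_C1 ct.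
have iw := continuous_integrable M_compact vol_g s_C1 cw.
have il := continuous_integrable M_compact vol_g s_C1 (cl (- (k * tau))).
have IE : \int[vol]_p u p = \int[vol]_p w p + - (k * tau) * \int[vol]_p taustar p.
  rewrite -(RintegralZl _ measurableT it); exact: (RintegralD measurableT iw il).
have sgn_ge0 : 0 <= - (k * tau) * \int[vol]_p taustar p.
  case: tau_sign => [h|h].
    have -> : tau = 0 by apply: le_anti; rewrite tau_le0 h.
    by rewrite mulr0 oppr0 mul0r.
  apply: mulr_ge0; first by rewrite -mulrN mulr_ge0 ?oppr_ge0 // ltW.
  exact: fine_ge0 h.
have w_ge0 p : 0 <= w p.
  by apply: addr_ge0 => //; rewrite mulr_ge0 ?(ltW k_gt0) // -expr2 sqr_ge0.
have int_w : \int[vol]_p w p <= 0 by move: int_u; rewrite IE; lra.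
have w0 := Rintegral_le0_eq0 M_compact vol_g s_gt0 s_C1 cw w_ge0 int_w.
have t0 p : taustar p = 0 /\ b = 0.
  have t_ge0 : 0 <= k * (taustar p * taustar p).
    by rewrite mulr_ge0 ?(ltW k_gt0) // -expr2 sqr_ge0.
  have wp : k * (taustar p * taustar p) + b = 0 := w0 p.
  have b0 : b = 0 by lra.
  split=> //; have : k * (taustar p * taustar p) = 0 by lra.
  by move/eqP; rewrite mulf_eq0 (gt_eqF k_gt0) -expr2 sqrf_eq0 => /eqP.
split=> [|p]; last by have [] := t0 p.
have [_ /eqP] := t0 point.
rewrite /b mulf_eq0 sqrf_eq0 invr_eq0 sqrf_eq0 pnatr_eq0 addn1 orbF.
by move/eqP.
Qed.

Lemma ricci_flat_cokahler : ricci_flat g /\ cokahler alpha omega g.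
Proof.
have [tau0 ts0] := tau_taustar_eq0; have [acm _ _] := cok; split.
  by move=> i x u v Ix; rewrite (ein u v Ix) tau0 mul0r.
split=> // i x.
  by move=> u v /local_facts[_ _ _ /(_ (ts0 _) tau0)[h _]]; exact: h.
by move=> u v w /local_facts[_ _ _ /(_ (ts0 _) tau0)[_ h]]; exact: h.
Qed.

End AlmostCokahlerEinstein.

Theorem corollary4p8 (R : realType) (n : nat) (n_gt0 : (0 < n)%N)
    (M : ptopologicalType) (A : smooth_manifold R n.*2.+1 M)
    (alpha : covector_field A) (omega g : bilinear_field A)
    (vol : {measure set (borel_type M) -> \bar R})
    (tau : R) (taustar : M -> R) :
  compact [set: M] ->
  almost_cokahler alpha omega g ->
  einstein g tau ->
  is_riemannian_measure g vol ->
  is_tau_star omega g taustar ->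
  0 <= tau \/ (0 <= \int[vol]_p (taustar p)%:E)%E ->
  ricci_flat g /\ cokahler alpha omega g.
Proof.
move=> cM cok ein vol_g tst sign.
exact: (ricci_flat_cokahler n_gt0 cok ein tst cM vol_g sign).
Qed.
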